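(* Let $G$ be a compact Lie group such that $[\xi]\neq[\overline\xi]$ for all $\xi\in\mathrm{Rep}(G)$. Let $L:\mathcal{D}'(G)\to\mathcal{D}'(G)$ be a diagonal operator, let $p,q\in\mathbb{C}$ with $p\neq0$, and let $P$ be the associated Vekua-type operator $Pu=Lu-q\,u-p\,\overline u$ on $\mathcal{D}'(G)$. Put $\Delta_k(\xi)=(\sigma_k(\xi)-q)(\sigma_k(\xi)-\overline q)-|p|^2$, and let $\mathcal{A}$ be the set of all $f\in\mathcal{D}'(G)$ such that, for all $[\xi]\in\widehat G$ and $1\le k,\ell\le d_\xi$, $$\Delta_k(\xi)=0\ \Longrightarrow\ (\sigma_k(\xi)-\overline q)\,\widehat f(\xi)_{k\ell}+p\,\overline{\widehat f(\overline\xi)_{k\ell}}=0.$$ Then $P$ is globally solvable, i.e. $P(\mathcal{D}'(G))=\mathcal{A}$, if and only if there exist $C>0$ and $M>0$ such that $$|\Delta_k(\xi)|\ge C\langle\xi\rangle^{-M}$$ for all $[\xi]\in\widehat G$ and $1\le k\le d_\xi$ such that $\Delta_k(\xi)\neq0$.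
   Context: $G$ carries its normalized Haar measure $\mu$. $\mathrm{Rep}(G)$ is the set of all continuous irreducible unitary representations of $G$, and $\widehat G$ is the set of their equivalence classes $[\xi]$; for $\Xi\in\widehat G$ a matrix representative is a homomorphism $\xi:G\to U(d_\xi)$, with $d_\xi$ the dimension. $\overline{\xi}(g)=\overline{\xi(g)}$ is the (entrywise) conjugate representation. The matrix entries of $\xi$ are eigenfunctions of the Laplace–Beltrami operator of $G$ with a common eigenvalue $\lambda(\xi)\le 0$, and $\langle\xi\rangle:=(1-\lambda(\xi))^{1/2}$. $\mathcal{D}'(G)$ is the dual of $C^\infty(G)$. For $u\in\mathcal{D}'(G)$, $\overline{u}$ is defined by $\langle\overline u,\varphi\rangle=\overline{\langle u,\overline\varphi\rangle}$, and the Fourier coefficient at $\xi$ is the $d_\xi\times d_\xi$ matrix $\widehat u(\xi)=\langle u,\xi^*\rangle$, i.e. $\widehat u(\xi)_{k\ell}=\langle u,\overline{\xi_{\ell k}}\rangle$ (for integrable $f$, $\widehat f(\xi)=\int_G f(g)\xi(g)^*\,d\mu(g)$). For a continuous linear left-invariant operator $L$ (commuting with left translations), the symbol is $\sigma_L(\xi)=\xi(g)^*(L\xi)(g)$ (independent of $g\in G$), where $(L\xi)_{mn}=L(\xi_{mn})$. Diagonal operator: a continuous linear left-invariant operator $L:\mathcal{D}'(G)\to\mathcal{D}'(G)$ with $L(C^\infty(G))\subset C^\infty(G)$ is diagonal if: (i) for each $\Xi\in\widehat G$ there is a matrix representative $\xi\in\Xi$ such that $\sigma_L(\xi)=\mathrm{diag}(\sigma_1(\xi),\dots,\sigma_{d_\xi}(\xi))$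 is a diagonal matrix and $\sigma_L(\overline\xi)=\overline{\sigma_L(\xi)}$; (ii) there are constants $C>0$ and $K\in\mathbb{N}$ such that $|\sigma_m(\xi)|\le C\langle\xi\rangle^K$ for all $[\xi]\in\widehat G$ and $1\le m\le d_\xi$. Such representatives $\xi$ are fixed once and for all, and $\sigma_k(\xi)$, $\Delta_k(\xi)$, $\widehat f(\xi)$, $\widehat f(\overline\xi)$ refer to them and their entrywise conjugates.
   Formalization: The condition [ξ]≠[ξ̄] is required only for nontrivial ξ: the trivial representation always equals its own conjugate, so as written the condition holds for no group; the theorem proved covers tori and every group whose nontrivial irreducible representations are not self-conjugate. *)

(* Defs.v *)
From HB Require Import structures.
From mathcomp Require Import all_boot all_order all_algebra.
From mathcomp Require Import all_classical all_reals all_analysis.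
From mathcomp Require Import measurable_realfun complex finmap.

Set Implicit Arguments.
Unset Strict Implicit.
Unset Printing Implicit Defensive.

Import Order.TTheory GRing.Theory Num.Theory numFieldNormedType.Exports.
Local Open Scope classical_set_scope.
Local Open Scope ring_scope.

(* A constant rather than R[i] itself: the topology and norm of
   MathComp-Analysis are attached to abstract numFieldTypes. *)
Definition Cx (R : realType) : numClosedFieldType := R[i].
Definition toC {R : realType} (x : R) : Cx R := (x%:C)%C.
Definition mkC {R : realType} (x y : R) : Cx R := (x +i* y)%C.
Definition re {R : realType} (z : Cx R) : R := complex.Re z.
Definition im {R : realType} (z : Cx R) : R := complex.Im z.

Definition std {R : realType} {n : nat} (i : 'I_n) : 'rV[R]_n := delta_mx 0 i.

Fixpoint Ck {R : realType} {n : nat} (k : nat) (U : set 'rV[R]_n)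
    (f : 'rV[R]_n -> R) : Prop :=
  (forall x, U x -> {for x, continuous f}) /\
  if k is k'.+1 then
    forall i : 'I_n, (forall x, U x -> derivable f x (std i)) /\
                     Ck k' U ('D_(std i) f)
  else True.

Definition smooth_on {R : realType} {n : nat} (U : set 'rV[R]_n)
  (f : 'rV[R]_n -> R) : Prop := forall k, Ck k U f.

Definition smooth_map {R : realType} {m n : nat} (U : set 'rV[R]_m)
  (F : 'rV[R]_m -> 'rV[R]_n) : Prop :=
  forall j : 'I_n, smooth_on U (fun x => F x 0 j).

Definition csmooth_on {R : realType} {n : nat} (U : set 'rV[R]_n)
  (f : 'rV[R]_n -> Cx R) : Prop :=
  smooth_on U (re \o f) /\ smooth_on U (im \o f).

Definition iter_pd {R : realType} {n : nat} (w : seq 'I_n)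
  (f : 'rV[R]_n -> R) : 'rV[R]_n -> R :=
  foldr (fun i g => 'D_(std i) g) f w.

Definition citer_pd {R : realType} {n : nat} (w : seq 'I_n)
  (f : 'rV[R]_n -> Cx R) (x : 'rV[R]_n) : Cx R :=
  mkC (iter_pd w (re \o f) x) (iter_pd w (im \o f) x).

(* The distinguished point of a pointedType plays no role; it is required by
   the library to form the Borel sigma-algebra. *)
HB.mixin Record isTopGroup T of Group T & PointedTopological T := {
  mulg_continuous : continuous (fun xy : T * T => (xy.1 * xy.2)%g);
  invg_continuous : continuous (fun x : T => (x^-1)%g)
}.
#[short(type="topGroupType")]
HB.structure Definition TopGroup :=
  {T of isTopGroup T & Group T & PointedTopological T}.

Record chart (R : realType) (n : nat) (T : topologicalType) := Chart {
  cdom : set T;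
  cmap :> T -> 'rV[R]_n;
  cinv : 'rV[R]_n -> T;
  cdom_open : open cdom;
  cimage_open : open (cmap @` cdom);
  cmapK : forall g, cdom g -> cinv (cmap g) = g;
  cmap_continuous : forall g, cdom g -> {for g, continuous cmap};
  cinv_continuous : forall x, (cmap @` cdom) x -> {for x, continuous cinv}
}.

Definition ccod {R : realType} {n : nat} {T : topologicalType}
  (c : chart R n T) : set 'rV[R]_n := c @` cdom c.

Lemma ccod_open {R : realType} {n : nat} {T : topologicalType}
  (c : chart R n T) : open (ccod c).
Proof. exact: cimage_open. Qed.
Arguments ccod_open {R n T} c.

Record lie_atlas {R : realType} {n : nat} {G : topGroupType}
    (A : set (chart R n G)) : Prop := LieAtlas {
  atlas_cover : forall g, exists2 c, A c & cdom c g;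
  atlas_compat : forall c d, A c -> A d ->
    smooth_map [set x | ccod c x /\ cdom d (cinv c x)]
               (fun x => d (cinv c x));
  atlas_mul : forall a b c, A a -> A b -> A c ->
    smooth_map [set z : 'rV[R]_(n + n) |
                 [/\ ccod a (lsubmx z), ccod b (rsubmx z) &
                     cdom c (cinv a (lsubmx z) * cinv b (rsubmx z))%g]]
               (fun z => c (cinv a (lsubmx z) * cinv b (rsubmx z))%g);
  atlas_inv : forall c d, A c -> A d ->
    smooth_map [set x | ccod c x /\ cdom d (cinv c x)^-1%g]
               (fun x => d (cinv c x)^-1%g)
}.

Record compactLieGroup (R : realType) (n : nat) := CompactLieGroup {
  clg_sort :> topGroupType;
  atlas : set (chart R n clg_sort);
  clg_hausdorff : hausdorff_space clg_sort;
  clg_compact : compact [set: clg_sort];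
  clg_atlas : lie_atlas atlas
}.

Arguments clg_hausdorff {R n} c.
Arguments clg_compact {R n} c.

Record haarMeasure {R : realType} {n : nat} (G : compactLieGroup R n) := Haar {
  haar_prob :> probability (g_sigma_algebraType (@open G)) R;
  haar_invariant : forall (g : G) (A : set (g_sigma_algebraType (@open G))),
    measurable A -> haar_prob ((fun x : G => (g * x)%g) @^-1` A) = haar_prob A
}.

(* [gram c x] is the Gram matrix of the coordinate fields of the chart c at the
   point of coordinates x; the last axiom says that x |-> a x b is an isometry
   (with a = b = 1, that the matrices transform as a tensor). *)
Record biinvariantMetric {R : realType} {n : nat} (G : compactLieGroup R n) :=
  BiinvariantMetric {
  gram :> chart R n G -> 'rV[R]_n -> 'M[R]_n;
  gram_smooth : forall c, atlas c -> forall i j,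
    smooth_on (ccod c) (fun x => gram c x i j);
  gram_sym : forall c, atlas c -> forall x, ccod c x ->
    (gram c x)^T = gram c x;
  gram_posdef : forall c, atlas c -> forall x, ccod c x ->
    forall v : 'rV[R]_n, v != 0 -> 0 < (v *m gram c x *m v^T) 0 0;
  gram_invariant : forall c d, atlas c -> atlas d ->
    forall (a b : G) x, ccod c x -> cdom d (a * cinv c x * b)%g ->
    let F := fun y => d (a * cinv c y * b)%g in
    gram c x = jacobian F x *m gram d (F x) *m (jacobian F x)^T
}.

(* div grad in local coordinates. *)
Definition laplace_beltrami {R : realType} {n : nat}
    (m : 'rV[R]_n -> 'M[R]_n) (f : 'rV[R]_n -> R) (x : 'rV[R]_n) : R :=
  let vol y := Num.sqrt (\det (m y)) in
  (vol x)^-1 * \sum_(i < n)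
    'D_(std i) (fun y => vol y *
      \sum_(j < n) invmx (m y) i j * 'D_(std j) f y) x.

Definition is_laplacian {R : realType} {n : nat} {G : compactLieGroup R n}
    (m : biinvariantMetric G) (f f' : G -> Cx R) : Prop :=
  forall c, atlas c -> forall x, ccod c x ->
    f' (cinv c x) = mkC (laplace_beltrami (m c) (fun y => re (f (cinv c y))) x)
                        (laplace_beltrami (m c) (fun y => im (f (cinv c y))) x).

Section CkTheory.
Context {R : realType} {n : nat}.
Implicit Types (U : set 'rV[R]_n) (f g : 'rV[R]_n -> R).

Lemma near_open U (P : 'rV[R]_n -> Prop) x : open U -> U x ->
  (forall y, U y -> P y) -> \forall y \near x, P y.
Proof. by move=> oU Ux UP; apply: filterS UP _; exact: open_nbhs_nbhs. Qed.

Lemma near_continuous f g x : (\forall y \near x, f y = g y) ->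
  {for x, continuous f} -> {for x, continuous g}.
Proof.
move=> fg cf; rewrite /prop_for /continuous_at -(nbhs_singleton fg).
by apply: cvg_trans cf; exact: (@near_eq_cvg _ _ (nbhs x) _ _ _ fg).
Qed.

Lemma Ck_ext k U f g : open U -> (forall x, U x -> f x = g x) ->
  Ck k U f -> Ck k U g.
Proof.
move=> oU; elim: k f g => [|k IH] f g fg [cf df].
  by split=> // x Ux; apply: (near_continuous (near_open oU Ux fg)); exact: cf.
split.
  by move=> x Ux; apply: (near_continuous (near_open oU Ux fg)); exact: cf.
move=> i; have [dfi Cf] := df i; split.
  move=> x Ux; apply: near_eq_derivable (dfi x Ux); exact: (near_open oU _ fg).
apply: IH Cf => x Ux; apply: near_eq_derive; exact: (near_open oU _ fg).
Qed.

Lemma Ck_add k U f g : open U -> Ck k U f -> Ck k U g ->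
  Ck k U (fun x => f x + g x).
Proof.
move=> oU; elim: k f g => [|k IH] f g /= [cf df] [cg dg].
  by split=> // x Ux; apply: (@continuousD _ _ _ f g x (cf x Ux) (cg x Ux)).
split; first by move=> x Ux; apply: (@continuousD _ _ _ f g x (cf x Ux) (cg x Ux)).
move=> i; have [dfi Cf] := df i; have [dgi Cg] := dg i; split.
  by move=> x Ux; exact: derivableD (dfi x Ux) (dgi x Ux).
apply: (Ck_ext oU _ (IH _ _ Cf Cg)) => x Ux.
by rewrite (deriveD (dfi x Ux) (dgi x Ux)).
Qed.

Lemma Ck_scale k U (a : R) f : open U -> Ck k U f -> Ck k U (fun x => a * f x).
Proof.
move=> oU; elim: k f => [|k IH] f /= [cf df].
  by split=> // x Ux; apply: (@continuousM _ _ (cst a) f x); [exact: cst_continuous|exact: cf].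
split; first by move=> x Ux; apply: (@continuousM _ _ (cst a) f x); [exact: cst_continuous|exact: cf].
move=> i; have [dfi Cf] := df i; split.
  by move=> x Ux; exact: (@derivableZ _ _ _ f a x _ (dfi x Ux)).
apply: (Ck_ext oU _ (IH _ Cf)) => x Ux.
by rewrite (@deriveZ _ _ _ f a x _ (dfi x Ux)).
Qed.

Lemma iter_pd_opp (w : seq 'I_n) U f : open U -> smooth_on U f ->
  forall x, U x -> iter_pd w (fun y => - f y) x = - iter_pd w f x.
Proof.
move=> oU sf.
have Cw k v : Ck k U (iter_pd v f).
  elim: v k => [|i v IH] k; first exact: sf.
  by have [_ /(_ i)[]] := IH k.+1.
elim: w => [//|i w IH] x Ux /=.
rewrite (@near_eq_derive _ _ _ _ (- iter_pd w f)) /=; last first.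
  exact: (near_open oU Ux IH).
by apply: deriveN; have [_ /(_ i)[/(_ x Ux)]] := Cw 1%N w.
Qed.

End CkTheory.

Section SmoothFunctions.
Context {R : realType} {n : nat} (G : compactLieGroup R n).

Definition smooth_fun (f : G -> Cx R) : Prop :=
  forall c, atlas c -> csmooth_on (ccod c) (fun x => f (cinv c x)).

Definition smooth_pred : {pred (G -> (Cx R)^o)} := fun f => `[< smooth_fun f >].

Lemma re_lin (a z w : Cx R) : re (a * z + w) = re a * re z + (- im a * im z + re w).
Proof. by case: a => ? ?; case: z => ? ?; case: w => ? ? /=; rewrite mulNr addrA. Qed.

Lemma im_lin (a z w : Cx R) : im (a * z + w) = re a * im z + (im a * re z + im w).
Proof. by case: a => ? ?; case: z => ? ?; case: w => ? ? /=; rewrite addrA. Qed.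

Lemma smooth_pred_submod : submod_closed smooth_pred.
Proof.
have C0 k (c : chart R n G) : Ck k (ccod c) (fun _ : 'rV[R]_n => 0 : R).
  elim: k => [|k IH] /=; split=> //; try by move=> x _; exact: cst_continuous.
  move=> i; split; first by move=> x _; exact: (@derivable_cst R _ _ (0 : R)).
  by apply: (Ck_ext (ccod_open c) _ IH) => x _; rewrite derive_cst.
split; first by apply/asboolP => c Ac; split=> k; exact: C0.
move=> a f g /asboolP sf /asboolP sg; apply/asboolP => c Ac.
have [sfr sfi] := sf c Ac; have [sgr sgi] := sg c Ac; split=> k.
  apply: (Ck_ext (ccod_open c) (f := fun x => re a * re (f (cinv c x)) +
     (- im a * im (f (cinv c x)) + re (g (cinv c x))))).
    by move=> x _ /=; rewrite -re_lin.
  by do !apply: (Ck_add (ccod_open c)) => //; apply: (Ck_scale _ (ccod_open c)).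
apply: (Ck_ext (ccod_open c) (f := fun x => re a * im (f (cinv c x)) +
     (im a * re (f (cinv c x)) + im (g (cinv c x))))).
  by move=> x _ /=; rewrite -im_lin.
by do !apply: (Ck_add (ccod_open c)) => //; apply: (Ck_scale _ (ccod_open c)).
Qed.
HB.instance Definition _ := GRing.isSubmodClosed.Build (Cx R) (G -> (Cx R)^o)
  smooth_pred smooth_pred_submod.

Record Cinfty := MkCinfty {
  cinfty_fun :> G -> (Cx R)^o;
  _ : cinfty_fun \in smooth_pred
}.
HB.instance Definition _ := [isSub for cinfty_fun].
HB.instance Definition _ := [Choice of Cinfty by <:].
HB.instance Definition _ := [SubChoice_isSubLmodule of Cinfty by <:].

Lemma CinftyP (f : Cinfty) : smooth_fun f.
Proof. by apply/asboolP; case: f. Qed.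

End SmoothFunctions.

Section SmoothConjugation.
Context {R : realType} {n : nat} (G : compactLieGroup R n).

Lemma re_conj (z : Cx R) : re z^* = re z. Proof. by case: z. Qed.
Lemma im_conj (z : Cx R) : im z^* = - im z. Proof. by case: z. Qed.

Lemma smooth_conj (f : G -> Cx R) : smooth_fun f -> smooth_fun (fun g => (f g)^*).
Proof.
move=> sf c Ac; have [sr si] := sf c Ac; split=> k.
  apply: (Ck_ext (ccod_open c) _ (sr k)) => x _ /=; exact/esym/re_conj.
apply: (Ck_ext (ccod_open c) _ (Ck_scale (-1) (ccod_open c) (si k))) => x _ /=.
by rewrite mulN1r im_conj.
Qed.

Definition conj_Cinfty (f : Cinfty G) : Cinfty G :=
  MkCinfty (asboolT (smooth_conj (CinftyP f))).

(* Junk value 0 when f is not smooth; it is only applied to translates of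
   smooth functions and to matrix entries of representations, which are smooth
   as soon as the representation is continuous. *)
Definition to_Cinfty (f : G -> Cx R) : Cinfty G := insubd 0 f.

End SmoothConjugation.

Section Distributions.
Context {R : realType} {n : nat} (G : compactLieGroup R n).

(* Continuity for the Frechet topology of uniform convergence, on compact
   subsets of chart domains, of all partial derivatives. *)
Definition seminorm_bounded (u : Cinfty G -> Cx R) : Prop :=
  exists (m : nat) (c : 'I_m -> chart R n G) (K : 'I_m -> set 'rV[R]_n)
         (N : nat) (C : R),
    (forall i, [/\ atlas (c i), compact (K i) & K i `<=` ccod (c i)]) /\
    forall (f : Cinfty G) (M : R), 0 <= M ->
      (forall i (w : seq 'I_n) x, (size w <= N)%N -> K i x ->
         `|citer_pd w (fun y => f (cinv (c i) y)) x| <= toC M) ->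
      `|u f| <= toC (C * M).

Definition is_distr (u : Cinfty G -> (Cx R)^o) : Prop :=
  linear u /\ seminorm_bounded u.

Definition distr_pred : {pred (Cinfty G -> (Cx R)^o)} :=
  fun u => `[< is_distr u >].

Lemma toCM (x y : R) : toC (x * y) = toC x * toC y.
Proof. exact: (rmorphM (real_complex R)). Qed.
Lemma toCD (x y : R) : toC (x + y) = toC x + toC y.
Proof. exact: (rmorphD (real_complex R)). Qed.
Lemma normC_toC (z : Cx R) : exists2 r : R, 0 <= r & `|z| = toC r.
Proof.
by exists (Num.sqrt (re z ^+ 2 + im z ^+ 2)); [exact: sqrtr_ge0|exact: (normc_def z)].
Qed.

Lemma distr_pred_submod : submod_closed distr_pred.
Proof.
split.
  apply/asboolP; split; first by move=> a f g; rewrite /= scaler0 addr0.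
  have c0 : 'I_0 -> chart R n G by case.
  exists 0%N, c0, (fun=> set0), 0%N, 0; split=> [[]//|f M M0 _].
  by rewrite normr0 mul0r.
move=> a u v /asboolP[lu [m1 [c1 [K1 [N1 [C1 [H1 B1]]]]]]].
move=> /asboolP[lv [m2 [c2 [K2 [N2 [C2 [H2 B2]]]]]]].
apply/asboolP; split.
  move=> b f g; rewrite /= !fctE lu lv.
  by rewrite !scalerDr !addrA !scalerA [b * a]mulrC -!addrA; congr (_ + _);
     rewrite addrCA.
have [r r0 ar] := normC_toC a.
pose c (i : 'I_(m1 + m2)) := match fintype.split i with inl j => c1 j | inr j => c2 j end.
pose K (i : 'I_(m1 + m2)) := match fintype.split i with inl j => K1 j | inr j => K2 j end.
exists (m1 + m2)%N, c, K, (maxn N1 N2), (r * C1 + C2); split.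
  by move=> i; rewrite /c /K; case: (fintype.split i).
move=> f M M0 HM; rewrite /= !fctE.
apply: (le_trans (ler_normD _ _)); rewrite mulrDl toCD; apply: lerD.
  rewrite normrZ ar -mulrA toCM; apply: ler_wpM2l; first by rewrite ler0c.
  apply: B1 => // i w x sw Kx.
  have := HM (lshift _ i) w x; rewrite /c /K.
  case: fintype.splitP => j /=; last by move=> /eqP; rewrite ltn_eqF// ltn_addr.
  by move=> /val_inj <-; apply => //; rewrite (leq_trans sw) ?leq_maxl.
apply: B2 => // i w x sw Kx.
have := HM (rshift _ i) w x; rewrite /c /K.
case: fintype.splitP => j /=; first by move=> /eqP; rewrite gtn_eqF// ltn_addr.
by move=> /addnI /val_inj <-; apply => //; rewrite (leq_trans sw) ?leq_maxr.
Qed.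
HB.instance Definition _ := GRing.isSubmodClosed.Build (Cx R)
  (Cinfty G -> (Cx R)^o) distr_pred distr_pred_submod.

Record distr := MkDistr {
  distr_fun :> Cinfty G -> (Cx R)^o;
  _ : distr_fun \in distr_pred
}.
HB.instance Definition _ := [isSub for distr_fun].
HB.instance Definition _ := [Choice of distr by <:].
HB.instance Definition _ := [SubChoice_isSubLmodule of distr by <:].

(* The weak-* topology, for which continuity of operators is understood. *)
HB.instance Definition _ := Topological.copy distr
  (initial_topology (distr_fun : distr -> {ptws Cinfty G -> (Cx R)^o})).

Lemma distrP (u : distr) : is_distr u.
Proof. by apply/asboolP; case: u. Qed.

HB.instance Definition _ (u : distr) :=
  GRing.isLinear.Build (Cx R) (Cinfty G) (Cx R)^o *:%R (distr_fun u)
    (proj1 (distrP u)).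

Lemma citer_pd_conj (w : seq 'I_n) (c : chart R n G) (f : Cinfty G) x :
  atlas c -> ccod c x ->
  citer_pd w (fun y => (f (cinv c y))^* : Cx R) x =
  (citer_pd w (fun y => f (cinv c y)) x)^*.
Proof.
move=> Ac cx; have [_ si] := CinftyP f Ac.
rewrite /citer_pd; congr Complex.
  by congr (iter_pd w _ x); apply/funext => y; exact: re_conj.
rewrite -(iter_pd_opp w (ccod_open c) si cx); congr (iter_pd w _ x).
by apply/funext => y; exact: im_conj.
Qed.

Lemma conj_is_distr (u : distr) :
  is_distr (fun f => (u (conj_Cinfty f))^* : Cx R).
Proof.
have [lu [m [c [K [N [C [H B]]]]]]] := distrP u.
split.
  move=> a f g.
  have -> : conj_Cinfty (a *: f + g) = a^* *: conj_Cinfty f + conj_Cinfty g.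
    by apply/val_inj/funext => x /=; rewrite !fctE rmorphD rmorphM.
  by rewrite linearP /= rmorphD rmorphM /= conjCK.
exists m, c, K, N, C; split=> // f M M0 HM.
rewrite norm_conjC; apply: B => // i w x sw Kx.
have [Ac _ Kc] := H i.
by rewrite citer_pd_conj ?norm_conjC; [exact: HM| |exact: Kc].
Qed.

Definition conj_distr (u : distr) : distr :=
  MkDistr (asboolT (conj_is_distr u)).

End Distributions.

Section Embedding.
Context {R : realType} {n : nat} (G : compactLieGroup R n) (mu : haarMeasure G).

Definition haar_int (f : G -> Cx R) : Cx R :=
  mkC (\int[mu]_x re (f x))%R (\int[mu]_x im (f x))%R.

Lemma smooth_continuous (f : Cinfty G) :
  continuous (fun x => re (f x)) /\ continuous (fun x => im (f x)).
Proof.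
have key (p : Cx R -> R) : (forall c, atlas c ->
    smooth_on (ccod c) (fun x => p (f (cinv c x)))) ->
    continuous (fun x => p (f x)).
  move=> sp g; have [c Ac cg] := atlas_cover (clg_atlas G) g.
  have dg : \forall y \near g, cdom c y.
    by apply: open_nbhs_nbhs; split=> //; exact: cdom_open.
  have [pc _] := sp c Ac 0%N.
  have h : {for g, continuous (fun y => p (f (cinv c (c y))))}.
    apply: (@continuous_comp _ _ _ c (fun x => p (f (cinv c x))) g).
      exact: cmap_continuous.
    by apply: pc; exists g.
  rewrite /prop_for /continuous_at /= (cmapK cg) in h *.
  apply: cvg_trans h; apply: near_eq_cvg.
  by apply: filterS dg => y dy /=; rewrite cmapK.
by split; apply: key => c /(CinftyP f)[].
Qed.

Lemma continuous_bounded (u : G -> R) : continuous u ->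
  exists2 B : R, 0 <= B & forall x, `|u x| <= B.
Proof.
move=> cu; have /compact_bounded[M [_ HM]] : compact (u @` [set: G]).
  apply: continuous_compact; last exact: clg_compact.
  exact: continuous_subspaceT.
have hB x : `|u x| <= `|M| + 1.
  by apply: HM; [rewrite (le_lt_trans (ler_norm M))// ltrDl|exists x].
by exists (`|M| + 1) => //; rewrite addr_ge0.
Qed.

Lemma continuous_integrable (u : G -> R) : continuous u ->
  mu.-integrable [set: g_sigma_algebraType (@open G)] (EFin \o u).
Proof.
move=> cu; have [B B0 uB] := continuous_bounded cu.
apply: measurable_bounded_integrable => //.
- by rewrite (le_lt_trans (probability_le1 mu _)) ?ltry.
- move=> _; apply: (measurability _ (RGenOpens.measurableE R)) => //.
  move=> _ [_ [a [b ->] <-]]; rewrite setTI; apply: sub_sigma_algebra.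
  by apply: open_comp => [x _|]; [exact: cu|exact: interval_open].
- exists B; split=> [|y By x _]; first exact: num_real.
  exact: le_trans (uB x) (ltW By).
Qed.

Lemma Rintegral_le_bound (u : G -> R) (B : R) : continuous u ->
  (forall x, `|u x| <= B) -> `|(\int[mu]_x u x)%R| <= B.
Proof.
move=> cu uB; have iu := continuous_integrable cu.
apply: (le_trans (le_normr_Rintegral _ iu)) => //.
have ci (b : R) : (\int[mu]_(x in [set: g_sigma_algebraType (@open G)]) b)%R = b.
  by rewrite Rintegral_cst//= probability_setT mulr1.
rewrite -[leRHS]ci; apply: le_Rintegral => //.
- by apply: continuous_integrable => x; apply: continuous_comp (cu x) (@norm_continuous _ _ _).
- by apply: continuous_integrable => x; exact: cst_continuous.
Qed.

Lemma finite_chart_cover : exists (m : nat) (c : 'I_m -> chart R n G)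
    (K : 'I_m -> set 'rV[R]_n),
  (forall i, [/\ atlas (c i), compact (K i) & K i `<=` ccod (c i)]) /\
  forall g, exists i x, K i x /\ cinv (c i) x = g.
Proof.
have loc (g : G) : exists cK : chart R n G * set 'rV[R]_n,
    [/\ atlas cK.1, compact cK.2, cK.2 `<=` ccod cK.1 &
     \forall y \near g, cK.2 (cK.1 y) /\ cinv cK.1 (cK.1 y) = y].
  have [c Ac cg] := atlas_cover (clg_atlas G) g.
  have ncod : nbhs (c g) (ccod c).
    by apply: open_nbhs_nbhs; split; [exact: ccod_open|exists g].
  have [r rc] := (nbhs_closedballP _ _).1 ncod.
  exists (c, closed_ball (c g) r%:num); split=> //=.
    apply: bounded_closed_compact; last exact: closed_ball_closed.
    rewrite closed_ballE//; exists (`|c g| + r%:num); split; first exact: num_real.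
    move=> y hy x; rewrite /closed_ball_ /= => hx.
    apply: le_trans (ltW hy); rewrite -[x](subKr (c g)).
    by rewrite (le_trans (ler_normB _ _))// lerD2l.
  have h1 : \forall y \near g, closed_ball (c g) r%:num (c y).
    apply: (cmap_continuous cg); apply/nbhs_closedballP; by exists r.
  have h2 : \forall y \near g, cdom c y.
    by apply: open_nbhs_nbhs; split=> //; exact: cdom_open.
  by apply: filterS2 h1 h2 => y ? /cmapK.
pose cK g := projT1 (cid (loc g)).
have cKP g := projT2 (cid (loc g)).
pose O g := [set y | (cK g).2 ((cK g).1 y) /\ cinv (cK g).1 ((cK g).1 y) = y]°.
have [D _ Dc] : finite_subset_cover [set: G] O [set: G].
  have := clg_compact G; rewrite compact_cover; apply.
    by move=> g _; exact: open_interior.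
  by move=> g _; exists g => //; have [] := cKP g.
pose s := enum_fset D.
exists (size s), (fun i => (cK (nth 1%g s i)).1), (fun i => (cK (nth 1%g s i)).2).
split; first by move=> i; have [] := cKP (nth 1%g s i).
move=> g; have [h hD /interior_subset [h1 h2]] := Dc g I.
have hs : h \in s by [].
have hi : (index h s < size s)%N by rewrite index_mem.
by exists (Ordinal hi), ((cK h).1 g); rewrite /= nth_index.
Qed.

Lemma re_mul (z w : Cx R) : re (z * w) = re z * re w - im z * im w.
Proof. by case: z; case: w. Qed.
Lemma im_mul (z w : Cx R) : im (z * w) = re z * im w + im z * re w.
Proof. by case: z; case: w. Qed.
Lemma Cx_ext (z w : Cx R) : re z = re w -> im z = im w -> z = w.
Proof. by case: z => ? ?; case: w => ? ? /= -> ->. Qed.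

Lemma norm_re_le (z : Cx R) (M : R) : `|z| <= toC M -> `|re z| <= M /\ `|im z| <= M.
Proof.
have -> : `|z| = toC (Num.sqrt (re z ^+ 2 + im z ^+ 2)) by exact: (normc_def z).
rewrite lecR => h; split; apply: le_trans h; rewrite -sqrtr_sqr ler_wsqrtr//.
  by rewrite lerDl sqr_ge0.
by rewrite lerDr sqr_ge0.
Qed.

Lemma norm_mkC_le (x y B : R) : `|x| <= B -> `|y| <= B -> `|mkC x y| <= toC (2 * B).
Proof.
move=> xB yB; have B0 := le_trans (normr_ge0 x) xB.
have -> : `|mkC x y| = toC (Num.sqrt (x ^+ 2 + y ^+ 2)) by exact: (normc_def (mkC x y)).
rewrite lecR -[leRHS]ger0_norm ?mulr_ge0// -sqrtr_sqr ler_wsqrtr//.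
rewrite -(real_normK (num_real x)) -(real_normK (num_real y)) exprMn.
apply: (@le_trans _ _ (B ^+ 2 + B ^+ 2)).
  by apply: lerD; apply: lerXn2r => //; rewrite nnegrE.
by rewrite -mulr2n -[leLHS]mulr_natl; apply: ler_wpM2r; [exact: sqr_ge0|rewrite expr2 -natrM ler_nat].
Qed.

Let ccD (u v : G -> R) : continuous u -> continuous v ->
  continuous (fun x => u x + v x).
Proof. by move=> cu cv x; exact: (@continuousD _ _ _ u v x (cu x) (cv x)). Qed.

Let ccM (u v : G -> R) : continuous u -> continuous v ->
  continuous (fun x => u x * v x).
Proof. by move=> cu cv x; exact: (@continuousM _ _ u v x (cu x) (cv x)). Qed.

Lemma smooth_prod_continuous (f h : Cinfty G) :
  continuous (fun x => re (f x * h x : Cx R)) /\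
  continuous (fun x => im (f x * h x : Cx R)).
Proof.
have [fr fi] := smooth_continuous f; have [hr hi] := smooth_continuous h.
split.
  have -> : (fun x => re (f x * h x : Cx R)) =
      (fun x => re (f x) * re (h x) + (- 1) * (im (f x) * im (h x))).
    by apply/funext => x; rewrite re_mul mulN1r.
  apply: ccD; first exact: ccM.
  by apply: ccM; [move=> x; exact: cst_continuous|exact: ccM].
have -> : (fun x => im (f x * h x : Cx R)) =
    (fun x => re (f x) * im (h x) + im (f x) * re (h x)).
  by apply/funext => x; rewrite im_mul.
by apply: ccD; exact: ccM.
Qed.

Lemma distr_of_is_distr (f : Cinfty G) :
  is_distr (fun h : Cinfty G => haar_int (fun x => f x * h x)).
Proof.
split.
  move=> a h k; have [ihr ihi] := smooth_prod_continuous f h.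
  have [ikr iki] := smooth_prod_continuous f k.
  have E x : f x * (a *: h + k) x = a * (f x * h x) + f x * k x :> Cx R.
    by rewrite /= !fctE mulrDr mulrCA.
  have I u : continuous u -> _ := @continuous_integrable u.
  have sc (b : R) (u : G -> R) : continuous u -> continuous (fun x => b * u x).
    by move=> cu; apply: ccM => // x; exact: cst_continuous.
  apply: Cx_ext; rewrite ?re_lin ?im_lin /=.
    under eq_Rintegral do rewrite E re_lin.
    rewrite RintegralD//; [|by apply/I/sc|by apply/I/ccD => //; exact: sc].
    rewrite RintegralZl//; last exact: I.
    rewrite RintegralD//; [|by apply/I/sc|exact: I].
    by rewrite RintegralZl//; exact: I.
  under eq_Rintegral do rewrite E im_lin.
  rewrite RintegralD//; [|by apply/I/sc|by apply/I/ccD => //; exact: sc].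
  rewrite RintegralZl//; last exact: I.
  rewrite RintegralD//; [|by apply/I/sc|exact: I].
  by rewrite RintegralZl//; exact: I.
have [m [c [K [HK cov]]]] := finite_chart_cover.
have [fr fi] := smooth_continuous f.
have [B1 B10 fB1] := continuous_bounded fr.
have [B2 B20 fB2] := continuous_bounded fi.
exists m, c, K, 0%N, (2 * (B1 + B2)); split=> // h M M0 HM.
have hM x : `|re (h x)| <= M /\ `|im (h x)| <= M.
  have [i [y [Ky <-]]] := cov x.
  apply: norm_re_le; have := HM i [::] y isT Ky.
  by rewrite /citer_pd /=; case: (h _).
have [cr ci] := smooth_prod_continuous f h.
rewrite -mulrA; apply: norm_mkC_le; apply: Rintegral_le_bound => // x.
  rewrite re_mul (le_trans (ler_normB _ _))// mulrDl !normrM.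
  by have [? ?] := hM x; apply: lerD; apply: ler_pM.
rewrite im_mul (le_trans (ler_normD _ _))// mulrDl !normrM.
by have [? ?] := hM x; apply: lerD; apply: ler_pM.
Qed.

Definition distr_of (f : Cinfty G) : distr G :=
  MkDistr (asboolT (distr_of_is_distr f)).

End Embedding.

Section Representations.
Context {R : realType} {n : nat} (G : compactLieGroup R n).

Definition adjmx {m k : nat} (A : 'M[Cx R]_(m, k)) : 'M[Cx R]_(k, m) :=
  map_mx Num.conj A^T.

(* The rows of U span, after transposition, a subspace of column vectors. *)
Definition is_irrep {d : nat} (xi : G -> 'M[Cx R]_d) : Prop :=
  [/\ (0 < d)%N,
      forall g h, xi (g * h)%g = xi g *m xi h,
      forall g, xi g *m adjmx (xi g) = 1%:M,
      forall i j, continuous (fun g => xi g i j) &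
      forall U : 'M[Cx R]_d, (forall g, stablemx U (xi g)^T) ->
        U = 0 \/ row_full U].

Record irrep := Irrep {
  rdim : nat;
  rmat :> G -> 'M[Cx R]_rdim;
  _ : is_irrep rmat
}.

Definition equiv_rep {d e : nat} (xi : G -> 'M[Cx R]_d) (eta : G -> 'M[Cx R]_e) :
    Prop :=
  exists (A : 'M[Cx R]_(e, d)) (B : 'M[Cx R]_(d, e)),
    [/\ A *m B = 1%:M, B *m A = 1%:M & forall g, A *m xi g = eta g *m A].

Definition trivial_rep {d : nat} (xi : G -> 'M[Cx R]_d) : Prop :=
  forall g, xi g = 1%:M.

Definition conj_rep {d : nat} (xi : G -> 'M[Cx R]_d) : G -> 'M[Cx R]_d :=
  fun g => map_mx Num.conj (xi g).

Definition representatives (S : set irrep) : Prop :=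
  forall eta : irrep, exists! xi : irrep, S xi /\ equiv_rep xi eta.

Definition fourier (u : distr G) {d : nat} (xi : G -> 'M[Cx R]_d) : 'M[Cx R]_d :=
  \matrix_(k, l) u (to_Cinfty (fun g => (xi g l k)^*)).

(* The common eigenvalue of the entries of an irreducible xi; it exists because
   the metric is bi-invariant, and is unique because xi is nonzero. *)
Definition rep_eigenvalue (m : biinvariantMetric G) {d : nat}
    (xi : G -> 'M[Cx R]_d) : R :=
  xget 0 [set l : R | forall i j,
    is_laplacian m (fun g => xi g i j) (fun g => toC l * xi g i j)].

Definition bracket (m : biinvariantMetric G) {d : nat} (xi : G -> 'M[Cx R]_d) : R :=
  Num.sqrt (1 - rep_eigenvalue m xi).

End Representations.

Section Operators.
Context {R : realType} {n : nat} (G : compactLieGroup R n)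
  (mu : haarMeasure G) (met : biinvariantMetric G).
Implicit Types L : distr G -> distr G.

(* v(g) = u(h^-1 g); such a v always exists. *)
Definition is_left_translate (h : G) (u v : distr G) : Prop :=
  forall f : Cinfty G, v f = u (to_Cinfty (fun g => f (h * g)%g)).

Definition left_invariant L : Prop := forall h u v,
  is_left_translate h u v -> is_left_translate h (L u) (L v).

Definition preserves_Cinfty L : Prop :=
  forall f : Cinfty G, exists h : Cinfty G, L (distr_of mu f) = distr_of mu h.

(* The unique such h when L preserves smooth functions. *)
Definition on_Cinfty L (f : Cinfty G) : Cinfty G :=
  xget 0 [set h | L (distr_of mu f) = distr_of mu h].

Definition symbol_at L {d : nat} (xi : G -> 'M[Cx R]_d) (g : G) : 'M[Cx R]_d :=
  adjmx (xi g) *m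
  \matrix_(k, l) (on_Cinfty L (to_Cinfty (fun x => xi x k l)) g : Cx R).

(* For left-invariant L, [symbol_at L xi g] does not depend on g. *)
Definition symbol L {d : nat} (xi : G -> 'M[Cx R]_d) : 'M[Cx R]_d :=
  symbol_at L xi 1%g.

(* S is the set of the representatives, one for each class, fixed once and for
   all. *)
Definition diagonal_operator (S : set (irrep G)) L : Prop :=
  [/\ continuous L, left_invariant L, preserves_Cinfty L,
      forall xi : irrep G, S xi -> is_diag_mx (symbol L xi) /\
        symbol L (conj_rep xi) = map_mx Num.conj (symbol L xi) &
      exists (C : R) (K : nat), 0 < C /\
        forall xi : irrep G, S xi -> forall k,
          `|symbol L xi k k| <= toC (C * bracket met xi ^+ K)].

Definition vekua L (p q : Cx R) (u : distr G) : distr G :=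
  L u - q *: u - p *: conj_distr u.

Definition Delta L (p q : Cx R) {d : nat} (xi : G -> 'M[Cx R]_d) (k : 'I_d) :
    Cx R :=
  (symbol L xi k k - q) * (symbol L xi k k - q^*) - `|p| ^+ 2.

Definition admissible (S : set (irrep G)) L (p q : Cx R) : set (distr G) :=
  [set f | forall xi : irrep G, S xi -> forall k l, Delta L p q xi k = 0 ->
     (symbol L xi k k - q^*) * fourier f xi k l
       + p * (fourier f (conj_rep xi) k l)^* = 0].

End Operators.

(* Main.v *)
Require Import Defs.
From HB Require Import structures.
From mathcomp Require Import all_boot all_order all_algebra all_fingroup.
From mathcomp Require Import all_classical all_reals all_analysis.
From mathcomp Require Import measurable_realfun complex finmap ring lra zify.

Import Order.TTheory GRing.Theory Num.Theory numFieldNormedType.Exports.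
Local Open Scope classical_set_scope.
Local Open Scope ring_scope.

(** The Fourier transform diagonalizes the problem. Conjugating a distribution
    exchanges its coefficients at [xi] and at the conjugate of [xi], so for each
    entry [(k, l)] the equation [vekua L p q u = f] is a system of two linear
    equations for the coefficient of [u] at [xi] and the conjugate of its
    coefficient at [conj_rep xi] ([fourier_vekua], [fourier_vekua_conj]). The
    determinant of this system is [Delta], and where it vanishes the system is
    compatible exactly under the condition that defines [admissible]. The range
    is therefore always contained in [admissible].

    If the nonzero determinants have a lower bound of polynomial type, the
    solutions of these systems ([vekua_cramer]) grow polynomially, hence are the
    coefficients of a distribution; it solves the equation because a
    distribution is determined by its coefficients. Conversely, there is an
    admissible right-hand side, with coefficients 0 and 1, whose preimages have
    the coefficients [p / Delta] wherever the determinant does not vanish; these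
    grow polynomially, which is the lower bound. The hypothesis that no
    nontrivial representation is equivalent to its conjugate makes the two
    unknowns of each system independent: the nontrivial classes fall into pairs,
    and prescribing both unknowns for one class of each pair is prescribing a
    distribution ([half_system_exists], [solvable_on]).

    This rests on harmonic analysis on [G], for which four facts are enough:
    the coefficients of a distribution grow polynomially in [bracket]
    ([fourier_growth]); conversely polynomial growth is sufficient
    ([fourier_synthesis]); the coefficients determine the distribution
    ([fourier_eq]); and a continuous left-invariant operator acts on them by its
    symbol ([fourier_multiplier]).

    Growth and decay of coefficients are measured with the right-invariant
    vector fields. They are divergence free, so the Laplacian is a quadratic
    expression in them with constant coefficients ([laplace_beltrami_rfield]);
    on the entries of an irreducible representation it is the Casimir operator,
    a nonpositive scalar that bounds each derivative ([gen_bound]). Integration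
    by parts then makes the coefficients of a test function decay rapidly
    ([fourier_decay]), and Fourier series of polynomial growth converge weakly
    once the representations are counted: those with [bracket] at most [m] have
    squared dimensions of sum O(m^n), since their weighted character stays large
    on a ball of radius of order 1/m ([dim2_bound]).

    Completeness of the matrix entries ([peter_weyl]) is obtained from the
    convolution powers of the autocorrelation of a function orthogonal to all of
    them: suitably normalized, these converge to an idempotent
    ([leading_idempotent]), whose reproduced functions form a
    finite-dimensional translation-invariant space, and the entries of an
    irreducible representation are found inside. Representations are smooth
    because smearing regularizes them without leaving the span of their entries
    ([rep_CGk]). *)

Set Implicit Arguments.
Unset Strict Implicit.
Unset Printing Implicit Defensive.

(** * Calculus in several variables *)

Section MultivariateCalculus.
Context {R : realType}.

Lemma is_derive_line n (f : 'rV[R]_n -> R) x v (t : R) :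
  derivable f (t *: v + x) v ->
  is_derive t 1 (fun s : R => f (s *: v + x)) ('D_v f (t *: v + x)).
Proof.
have E : (fun h : R => h^-1 *: (f ((h *: 1 + t) *: v + x) - f (t *: v + x))) =
         (fun h : R => h^-1 *: (f (h *: v + (t *: v + x)) - f (t *: v + x))).
  by apply/funext => h; rewrite [h *: 1]mulr1 scalerDl addrA.
move=> df; apply: DeriveDef.
  by rewrite /derivable /= E; exact: df.
by rewrite /derive /= E.
Qed.

Lemma is_deriveZv n (f : 'rV[R]_n -> R) x v (c : R) : derivable f x v ->
  is_derive x (c *: v) f (c * 'D_v f x).
Proof.
move=> df; have [->|c0] := eqVneq c 0.
  by rewrite scale0r mul0r; exact: is_derive0.
have df0 : derivable f (0 *: v + x) v by rewrite scale0r add0r.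
have := is_derive_line df0; rewrite scale0r add0r => -[d1 d2].
have key : (fun h : R => h^-1 *: (f (h *: (c *: v) + x) - f x)) @ 0^' --> c * 'D_v f x.
  have h1 : (fun h : R => h^-1 *: (f (h *: v + x) - f x)) @ 0^' --> 'D_v f x.
    exact: df.
  have h2 : (fun h : R => c * ((h * c)^-1 *: (f ((h * c) *: v + x) - f x))) @ 0^' -->
     c * 'D_v f x.
    apply: cvgMr; apply: (cvg_comp (fun h : R => h * c) _ _ h1).
    move=> A [e /= e0 eA]; exists (e / `|c|) => /=.
      by rewrite divr_gt0 ?normr_gt0.
    move=> h /=; rewrite sub0r normrN => he h0; apply: eA => /=.
      by rewrite sub0r normrN normrM -ltr_pdivlMr ?normr_gt0.
    by rewrite mulf_eq0 negb_or h0.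
  apply: cvg_trans h2; apply: near_eq_cvg; near=> h.
  have h0 : h != 0 by near: h; exact: nbhs_dnbhs_neq.
  rewrite scalerA /=; set d := f _ - f x.
  by rewrite -[_ *: d]/(_ * d) -[_ *: d]/(_ * d) mulrA invfM mulrCA divff // mulr1.
apply: DeriveDef; first by apply/cvg_ex; exists (c * 'D_v f x).
exact: cvg_lim key.
Unshelve. all: by end_near. Qed.

Lemma line_MVT n (f : 'rV[R]_n -> R) x v :
  (forall t : R, 0 <= t <= 1 -> derivable f (t *: v + x) v) ->
  exists2 t : R, 0 <= t <= 1 & f (v + x) - f x = 'D_v f (t *: v + x).
Proof.
move=> df.
have [||c] := @MVT_segment R (fun s : R => f (s *: v + x))
    (fun t => 'D_v f (t *: v + x)) 0 1 ler01.
- move=> t; rewrite in_itv/= => /andP[t0 t1]; apply: is_derive_line.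
  by apply: df; rewrite !ltW.
- apply: derivable_within_continuous => t; rewrite in_itv/= => t01.
  by have [] := is_derive_line (df t t01).
rewrite in_itv/= => c01; rewrite scale1r scale0r add0r subr0 mulr1 => ->.
by exists c.
Qed.

Lemma rV_norm_le n (v : 'rV[R]_n) (e : R) : 0 <= e ->
  (forall i, `|v 0 i| <= e) -> `|v| <= e.
Proof.
move=> e0 H; rewrite [leLHS]/Num.Def.normr/= mx_normrE.
by apply: bigmax_le => //= -[i j] _; rewrite ord1.
Qed.

Lemma coord_norm_le n (v : 'rV[R]_n) i : `|v 0 i| <= `|v|.
Proof.
rewrite [leRHS]/Num.Def.normr/= mx_normrE.
exact: (le_bigmax _ (fun ij => `|v ij.1 ij.2|) (0, i)).
Qed.

Lemma rV_sum_std n (v : 'rV[R]_n) : v = \sum_i v 0 i *: std i.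
Proof. exact: row_sum_delta. Qed.

Lemma Ck_continuous n k U (f : 'rV[R]_n -> R) x : Ck k U f -> U x ->
  {for x, continuous f}.
Proof. by case: k => [|k] [cf _] /cf. Qed.

Lemma Ck_le n j k U (f : 'rV[R]_n -> R) : (j <= k)%N -> Ck k U f -> Ck j U f.
Proof.
elim: k j f => [|k IH] [|j] f //=.
  by move=> _ [].
by move=> jk [cf df]; split=> // i; have [h1 h2] := df i; split=> //; exact: IH.
Qed.

Lemma Ck_sub n k (U V : set 'rV[R]_n) f : V `<=` U -> Ck k U f -> Ck k V f.
Proof.
move=> VU; elim: k f => [|k IH] f /= [cf df]; split=> //;
  try by move=> x /VU/cf.
by move=> i; have [h1 h2] := df i; split; [move=> x /VU/h1|exact: IH].
Qed.

(** Being of class C^k is a local property, although [Ck] is defined by a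
    recursion over a fixed open set; this is what permits to change charts. *)
Lemma Ck_local n k (U : set 'rV[R]_n) f :
  (forall x, U x -> exists V : set 'rV[R]_n, V x /\ Ck k V f) -> Ck k U f.
Proof.
elim: k f => [|k IH] f H.
  by split=> // x Ux; have [V [Vx [cf _]]] := H x Ux; exact: cf.
split; first by move=> x Ux; have [V [Vx [cf _]]] := H x Ux; exact: cf.
move=> i; split.
  by move=> x Ux; have [V [Vx [_ /(_ i)[df _]]]] := H x Ux; exact: df.
apply: IH => x Ux; have [V [Vx [_ /(_ i)[_ Cf]]]] := H x Ux.
by exists V.
Qed.

Lemma Ck_cst n k (U : set 'rV[R]_n) (a : R) : open U -> Ck k U (fun=> a).
Proof.
move=> oU; elim: k a => [|k IH] a /=; split=> //; try by move=> x _; exact: cst_continuous.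
move=> i; split; first by move=> x _; exact: derivable_cst.
by apply: (Ck_ext oU _ (IH 0)) => x _; rewrite derive_cst.
Qed.

Lemma Ck_mul n k (U : set 'rV[R]_n) f g : open U -> Ck k U f -> Ck k U g ->
  Ck k U (fun x => f x * g x).
Proof.
move=> oU; elim: k f g => [|k IH] f g Cf Cg.
  split=> // x Ux; apply: (@continuousM _ _ f g x);
  [exact: Ck_continuous Cf Ux | exact: Ck_continuous Cg Ux].
split.
  move=> x Ux; apply: (@continuousM _ _ f g x);
  [exact: Ck_continuous Cf Ux | exact: Ck_continuous Cg Ux].
have [_ df] := Cf; have [_ dg] := Cg.
move=> i; have [dfi Cfi] := df i; have [dgi Cgi] := dg i; split.
  by move=> x Ux; exact: derivableM (dfi x Ux) (dgi x Ux).
apply: (Ck_ext oU (f := fun x => f x * 'D_(std i) g x + g x * 'D_(std i) f x)).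
  by move=> x Ux; rewrite (deriveM (dfi x Ux) (dgi x Ux)).
by apply: Ck_add => //; apply: IH => //; exact: (@Ck_le _ k k.+1).
Qed.

Lemma Ck_sum n k (U : set 'rV[R]_n) I (r : seq I) (f : I -> 'rV[R]_n -> R) :
  open U -> (forall i, Ck k U (f i)) -> Ck k U (fun x => \sum_(i <- r) f i x).
Proof.
move=> oU Cf; elim: r => [|i r IH].
  by apply: (Ck_ext oU _ (Ck_cst k 0 oU)) => x _; rewrite big_nil.
by apply: (Ck_ext oU _ (Ck_add oU (Cf i) IH)) => x _; rewrite big_cons.
Qed.

Lemma is_derive_coord n (x v : 'rV[R]_n) i : is_derive x v (fun y => y 0 i) (v 0 i).
Proof.
have key : (fun h : R => h^-1 *: ((h *: v + x) 0 i - x 0 i)) @ 0^' --> v 0 i.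
  apply: cvg_near_cst; near=> h.
  have h0 : h != 0 by near: h; exact: nbhs_dnbhs_neq.
  by rewrite !mxE addrK [_ *: _]mulKf.
by apply: DeriveDef; [apply/cvg_ex; exists (v 0 i)|exact: cvg_lim key].
Unshelve. all: by end_near. Qed.

Lemma Ck_coord n k (U : set 'rV[R]_n) i : open U -> Ck k U (fun y => y 0 i).
Proof.
move=> oU; have cc x : {for x, continuous (fun y : 'rV[R]_n => y 0 i)}.
  exact: coord_continuous.
case: k => [|k]; split=> // j; split=> [x _|].
  by have [] := is_derive_coord x (std j) i.
apply: (Ck_ext oU _ (Ck_cst k ((std j : 'rV[R]_n) 0 i) oU)) => x _.
by have [_ ->] := is_derive_coord x (std j) i.
Qed.

Lemma continuous_sumr (T : topologicalType) n (f : 'I_n -> T -> R) (x : T) :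
  (forall i, {for x, continuous (f i)}) ->
  {for x, continuous (fun y => \sum_i f i y)}.
Proof.
move=> cf; rewrite /prop_for /continuous_at.
elim: (index_enum _) => [|i r IH].
  by under eq_fun do rewrite big_nil; rewrite big_nil; exact: cvg_cst.
under eq_fun do rewrite big_cons; rewrite big_cons.
by apply: cvgD IH; exact: cf.
Qed.

(** The increment is telescoped along the coordinate directions, and each
    step is an increment along a line where the mean value theorem applies. *)
Lemma C1_differentiable n (U : set 'rV[R]_n) f x : open U -> Ck 1 U f -> U x ->
  differentiable f x.
Proof.
move=> oU [cf df] Ux.
pose dfx (h : 'rV[R]_n) : R := \sum_i h 0 i * 'D_(std i) f x.
have dlin : linear dfx.
  move=> a u v; rewrite /dfx scaler_sumr -big_split /=; apply: eq_bigr => i _.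
  by rewrite !mxE mulrDl -mulrA.
pose dL : {linear 'rV[R]_n -> R} :=
  HB.pack dfx (GRing.isLinear.Build R 'rV[R]_n R *:%R dfx dlin).
have dc : continuous dL.
  move=> y; apply: continuous_sumr => i; apply: (@continuousM _ _ (fun h : 'rV[R]_n => h 0 i)).
    exact: coord_continuous.
  exact: cst_continuous.
have E (e : {posnum R}) : \forall h \near (0 : 'rV[R]_n),
    `|f (h + x) - (f x + dL h)| <= e%:num * `|h|.
  pose e' := e%:num / n.+1%:R.
  have e'0 : 0 < e' by rewrite divr_gt0.
  have cD i : \forall y \near x, U y /\ `|'D_(std i) f x - 'D_(std i) f y| <= e'.
    have [_ [cDi _]] := df i.
    near=> y; split.
      by near: y; apply: open_nbhs_nbhs.
    near: y; have := cDi x Ux => /cvgrPdist_le /(_ _ e'0); exact.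
  have : \forall y \near x, forall i, U y /\ `|'D_(std i) f x - 'D_(std i) f y| <= e'.
    exact: (filter_forall (nbhs_filter x)) cD.
  move=> /nbhs_ballP[r /= r0 Hr].
  apply/nbhs_ballP; exists r => //= h.
  rewrite -ball_normE /= sub0r normrN => hr.
  (* [hp j] keeps the first [j] coordinates of [h]. *)
  pose hp (j : nat) : 'rV[R]_n := \row_i (if (i < j)%N then h 0 i else 0).
  have hpS (j : 'I_n) : hp j.+1 = h 0 j *: std j + hp j.
    apply/rowP => i; rewrite !mxE ltnS leq_eqVlt eqxx /=.
    have [->|ij] := eqVneq i j; first by rewrite eqxx ltnn mulr1 addr0.
    rewrite (_ : (i == j :> nat) = false); last by apply/negbTE.
    by rewrite mulr0 add0r.
  have hp0 : hp 0%N = 0 by apply/rowP => i; rewrite !mxE.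
  have hpn : hp n = h by apply/rowP => i; rewrite !mxE ltn_ord.
  have T : f (h + x) - f x = \sum_(j < n) (f (hp j.+1 + x) - f (hp j + x)).
    rewrite -(big_mkord xpredT (fun j => f (hp j.+1 + x) - f (hp j + x))).
    by rewrite telescope_sumr // hpn hp0 add0r.
  have -> : f (h + x) - (f x + dL h) =
      \sum_(j < n) (f (hp j.+1 + x) - f (hp j + x) - h 0 j * 'D_(std j) f x).
    by rewrite big_split /= sumrN -T opprD addrA.
  apply: (le_trans (ler_norm_sum _ _ _)).
  apply: (@le_trans _ _ (\sum_(j < n) (e' * `|h|))); last first.
    rewrite sumr_const card_ord -mulr_natr mulrAC ler_wpM2r //.
    by rewrite /e' -mulrA ler_piMr // mulrC ler_pdivrMr // mul1r ler_nat.
  apply: ler_sum => j _.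
  have inb (t : R) : 0 <= t <= 1 -> ball x r (t *: (h 0 j *: std j) + (hp j + x)).
    move=> /andP[t0 t1]; rewrite -ball_normE /= distrC addrA addrK.
    apply: le_lt_trans hr; apply: rV_norm_le => // i; rewrite !mxE eqxx /=.
    apply: le_trans (coord_norm_le h i).
    case: eqVneq => [->|ij]; last by rewrite !mulr0 add0r; case: ifP => //; rewrite normr0.
    by rewrite ltnn mulr1 addr0 normrM ger0_norm // ler_piMl.
  have dd t : 0 <= t <= 1 ->
      derivable f (t *: (h 0 j *: std j) + (hp j + x)) (h 0 j *: std j).
    move=> /inb/Hr/(_ j)[Uy _]; have [/(_ _ Uy) d _] := df j.
    by have [] := is_deriveZv (h 0 j) d.
  have [t /inb/Hr/(_ j)[Uy He]] := line_MVT dd.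
  rewrite addrA -hpS => ->; have [/(_ _ Uy) d _] := df j.
  have [_ ->] := is_deriveZv (h 0 j) d.
  (* The partial derivative at the intermediate point is within [e'] of the one
  at [x]. *)
  rewrite -mulrBr normrM mulrC distrC; apply: ler_pM => //.
  exact: coord_norm_le.
have dE : 'd f x = dL :> ('rV[R]_n -> R).
  by apply: diff_unique => //; apply/eqaddoP => _/posnumP[e]; exact: E.
apply/diff_locallyP; rewrite dE; split => //.
by apply/eqaddoP => _/posnumP[e]; exact: E.
Unshelve. all: by end_near. Qed.

Lemma is_derive_comp_rV n m (f : 'rV[R]_m -> R) (F : 'rV[R]_n -> 'rV[R]_m) x v :
  differentiable f (F x) -> (forall j, derivable (fun y => F y 0 j) x v) ->
  is_derive x v (fun y => f (F y))
    (\sum_j 'D_(std j) f (F x) * 'D_v (fun y => F y 0 j) x).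
Proof.
move=> df dF.
have dFx : derivable F x v.
  by apply/derivable_mxP => i j; rewrite ord1.
have d1 : derivable (fun h : R => F (h *: v + x)) 0 1.
  exact: (derivable1P F x v).1 dFx.
have dd1 := (derivable1_diffP _ _).1 d1.
have F0 : F (0 *: v + x) = F x by rewrite scale0r add0r.
have df' : differentiable f ((fun h : R => F (h *: v + x)) 0) by rewrite F0.
have dc := differentiable_comp dd1 df'.
have dfF : derivable (fun y => f (F y)) x v.
  apply: (derivable1P (fun y => f (F y)) x v).2.
  exact: (derivable1_diffP (fun h : R => f (F (h *: v + x))) 0).2 dc.
apply: DeriveDef => //.
have E (g : 'rV[R]_n -> R) : 'D_v g x = 'D_1 (fun h : R => g (h *: v + x)) 0.
  rewrite /derive; set g1 := fun h => h^-1 *: _; set g2 := fun h => h^-1 *: _.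
  suff -> : g1 = g2 by [].
  by rewrite funeqE /g1 /g2 => h /=; rewrite addr0 scale0r add0r [_%:A]mulr1.
rewrite E deriveE // [X in 'd X _ _](_ : _ = f \o (fun h : R => F (h *: v + x))) //.
rewrite diff_comp //= F0 -(deriveE _ dd1) derive_mx //.
rewrite [in LHS](rV_sum_std (\matrix_(i, j) _)) raddf_sum /=.
apply: eq_bigr => j _; rewrite linearZ /= -deriveE // !mxE mulrC; congr (_ * _).
by rewrite -(E (fun y => F y 0 j)).
Qed.

Lemma Ck_comp n m k (U : set 'rV[R]_n) (V : set 'rV[R]_m)
    (f : 'rV[R]_m -> R) (F : 'rV[R]_n -> 'rV[R]_m) :
  open U -> open V -> (forall x, U x -> V (F x)) ->
  (forall j, Ck k U (fun x => F x 0 j)) -> Ck k V f -> Ck k U (fun x => f (F x)).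
Proof.
move=> oU oV UV; have cF k' : (forall j, Ck k' U (fun x => F x 0 j)) ->
    forall x, U x -> {for x, continuous F}.
  move=> CF x Ux; apply/(@cvgrPdist_le _ _ _ _ (nbhs_filter x) F) => /= e e0.
  have : \forall y \near x, forall i, `|F x 0 i - F y 0 i| <= e.
    apply: (filter_forall (nbhs_filter x)) => i.
    by have /cvgrPdist_le/(_ _ e0) := Ck_continuous (CF i) Ux.
  apply: filterS => y Hy; apply: rV_norm_le; first exact: ltW.
  by move=> i; rewrite !mxE.
have cc k' f' : (forall j, Ck k' U (fun x => F x 0 j)) -> Ck k' V f' ->
    forall x, U x -> {for x, continuous (fun x => f' (F x))}.
  move=> CF Cf x Ux; apply: (@continuous_comp _ _ _ F f'); first exact: (cF k').
  exact: (Ck_continuous Cf (UV _ Ux)).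
elim: k f => [|k IH] f CF Cf; split => //; try exact: (cc _ f CF Cf).
have dcomp i x (Ux : U x) := @is_derive_comp_rV n m f F x (std i)
  (C1_differentiable oV (@Ck_le _ 1 k.+1 _ _ isT Cf) (UV _ Ux))
  (fun j => ((CF j).2 i).1 x Ux).
move=> i; split; first by move=> x Ux; have [] := dcomp i x Ux.
apply: (Ck_ext oU (f := fun x => \sum_j 'D_(std j) f (F x) * 'D_(std i) (fun y => F y 0 j) x)).
  by move=> x Ux; have [_ ->] := dcomp i x Ux.
apply: Ck_sum => // j; apply: Ck_mul => //; last by have [_ /(_ i)[]] := CF j.
apply: (IH ('D_(std j) f)); first by move=> l; exact: (@Ck_le _ k k.+1).
by have [_ /(_ j)[]] := Cf.
Unshelve. all: by end_near. Qed.

(** Both mixed derivatives are limits of the same second difference quotient,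
    as seen by applying the mean value theorem twice, in either order. *)
Lemma derive_swap n (U : set 'rV[R]_n) f x i j : open U -> Ck 2 U f -> U x ->
  'D_(std i) ('D_(std j) f) x = 'D_(std j) ('D_(std i) f) x.
Proof.
move=> oU Cf Ux.
have key (i' j' : 'I_n) (e : R) : 0 < e -> \forall h \near (0 : R)^'+,
   `|(f (h *: std i' + (h *: std j' + x)) - f (h *: std i' + x) -
      (f (h *: std j' + x) - f x)) / h ^+ 2 - 'D_(std j') ('D_(std i') f) x| <= e.
  move=> e0.
  have [_ /(_ i')[dfi [_ /(_ j')[dij [cij _]]]]] := Cf.
  have : \forall y \near x, U y /\ `|'D_(std j') ('D_(std i') f) x - 'D_(std j') ('D_(std i') f) y| <= e.
    near=> y; split; first by near: y; apply: open_nbhs_nbhs.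
    near: y; have /cvgrPdist_le/(_ _ e0) := cij x Ux; exact.
  move=> /nbhs_ballP[r /= r0 Hr].
  near=> h.
  have h0 : 0 < h by near: h; exact: nbhs_right_gt.
  have hr : h < r / 2 by near: h; apply: nbhs_right_lt; rewrite divr_gt0.
  have inb (s t : R) : 0 <= s <= 1 -> 0 <= t <= 1 ->
      ball x r (t *: (h *: std j') + (s *: (h *: std i') + x)).
    move=> /andP[s0 s1] /andP[t0 t1]; rewrite -ball_normE /= distrC addrA addrK.
    apply: (@le_lt_trans _ _ (h + h)); last by lra.
    have dle (k : 'I_n) : `|std k : 'rV[R]_n| <= 1.
      by apply: rV_norm_le => // l; rewrite !mxE eqxx /=; case: eqP => _; rewrite ?normr1 ?normr0.
    have aux (k : 'I_n) (s' : R) : 0 <= s' -> s' <= 1 -> `|s' *: (h *: std k : 'rV[R]_n)| <= h.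
      move=> ? ?; rewrite !normrZ ger0_norm // (gtr0_norm h0).
      by rewrite -[leRHS]mul1r ler_pM // ?mulr_ge0 // ?(ltW h0) // ler_piMr // ltW.
    by rewrite (le_trans (ler_normD _ _)) // lerD // aux.
  pose g y := f (h *: std j' + y) - f y.
  have sh (y : 'rV[R]_n) (k : 'I_n) : derivable f (h *: std j' + y) (std k) ->
      is_derive y (std k) (fun y => f (h *: std j' + y)) ('D_(std k) f (h *: std j' + y)).
    move=> d; have E : (fun t : R => t^-1 *: (f (h *: std j' + (t *: std k + y)) - f (h *: std j' + y)))
       = (fun t : R => t^-1 *: (f (t *: std k + (h *: std j' + y)) - f (h *: std j' + y))).
      by apply/funext => t; rewrite addrCA.
    by apply: DeriveDef; [rewrite /derivable /= E; exact: d|rewrite /derive /= E].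
  have i1 : (0 : R) <= 1 <= (1 : R).
    by rewrite lexx ler01.
  have i0 : (0 : R) <= 0 <= (1 : R) by rewrite lexx ler01.
  have dg (t : R) : 0 <= t <= 1 -> is_derive (t *: (h *: std i') + x) (h *: std i') g
      (h * ('D_(std i') f (h *: std j' + (t *: (h *: std i') + x)) - 'D_(std i') f (t *: (h *: std i') + x))).
    move=> t01.
    have [U1 _] := Hr _ (inb t 1 t01 i1); have [U0 _] := Hr _ (inb t 0 t01 i0).
    rewrite scale0r add0r scale1r in U0 U1.
    have D1 := sh _ _ (dfi _ U1); have D0 := derivableP (dfi _ U0).
    have DD := is_deriveB D1 D0.
    have [d3 d3E] := DD.
    have := is_deriveZv h d3.
    by rewrite -/g d3E.
  have [t t01] : exists2 t : R, 0 <= t <= 1 & g (h *: std i' + x) - g x = 'D_(h *: std i') g (t *: (h *: std i') + x).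
    by apply: line_MVT => t /dg[].
  have [_ ->] := dg t t01.
  have [|s s01] := @line_MVT n ('D_(std i') f) (t *: (h *: std i') + x) (h *: std j').
    move=> s s01; have [U1 _] := Hr _ (inb t s t01 s01).
    by have [] := is_deriveZv h (dij _ U1).
  have [U1 HU1] := Hr _ (inb t s t01 s01).
  have [_ ->] := is_deriveZv h (dij _ U1).
  move=> E1 E2.
  rewrite [X in `|X / _ - _|](_ : _ = g (h *: std i' + x) - g x); last first.
    by rewrite /g [h *: std j' + (_ + _)]addrCA; ring.
  rewrite E2 E1 mulrA -expr2 mulrAC mulfV ?mul1r; last by rewrite expf_neq0 // gt_eqF.
  by rewrite distrC.
apply/eqP; rewrite -subr_eq0 -normr_le0; apply/ler_addgt0Pl => e e0.
have e2 : 0 < e / 2 by rewrite divr_gt0.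
rewrite addr0.
have [h [h1 h2]] := filter_ex (filterI (key i j _ e2) (key j i _ e2)).
have E : f (h *: std j + (h *: std i + x)) - f (h *: std j + x) -
      (f (h *: std i + x) - f x) = f (h *: std i + (h *: std j + x)) - f (h *: std i + x) -
      (f (h *: std j + x) - f x) by rewrite [h *: std j + (_ + _)]addrCA; ring.
rewrite {}E in h2.
set q := _ / h ^+ 2 in h1 h2.
move: q ('D_(std j) _ _) ('D_(std i) _ _) h1 h2 => q a b h1 h2.
by rewrite (splitr e) (le_trans (ler_distD q _ _)) // lerD // distrC.
Unshelve. all: by end_near. Qed.

End MultivariateCalculus.

(** * Smooth maps into the group *)

Section SmoothMapsIntoGroup.
Context {R : realType} {n : nat} (G : compactLieGroup R n).
Implicit Types (c d : chart R n G).

Lemma cinv_dom c x : ccod c x -> cdom c (cinv c x).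
Proof. by move=> [g cg <-]; rewrite cmapK. Qed.

Lemma cinvK c x : ccod c x -> c (cinv c x) = x.
Proof. by move=> [g cg <-]; rewrite cmapK. Qed.

Lemma chart_ccod c g : cdom c g -> ccod c (c g).
Proof. by move=> cg; exists g. Qed.

Lemma nbhs_cdom c g : cdom c g -> nbhs g (cdom c).
Proof. by move=> cg; apply: open_nbhs_nbhs; split=> //; exact: cdom_open. Qed.

Lemma nbhs_openP {T : topologicalType} (A : set T) :
  (forall x, A x -> nbhs x A) -> open A.
Proof. by move=> H; rewrite openE => x /H. Qed.

(** Finite classes of differentiability are needed alongside [smooth_fun], as
    the bump functions used to smooth out have finite class only. *)
Definition GCk k (f : G -> R) := forall c, atlas c ->
  Ck k (ccod c) (fun x => f (cinv c x)).

(** Smoothness of a map from an open set of coordinates into the group, tested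
    in every chart of the atlas; unlike [smooth_map] it composes with the
    group law without choosing charts. *)
Definition smooth_into m (U : set 'rV[R]_m) (Phi : 'rV[R]_m -> G) :=
  [/\ open U, forall x, U x -> {for x, continuous Phi} &
      forall d, atlas d ->
        smooth_map [set x | U x /\ cdom d (Phi x)] (fun x => d (Phi x))].

Lemma smooth_into_open m (U : set 'rV[R]_m) (Phi : 'rV[R]_m -> G) d :
  smooth_into U Phi -> open [set x | U x /\ cdom d (Phi x)].
Proof.
move=> [oU cP _]; apply: nbhs_openP => x [Ux dx].
have h1 : \forall y \near x, U y by apply: open_nbhs_nbhs.
have h2 : \forall y \near x, cdom d (Phi y) by apply: (cP x Ux); exact: nbhs_cdom.
by apply: filterS2 h1 h2 => y.
Qed.

Lemma GCk_smooth_into k m (U : set 'rV[R]_m) (Phi : 'rV[R]_m -> G) f :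
  smooth_into U Phi -> GCk k f -> Ck k U (fun x => f (Phi x)).
Proof.
move=> sP Cf; apply: Ck_local => x Ux.
have [d Ad dx] := atlas_cover (clg_atlas G) (Phi x).
have oV := @smooth_into_open _ _ _ d sP; have [_ _ /(_ d Ad) sd] := sP.
exists [set x | U x /\ cdom d (Phi x)]; split => //.
apply: (@Ck_ext _ _ _ _ (fun y => f (cinv d (d (Phi y))))) => //.
  by move=> y [_ dy]; rewrite cmapK.
apply: (Ck_comp oV (ccod_open d) _ (fun j => sd j k) (Cf d Ad)).
by move=> y [_ dy]; exact: chart_ccod.
Qed.

(** The chain rule through a chart: [Phi] itself has values in the group, so
    its derivative makes sense only in coordinates. *)
Lemma is_derive_chart m (U : set 'rV[R]_m) (Phi : 'rV[R]_m -> G) f d x i :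
  smooth_into U Phi -> GCk 1 f -> atlas d -> U x -> cdom d (Phi x) ->
  is_derive x (std i) (fun y => f (Phi y))
   (\sum_j 'D_(std j) (fun z => f (cinv d z)) (d (Phi x)) *
           'D_(std i) (fun y => d (Phi y) 0 j) x).
Proof.
move=> sP Cf Ad Ux dx; have oV := @smooth_into_open _ _ _ d sP.
have [_ _ /(_ d Ad) sd] := sP.
have := @is_derive_comp_rV R m n (fun z => f (cinv d z)) (fun y => d (Phi y)) x (std i)
  (C1_differentiable (ccod_open d) (Cf d Ad) (chart_ccod dx))
  (fun j => ((sd j 1%N).2 i).1 x (conj Ux dx)).
apply: near_eq_is_derive; apply: (near_open oV); first by split.
by move=> y [_ dy]; rewrite cmapK.
Qed.

Lemma smooth_into_chart c : atlas c -> smooth_into (ccod c) (cinv c).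
Proof.
move=> Ac; split; [exact: ccod_open|exact: cinv_continuous|].
by move=> d Ad; exact: (atlas_compat (clg_atlas G)).
Qed.

Lemma smooth_into_cst m (U : set 'rV[R]_m) g : open U -> smooth_into U (fun=> g).
Proof.
move=> oU; split=> // [x _|d Ad j k]; first exact: cst_continuous.
have [dg|dg] := pselect (cdom d g); last first.
  by apply: Ck_local => x [].
apply: Ck_cst; rewrite [X in open X](_ : _ = U) //.
by apply/seteqP; split=> x; [case|split].
Qed.

Lemma continuous_rV m l (F : 'rV[R]_m -> 'rV[R]_l) x :
  (forall j, {for x, continuous (fun x => F x 0 j)}) -> {for x, continuous F}.
Proof.
move=> cF; apply/(@cvgrPdist_le _ _ _ _ (nbhs_filter x) F) => /= e e0.
have : \forall y \near x, forall i, `|F x 0 i - F y 0 i| <= e.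
  apply: (filter_forall (nbhs_filter x)) => i.
  by have /cvgrPdist_le/(_ _ e0) := cF i.
apply: filterS => y Hy; apply: rV_norm_le; first exact: ltW.
by move=> i; rewrite !mxE.
Qed.

Lemma smooth_into_comp m l (U : set 'rV[R]_m) (V : set 'rV[R]_l)
    (F : 'rV[R]_m -> 'rV[R]_l) (Phi : 'rV[R]_l -> G) :
  open U -> smooth_map U F -> (forall x, U x -> V (F x)) ->
  smooth_into V Phi -> smooth_into U (fun x => Phi (F x)).
Proof.
move=> oU sF UV sP; have [oV cP sd] := sP.
have cF x : U x -> {for x, continuous F}.
  by move=> Ux; apply: continuous_rV => j; exact: Ck_continuous (sF j 0%N) Ux.
have cPF x : U x -> {for x, continuous (fun x => Phi (F x))}.
  move=> Ux; apply: (@continuous_comp _ _ _ F Phi); first exact: cF.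
  exact: cP (UV _ Ux).
split=> // d Ad j k.
have oW : open [set x | U x /\ cdom d (Phi (F x))].
  apply: nbhs_openP => x [Ux dx].
  have h1 : \forall y \near x, U y by apply: open_nbhs_nbhs.
  have h2 : \forall y \near x, cdom d (Phi (F y)) by apply: (cPF x Ux); exact: nbhs_cdom.
  by apply: filterS2 h1 h2 => y.
apply: (Ck_comp oW (@smooth_into_open _ _ _ d sP) _ _ (sd d Ad j k)).
  by move=> x [/UV].
by move=> l'; apply: Ck_sub (sF l' k) => x [].
Qed.

(** Smoothness is local, so the product may be written in charts around
    [Phi x] and [Psi x], where the compatibility of the atlas with the group law
    applies. *)
Lemma smooth_into_mul m (U : set 'rV[R]_m) (Phi Psi : 'rV[R]_m -> G) :
  smooth_into U Phi -> smooth_into U Psi -> smooth_into U (fun x => Phi x * Psi x)%g.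
Proof.
move=> sP sQ; have [oU cP sdP] := sP; have [_ cQ sdQ] := sQ.
have cPQ x : U x -> {for x, continuous (fun x => (Phi x * Psi x)%g)}.
  move=> Ux; rewrite /prop_for /continuous_at.
  exact: (cvg_comp _ _ (cvg_pair (cP x Ux) (cQ x Ux)) (mulg_continuous (Phi x, Psi x))).
split=> // d Ad j k; apply: Ck_local => x [Ux dx].
have [a Aa ax] := atlas_cover (clg_atlas G) (Phi x).
have [b Ab bx] := atlas_cover (clg_atlas G) (Psi x).
pose W := [set y | U y /\ [/\ cdom a (Phi y), cdom b (Psi y) & cdom d (Phi y * Psi y)%g]].
exists W; split; first by [].
have oW : open W.
  apply: nbhs_openP => y [Uy [ay b_y dy]].
  have h1 : \forall y \near y, U y by apply: open_nbhs_nbhs.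
  have h2 : \forall y \near y, cdom a (Phi y) by apply: (cP y Uy); exact: nbhs_cdom.
  have h3 : \forall y \near y, cdom b (Psi y) by apply: (cQ y Uy); exact: nbhs_cdom.
  have h4 : \forall y \near y, cdom d (Phi y * Psi y)%g by apply: (cPQ y Uy); exact: nbhs_cdom.
  by apply: filterS2 (filterI h1 h2) (filterI h3 h4) => z [? ?] [].
have oV : open [set z : 'rV[R]_(n + n) |
   [/\ ccod a (lsubmx z), ccod b (rsubmx z) &
       cdom d (cinv a (lsubmx z) * cinv b (rsubmx z))%g]].
  apply: nbhs_openP => z [az bz dz].
  have cl : {for z, continuous (lsubmx : 'rV[R]_(n + n) -> 'rV[R]_n)}.
    by apply: differentiable_continuous; exact: differentiable_lsubmx.
  have cr : {for z, continuous (rsubmx : 'rV[R]_(n + n) -> 'rV[R]_n)}.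
    by apply: differentiable_continuous; exact: differentiable_rsubmx.
  have h1 : \forall z \near z, ccod a (lsubmx z).
    by apply: cl; apply: open_nbhs_nbhs; split=> //; exact: ccod_open.
  have h2 : \forall z \near z, ccod b (rsubmx z).
    by apply: cr; apply: open_nbhs_nbhs; split=> //; exact: ccod_open.
  have h3 : \forall z \near z, cdom d (cinv a (lsubmx z) * cinv b (rsubmx z))%g.
    have ca := @continuous_comp _ _ _ (lsubmx : 'rV[R]_(n + n) -> 'rV[R]_n) (cinv a) z cl (cinv_continuous az).
    have cb := @continuous_comp _ _ _ (rsubmx : 'rV[R]_(n + n) -> 'rV[R]_n) (cinv b) z cr (cinv_continuous bz).
    have := cvg_comp _ _ (cvg_pair ca cb) (mulg_continuous (cinv a (lsubmx z), cinv b (rsubmx z))).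
    by apply; exact: nbhs_cdom.
  by apply: filterS2 h1 (filterI h2 h3) => y ? [].
apply: (@Ck_ext _ _ _ _ (fun y => d (cinv a (lsubmx (row_mx (a (Phi y)) (b (Psi y)))) *
    cinv b (rsubmx (row_mx (a (Phi y)) (b (Psi y)))))%g 0 j)) => //.
  by move=> y [_ [ay b_y _]]; rewrite row_mxKl row_mxKr !cmapK.
apply: (Ck_comp (F := fun y => row_mx (a (Phi y)) (b (Psi y))) oW oV _ _
   (atlas_mul (clg_atlas G) Aa Ab Ad j k)).
  move=> y [_ [ay b_y dy]]; rewrite /= row_mxKl row_mxKr !cmapK //.
  by split=> //; exact: chart_ccod.
move=> l; rewrite -(splitK l); case: (fintype.split l) => l' /=.
  apply: (@Ck_ext _ _ _ _ (fun x => a (Phi x) 0 l')) => //.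
    by move=> y _; rewrite row_mxEl.
  by apply: Ck_sub (sdP a Aa l' k) => y [? []].
apply: (@Ck_ext _ _ _ _ (fun x => b (Psi x) 0 l')) => //.
  by move=> y _; rewrite row_mxEr.
by apply: Ck_sub (sdQ b Ab l' k) => y [? []].
Qed.

Lemma smooth_into_translate c (a b : G) : atlas c ->
  smooth_into (ccod c) (fun x => a * cinv c x * b)%g.
Proof.
move=> Ac; apply: smooth_into_mul; last exact/smooth_into_cst/ccod_open.
apply: smooth_into_mul; last exact: smooth_into_chart.
exact/smooth_into_cst/ccod_open.
Qed.

Lemma GCk_translate k (a b : G) f : GCk k f -> GCk k (fun g => f (a * g * b)%g).
Proof.
by move=> Cf c Ac; exact: GCk_smooth_into (smooth_into_translate a b Ac) Cf.
Qed.

End SmoothMapsIntoGroup.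

(** * Right-invariant vector fields *)

Section RightInvariantFields.
Context {R : realType} {n : nat} (G : compactLieGroup R n).
Implicit Types (c d : chart R n G).

(** A fixed chart at the identity; its coordinate vectors at the identity serve
    as a basis of the Lie algebra. *)
Definition base_chart : chart R n G :=
  s2val (cid2 (atlas_cover (clg_atlas G) 1%g)).
Local Notation c0 := base_chart.
Local Notation y0 := (c0 1%g).

Lemma base_atlas : atlas c0.
Proof. exact: (s2valP (cid2 (atlas_cover (clg_atlas G) 1%g))). Qed.

Lemma base_cdom : cdom c0 1%g.
Proof. exact: (s2valP' (cid2 (atlas_cover (clg_atlas G) 1%g))). Qed.

Lemma base_ccod : ccod c0 y0.
Proof. exact: chart_ccod base_cdom. Qed.

Lemma cinv_base : cinv c0 y0 = 1%g.
Proof. exact: cmapK base_cdom. Qed.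

(** The derivation of functions along the right-invariant vector field whose
    value at the identity is the [i]-th coordinate vector of the base chart. *)
Definition rfield (i : 'I_n) (f : G -> R) : G -> R := fun g =>
  'D_(std i) (fun y => f (cinv c0 y * g)%g) y0.

(** The coordinates in the chart [c] of the right-invariant fields. *)
Definition frame c (x : 'rV[R]_n) : 'M[R]_n :=
  \matrix_(i, k) 'D_(std i) (fun y => c (cinv c0 y * cinv c x)%g 0 k) y0.

Lemma smooth_into_base g : smooth_into (ccod c0) (fun y => cinv c0 y * g)%g.
Proof.
apply: smooth_into_mul; first exact: smooth_into_chart base_atlas.
exact/smooth_into_cst/ccod_open.
Qed.

(** Right-invariant fields commute with right translations; this makes the
    entries of a representation satisfy a linear system. *)
Lemma rfield_right_translate i f h g :
  rfield i (fun g => f (g * h)%g) g = rfield i f (g * h)%g.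
Proof. by rewrite /rfield; under eq_fun do rewrite -mulgA. Qed.

Lemma rfield_is_derive i f g : GCk 1 f ->
  is_derive y0 (std i) (fun y => f (cinv c0 y * g)%g) (rfield i f g).
Proof.
move=> Cf; apply: derivableP; have [_ /(_ i)[d _]] :=
  GCk_smooth_into (smooth_into_base g) Cf.
exact: d base_ccod.
Qed.

Lemma rfield_frame i f c x : GCk 1 f -> atlas c -> ccod c x ->
  rfield i f (cinv c x) =
  \sum_k frame c x i k * 'D_(std k) (fun y => f (cinv c y)) x.
Proof.
move=> Cf Ac cx.
have cg : cdom c (cinv c0 y0 * cinv c x)%g.
  by rewrite cinv_base mul1g; exact: cinv_dom.
have [_] := is_derive_chart i (smooth_into_base (cinv c x)) Cf Ac base_ccod cg.
rewrite cinv_base mul1g cinvK // /rfield => ->.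
by apply: eq_bigr => k _; rewrite mxE mulrC.
Qed.

Lemma Ck_row_mxl m l k (U : set 'rV[R]_m) (x : 'rV[R]_l) j : open U ->
  Ck k U (fun y : 'rV[R]_m => row_mx y x 0 j).
Proof.
move=> oU; rewrite -(splitK j); case: (fintype.split j) => j' /=.
  by apply: (Ck_ext oU _ (Ck_coord k j' oU)) => y _; rewrite row_mxEl.
by apply: (Ck_ext oU _ (Ck_cst k (x 0 j') oU)) => y _; rewrite row_mxEr.
Qed.

Lemma Ck_row_mxr m l k (U : set 'rV[R]_m) (x : 'rV[R]_l) j : open U ->
  Ck k U (fun y : 'rV[R]_m => row_mx x y 0 j).
Proof.
move=> oU; rewrite -(splitK j); case: (fintype.split j) => j' /=.
  by apply: (Ck_ext oU _ (Ck_cst k (x 0 j') oU)) => y _; rewrite row_mxEl.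
by apply: (Ck_ext oU _ (Ck_coord k j' oU)) => y _; rewrite row_mxEr.
Qed.

Lemma delta_mx_lshift m l (i : 'I_m) :
  std (lshift l i) = row_mx (std i) 0 :> 'rV[R]_(m + l).
Proof.
apply/rowP => j; rewrite -(splitK j); case: (fintype.split j) => j' /=.
  by rewrite row_mxEl !mxE eq_lshift.
by rewrite row_mxEr !mxE eq_rlshift andbF.
Qed.

Lemma delta_mx_rshift m l (i : 'I_l) :
  std (rshift m i) = row_mx 0 (std i) :> 'rV[R]_(m + l).
Proof.
apply/rowP => j; rewrite -(splitK j); case: (fintype.split j) => j' /=.
  by rewrite row_mxEl !mxE eq_lrshift andbF.
by rewrite row_mxEr !mxE eq_rshift.
Qed.

Lemma smooth_into_pair c d : atlas c -> atlas d ->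
  let W := [set z : 'rV[R]_(n + n) | ccod c (lsubmx z) /\ ccod d (rsubmx z)] in
  open W /\ smooth_into W (fun z => cinv c (lsubmx z) * cinv d (rsubmx z))%g.
Proof.
move=> Ac Ad W.
have cl (z : 'rV[R]_(n + n)) : {for z, continuous (lsubmx : 'rV[R]_(n + n) -> 'rV[R]_n)}.
  by apply: differentiable_continuous; exact: differentiable_lsubmx.
have cr (z : 'rV[R]_(n + n)) : {for z, continuous (rsubmx : 'rV[R]_(n + n) -> 'rV[R]_n)}.
  by apply: differentiable_continuous; exact: differentiable_rsubmx.
have oW : open W.
  apply: nbhs_openP => z [az bz].
  have h1 : \forall z \near z, ccod c (lsubmx z).
    by apply: cl; apply: open_nbhs_nbhs; split=> //; exact: ccod_open.
  have h2 : \forall z \near z, ccod d (rsubmx z).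
    by apply: cr; apply: open_nbhs_nbhs; split=> //; exact: ccod_open.
  by apply: filterS2 h1 h2 => y ? ?.
split=> //; apply: smooth_into_mul.
  apply: (smooth_into_comp oW _ _ (smooth_into_chart Ac)); last by move=> z [].
  move=> j N'; apply: (Ck_ext oW _ (Ck_coord N' (lshift n j) oW)) => z _.
  by rewrite mxE.
apply: (smooth_into_comp oW _ _ (smooth_into_chart Ad)); last by move=> z [].
move=> j N'; apply: (Ck_ext oW _ (Ck_coord N' (rshift n j) oW)) => z _.
by rewrite mxE.
Qed.

Lemma frame_smooth c i k : atlas c -> smooth_on (ccod c) (fun x => frame c x i k).
Proof.
move=> Ac N.
pose W := [set z : 'rV[R]_(n + n) | ccod c0 (lsubmx z) /\ ccod c (rsubmx z)].
pose Phi (z : 'rV[R]_(n + n)) := (cinv c0 (lsubmx z) * cinv c (rsubmx z))%g.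
have [oW sPhi] := smooth_into_pair base_atlas Ac.
have oW' := @smooth_into_open _ _ _ _ _ _ c sPhi.
have [_ _ /(_ c Ac k N.+1)[_ /(_ (lshift n i))[_ CM]]] := sPhi.
apply: (@Ck_ext _ _ _ _ (fun x => 'D_(std (lshift n i)) (fun z => c (Phi z) 0 k) (row_mx y0 x))).
- exact: ccod_open.
- move=> x cx; rewrite mxE /derive.
  set g1 := fun h => h^-1 *: _; set g2 := fun h => h^-1 *: _.
  suff -> : g1 = g2 by [].
  rewrite funeqE /g1 /g2 /Phi => h /=.
  have -> : h *: std (lshift n i) + row_mx y0 x = row_mx (h *: std i + y0) x.
    by rewrite delta_mx_lshift scale_row_mx add_row_mx scaler0 add0r.
  by rewrite !row_mxKl !row_mxKr.
apply: (Ck_comp (F := fun x => row_mx y0 x) (ccod_open c) oW' _ _ CM).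
  move=> x cx /=; rewrite /W /Phi /= row_mxKl row_mxKr cinv_base mul1g.
  by split; [split=> //; exact: base_ccod|exact: cinv_dom].
by move=> l; apply: Ck_row_mxr; exact: ccod_open.
Qed.

(** In a chart the field is a first order operator with smooth coefficients. *)
Lemma GCk_rfield k i f : GCk k.+1 f -> GCk k (rfield i f).
Proof.
move=> Cf c Ac.
apply: (@Ck_ext _ _ _ _ (fun x => \sum_j frame c x i j *
   'D_(std j) (fun y => f (cinv c y)) x)); first exact: ccod_open.
  move=> x cx; rewrite rfield_frame //.
  by move=> d Ad; exact: (@Ck_le _ _ _ k.+1 _ _ _ (Cf d Ad)).
apply: Ck_sum => [|j]; first exact: ccod_open.
apply: Ck_mul; [exact: ccod_open|exact: frame_smooth|].
by have [_ /(_ j)[]] := Cf c Ac.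
Qed.

End RightInvariantFields.

Lemma differentiable_rV {R : realType} m l (F : 'rV[R]_m -> 'rV[R]_l) x :
  (forall j, differentiable (fun y => F y 0 j) x) -> differentiable F x.
Proof.
move=> dF; have -> : F = \sum_j (fun y => F y 0 j *: std j).
  by apply/funext => y; rewrite fct_sumE; exact: rV_sum_std.
by apply: differentiable_sum => j; exact: differentiableZl.
Qed.

Lemma jacobianE {R : realType} m l (F : 'rV[R]_m -> 'rV[R]_l) x i j :
  (forall j, differentiable (fun y => F y 0 j) x) ->
  jacobian F x i j = 'D_(std i) (fun y => F y 0 j) x.
Proof.
move=> dF; have dFx := differentiable_rV dF.
have := deriveEjacobian (std i) dFx; rewrite -rowE => /(congr1 (fun A : 'rV_l => A 0 j)).
by rewrite derive_mx; [rewrite !mxE => ->|exact: diff_derivable].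
Qed.

Section Metric.
Context {R : realType} {n : nat} (G : compactLieGroup R n) (met : biinvariantMetric G).
Implicit Types (c d : chart R n G).
Local Notation c0 := (base_chart G).
Local Notation y0 := (c0 1%g).

Definition gram0 : 'M[R]_n := met c0 y0.

Lemma gram0_unit : gram0 \in unitmx.
Proof.
rewrite -row_free_unit -kermx_eq0; apply/rowV0P => v /sub_kermxP v0.
apply/eqP; apply: contraT => vn0.
have := gram_posdef met (base_atlas G) (base_ccod G) vn0.
by rewrite -/gram0 v0 mul0mx mxE ltxx.
Qed.

(** Right translations are isometries, and carry the coordinate fields of the
    base chart at the identity to the frame. *)
Lemma gram_frame c x : atlas c -> ccod c x ->
  gram0 = frame c x *m met c x *m (frame c x)^T.
Proof.
move=> Ac cx; have cg : cdom c (1 * cinv c0 y0 * cinv c x)%g.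
  by rewrite cinv_base !mul1g; exact: cinv_dom.
have := gram_invariant met (base_atlas G) Ac (base_ccod G) cg.
rewrite /= -/gram0; set F := fun y => _.
have -> : c (1 * cinv c0 y0 * cinv c x)%g = x by rewrite cinv_base !mul1g cinvK.
have E : F = fun y => c (cinv c0 y * cinv c x)%g.
  by apply/funext => y; rewrite /F mul1g.
suff -> : jacobian F y0 = frame c x by [].
apply/matrixP => i k; rewrite jacobianE ?mxE E // => j.
have sP := @smooth_into_base _ _ G (cinv c x).
have [_ _ /(_ c Ac) sd] := sP.
apply: (C1_differentiable (@smooth_into_open _ _ _ _ _ _ c sP) (sd j 1%N)).
by split; [exact: base_ccod|move: cg; rewrite mul1g].
Qed.

(** The inverse of the frame, read off from [gram_frame]; this form shows that
    it depends smoothly on the point. *)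
Definition coframe c x : 'M[R]_n := met c x *m (frame c x)^T *m invmx gram0.

Lemma frameK c x : atlas c -> ccod c x -> frame c x *m coframe c x = 1%:M.
Proof.
move=> Ac cx; rewrite /coframe !mulmxA -gram_frame //.
exact: mulmxV gram0_unit.
Qed.

Lemma coframeK c x : atlas c -> ccod c x -> coframe c x *m frame c x = 1%:M.
Proof. by move=> Ac cx; apply: mulmx1C; exact: frameK. Qed.

Lemma coframe_smooth c i k : atlas c -> smooth_on (ccod c) (fun x => coframe c x i k).
Proof.
move=> Ac N; have oc := ccod_open c.
apply: (@Ck_ext _ _ _ _ (fun x => \sum_j (\sum_l met c x i l * frame c x j l) * invmx gram0 j k)) => //.
  by move=> x _; rewrite mxE; apply: eq_bigr => j _; congr (_ * _); rewrite mxE;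
     apply: eq_bigr => l _; rewrite [in RHS]mxE.
apply: Ck_sum => // j; apply: Ck_mul => //; last exact: Ck_cst.
apply: Ck_sum => // l; apply: Ck_mul => //; last exact: frame_smooth.
exact: gram_smooth.
Qed.

Lemma derive_coframe k f c x : GCk 1 f -> atlas c -> ccod c x ->
  'D_(std k) (fun y => f (cinv c y)) x =
  \sum_i coframe c x k i * rfield i f (cinv c x).
Proof.
move=> Cf Ac cx; under eq_bigr do rewrite rfield_frame // mulr_sumr.
rewrite exchange_big /=.
transitivity (\sum_j (coframe c x *m frame c x) k j * 'D_(std j) (fun y => f (cinv c y)) x).
  rewrite coframeK // (bigD1 k) //= mxE eqxx mul1r big1 ?addr0 // => j jk.
  by rewrite mxE eq_sym (negbTE jk) mul0r.
apply: eq_bigr => j _; rewrite mxE mulr_suml; apply: eq_bigr => i _.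
by rewrite mulrA.
Qed.

Lemma invmx_gram c x : atlas c -> ccod c x ->
  invmx (met c x) = (frame c x)^T *m invmx gram0 *m frame c x.
Proof.
move=> Ac cx.
have h : met c x *m ((frame c x)^T *m invmx gram0 *m frame c x) = 1%:M.
  by rewrite !mulmxA -/(coframe c x) coframeK.
have [U _] := mulmx1_unit h.
by rewrite -[RHS](mulKmx U) h mulmx1.
Qed.

End Metric.

(** * The Laplace-Beltrami operator by invariant fields *)

Section DeterminantCalculus.
Context {R : realType}.

Lemma is_derive_sum_seq m I (r : seq I) (f : I -> 'rV[R]_m -> R) (df : I -> R) x v :
  (forall i, is_derive x v (f i) (df i)) ->
  is_derive x v (fun y => \sum_(i <- r) f i y) (\sum_(i <- r) df i).
Proof.
move=> H; elim: r => [|i r IH].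
  rewrite big_nil (_ : (fun y => _) = cst 0); first exact: is_derive_cst.
  by apply/funext => y; rewrite big_nil.
rewrite big_cons (_ : (fun y => _) = f i \+ (fun y => \sum_(i <- r) f i y)); last first.
  by apply/funext => y; rewrite big_cons.
exact: is_deriveD.
Qed.

Lemma derivable_prod m I (r : seq I) (P : pred I) (f : I -> 'rV[R]_m -> R) x v :
  (forall i, derivable (f i) x v) ->
  derivable (fun y => \prod_(i <- r | P i) f i y) x v.
Proof.
move=> H; elim: r => [|i r IH].
  rewrite (_ : (fun y => _) = cst 1); first exact: derivable_cst.
  by apply/funext => y; rewrite big_nil.
have E : (fun y => \prod_(j <- i :: r | P j) f j y) =
    fun y => if P i then f i y * \prod_(j <- r | P j) f j y else \prod_(j <- r | P j) f j y.
  by apply/funext => y; rewrite big_cons.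
by rewrite E; case: (P i); [exact: (derivableM (H i) IH)|exact: IH].
Qed.

Lemma is_derive_prod1 m I (r : seq I) (f : I -> 'rV[R]_m -> R) x v :
  (forall i, derivable (f i) x v) -> (forall i, f i x = 1) ->
  is_derive x v (fun y => \prod_(i <- r) f i y) (\sum_(i <- r) 'D_v (f i) x).
Proof.
move=> H H1; elim: r => [|i r IH].
  rewrite big_nil (_ : (fun y => _) = cst 1); first exact: is_derive_cst.
  by apply/funext => y; rewrite big_nil.
rewrite big_cons (_ : (fun y => _) = f i \* (fun y => \prod_(i <- r) f i y)); last first.
  by apply/funext => y; rewrite big_cons.
have := is_deriveM (derivableP (H i)) IH.
rewrite H1 [X in X *: 'D_v _ _](_ : _ = 1); last by rewrite big1.
by rewrite !scale1r addrC.
Qed.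

(** With two vanishing factors the product vanishes to the second order. *)
Lemma is_derive_prod0 m (I : finType) (f : I -> 'rV[R]_m -> R) x v i j :
  (forall i, derivable (f i) x v) -> i != j -> f i x = 0 -> f j x = 0 ->
  is_derive x v (fun y => \prod_i f i y) 0.
Proof.
move=> H ij fi fj.
rewrite (_ : (fun y => _) = f i \* (f j \* (fun y => \prod_(k | (k != i) && (k != j)) f k y))); last first.
  by apply/funext => y; rewrite (bigD1 i) //= (bigD1 j) //= eq_sym.
have d1 := @derivable_prod _ _ (index_enum I) (fun k => (k != i) && (k != j)) _ _ _ H.
move: d1; set h := fun y => _ => d1.
have := is_deriveM (derivableP (H i)) (is_deriveM (derivableP (H j)) (derivableP d1)).
by rewrite fi -[(f j * h) x]/(f j x * h x) fj mul0r !scale0r addr0.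
Qed.

(** Only the identity permutation contributes at first order. *)
Lemma is_derive_det1 m l (M : 'rV[R]_m -> 'M[R]_l) x v :
  (forall i j, derivable (fun y => M y i j) x v) -> M x = 1%:M ->
  is_derive x v (fun y => \det (M y)) (\sum_i 'D_v (fun y => M y i i) x).
Proof.
move=> dM M1.
pose D (s : {perm 'I_l}) := if s == 1%g then \sum_i 'D_v (fun y => M y i i) x else 0.
have -> : \sum_i 'D_v (fun y => M y i i) x = \sum_(s : {perm 'I_l}) D s.
  by rewrite [RHS](bigD1 1%g) //= {1}/D eqxx [X in _ + X]big1 ?addr0 // => s; rewrite /D => /negbTE ->.
rewrite /determinant; apply: is_derive_sum_seq => s.
have [->|s1] := eqVneq s 1%g.
  rewrite /D eqxx odd_perm1 (_ : (fun y => _) = (fun y => \prod_i M y i i)); last first.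
    by apply/funext => y; rewrite mul1r; apply: eq_bigr => i _; rewrite perm1.
  by apply: is_derive_prod1 => // i; rewrite M1 mxE eqxx.
rewrite /D (negbTE s1).
have [i si] : exists i, s i != i.
  apply/existsP; rewrite -negb_forall; apply: contraNN s1 => /forallP H.
  by apply/eqP/permP => i; rewrite perm1; apply/eqP/H.
have h : is_derive x v (fun y => \prod_i0 M y i0 (s i0)) 0.
  apply: (@is_derive_prod0 _ _ (fun i y => M y i (s i)) _ _ i (s i)) => //.
  - by rewrite eq_sym.
  - by rewrite M1 mxE eq_sym (negbTE si).
  - by rewrite M1 mxE (inj_eq perm_inj) eq_sym (negbTE si).
have := is_deriveZ ((-1) ^+ s) h; rewrite scaler0.
by rewrite (_ : _ \*: _ = fun y => (-1) ^+ s * \prod_i M y i (s i)).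
Qed.

Lemma Ck_prod m k (U : set 'rV[R]_m) I (r : seq I) (f : I -> 'rV[R]_m -> R) :
  open U -> (forall i, Ck k U (f i)) -> Ck k U (fun x => \prod_(i <- r) f i x).
Proof.
move=> oU Cf; elim: r => [|i r IH].
  by apply: (Ck_ext oU _ (Ck_cst k 1 oU)) => x _; rewrite big_nil.
by apply: (Ck_ext oU _ (Ck_mul oU (Cf i) IH)) => x _; rewrite big_cons.
Qed.

Lemma Ck_det m l k (U : set 'rV[R]_m) (M : 'rV[R]_m -> 'M[R]_l) :
  open U -> (forall i j, Ck k U (fun x => M x i j)) -> Ck k U (fun x => \det (M x)).
Proof.
move=> oU CM; apply: Ck_sum => // s; apply: Ck_mul => //; first exact: Ck_cst.
exact: Ck_prod.
Qed.

Lemma is_derive_sqrt_comp m (U : set 'rV[R]_m) (g : 'rV[R]_m -> R) x v :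
  open U -> Ck 1 U g -> U x -> 0 < g x ->
  is_derive x v (fun y => Num.sqrt (g y)) ((2 * Num.sqrt (g x))^-1 * 'D_v g x).
Proof.
move=> oU Cg Ux gx; have dg := C1_differentiable oU Cg Ux.
have [ds sE] := is_derive1_sqrt gx.
have dsq := (derivable1_diffP _ _).1 ds.
have dc := differentiable_comp dg dsq.
apply: DeriveDef; first by apply: diff_derivable; exact: dc.
rewrite deriveE // [X in 'd X _ _](_ : _ = Num.sqrt \o g) //.
rewrite diff_comp //= diff1E // derive1E sE -deriveE //.
exact: mulrC.
Qed.

(** The segment from the identity to a positive definite matrix stays positive
    definite, so the determinant does not vanish along it. *)
Lemma posdef_det_gt0 l (A : 'M[R]_l) :
  (forall v : 'rV[R]_l, v != 0 -> 0 < (v *m A *m v^T) 0 0) -> 0 < \det A.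
Proof.
move=> pA.
(* The determinant along the segment is a polynomial in the parameter, to which
the intermediate value theorem applies. *)
pose P : 'M[{poly R}]_l := map_mx polyC (1%:M) + 'X *: map_mx polyC (A - 1%:M).
have PE t : (\det P).[t] = \det (1%:M + t *: (A - 1%:M)).
  rewrite -[LHS]/(horner_eval t (\det P)) -det_map_mx; congr (\det _).
  by apply/matrixP => i j; rewrite /P !mxE /= /horner_eval !(hornerD, hornerM, hornerX, hornerC).
have nz t : 0 <= t <= 1 -> \det (1%:M + t *: (A - 1%:M)) != 0.
  move=> /andP[t0 t1]; rewrite -unitfE -/(unitmx _).
  have : 1%:M + t *: (A - 1%:M) \in unitmx.
    rewrite -row_free_unit -kermx_eq0; apply/rowV0P => v /sub_kermxP v0.
    apply/eqP; apply: contraT => vn0.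
    have /(congr1 (fun M : 'M[R]_1 => M 0 0)) : v *m (1%:M + t *: (A - 1%:M)) *m v^T = 0.
      by rewrite v0 mul0mx.
    rewrite scalerBr addrCA mulmxDr mulmxBr mulmx1 -!scalemxAr mulmx1 mulmxDl mulmxBl.
    rewrite -!scalemxAl [in X in _ = X -> _]mxE => h.
    have vv : 0 < (v *m v^T) 0 0.
      rewrite mxE; have [i vi] : exists i, v 0 i != 0.
        apply/existsP; rewrite -negb_forall; apply: contraNN vn0 => /forallP H.
        by apply/eqP/rowP => i; rewrite mxE; apply/eqP/H.
      rewrite (bigD1 i) //= ltr_pwDl //.
        by rewrite mxE -expr2 exprn_even_gt0.
      by apply: sumr_ge0 => j _; rewrite mxE -expr2 sqr_ge0.
    move: h (pA v vn0) vv; rewrite !mxE.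
    set a := \sum_j _; set b := \sum_j _ => h a0 b0.
    nra.
  by rewrite unitmxE.
rewrite ltNge; apply/negP => dA.
have [|t t01 /rootP] := @poly_ivt R (- \det P) 0 1 ler01.
  by rewrite !hornerN !PE scale0r addr0 det1 scale1r addrCA subrr addr0 oppr_le0 ler01 oppr_ge0.
by rewrite hornerN PE => /eqP; rewrite oppr_eq0; apply/negP/nz.
Qed.

End DeterminantCalculus.

Section Laplacian.
Context {R : realType} {n : nat} (G : compactLieGroup R n) (met : biinvariantMetric G).
Implicit Types (c d : chart R n G).
Local Notation c0 := (base_chart G).
Local Notation y0 := (c0 1%g).

Lemma gram_det_gt0 c x : atlas c -> ccod c x -> 0 < \det (met c x).
Proof. by move=> Ac cx; apply: posdef_det_gt0; exact: gram_posdef. Qed.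

Lemma derive_lshift m l (g : 'rV[R]_(m + l) -> R) y x i :
  'D_(std (lshift l i)) g (row_mx y x) = 'D_(std i) (fun y => g (row_mx y x)) y.
Proof.
rewrite /derive; set g1 := fun h => h^-1 *: _; set g2 := fun h => h^-1 *: _.
suff -> : g1 = g2 by [].
rewrite funeqE /g1 /g2 => h /=.
by rewrite delta_mx_lshift scale_row_mx add_row_mx scaler0 add0r.
Qed.

Lemma derive_rshift m l (g : 'rV[R]_(m + l) -> R) y x i :
  'D_(std (rshift m i)) g (row_mx y x) = 'D_(std i) (fun x => g (row_mx y x)) x.
Proof.
rewrite /derive; set g1 := fun h => h^-1 *: _; set g2 := fun h => h^-1 *: _.
suff -> : g1 = g2 by [].
rewrite funeqE /g1 /g2 => h /=.
by rewrite delta_mx_rshift scale_row_mx add_row_mx scaler0 add0r.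
Qed.

(** Left translations preserve the metric, hence its volume density, so the
    right-invariant fields, whose flows are left translations, are divergence
    free. The variation of the Jacobian determinant of the left translation by
    [cinv c0 y] is computed at [y = y0], where this translation is the
    identity; the two orders of differentiation are exchanged. *)
Lemma frame_divergence c x i : atlas c -> ccod c x ->
  2 * \det (met c x) * (\sum_k 'D_(std k) (fun z => frame c z i k) x) +
  \sum_k frame c x i k * 'D_(std k) (fun z => \det (met c z)) x = 0.
Proof.
move=> Ac cx.
pose W := [set z : 'rV[R]_(n + n) | ccod c0 (lsubmx z) /\ ccod c (rsubmx z)].
pose Phi (z : 'rV[R]_(n + n)) := (cinv c0 (lsubmx z) * cinv c (rsubmx z))%g.
have [oW sPhi] := @smooth_into_pair R n G c0 c (base_atlas G) Ac.
pose W' := [set z | W z /\ cdom c (Phi z)].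
have oW' : open W' := @smooth_into_open _ _ _ _ _ _ c sPhi.
have [_ _ /(_ c Ac) sM] := sPhi.
pose M k (z : 'rV[R]_(n + n)) := c (Phi z) 0 k.
have W'x : W' (row_mx y0 x).
  rewrite /W' /W /Phi /= row_mxKl row_mxKr cinv_base mul1g.
  by split; [split=> //; exact: base_ccod|exact: cinv_dom].
pose U := [set y | W' (row_mx y x)].
have rc y : {for y, continuous (fun y : 'rV[R]_n => row_mx y x)}.
  by apply: continuous_rV => l; exact: (Ck_continuous (Ck_row_mxl 0 x l openT)).
have oU : open U.
  by apply: nbhs_openP => y Uy; apply: rc; apply: open_nbhs_nbhs.
have Ux : U y0 by [].
pose J y : 'M[R]_n := \matrix_(l, k) 'D_(std (rshift n l)) (M k) (row_mx y x).
have CJ l k : Ck 1 U (fun y => J y l k).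
  apply: (Ck_ext oU (f := fun y => 'D_(std (rshift n l)) (M k) (row_mx y x))).
    by move=> y _; rewrite mxE.
  have CM : Ck 1 W' ('D_(std (rshift n l)) (M k)).
    by have [_ /(_ (rshift n l))[_]] := sM k 2%N.
  by apply: (Ck_comp (F := fun y => row_mx y x) oU oW' _ _ CM) => // j; exact: Ck_row_mxl.
have JE y : U y -> jacobian (fun x' => c (cinv c0 y * cinv c x' * 1)%g) x = J y.
  move=> Uy.
  have [[_ _] cy] := Uy; rewrite /Phi row_mxKl row_mxKr in cy.
  have sT := smooth_into_translate (cinv c0 y) 1%g Ac.
  have [_ _ /(_ c Ac) sd] := sT.
  apply/matrixP => l k; rewrite jacobianE; last first.
    move=> j; apply: (C1_differentiable (@smooth_into_open _ _ _ _ _ _ c sT) (sd j 1%N)).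
    by split=> //; rewrite mulg1.
  have E : (fun z => c (cinv c0 y * cinv c z * 1)%g 0 k) = (fun z => M k (row_mx y z)).
    by apply/funext => z; rewrite /M /Phi row_mxKl row_mxKr mulg1.
  by rewrite E [RHS]mxE derive_rshift.
pose F y := c (cinv c0 y * cinv c x)%g.
(* The isometry property, with [J y] the Jacobian of the left translation. *)
have detE y : U y -> \det (met c x) = \det (J y) ^+ 2 * \det (met c (F y)).
  move=> Uy; have [[_ _] cy] := Uy; rewrite /Phi row_mxKl row_mxKr in cy.
  have := gram_invariant met Ac Ac (a := cinv c0 y) (b := 1%g) cx; rewrite mulg1 => /(_ cy).
  by rewrite /= JE // mulg1 => ->; rewrite !det_mulmx det_tr /F mulrAC -expr2.
have J1 : J y0 = 1%:M.
  apply/matrixP => l k; rewrite -JE // jacobianE; last first.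
    move=> j; have sT := smooth_into_translate (cinv c0 y0) 1%g Ac.
    have [_ _ /(_ c Ac) sd] := sT.
    apply: (C1_differentiable (@smooth_into_open _ _ _ _ _ _ c sT) (sd j 1%N)).
    by split=> //; rewrite cinv_base mul1g mulg1; exact: cinv_dom.
  have [_] : is_derive x (std l) (fun y => y 0 k) ((std l : 'rV[R]_n) 0 k).
    exact: is_derive_coord.
  have -> : (1%:M : 'M[R]_n) l k = (std l : 'rV[R]_n) 0 k by rewrite !mxE eqxx eq_sym.
  move=> <-.
  apply: near_eq_derive; apply: (near_open (ccod_open c) cx) => z cz.
  by rewrite cinv_base mul1g mulg1 cinvK.
have d1 := is_derive_det1 (fun l k => ((CJ l k).2 i).1 y0 Ux) J1.
have Cg : Ck 1 (ccod c) (fun z => \det (met c z)).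
  by apply: Ck_det => [|k l]; [exact: ccod_open|exact: gram_smooth].
have CF k : Ck 1 U (fun y => F y 0 k).
  apply: (Ck_ext oU (f := fun y => M k (row_mx y x))).
    by move=> y _; rewrite /M /Phi /F row_mxKl row_mxKr.
  by apply: (Ck_comp (F := fun y => row_mx y x) oU oW' _ _ (sM k 1%N)) => // j; exact: Ck_row_mxl.
have F0 : F y0 = x by rewrite /F cinv_base mul1g cinvK.
have d2 := @is_derive_comp_rV R n n (fun z => \det (met c z)) F y0 (std i).
have {}d2 := d2 _ (fun k => ((CF k).2 i).1 y0 Ux).
have {}d2 := d2 _; rewrite F0 in d2.
have {}d2 := d2 (C1_differentiable (ccod_open c) Cg cx).
have [_ h] := is_deriveM (is_deriveM d1 d1) d2.
have near_const : \forall y \near y0, \det (met c x) = (\det (J y) * \det (J y)) * \det (met c (F y)).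
  by apply: (near_open oU Ux) => y /detE; rewrite expr2.
have [_ dcst] : is_derive y0 (std i) (cst (\det (met c x))) 0 by exact: is_derive_cst.
(* The product of the next three factors does not depend on [y]. *)
have dE : 'D_(std i) (fun y => (\det (J y) * \det (J y)) * \det (met c (F y))) y0 = 0.
  by rewrite -dcst; apply/esym/near_eq_derive.
move: (etrans (esym dE) h) => {}h.
rewrite F0 -[(_ * _) y0]/(\det (J y0) * \det (J y0)) J1 det1 mulr1 !scale1r in h.
have DJ k : 'D_(std i) (fun y => J y k k) y0 = 'D_(std k) (fun z => frame c z i k) x.
  have CM : Ck 2 W' (M k) := sM k 2%N.
  transitivity ('D_(std (lshift n i)) ('D_(std (rshift n k)) (M k)) (row_mx y0 x)).
    have E : (fun y => J y k k) = (fun y => 'D_(std (rshift n k)) (M k) (row_mx y x)).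
      by apply/funext => y; rewrite mxE.
    by rewrite E derive_lshift.
  rewrite (derive_swap _ _ oW' CM W'x) derive_rshift.
  have E : (fun z => frame c z i k) = (fun z => 'D_(std (lshift n i)) (M k) (row_mx y0 z)).
    apply/funext => z; rewrite derive_lshift mxE.
    have E' : (fun y => c (cinv c0 y * cinv c z)%g 0 k) = (fun y => M k (row_mx y z)).
      by apply/funext => y; rewrite /M /Phi row_mxKl row_mxKr.
    by rewrite E'.
  by rewrite E.
apply/esym; rewrite [LHS]h addrC; congr (_ + _).
  under eq_bigr do rewrite DJ.
  set s := \sum_i _; rewrite -[LHS]/(_ * (s + s)); ring.
by apply: eq_bigr => k _; rewrite mxE mulrC.
Qed.

(** In local coordinates the Laplace-Beltrami operator is the constant
    coefficient quadratic expression in the right-invariant fields given by the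
    inverse metric at the identity: the first order terms vanish because these
    fields are divergence free. *)
Lemma laplace_beltrami_rfield c x f : atlas c -> ccod c x -> GCk 2 f ->
  laplace_beltrami (met c) (fun y => f (cinv c y)) x =
  \sum_i \sum_j invmx (gram0 met) i j * rfield i (rfield j f) (cinv c x).
Proof.
move=> Ac cx Cf; have oc := ccod_open c.
have Cf1 : GCk 1 f by move=> d Ad; exact: (@Ck_le _ _ 1 2 _ _ _ (Cf d Ad)).
have CY j : GCk 1 (rfield j f) by exact: GCk_rfield.
pose Q := invmx (gram0 met); pose vol y := Num.sqrt (\det (met c y)).
have Cg : Ck 1 (ccod c) (fun z => \det (met c z)).
  by apply: Ck_det => // k l; exact: gram_smooth.
have g0 := gram_det_gt0 Ac cx; have v0 : 0 < vol x by rewrite sqrtr_gt0.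
have dvol k := is_derive_sqrt_comp (std k) oc Cg cx g0.
have da i k : derivable (fun z => frame c z i k) x (std k).
  by have [_ /(_ k)[d _]] := @frame_smooth _ _ G c i k Ac 1%N; exact: d.
have dY j k : derivable (fun z => rfield j f (cinv c z)) x (std k).
  by have [_ /(_ k)[d _]] := CY j c Ac; exact: d.
rewrite /laplace_beltrami -/(vol x).
have inner k : 'D_(std k) (fun y => vol y *
      \sum_l invmx (met c y) k l * 'D_(std l) (fun y => f (cinv c y)) y) x =
    \sum_i \sum_j Q i j * ((vol x * 'D_(std k) (fun z => frame c z i k) x +
       (2 * vol x)^-1 * 'D_(std k) (fun z => \det (met c z)) x * frame c x i k) *
         rfield j f (cinv c x) + vol x * frame c x i k *
       'D_(std k) (fun z => rfield j f (cinv c z)) x).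
  have E : {near x, (fun y => vol y *
      \sum_l invmx (met c y) k l * 'D_(std l) (fun y => f (cinv c y)) y) =1
      (fun y => \sum_i \sum_j (Q i j * (vol y * frame c y i k * rfield j f (cinv c y))))}.
    apply: (near_open oc cx) => y cy.
    under [X in vol y * X]eq_bigr do rewrite invmx_gram //.
    transitivity (vol y * \sum_l (\sum_j (\sum_i frame c y i k * Q i j) * frame c y j l) *
       'D_(std l) (fun y => f (cinv c y)) y).
      congr (_ * _); apply: eq_bigr => l _; congr (_ * _); rewrite mxE.
      apply: eq_bigr => j _; congr (_ * _); rewrite mxE.
      by apply: eq_bigr => i _; rewrite mxE.
    transitivity (\sum_l \sum_j \sum_i Q i j * (vol y * frame c y i k *
        (frame c y j l * 'D_(std l) (fun y => f (cinv c y)) y))).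
      rewrite mulr_sumr; apply: eq_bigr => l _.
      rewrite mulr_suml mulr_sumr; apply: eq_bigr => j _.
      rewrite !mulr_suml mulr_sumr; apply: eq_bigr => i _.
      by ring.
    rewrite exchange_big /=; under eq_bigr do rewrite exchange_big /=.
    rewrite exchange_big /=; apply: eq_bigr => i _; apply: eq_bigr => j _.
    by rewrite rfield_frame // -!mulr_sumr.
  rewrite (near_eq_derive _ E).
  have [_ h] := (is_derive_sum_seq (index_enum _) (fun i =>
     is_derive_sum_seq (index_enum _) (fun j => is_deriveZ (Q i j)
       (is_deriveM (is_deriveM (dvol k) (derivableP (da i k))) (derivableP (dY j k)))))).
  apply: (etrans h); apply: eq_bigr => i _; apply: eq_bigr => j _.
  rewrite -[LHS]/(Q i j * ((vol x * frame c x i k) * 'D_(std k) (fun z => rfield j f (cinv c z)) x +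
     rfield j f (cinv c x) * (vol x * 'D_(std k) (fun z => frame c z i k) x +
     frame c x i k * ((2 * vol x)^-1 * 'D_(std k) (fun z => \det (met c z)) x)))).
  by ring.
under eq_bigr do rewrite inner.
rewrite exchange_big mulr_sumr; apply: eq_bigr => i _ /=.
rewrite exchange_big mulr_sumr; apply: eq_bigr => j _ /=.
rewrite -mulr_sumr big_split /= -mulr_suml.
have -> : \sum_k (vol x * 'D_(std k) (fun z => frame c z i k) x +
       (2 * vol x)^-1 * 'D_(std k) (fun z => \det (met c z)) x * frame c x i k) = 0.
  have := frame_divergence i Ac cx.
  rewrite -(sqr_sqrtr (ltW g0)) -/(vol x) => dv.
  apply: (etrans _ (etrans (congr1 (fun t => (2 * vol x)^-1 * t) dv) (mulr0 _))).
  rewrite /= mulrDr big_split /= -mulr_sumr; congr (_ + _).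
    by field; rewrite gt_eqF.
  by rewrite mulr_sumr; apply: eq_bigr => k _; ring.
under eq_bigr do rewrite -mulrA.
by rewrite -mulr_sumr mul0r add0r mulrCA mulKf ?gt_eqF // rfield_frame.
Qed.

End Laplacian.

(** * The Haar integral of continuous functions *)

Section HaarIntegral.
Context {R : realType} {n : nat} (G : compactLieGroup R n) (mu : haarMeasure G).
Local Notation cont := (fun u : G -> R => continuous u).
Local Notation T := (g_sigma_algebraType (@open G)).

(** The real-valued counterpart of [haar_int]: positivity and approximation by
    finite sums are statements about real integrals. *)
Definition hint (u : G -> R) : R := (\int[mu]_x u x)%R.

Lemma hint_cst (a : R) : hint (fun=> a) = a.
Proof. by rewrite /hint Rintegral_cst //= probability_setT mulr1. Qed.

Lemma cont_cst (a : R) : continuous (fun _ : G => a).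
Proof. by move=> x; exact: cst_continuous. Qed.

Lemma contD u v : cont u -> cont v -> continuous (fun x => u x + v x).
Proof. by move=> cu cv x; exact: (@continuousD _ _ _ u v x (cu x) (cv x)). Qed.

Lemma contM u v : cont u -> cont v -> continuous (fun x => u x * v x).
Proof. by move=> cu cv x; exact: (@continuousM _ _ u v x (cu x) (cv x)). Qed.

Lemma contN u : cont u -> continuous (fun x => - u x).
Proof. by move=> cu x; exact: (@continuousN _ _ _ u x (cu x)). Qed.

Lemma contB u v : cont u -> cont v -> continuous (fun x => u x - v x).
Proof. by move=> cu cv; apply: contD => //; exact: contN. Qed.

Lemma cont_sum I (r : seq I) (f : I -> G -> R) : (forall i, cont (f i)) ->
  continuous (fun x => \sum_(i <- r) f i x).
Proof.
move=> cf; elim: r => [|i r IH].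
  by under eq_fun do rewrite big_nil; exact: cont_cst.
by under eq_fun do rewrite big_cons; exact: contD.
Qed.

Lemma cont_norm u : cont u -> continuous (fun x => `|u x|).
Proof. by move=> cu x; apply: continuous_comp (cu x) (@norm_continuous _ _ _). Qed.

Lemma cont_shift (a b : G) u : cont u -> continuous (fun x => u (a * x * b)%g).
Proof.
move=> cu x; apply: (@continuous_comp _ _ _ (fun x => a * x * b)%g u) (cu _).
have h1 : {for x, continuous (fun x : G => (a * x)%g)}.
  exact: (cvg_comp _ _ (cvg_pair (cvg_cst a) cvg_id) (mulg_continuous (a, x))).
exact: (cvg_comp _ _ (cvg_pair h1 (cvg_cst b)) (mulg_continuous ((a * x)%g, b))).
Qed.

Lemma cont_lshift (a : G) u : cont u -> continuous (fun x => u (a * x)%g).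
Proof. by move=> cu; have := @cont_shift a 1%g u cu; under eq_fun do rewrite mulg1. Qed.

Lemma hintD u v : cont u -> cont v -> hint (fun x => u x + v x) = hint u + hint v.
Proof. by move=> cu cv; rewrite /hint RintegralD //; exact: continuous_integrable. Qed.

Lemma hintZ (a : R) u : cont u -> hint (fun x => a * u x) = a * hint u.
Proof. by move=> cu; rewrite /hint RintegralZl //; exact: continuous_integrable. Qed.

Lemma hintN u : cont u -> hint (fun x => - u x) = - hint u.
Proof. by move=> cu; under eq_fun do rewrite -mulN1r; rewrite hintZ // mulN1r. Qed.

Lemma hintB u v : cont u -> cont v -> hint (fun x => u x - v x) = hint u - hint v.
Proof. by move=> cu cv; rewrite hintD // ?hintN //; exact: contN. Qed.

Lemma hint_sum I (r : seq I) (f : I -> G -> R) : (forall i, cont (f i)) ->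
  hint (fun x => \sum_(i <- r) f i x) = \sum_(i <- r) hint (f i).
Proof.
move=> cf; elim: r => [|i r IH].
  by under eq_fun do rewrite big_nil; rewrite big_nil hint_cst.
by under eq_fun do rewrite big_cons; rewrite big_cons hintD // ?IH //; exact: cont_sum.
Qed.

Lemma hint_norm_le u B : cont u -> (forall x, `|u x| <= B) -> `|hint u| <= B.
Proof. exact: Rintegral_le_bound. Qed.

Lemma hint_le u v : cont u -> cont v -> (forall x, u x <= v x) -> hint u <= hint v.
Proof.
move=> cu cv uv; apply: le_Rintegral => //; exact: continuous_integrable.
Qed.

Lemma hint_ge0 u : (forall x, 0 <= u x) -> 0 <= hint u.
Proof. by move=> u0; exact: Rintegral_ge0. Qed.

Lemma hint_left (h : G) u : cont u -> hint (fun x => u (h * x)%g) = hint u.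
Proof.
move=> cu; have mh : measurable_fun setT (fun x : T => (h * x)%g : T).
  apply: (@measurability _ _ T T setT (fun x : G => (h * x)%g) (@open G)) => //.
  move=> _ [U oU <-]; rewrite setTI; apply: sub_sigma_algebra.
  apply: open_comp => // x _.
  exact: (cvg_comp _ _ (cvg_pair (cvg_cst h) cvg_id) (mulg_continuous (h, x))).
have mu_ : measurable_fun setT (EFin \o u : T -> \bar R).
  by have /integrableP[] := continuous_integrable mu cu.
have iu : mu.-integrable ((fun x : T => (h * x)%g : T) @^-1` setT)
    ((EFin \o u) \o (fun x : T => (h * x)%g : T)).
  by rewrite preimage_setT; exact: (continuous_integrable mu (@cont_lshift h u cu)).
rewrite /hint /Rintegral; congr fine.
have := integral_pushforward mh mu_ iu measurableT.
rewrite preimage_setT /= => <-.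
by apply: eq_measure_integral => A mA _; exact: haar_invariant.
Qed.

(** Finitely many left translates of [u] have a sum bounded below by a positive
    constant, by compactness, and they all have the same integral. *)
Lemma hint_gt0 u x0 : cont u -> (forall x, 0 <= u x) -> 0 < u x0 -> 0 < hint u.
Proof.
move=> cu u0 ux0; pose e := u x0 / 2; have e0 : 0 < e by rewrite divr_gt0.
pose O (g : G) := [set x : G | e < u (g * x)%g].
have [D _ Dc] : finite_subset_cover [set: G] O [set: G].
  have := clg_compact G; rewrite compact_cover; apply.
    move=> g _; apply: (@open_comp _ _ (fun x => u (g * x)%g) [set y | e < y]).
      by move=> x _; exact: cont_lshift.
    exact: open_gt.
  move=> g _; exists (x0 * g^-1)%g => //; rewrite /O /= mulgKV /e.
  by rewrite ltr_pdivrMr // ltr_pMr // ltr1n.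
pose s := enum_fset D.
have cs : continuous (fun x => \sum_(g <- s) u (g * x)%g).
  by apply: cont_sum => g; exact: cont_lshift.
have : e <= hint (fun x => \sum_(g <- s) u (g * x)%g).
  rewrite -(hint_cst e); apply: hint_le => //; first exact: cont_cst.
  move=> x; have [g gD gx] := Dc x I.
  have gs : g \in s by [].
  rewrite (big_rem g) //= ler_wpDr //; last exact: ltW.
  by apply: sumr_ge0.
rewrite hint_sum; last by move=> g; exact: cont_lshift.
under eq_bigr do rewrite hint_left //.
rewrite lt_neqAle hint_ge0 // andbT; apply: contraTN => /eqP <-.
by rewrite big1 // -ltNge.
Qed.

Lemma hint_eq0 u : cont u -> (forall x, 0 <= u x) -> hint u = 0 -> forall x, u x = 0.
Proof.
move=> cu u0 iu x; apply/eqP; apply: contraT => ux.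
have : 0 < hint u by apply: (hint_gt0 (x0 := x)) => //; rewrite lt_neqAle eq_sym ux u0.
by rewrite iu ltxx.
Qed.

(** A finite measurable partition subordinate to the neighborhoods [N h] gives a
    quadrature formula whose error is controlled for all functions with a given
    oscillation on them at once; the nodes are chosen before the function, which
    is what interchanging limits requires. *)
Lemma hint_quadrature (N : G -> set G) : (forall h, nbhs h (N h)) ->
  exists (m : nat) (t : 'I_m -> R) (g : 'I_m -> G),
  [/\ forall i, 0 <= t i, \sum_i t i = 1 &
   forall F e, cont F -> (forall h x, N h x -> `|F x - F h| <= e) ->
     `|hint F - \sum_i t i * F (g i)| <= e].
Proof.
move=> nN.
have [D _ Dc] : finite_subset_cover [set: G] (fun g => (N g)°) [set: G].
  have := clg_compact G; rewrite compact_cover; apply.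
    by move=> g _; exact: open_interior.
  by move=> g _; exists g => //; exact: nN.
pose s := enum_fset D; pose m := size s.
pose gg i := nth 1%g s i.
pose O i : set T := (N (gg i))°.
have mO i : measurable (O i).
  by apply: sub_sigma_algebra; exact: open_interior.
(* The cells: a finite cover made disjoint. *)
pose A i : set T := O i `\` \big[setU/set0]_(j < i) O j.
have mA i : measurable (A i).
  by apply: measurableD => //; apply: bigsetU_measurable => j _.
pose ind i (x : G) : R := \1_(A i) x.
have ind1 x : \sum_(i < m) ind i x = 1.
  have ex : exists i, (i < m)%N && `[< O i x >].
    have [g gD gx] := Dc x I.
    have gs : g \in s by [].
    exists (index g s); rewrite index_mem gs /=; apply/asboolP.
    by rewrite /O /gg nth_index.
  case: (ex_minnP ex) => i /andP[im /asboolP Oi] mini.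
  have Ai : A i x.
    split=> //; rewrite -bigcup_mkord => -[j /= ji Oj].
    have := mini j; rewrite (ltn_trans ji im) /= => /(_ (asboolT Oj)).
    by rewrite leqNgt ji.
  rewrite (bigD1 (Ordinal im)) //= /ind indicE mem_set // big1 ?addr0 // => j ji.
  rewrite indicE memNset // => -[Oj nO].
  have [ij|] := ltnP i j.
    by apply: nO; rewrite -bigcup_mkord; exists i.
  rewrite leq_eqVlt => /orP[/eqP E|lji].
    by move/eqP: ji; apply; exact: val_inj.
  have := mini j; rewrite (ltn_trans lji im) /= => /(_ (asboolT Oj)).
  by rewrite leqNgt lji.
have mind i : measurable_fun setT (ind i : T -> R).
  exact: measurable_indic.
have int_bm (u : G -> R) i : cont u -> mu.-integrable [set: T] (EFin \o (fun x => u x * ind i x)).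
  move=> cu; have [B B0 uB] := continuous_bounded cu.
  apply: measurable_bounded_integrable => //.
  - by rewrite (le_lt_trans (probability_le1 mu _)) ?ltry.
  - apply: measurable_funM => //.
    by have /integrableP[/measurable_EFinP] := continuous_integrable mu cu.
  - exists B; split=> [|y By x _]; first exact: num_real.
    rewrite /= normrM (le_trans _ (ltW By)) // -[leRHS]mulr1 ler_pM //.
    by rewrite /ind indicE; case: (_ \in _); rewrite ?normr1 ?normr0.
(* The weight of a node is the measure of its cell. *)
pose t (i : 'I_m) := hint (fun x => 1 * ind i x).
have sum_int (u : 'I_m -> G -> R) (r : seq 'I_m) :
    (forall i, mu.-integrable [set: T] (EFin \o u i)) ->
    hint (fun x => \sum_(i <- r) u i x) = \sum_(i <- r) hint (u i) /\
    mu.-integrable [set: T] (EFin \o (fun x => \sum_(i <- r) u i x)).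
  move=> iu; elim: r => [|i r [IH1 IH2]].
    rewrite big_nil (_ : (fun x => _) = fun=> 0); last by apply/funext => x; rewrite big_nil.
    by rewrite hint_cst; split=> //; apply: (continuous_integrable mu); exact: cont_cst.
  rewrite big_cons (_ : (fun x => _) = u i \+ (fun x => \sum_(i <- r) u i x)); last first.
    by apply/funext => x; rewrite big_cons.
  split; first by rewrite -IH1 /hint -RintegralD.
  exact: (integrableD measurableT (iu i) IH2).
exists m, t, gg; split.
- by move=> i; apply: hint_ge0 => x; rewrite mul1r /ind indicE.
- have [<- _] := sum_int (fun i x => 1 * ind i x) (index_enum _) (fun i => int_bm (fun=> 1) i (@cont_cst 1)).
  rewrite -[RHS](hint_cst 1); congr hint; apply/funext => x.
  by under eq_bigr do rewrite mul1r; rewrite ind1.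
move=> F e cF HF.
have -> : hint F = \sum_(i < m) hint (fun x => F x * ind i x).
  have [<- _] := sum_int (fun i x => F x * ind i x) (index_enum _) (fun i => int_bm F i cF).
  by congr hint; apply/funext => x; rewrite -mulr_sumr ind1 mulr1.
have -> : e = \sum_(i < m) e * t i.
  have [h _] := sum_int (fun i x => 1 * ind i x) (index_enum _) (fun i => int_bm (fun=> 1) i (@cont_cst 1)).
  rewrite -mulr_sumr -h (_ : (fun x => _) = fun=> 1) ?hint_cst ?mulr1 //.
  by apply/funext => x; under eq_bigr do rewrite mul1r; rewrite ind1.
rewrite -sumrB (le_trans (ler_norm_sum _ _ _)) //; apply: ler_sum => i _.
have cZ (a : R) : hint (fun x => a * ind i x) = a * t i.
  have E : (fun x => 1 * ind i x) = ind i by apply/funext => x; rewrite mul1r.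
  have := int_bm (fun=> 1) i (@cont_cst 1); rewrite /t /= E => ii.
  by rewrite /hint RintegralZl.
rewrite mulrC -!cZ -[X in `|X|](_ : hint (fun x => F x * ind i x - F (gg i) * ind i x) = _); last first.
  rewrite /hint RintegralB //; first exact: (int_bm F i cF).
  exact: (int_bm (fun=> F (gg i)) i (@cont_cst _)).
have iB : mu.-integrable [set: T] (EFin \o (fun x => F x * ind i x - F (gg i) * ind i x)).
  have := int_bm (fun x => F x - F (gg i)) i (contB cF (@cont_cst _)).
  by congr (mu.-integrable _ _); apply/funext => x /=; rewrite mulrBl.
apply: (le_trans (le_normr_Rintegral _ iB)) => //.
apply: le_Rintegral => //.
- have := int_bm (fun x => `|F x - F (gg i)|) i (cont_norm (contB cF (@cont_cst _))).
  congr (mu.-integrable _ _); apply/funext => x /=; rewrite -mulrBl normrM.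
  by rewrite [X in _ = (_ * X)%:E]ger0_norm // /ind indicE.
- exact: (int_bm (fun=> e) i (@cont_cst e)).
move=> x _; rewrite -mulrBl normrM [X in _ * X]ger0_norm /ind ?indicE //.
have [Aix|nAix] := boolP (x \in A i); last by rewrite !mulr0.
rewrite !mulr1; apply: HF.
by have [Oix _] := set_mem Aix; exact: (interior_subset Oix).
Qed.

(** Compactness of the group turns continuity at each [(x0, g)] into uniformity
    in [g]. *)
Lemma near_unif (X : topologicalType) (F : X * G -> R) x0 e : continuous F -> 0 < e ->
  \forall x \near x0, forall g, `|F (x, g) - F (x0, g)| <= e.
Proof.
move=> cF e0; have := (compact_near_coveringP _).1 (clg_compact G).
move=> /(_ X (nbhs x0) (fun x g => `|F (x, g) - F (x0, g)| <= e) _) h.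
have e2 : 0 < e / 2 by rewrite divr_gt0.
apply: filterS (h _); first by move=> x Hx g; exact: Hx.
move=> g _; have /cvgrPdist_le/(_ _ e2) := cF (x0, g).
move=> [[U V] /= [Ux Vg] UV].
exists (V, U) => //= -[y x] [/= Vy Ux'] /=.
have h1 := UV (x, y) (conj Ux' Vy).
have h2 := UV (x0, y) (conj (nbhs_singleton Ux) Vy).
rewrite (splitr e) (le_trans (ler_distD (F (x0, g)) _ _)) // lerD //.
by rewrite distrC.
Qed.

Lemma hint_param_continuous (X : topologicalType) (F : X * G -> R) : continuous F ->
  continuous (fun x => hint (fun g => F (x, g))).
Proof.
move=> cF x0; apply/cvgrPdist_le => e e0.
have cx x : cont (fun g => F (x, g)).
  move=> g; exact: (cvg_comp _ _ (cvg_pair (cvg_cst x) cvg_id) (cF (x, g))).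
have := near_unif x0 cF e0; apply: filterS => x Hx.
rewrite -hintB //; apply: hint_norm_le; first exact: contB.
by move=> g; rewrite distrC.
Qed.

(** Both iterated integrals are approximated by the same finite sum, by
    [hint_quadrature]. *)
Lemma hint_fubini (F : G * G -> R) : continuous F ->
  hint (fun x => hint (fun y => F (x, y))) = hint (fun y => hint (fun x => F (x, y))).
Proof.
move=> cF; have cx x : cont (fun g => F (x, g)).
  move=> g; exact: (cvg_comp _ _ (cvg_pair (cvg_cst x) cvg_id) (cF (x, g))).
have cy y : cont (fun g => F (g, y)).
  move=> g; exact: (cvg_comp _ _ (cvg_pair cvg_id (cvg_cst y)) (cF (g, y))).
have cF' : continuous (fun z : G * G => F (z.2, z.1)).
  move=> [a b].
  exact: (cvg_comp _ _ (cvg_pair cvg_snd cvg_fst) (cF (b, a))).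
have c1 : cont (fun x => hint (fun y => F (x, y))) by exact: hint_param_continuous.
have c2 : cont (fun y => hint (fun x => F (x, y))) by exact: (hint_param_continuous cF').
apply/eqP; rewrite -subr_eq0 -normr_le0; apply/ler_addgt0Pl => e e0; rewrite addr0.
have e2 : 0 < e / 2 by rewrite divr_gt0.
have [m [t [g [t0 t1 H]]]] := hint_quadrature (fun h => near_unif h cF e2).
have h1 : `|hint (fun x => hint (fun y => F (x, y))) -
    \sum_i t i * hint (fun y => F (g i, y))| <= e / 2.
  apply: (H (fun x => hint (fun y => F (x, y)))) => // h x Hx.
  rewrite -hintB //; apply: hint_norm_le; [exact: contB|exact: Hx].
have h2 : `|hint (fun y => hint (fun x => F (x, y))) -
    \sum_i t i * hint (fun y => F (g i, y))| <= e / 2.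
  have -> : \sum_i t i * hint (fun y => F (g i, y)) = hint (fun y => \sum_i t i * F (g i, y)).
    rewrite hint_sum; first by apply: eq_bigr => i _; rewrite hintZ.
    by move=> i; apply: contM => //; exact: cont_cst.
  have cs : cont (fun y => \sum_i t i * F (g i, y)).
    by apply: cont_sum => i; apply: contM => //; exact: cont_cst.
  rewrite -hintB //; apply: hint_norm_le; first exact: contB.
  by move=> y; apply: (H (fun x => F (x, y))) => // h x; exact.
rewrite (splitr e) (le_trans (ler_distD (\sum_i t i * hint (fun y => F (g i, y))) _ _)) //.
by apply: lerD; [exact: h1|rewrite distrC; exact: h2].
Qed.

Lemma hint_is_derive (F dF : R -> G -> R) a r B : 0 < r ->
  (forall t, `|t - a| < r -> cont (F t)) ->
  (forall t g, `|t - a| < r -> is_derive t 1 (fun t => F t g) (dF t g)) ->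
  (forall t g, `|t - a| < r -> `|dF t g| <= B) ->
  is_derive a 1 (fun t => hint (F t)) (hint (dF a)).
Proof.
move=> r0 cF dFP dB.
have I0 : `]a - r, a + r[%classic a by rewrite /= in_itv /= ltrBlDr ltrDl r0.
have IP t : `]a - r, a + r[%classic t -> `|t - a| < r.
  by rewrite /= in_itv /= ltr_distl.
have B0 : 0 <= B by apply: (le_trans (normr_ge0 (dF a 1%g))); apply: dB; rewrite subrr normr0.
have h1 t : `]a - r, a + r[%classic t -> mu.-integrable [set: T] (EFin \o F t).
  by move=> /IP tr; exact: (continuous_integrable mu (cF t tr)).
have h2 t (y : T) : `]a - r, a + r[%classic t -> [set: T] y -> derivable (F ^~ y) t 1.
  by move=> /IP tr _; have [] := dFP t y tr.
have h3 t (y : T) : `]a - r, a + r[%classic t -> [set: T] y -> `|partial1of2 F t y| <= B.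
  by move=> /IP tr _; rewrite partial1of2E; have [_ ->] := dFP t y tr; exact: dB.
have iB : mu.-integrable [set: T] (EFin \o (fun=> B : R)).
  by apply: (continuous_integrable mu); exact: cont_cst.
have D := @derivable_under_integral R _ T mu F setT measurableT a _ _ I0 h1 h2 _ (fun=> B0) iB h3.
have E := @differentiation_under_integral R _ T mu F setT measurableT a _ _ I0 h1 h2 _ (fun=> B0) iB h3.
apply: DeriveDef; first exact: D.
rewrite -derive1E [LHS]E /hint; suff -> : partial1of2 F a = dF a by [].
apply/funext => g; rewrite partial1of2E; have [|_ ->] := dFP a g _ => //.
by rewrite subrr normr0.
Qed.

End HaarIntegral.

(** * Complex integral and inner product *)

Section ComplexIntegral.
Context {R : realType} {n : nat} (G : compactLieGroup R n) (mu : haarMeasure G).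
Implicit Types f g h : G -> Cx R.

Lemma Cx_eta (z : Cx R) : z = mkC (re z) (im z).
Proof. by case: z. Qed.

Lemma reD (z w : Cx R) : re (z + w) = re z + re w. Proof. by case: z; case: w. Qed.
Lemma imD (z w : Cx R) : im (z + w) = im z + im w. Proof. by case: z; case: w. Qed.
Lemma reN (z : Cx R) : re (- z) = - re z. Proof. by case: z. Qed.
Lemma imN (z : Cx R) : im (- z) = - im z. Proof. by case: z. Qed.
Lemma re_toC (x : R) : re (toC x) = x. Proof. by []. Qed.
Lemma toC0 : toC (0 : R) = 0. Proof. by []. Qed.
Lemma toC1 : toC (1 : R) = 1. Proof. by []. Qed.
Lemma toCN (x : R) : toC (- x) = - toC x.
Proof. exact: (rmorphN (real_complex R)). Qed.
Lemma toC_inj : injective (@toC R). Proof. by move=> x y []. Qed.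
Lemma toC_le (x y : R) : (toC x <= toC y) = (x <= y). Proof. exact: lecR. Qed.
Lemma toC_sum I (r : seq I) (P : pred I) (F : I -> R) :
  toC (\sum_(i <- r | P i) F i) = \sum_(i <- r | P i) toC (F i).
Proof. exact: (rmorph_sum (real_complex R)). Qed.
Lemma toCX (x : R) k : toC (x ^+ k) = toC x ^+ k.
Proof. exact: (rmorphXn (real_complex R)). Qed.
Lemma toC_conj (x : R) : (toC x)^* = toC x.
Proof. by apply: Cx_ext; rewrite ?re_conj ?im_conj //= oppr0. Qed.
Lemma re_sum I (r : seq I) (F : I -> Cx R) :
  re (\sum_(i <- r) F i) = \sum_(i <- r) re (F i).
Proof. by elim: r => [|i r IH]; rewrite ?big_nil // !big_cons reD IH. Qed.
Lemma im_sum I (r : seq I) (F : I -> Cx R) :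
  im (\sum_(i <- r) F i) = \sum_(i <- r) im (F i).
Proof. by elim: r => [|i r IH]; rewrite ?big_nil // !big_cons imD IH. Qed.
Lemma re_toCM (x : R) (z : Cx R) : re (toC x * z) = x * re z.
Proof. by rewrite re_mul /= mul0r subr0. Qed.
Lemma im_toCM (x : R) (z : Cx R) : im (toC x * z) = x * im z.
Proof. by rewrite im_mul /= mul0r addr0. Qed.

Definition normsq (z : Cx R) : R := re z ^+ 2 + im z ^+ 2.
Lemma normsq_ge0 z : 0 <= normsq z. Proof. by rewrite addr_ge0 ?sqr_ge0. Qed.
Lemma normsqE z : z * z^* = toC (normsq z).
Proof.
apply: Cx_ext; rewrite ?re_mul ?im_mul re_conj im_conj /= /normsq; first by ring.
by ring.
Qed.
Lemma norm_normsq z : `|z| ^+ 2 = toC (normsq z).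
Proof. by rewrite -normsqE normCK. Qed.
Lemma normsq_eq0 z : normsq z = 0 -> z = 0.
Proof.
move=> z0; have : `|z| ^+ 2 = 0 by rewrite norm_normsq z0.
by move/eqP; rewrite sqrf_eq0 normr_eq0 => /eqP.
Qed.
Lemma norm_le_normsq z (B : R) : 0 <= B -> (`|z| <= toC B) = (normsq z <= B ^+ 2).
Proof.
move=> B0; rewrite -toC_le -norm_normsq toCX ler_sqr ?nnegrE //.
by rewrite -toC0 toC_le.
Qed.

(** Continuity in terms of the two parts, on which the lemmas on real integrals
    apply. *)
Definition ccont f := continuous (fun x => re (f x)) /\ continuous (fun x => im (f x)).

Lemma ccontP f : continuous f <-> ccont f.
Proof.
split=> [cf|[cr ci] x].
  split=> x; apply/cvgrPdist_le => e e0.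
    have e0' : 0 < toC e by rewrite -toC0 ltcR.
    have /cvgrPdist_le/(_ _ e0') := cf x; apply: filterS => y.
    by move=> /norm_re_le[+ _]; rewrite reD reN.
  have e0' : 0 < toC e by rewrite -toC0 ltcR.
  have /cvgrPdist_le/(_ _ e0') := cf x; apply: filterS => y.
  by move=> /norm_re_le[_ +]; rewrite imD imN.
apply/cvgrPdist_le => e e0.
have [r r0 er] := normC_toC e; rewrite gtr0_norm // in er.
have r0' : 0 < r by rewrite -ltcR -/(toC r) -er.
have r2 : 0 < r / 2 by rewrite divr_gt0.
have /cvgrPdist_le/(_ _ r2) h1 := cr x.
have /cvgrPdist_le/(_ _ r2) h2 := ci x.
apply: filterS2 h1 h2 => y h1 h2; rewrite er [_ - _]Cx_eta reD reN imD imN.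
by rewrite (le_trans (norm_mkC_le h1 h2)) // toC_le mulrCA mulfV ?mulr1.
Qed.

Lemma ccont_toC (u : G -> R) : continuous u -> ccont (fun x => toC (u x)).
Proof. by move=> cu; split=> //; exact: cont_cst. Qed.

Lemma ccont_cst (a : Cx R) : ccont (fun=> a).
Proof. by split; exact: cont_cst. Qed.

Lemma ccontD f g : ccont f -> ccont g -> ccont (fun x => f x + g x).
Proof.
move=> [fr fi] [gr gi]; split; first by under eq_fun do rewrite reD; exact: contD.
by under eq_fun do rewrite imD; exact: contD.
Qed.

Lemma ccontM f g : ccont f -> ccont g -> ccont (fun x => f x * g x).
Proof.
move=> [fr fi] [gr gi]; split.
  by under eq_fun do rewrite re_mul; apply: contB; exact: contM.
by under eq_fun do rewrite im_mul; apply: contD; exact: contM.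
Qed.

Lemma ccontZ (a : Cx R) f : ccont f -> ccont (fun x => a * f x).
Proof. by move=> cf; apply: ccontM => //; exact: ccont_cst. Qed.

Lemma ccont_conj f : ccont f -> ccont (fun x => (f x)^*).
Proof.
move=> [fr fi]; split; first by under eq_fun do rewrite re_conj.
by under eq_fun do rewrite im_conj; exact: contN.
Qed.

Lemma ccont_sum I (r : seq I) (F : I -> G -> Cx R) : (forall i, ccont (F i)) ->
  ccont (fun x => \sum_(i <- r) F i x).
Proof.
move=> cF; elim: r => [|i r IH].
  by under eq_fun do rewrite big_nil; exact: ccont_cst.
by under eq_fun do rewrite big_cons; exact: ccontD.
Qed.

Lemma ccontB f g : ccont f -> ccont g -> ccont (fun x => f x - g x).
Proof.
move=> cf cg; apply: ccontD => //; have := ccontZ (-1) cg.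
by under eq_fun do rewrite mulN1r.
Qed.

Lemma ccont_lshift (a : G) f : ccont f -> ccont (fun x => f (a * x)%g).
Proof. by move=> [fr fi]; split; [exact: (cont_lshift fr)|exact: (cont_lshift fi)]. Qed.

Local Notation cint := (haar_int mu).

Lemma cintE f : cint f = mkC (hint mu (fun x => re (f x))) (hint mu (fun x => im (f x))).
Proof. by []. Qed.

Lemma cint_cst (a : Cx R) : cint (fun=> a) = a.
Proof. by rewrite cintE !hint_cst -Cx_eta. Qed.

Lemma cintD f g : ccont f -> ccont g -> cint (fun x => f x + g x) = cint f + cint g.
Proof.
move=> [fr fi] [gr gi]; rewrite !cintE.
under eq_fun do rewrite reD; under [X in mkC _ (hint mu X)]eq_fun do rewrite imD.
by rewrite !hintD.
Qed.

Lemma cintZ (a : Cx R) f : ccont f -> cint (fun x => a * f x) = a * cint f.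
Proof.
move=> [fr fi]; have cZ (b : R) u : continuous u -> continuous (fun x : G => b * u x).
  by move=> cu; apply: contM => //; exact: cont_cst.
apply: Cx_ext; rewrite ?re_mul ?im_mul !cintE /=.
  under eq_fun do rewrite re_mul.
  by rewrite hintB ?hintZ //; exact: cZ.
under eq_fun do rewrite im_mul.
by rewrite hintD ?hintZ //; exact: cZ.
Qed.

Lemma cintB f g : ccont f -> ccont g -> cint (fun x => f x - g x) = cint f - cint g.
Proof.
move=> cf cg; under eq_fun do rewrite -mulN1r.
by rewrite cintD ?cintZ ?mulN1r //; exact: ccontZ.
Qed.

Lemma cint_sum I (r : seq I) (F : I -> G -> Cx R) : (forall i, ccont (F i)) ->
  cint (fun x => \sum_(i <- r) F i x) = \sum_(i <- r) cint (F i).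
Proof.
move=> cF; elim: r => [|i r IH].
  by under eq_fun do rewrite big_nil; rewrite big_nil cint_cst.
by under eq_fun do rewrite big_cons; rewrite big_cons cintD ?IH //; exact: ccont_sum.
Qed.

Lemma cint_conj f : ccont f -> cint (fun x => (f x)^*) = (cint f)^*.
Proof.
move=> [fr fi]; apply: Cx_ext; rewrite ?re_conj ?im_conj !cintE /=.
  by under eq_fun do rewrite re_conj.
by under eq_fun do rewrite im_conj; rewrite hintN.
Qed.

Lemma cint_left (h : G) f : ccont f -> cint (fun x => f (h * x)%g) = cint f.
Proof.
move=> [fr fi]; rewrite !cintE.
by rewrite (hint_left mu h fr) (hint_left mu h fi).
Qed.

Lemma cint_norm_le f B : ccont f -> (forall x, `|f x| <= toC B) -> `|cint f| <= toC (2 * B).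
Proof.
move=> [fr fi] fB; rewrite cintE; apply: norm_mkC_le; apply: hint_norm_le => // x.
  by have [] := norm_re_le (fB x).
by have [] := norm_re_le (fB x).
Qed.

Lemma cont_normsq f : ccont f -> continuous (fun x => normsq (f x)).
Proof. by move=> [fr fi]; apply: contD; under eq_fun do rewrite expr2; exact: contM. Qed.

Lemma cint_normsq f : ccont f ->
  cint (fun x => f x * (f x)^*) = toC (hint mu (fun x => normsq (f x))).
Proof.
move=> cf; rewrite cintE; under eq_fun do rewrite normsqE.
under [X in mkC _ (hint mu X)]eq_fun do rewrite normsqE.
by rewrite /= hint_cst.
Qed.

Lemma cint_normsq_eq0 f : ccont f -> cint (fun x => f x * (f x)^*) = 0 -> forall x, f x = 0.
Proof.
move=> cf; rewrite cint_normsq // -toC0 => /toC_inj h x.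
apply: normsq_eq0; apply: (hint_eq0 (mu := mu) _ _ h); first exact: cont_normsq.
by move=> y; exact: normsq_ge0.
Qed.

Lemma ccont_bounded f : ccont f -> exists2 B : R, 0 <= B & forall x, `|f x| <= toC B.
Proof.
move=> [fr fi]; have [B1 B10 h1] := continuous_bounded fr.
have [B2 B20 h2] := continuous_bounded fi.
exists (2 * (B1 + B2)); first by rewrite mulr_ge0 ?addr_ge0.
move=> x; rewrite [f x]Cx_eta; apply: norm_mkC_le.
  by rewrite (le_trans (h1 x)) // lerDl.
by rewrite (le_trans (h2 x)) // lerDr.
Qed.

Section InnerProduct.

Definition cip f g : Cx R := cint (fun x => f x * (g x)^*).

Definition orthonormal_family m (phi : 'I_m -> G -> Cx R) :=
  (forall i, ccont (phi i)) /\ forall i j, cip (phi i) (phi j) = (i == j)%:R.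

Lemma cip_conj f g : ccont f -> ccont g -> (cip f g)^* = cip g f.
Proof.
move=> cf cg; rewrite /cip -cint_conj; last by apply: ccontM => //; exact: ccont_conj.
by congr haar_int; apply/funext => x; rewrite rmorphM /= conjCK mulrC.
Qed.

Lemma cip_suml I (r : seq I) (F : I -> G -> Cx R) (a : I -> Cx R) g :
  (forall i, ccont (F i)) -> ccont g ->
  cip (fun x => \sum_(i <- r) a i * F i x) g = \sum_(i <- r) a i * cip (F i) g.
Proof.
move=> cF cg; rewrite /cip; under eq_fun do rewrite mulr_suml.
rewrite cint_sum; last by move=> i; apply: ccontM; [exact: ccontZ|exact: ccont_conj].
apply: eq_bigr => i _; under eq_fun do rewrite -mulrA.
by rewrite cintZ //; apply: ccontM => //; exact: ccont_conj.
Qed.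

Lemma cip_sumr I (r : seq I) (F : I -> G -> Cx R) (a : I -> Cx R) g :
  (forall i, ccont (F i)) -> ccont g ->
  cip g (fun x => \sum_(i <- r) a i * F i x) = \sum_(i <- r) (a i)^* * cip g (F i).
Proof.
move=> cF cg; rewrite -cip_conj //; last by apply: ccont_sum => i; exact: ccontZ.
rewrite cip_suml // rmorph_sum; apply: eq_bigr => i _.
by rewrite rmorphM /= cip_conj.
Qed.

Lemma cipBl f g h : ccont f -> ccont g -> ccont h ->
  cip (fun x => f x - g x) h = cip f h - cip g h.
Proof.
move=> cf cg ch; rewrite /cip; under eq_fun do rewrite mulrBl.
by rewrite cintB //; apply: ccontM => //; exact: ccont_conj.
Qed.

Lemma cipBr f g h : ccont f -> ccont g -> ccont h ->
  cip h (fun x => f x - g x) = cip h f - cip h g.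
Proof.
move=> cf cg ch; rewrite -cip_conj //; last exact: ccontB.
by rewrite cipBl // rmorphB /= !cip_conj.
Qed.

Lemma bessel_identity m (phi : 'I_m -> G -> Cx R) v : orthonormal_family phi -> ccont v ->
  let w := fun x => v x - \sum_i cip v (phi i) * phi i x in
  cip w w = cip v v - \sum_i toC (normsq (cip v (phi i))).
Proof.
move=> [cphi ophi] cv w.
have cs : ccont (fun x => \sum_i cip v (phi i) * phi i x).
  by apply: ccont_sum => i; exact: ccontZ.
rewrite /w cipBl //; last exact: ccontB.
rewrite !cipBr // cip_sumr // cip_suml //.
rewrite [X in _ - (_ - X)](_ : _ = \sum_i cip v (phi i) * cip (phi i) v); last first.
  rewrite cip_suml //; apply: eq_bigr => i _; rewrite cip_sumr //.
  rewrite (bigD1 i) //= ophi eqxx mulr1 big1 ?addr0 ?cip_conj // => j ji.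
  by rewrite ophi eq_sym (negbTE ji) mulr0.
rewrite subrr subr0; congr (_ - _); apply: eq_bigr => i _.
by rewrite mulrC normsqE.
Qed.

Lemma bessel_ineq m (phi : 'I_m -> G -> Cx R) v : orthonormal_family phi -> ccont v ->
  \sum_i normsq (cip v (phi i)) <= hint mu (fun x => normsq (v x)).
Proof.
move=> ophi cv; have [cphi _] := ophi.
have := bessel_identity ophi cv => /=; set w := fun x => _ => H.
have cw : ccont w.
  by apply: ccontB => //; apply: ccont_sum => i; exact: ccontZ.
move: H; rewrite /cip !cint_normsq // -toC_sum -toCN -toCD => /toC_inj H.
rewrite -subr_ge0 -[X in 0 <= X]H.
by apply: hint_ge0 => x; exact: normsq_ge0.
Qed.

End InnerProduct.
End ComplexIntegral.

(** * Convolution powers of a symmetric kernel *)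

Section PowerSequence.
Context {R : realType}.
Variable b : nat -> R.
Hypotheses (b0 : forall m, 0 < b m) (blog : forall m, b m.+1 ^+ 2 <= b m * b m.+2)
  (bsub : forall m k, b (m + k).+1 <= b m * b k).

(** Log-convexity makes the ratios of a positive sequence nondecreasing, so the
    normalized sequence is nonincreasing with ratios tending to one;
    submultiplicativity then forbids it to go below one, since its decay over a
    fixed number of steps would be bounded away from one. *)
Lemma power_sequence_limit :
  exists2 a : R, 0 < a & exists2 l : R, 1 <= l &
    (fun m => b m / a ^+ m.+1) @ \oo --> l.
Proof.
pose r m := b m.+1 / b m.
have r0 m : 0 < r m by rewrite divr_gt0.
have rinc : nondecreasing_seq r.
  apply/nondecreasing_seqP => m; rewrite /r ler_pdivrMr // mulrAC ler_pdivlMr //.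
  by rewrite -expr2 mulrC.
have rb : has_ubound (range r).
  exists (b 0%N) => _ [m _ <-]; rewrite /r ler_pdivrMr //.
  by have := bsub 0%N m; rewrite add0n.
pose a := sup (range r).
have ra : r @ \oo --> a := nondecreasing_cvgn rinc rb.
have rle m : r m <= a by apply: sup_upper_bound; [split=> //; exists (r 0%N), 0%N|exists m].
have a0 : 0 < a := lt_le_trans (r0 0%N) (rle 0%N).
pose q m := b m / a ^+ m.+1.
have q0 m : 0 < q m by rewrite divr_gt0 ?exprn_gt0.
have qS m : q m.+1 = q m * (r m / a).
  by rewrite /q /r exprS; field; rewrite !gt_eqF ?exprn_gt0.
have qdec : nonincreasing_seq q.
  apply/nonincreasing_seqP => m; rewrite qS ler_piMr ?(ltW (q0 m)) //.
  by rewrite ler_pdivrMr // mul1r.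
have qlb : has_lbound (range q) by exists 0 => _ [m _ <-]; exact: ltW.
have ql := nonincreasing_cvgn qdec qlb; set l := inf _ in ql.
have qsub m k : q (m + k).+1 <= q m * q k.
  rewrite /q mulrACA -invfM -exprD addSn addnS ler_pM2r ?bsub //.
  by rewrite invr_gt0 exprn_gt0.
(* The ratios tend to 1 for a fixed shift, which contradicts a value [q k < 1]:
submultiplicativity would make every shift by [k.+1] contract by [q k]. *)
have ratio k : (fun m => q (m + k)%N / q m) @ \oo --> (1 : R).
  elim: k => [|k IH].
    by under eq_fun do rewrite addn0 divff ?gt_eqF //; exact: cvg_cst.
  have h : (fun m => r (m + k)%N / a) @ \oo --> a / a.
    by apply: cvgMl; rewrite (cvg_shiftn k r).
  have hh : ((fun m => q (m + k)%N / q m) \* (fun m => r (m + k)%N / a)) @ \oo -->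
      (1 * (a / a) : R) by exact: cvgM.
  rewrite divff ?gt_eqF // mulr1 in hh.
  suff -> : (fun m => q (m + k.+1)%N / q m) =
     ((fun m => q (m + k)%N / q m) \* (fun m => r (m + k)%N / a)) by [].
  by apply/funext => m; rewrite /= addnS qS mulrAC.
have q1 k : 1 <= q k.
  rewrite -(cvg_lim _ (ratio k.+1)) //; apply: limr_le; first exact: cvgP (ratio k.+1).
  by near=> m; rewrite ler_pdivrMr // addnS (le_trans (qsub m k)) // mulrC.
exists a => //; exists l => //; rewrite -(cvg_lim _ ql) //.
by apply: limr_ge; [exact: cvgP ql|near=> m; exact: q1].
Unshelve. all: by end_near. Qed.

End PowerSequence.

Section Convolution.
Context {R : realType} {n : nat} (G : compactLieGroup R n) (mu : haarMeasure G).
Local Notation cont := (fun u : G -> R => continuous u).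
Local Notation hm := (hint mu).

Definition conv (k l : G -> R) (x : G) : R := hm (fun z => k z * l (z^-1 * x)%g).

Lemma cont_pull (X : topologicalType) (u : G -> R) (a : X -> G) :
  cont u -> continuous a -> continuous (fun x => u (a x)).
Proof. by move=> cu ca x; apply: (@continuous_comp _ _ _ a u) (ca x) (cu _). Qed.

Lemma cont_ldiv (X : topologicalType) (a b : X -> G) :
  continuous a -> continuous b -> continuous (fun x => ((a x)^-1 * b x)%g).
Proof.
move=> ca cb x.
have h : {for x, continuous (fun x => (a x)^-1%g)}.
  by apply: (@continuous_comp _ _ _ a (fun g => g^-1)%g) (ca x) _; exact: invg_continuous.
exact: (cvg_comp _ _ (cvg_pair h (cb x)) (mulg_continuous (((a x)^-1)%g, b x))).
Qed.

Lemma cont_fst2 (X : topologicalType) : continuous (fun p : X * X => p.1).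
Proof. by move=> p; exact: cvg_fst. Qed.
Lemma cont_snd2 (X : topologicalType) : continuous (fun p : X * X => p.2).
Proof. by move=> p; exact: cvg_snd. Qed.

Lemma contMX (X : topologicalType) (u v : X -> R) : continuous u -> continuous v ->
  continuous (fun x => u x * v x).
Proof. by move=> cu cv x; exact: (@continuousM _ _ u v x (cu x) (cv x)). Qed.

Lemma cont_rev (k : G -> R) : cont k -> continuous (fun x => k (x^-1)%g).
Proof. by move=> ck; apply: cont_pull => //; exact: invg_continuous. Qed.

Lemma cont_inv_shift (k : G -> R) x : cont k -> continuous (fun z => k (z^-1 * x)%g).
Proof.
move=> ck; apply: (cont_pull ck); apply: cont_ldiv => z; first exact: cvg_id.
exact: cvg_cst.
Qed.

Lemma conv_integrand k l x : cont k -> cont l -> continuous (fun z => k z * l (z^-1 * x)%g).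
Proof. by move=> ck cl; apply: contM => //; exact: cont_inv_shift. Qed.

Lemma conv_cont k l : cont k -> cont l -> continuous (conv k l).
Proof.
move=> ck cl.
apply: (hint_param_continuous (F := fun p : G * G => k p.2 * l (p.2^-1 * p.1)%g)).
apply: contMX; first exact: cont_pull (@cont_snd2 _).
by apply: (cont_pull cl); apply: cont_ldiv; [exact: cont_snd2|exact: cont_fst2].
Qed.

(** Fubini and left invariance of the Haar measure. *)
Lemma conv_assoc k l m : cont k -> cont l -> cont m ->
  conv (conv k l) m =1 conv k (conv l m).
Proof.
move=> ck cl cm x; rewrite /conv.
transitivity (hm (fun y => hm (fun z => k z * l (z^-1 * y)%g * m (y^-1 * x)%g))).
  congr (hint mu _); apply/funext => y.
  rewrite mulrC -hintZ; last exact: conv_integrand.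
  by congr (hint mu _); apply/funext => z; rewrite mulrC.
rewrite (hint_fubini mu (F := fun p : G * G => k p.2 * l (p.2^-1 * p.1)%g * m (p.1^-1 * x)%g)).
  congr (hint mu _); apply/funext => z /=.
  rewrite -hintZ /=; last exact: conv_integrand.
  rewrite -(hint_left mu z); last first.
    apply: contM; last exact: cont_inv_shift.
    by apply: contM; [exact: cont_cst|exact: cont_lshift].
  by congr (hint mu _); apply/funext => y; rewrite mulKg invMg mulgA mulrA.
apply: contMX; [apply: contMX|].
- exact: cont_pull (@cont_snd2 _).
- by apply: (cont_pull cl); apply: cont_ldiv; [exact: cont_snd2|exact: cont_fst2].
- by apply: (cont_pull cm); apply: cont_ldiv; [exact: cont_fst2|move=> y; exact: cvg_cst].
Qed.

Lemma conv_rev k l x : cont k -> cont l ->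
  conv k l x^-1%g = conv (fun y => l y^-1%g) (fun y => k y^-1%g) x.
Proof.
move=> ck cl; rewrite /conv -(hint_left mu x^-1%g); last exact: conv_integrand.
by congr (hint mu _); apply/funext => z; rewrite !invMg !invgK -mulgA mulgV mulg1 mulrC.
Qed.

Definition even_fun (k : G -> R) := forall x, k x^-1%g = k x.

Lemma conv1 k l : even_fun l -> conv k l 1%g = hm (fun z => k z * l z).
Proof.
by move=> el; congr (hint mu _); apply/funext => z; rewrite mulg1 el.
Qed.

Lemma hint_cauchy_schwarz u v : cont u -> cont v ->
  hm (fun x => u x * v x) ^+ 2 <= hm (fun x => u x ^+ 2) * hm (fun x => v x ^+ 2).
Proof.
move=> cu cv; set a := hm _; set b := hm _; set c := hm _.
have cu2 : cont (fun x => u x ^+ 2) by under eq_fun do rewrite expr2; exact: contM.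
have cv2 : cont (fun x => v x ^+ 2) by under eq_fun do rewrite expr2; exact: contM.
have key (s t : R) : 0 <= s ^+ 2 * b - 2 * s * t * a + t ^+ 2 * c.
  have -> : s ^+ 2 * b - 2 * s * t * a + t ^+ 2 * c = hm (fun x => (s * u x - t * v x) ^+ 2).
    rewrite /a /b /c -!hintZ //; last exact: contM.
    have cZ (d : R) w : cont w -> continuous (fun x : G => d * w x).
      by move=> cw; apply: contM cw; exact: cont_cst.
    have cuv : continuous (fun x : G => u x * v x) by exact: contM.
    rewrite -hintB; [|exact: cZ|exact: cZ]; rewrite -hintD; [|by apply: contB; exact: cZ|exact: cZ].
    by congr (hint mu _); apply/funext => x; ring.
  by apply: hint_ge0 => x; exact: sqr_ge0.
have b0 : 0 <= b by apply: hint_ge0 => x; exact: sqr_ge0.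
have c0 : 0 <= c by apply: hint_ge0 => x; exact: sqr_ge0.
have [b00|bn0] := eqVneq b 0.
  have := key (a * (c + 1)) (a ^+ 2); rewrite b00 !mul0r !mulr0 add0r => h.
  have a4 : 0 <= a ^+ 4 by rewrite (exprM a 2 2) sqr_ge0.
  have h' : a ^+ 4 * (c + 2) <= 0 by nra.
  have [->|a0] := eqVneq a 0; first by rewrite expr0n.
  have : 0 < a ^+ 4 by rewrite lt_neqAle a4 andbT eq_sym expf_neq0.
  by nra.
have bp : 0 < b by rewrite lt_neqAle eq_sym bn0.
have := key a b; nra.
Qed.

End Convolution.

Section ConvolutionPowers.
Context {R : realType} {n : nat} (G : compactLieGroup R n) (mu : haarMeasure G).
Local Notation cont := (fun u : G -> R => continuous u).
Local Notation conv := (conv mu).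
Variable kp : nat -> G -> R.
Hypotheses (ckp : forall m, cont (kp m)) (ekp : forall m, even_fun (kp m))
  (kpD : forall m l, conv (kp m) (kp l) = kp (m + l).+1) (k1 : kp 0 1%g != 0).

(** The inner products of convolution powers only depend on the sum of the
    exponents: this is where the symmetry of the kernel enters. Log-convexity is
    then the Cauchy-Schwarz inequality. *)
Let ip m l : hint mu (fun z => kp m z * kp l z) = kp (m + l).+1 1%g.
Proof. by rewrite -kpD conv1. Qed.

Let shift_norm l x : hint mu (fun z => kp l (z^-1 * x)%g ^+ 2) = kp (l + l).+1 1%g.
Proof.
rewrite -ip -(hint_left mu x^-1%g (u := fun z => kp l z * kp l z)); last exact: contM.
by congr (hint mu _); apply/funext => z; rewrite expr2 -(ekp l (z^-1 * x)%g) invMg invgK.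
Qed.

Let kp_bound l x : `|kp (l + l).+1 x| <= kp (l + l).+1 1%g.
Proof.
have h := hint_cauchy_schwarz mu (@ckp l) (@cont_inv_shift _ _ _ _ x (@ckp l)).
have e2 : hint mu (fun z => kp l z ^+ 2) = kp (l + l).+1 1%g.
  by rewrite -ip; congr (hint mu _); apply/funext => z; rewrite expr2.
have n0 : 0 <= kp (l + l).+1 1%g by rewrite -e2; apply: hint_ge0 => z; exact: sqr_ge0.
rewrite shift_norm e2 -expr2 -[hint mu _]/(conv (kp l) (kp l) x) kpD in h.
by rewrite -(ler_pXn2r (isT : (0 < 2)%N)) ?nnegrE // real_normK ?num_real.
Qed.

Let ip_pos m : kp m 1%g != 0 -> 0 < kp (m + m).+1 1%g.
Proof.
move=> km; rewrite -ip; apply: (@hint_gt0 _ _ _ mu _ 1%g).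
- exact: contM.
- by move=> x; rewrite -expr2 sqr_ge0.
- by rewrite -expr2 exprn_even_gt0.
Qed.

Let b m := kp (m + m).+1 1%g.

Let blog m : b m.+1 ^+ 2 <= b m * b m.+2.
Proof.
have := hint_cauchy_schwarz mu (@ckp m) (@ckp m.+2).
rewrite ip; have E l : hint mu (fun x => kp l x ^+ 2) = b l.
  by rewrite /b -ip; congr (hint mu _); apply/funext => z; rewrite expr2.
by rewrite !E /b !addnS !addSn.
Qed.

Let bsub m l : b (m + l).+1 <= b m * b l.
Proof.
have -> : b (m + l).+1 = hint mu (fun z => kp (m + m).+1 z * kp (l + l).+1 z).
  by rewrite ip /b; have -> : ((m + m).+1 + (l + l).+1 = (m + l).+1 + (m + l).+1)%N by lia.
rewrite (le_trans (ler_norm _)) //; apply: hint_norm_le; first exact: contM.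
by move=> x; rewrite normrM; apply: ler_pM => //; exact: kp_bound.
Qed.

Let bpos m : 0 < b m.
Proof.
have b0 : 0 < b 0%N by apply: ip_pos.
have b1 : 0 < b 1%N by apply: ip_pos; rewrite -[1%N]/((0 + 0).+1)%N gt_eqF.
suff : 0 < b m /\ 0 < b m.+1 by case.
elim: m => [|m [h1 h2]]; split => //.
have := blog m; have : 0 < b m.+1 ^+ 2 by rewrite exprn_gt0.
by move=> /lt_le_trans/[apply]; rewrite pmulr_rgt0.
Qed.

(** The normalized even powers of a symmetric kernel converge uniformly to the
    projection on its leading eigenspace: they form a Cauchy sequence for the
    quadratic norm, hence, after one more convolution, for the uniform norm. *)
Lemma leading_idempotent : exists2 a : R, a != 0 & exists p : G -> R,
  [/\ cont p, even_fun p, p 1%g != 0, conv p p = p & conv p (kp 1) = fun x => a * p x].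
Proof.
have [a a0 [l l1 ql]] := power_sequence_limit bpos blog bsub.
exists a; first by rewrite gt_eqF.
pose q m := b m / a ^+ m.+1.
pose P m (x : G) := kp (m + m).+1 x / a ^+ m.+1.
have an0 m : a ^+ m != 0 by rewrite expf_neq0 // gt_eqF.
have PE m : P m = fun x => (a ^+ m.+1)^-1 * kp (m + m).+1 x.
  by apply/funext => x; rewrite /P mulrC.
have cP m : continuous (P m).
  by rewrite PE; apply: contM; [exact: cont_cst|exact: ckp].
have ipP m m' : hint mu (fun x => P m x * P m' x) = q (m + m').+1.
  transitivity ((a ^+ (m.+1 + m'.+1))^-1 * hint mu (fun x => kp (m + m).+1 x * kp (m' + m').+1 x)).
    rewrite -hintZ; last exact: contM.
    by congr (hint mu _); apply/funext => x; rewrite /P exprD invfM; ring.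
  rewrite ip /q mulrC /b.
  have -> : ((m + m).+1 + (m' + m').+1 = (m + m').+1 + (m + m').+1)%N by lia.
  by have -> : (m.+1 + m'.+1 = (m + m').+2)%N by lia.
(* All the inner products tend to [l], so the quadratic distances tend to
[l - 2 * l + l = 0]. *)
have dist m m' : hint mu (fun x => (P m x - P m' x) ^+ 2) =
    q (m + m).+1 - 2 * q (m + m').+1 + q (m' + m').+1.
  rewrite -!ipP -hintZ; last exact: contM.
  have c1 : continuous (fun x => P m x * P m x) by exact: contM.
  have c2 : continuous (fun x => 2 * (P m x * P m' x)).
    by apply: contM; [exact: cont_cst|exact: contM].
  have c3 : continuous (fun x => P m' x * P m' x) by exact: contM.
  rewrite -hintB // -hintD //; last exact: contB.
  by congr (hint mu _); apply/funext => x; ring.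
have PS m x : P m.+1 x = a^-1 * hint mu (fun z => P m z * kp 1 (z^-1 * x)%g).
  have -> : hint mu (fun z => P m z * kp 1 (z^-1 * x)%g) =
     (a ^+ m.+1)^-1 * conv (kp (m + m).+1) (kp 1) x.
    rewrite -hintZ; last exact: conv_integrand.
    by congr (hint mu _); apply/funext => z; rewrite PE mulrA.
  rewrite kpD /P exprS invfM mulrC mulrA.
  by have -> : (((m + m).+1 + 1).+1 = (m.+1 + m.+1).+1)%N by lia.
(* One more convolution turns the quadratic distance into a uniform one. *)
have step m m' x : (P m.+1 x - P m'.+1 x) ^+ 2 <=
    a ^- 2 * b 1 * (q (m + m).+1 - 2 * q (m + m').+1 + q (m' + m').+1).
  rewrite !PS -mulrBr exprMn -exprVn -mulrA ler_wpM2l ?sqr_ge0 //.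
  have c0 m0 : continuous (fun z => P m0 z * kp 1 (z^-1 * x)%g) by exact: conv_integrand.
  rewrite -hintB // -dist mulrC.
  have -> : b 1 = hint mu (fun z => kp 1 (z^-1 * x)%g ^+ 2) by rewrite shift_norm.
  apply: le_trans (hint_cauchy_schwarz mu (contB (@cP m) (@cP m')) (@cont_inv_shift _ _ _ _ x (@ckp 1))).
  by rewrite le_eqVlt; apply/orP; left; apply/eqP; congr (hint mu _ ^+ 2); apply/funext => z; ring.
have cauchy (e : R) : 0 < e -> exists N, forall m m' x, (N <= m)%N -> (N <= m')%N ->
    `|P m x - P m' x| <= e.
  move=> e0; pose C := a ^- 2 * b 1.
  have C0 : 0 <= C by rewrite mulr_ge0 ?invr_ge0 ?sqr_ge0 // ltW.
  pose d := e ^+ 2 / (4 * (C + 1)).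
  have d0 : 0 < d by rewrite divr_gt0 ?exprn_gt0 // mulr_gt0 // ltr_wpDl.
  have /cvgrPdist_le/(_ _ d0)[N _ HN] := ql.
  exists N.+1 => -[//|m] [//|m'] x Nm Nm'.
  rewrite -(ger0_norm (ltW e0)) -ler_sqr ?nnegrE // !real_normK ?num_real //.
  rewrite (le_trans (step m m' x)) // -/C.
  have h1 := HN (m + m).+1 _; have h2 := HN (m + m').+1 _; have h3 := HN (m' + m').+1 _.
  have {}h1 : `|l - q (m + m).+1| <= d by apply: h1; rewrite /=; lia.
  have {}h2 : `|l - q (m + m').+1| <= d by apply: h2; rewrite /=; lia.
  have {}h3 : `|l - q (m' + m').+1| <= d by apply: h3; rewrite /=; lia.
  apply: (@le_trans _ _ (C * (4 * d))).
    apply: ler_wpM2l => //; move: h1 h2 h3; rewrite !ler_norml.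
    by move=> /andP[? ?] /andP[? ?] /andP[? ?]; lra.
  have -> : e ^+ 2 = 4 * (C + 1) * d.
    by rewrite /d; field; rewrite gt_eqF // ltr_wpDl.
  by have := ltW d0; nra.
pose p x := lim ((fun m => P m x) @ \oo).
have cvP x : (fun m => P m x) @ \oo --> p x.
  apply: cauchy_cvg; apply/cauchy_exP => e e0.
  have e2 : 0 < e / 2 by rewrite divr_gt0.
  have [N HN] := cauchy _ e2; exists (P N x).
  exists N => // m /= Nm; rewrite -ball_normE /=.
  by rewrite (le_lt_trans (HN _ _ x (leqnn N) Nm)) // ltr_pdivrMr // ltr_pMr // ltr1n.
have unif (e : R) : 0 < e -> exists N, forall m, (N <= m)%N -> forall x, `|P m x - p x| <= e.
  move=> e0; have e2 : 0 < e / 2 by rewrite divr_gt0.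
  have [N HN] := cauchy _ e2; exists N => m Nm x.
  have /cvgrPdist_le/(_ _ e2)[N' _ HN'] := cvP x.
  pose m' := maxn N N'.
  rewrite (splitr e) (le_trans (ler_distD (P m' x) _ _)) // lerD //.
    by apply: HN => //; exact: leq_maxl.
  by rewrite distrC; apply: HN'; exact: leq_maxr.
have cp : continuous p.
  move=> x; apply/cvgrPdist_le => e e0.
  have e3 : 0 < e / 3 by rewrite divr_gt0.
  have [N HN] := unif _ e3.
  have /cvgrPdist_le/(_ _ e3) := @cP N x; apply: filterS => y Hy.
  have := HN N (leqnn N) x; have := HN N (leqnn N) y; move: Hy.
  rewrite !ler_norml => /andP[? ?] /andP[? ?] /andP[? ?].
  by apply/andP; split; lra.
(* Convolution is continuous for uniform convergence. *)
have uconv (u v : nat -> G -> R) (u' v' : G -> R) :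
    (forall m, cont (u m)) -> (forall m, cont (v m)) -> cont u' -> cont v' ->
    (forall e : R, 0 < e -> exists N, forall m, (N <= m)%N -> forall x, `|u m x - u' x| <= e) ->
    (forall e : R, 0 < e -> exists N, forall m, (N <= m)%N -> forall x, `|v m x - v' x| <= e) ->
    forall x, (fun m => conv (u m) (v m) x) @ \oo --> conv u' v' x.
  move=> cu cv cu' cv' Hu Hv x.
  have [B B0 uB] := continuous_bounded cu'; have [B' B'0 vB] := continuous_bounded cv'.
  apply/cvgrPdist_le => e e0.
  pose d := Num.min 1 (e / (B + B' + 1)).
  have BB : 0 < B + B' + 1 by rewrite ltr_wpDl // addr_ge0.
  have d0 : 0 < d by rewrite lt_min ltr01 divr_gt0.
  have [N1 H1] := Hu _ d0; have [N2 H2] := Hv _ d0.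
  exists (maxn N1 N2) => // m /=; rewrite geq_max => /andP[m1 m2].
  rewrite -hintB; [|exact: conv_integrand|exact: conv_integrand].
  apply: hint_norm_le.
    by apply: contB; exact: conv_integrand.
  move=> z; set w := (z^-1 * x)%g.
  have -> : u' z * v' w - u m z * v m w =
    - ((u m z - u' z) * v' w) - (u m z - u' z) * (v m w - v' w) - u' z * (v m w - v' w) by ring.
  have h1 := H1 m m1 z; have h2 := H2 m m2 w; have h3 := uB z; have h4 := vB w.
  have dd : d * (B + B' + 1) <= e by rewrite -ler_pdivlMr // ge_min lexx orbT.
  have d1 : d <= 1 by rewrite ge_min lexx.
  apply: (@le_trans _ _ (d * B' + d * d + B * d)).
    rewrite (le_trans (ler_normB _ _)) // lerD //; last by rewrite normrM ler_pM.
    by rewrite (le_trans (ler_normB _ _)) // normrN !normrM lerD // ler_pM.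
  by nra.
exists p; split => //.
- move=> x; rewrite /p (_ : P ^~ x^-1%g = P ^~ x) //.
  by apply/funext => m; rewrite /P ekp.
(* The limit is not zero as [1 <= l]. *)
- have -> : p 1%g = l by apply: (cvg_unique _ (cvP 1%g) ql).
  by rewrite gt_eqF // (lt_le_trans ltr01).
- apply/funext => x; have h := uconv P P p p cP cP cp cp unif unif x.
  apply: (cvg_unique (@norm_hausdorff _ R) h).
  have E : (fun m => conv (P m) (P m) x) = (fun m => P (m + m).+1 x).
    apply/funext => m; rewrite [in RHS]/P.
    rewrite -kpD mulrC -[conv (kp _) _ x]/(hint mu _) -hintZ; last exact: conv_integrand.
    congr (hint mu _); apply/funext => z; rewrite /P.
    have -> : ((m + m).+2 = m.+1 + m.+1)%N by lia.
    by rewrite exprD invfM; ring.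
  rewrite E; apply/cvgrPdist_le => e e0; have [N HN] := unif _ e0.
  by exists N => // m /= Nm; rewrite distrC; apply: HN; lia.
apply/funext => x.
have uc (e : R) : 0 < e -> exists N, forall m, (N <= m)%N -> forall x, `|kp 1 x - kp 1 x| <= e.
  by move=> e0; exists 0%N => m _ z; rewrite subrr normr0 ltW.
have h := uconv P (fun=> kp 1) p (kp 1) cP (fun=> @ckp 1) cp (@ckp 1) unif uc x.
apply: (cvg_unique (@norm_hausdorff _ R) h).
have E : (fun m => conv (P m) (kp 1) x) = (fun m => a * P m.+1 x).
  by apply/funext => m; rewrite PS mulrA mulfV ?mul1r // gt_eqF.
rewrite E; apply: cvgMr; rewrite (cvg_shiftS (fun m => P m x)); exact: cvP.
Qed.

End ConvolutionPowers.

(** * Completeness of the matrix entries *)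

Section IrrepBasics.
Context {R : realType} {n : nat} (G : compactLieGroup R n).
Implicit Types xi : irrep G.

Lemma irrepP xi : is_irrep xi. Proof. by case: xi. Qed.

Lemma rdim_gt0 xi : (0 < rdim xi)%N. Proof. by case: (irrepP xi). Qed.

Lemma repM xi g h : xi (g * h)%g = xi g *m xi h. Proof. by case: (irrepP xi). Qed.

Lemma rep_unitary xi g : xi g *m adjmx (xi g) = 1%:M.
Proof. by case: (irrepP xi). Qed.

Lemma rep1 xi : xi 1%g = 1%:M.
Proof.
by rewrite -[LHS]mulmx1 -(rep_unitary xi 1%g) mulmxA -repM mulg1.
Qed.

Lemma rep_adj xi g : xi g^-1%g = adjmx (xi g).
Proof. by rewrite -[LHS]mulmx1 -(rep_unitary xi g) mulmxA -repM mulVg rep1 mul1mx. Qed.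

Lemma rep_inv xi g i j : xi g^-1%g i j = (xi g j i)^*.
Proof. by rewrite rep_adj !mxE. Qed.

Lemma rep_ccont xi i j : ccont (fun g => xi g i j).
Proof. by apply/ccontP; case: (irrepP xi) => _ _ _ + _. Qed.

End IrrepBasics.

Section TranslationIrrep.
Context {R : realType} {n : nat} (G : compactLieGroup R n) (mu : haarMeasure G).
Local Notation cI := (cip mu).
(** A space of continuous functions given by a predicate; its dimension is
    controlled by the size of orthonormal families, which avoids bases. *)
Variable E : (G -> Cx R) -> Prop.
Hypotheses (Ec : forall f, E f -> ccont f)
  (EL : forall g f, E f -> E (fun x => f (g^-1 * x)%g))
  (Ecomb : forall m (a : 'I_m -> Cx R) (f : 'I_m -> G -> Cx R),
     (forall i, E (f i)) -> E (fun x => \sum_i a i * f i x)).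

Definition orthonormal_in m (phi : 'I_m -> G -> Cx R) :=
  orthonormal_family mu phi /\ forall i, E (phi i).

Let cip_basis m (phi : 'I_m -> G -> Cx R) (c : 'I_m -> Cx R) i : orthonormal_in phi ->
  cI (fun x => \sum_j c j * phi j x) (phi i) = c i.
Proof.
move=> [[cphi ophi] _]; rewrite cip_suml // (bigD1 i) //= ophi eqxx mulr1.
by rewrite big1 ?addr0 // => j ji; rewrite ophi (negbTE ji) mulr0.
Qed.

(** Gram-Schmidt. *)
Lemma orthonormal_extend m (phi : 'I_m -> G -> Cx R) f : orthonormal_in phi -> E f ->
  (forall x, f x = \sum_i cI f (phi i) * phi i x) \/
  exists psi : 'I_m.+1 -> G -> Cx R, orthonormal_in psi.
Proof.
move=> phiE Ef; have [[cphi ophi] Ephi] := phiE; have cf := Ec Ef.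
pose w := fun x => f x - \sum_i cI f (phi i) * phi i x.
have Ew : E w.
  pose a (i : 'I_m.+1) : Cx R := if unlift ord0 i is Some j then - cI f (phi j) else 1.
  pose F (i : 'I_m.+1) := if unlift ord0 i is Some j then phi j else f.
  have -> : w = fun x => \sum_i a i * F i x.
    apply/funext => x; rewrite /w big_ord_recl /a /F unlift_none mul1r -sumrN; congr (_ + _).
    by apply: eq_bigr => i _; rewrite liftK mulNr.
  by apply: Ecomb => i; rewrite /F; case: unlift.
have cw := Ec Ew.
have [w0|] := pselect (forall x, w x = 0).
  by left=> x; apply/eqP; rewrite -subr_eq0; apply/eqP/w0.
move=> /existsNP[x0 wx0]; right.
pose c := hint mu (fun x => normsq (w x)).
have c0 : 0 < c.
  apply: (@hint_gt0 _ _ _ mu _ x0); first exact: cont_normsq.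
    by move=> x; exact: normsq_ge0.
  rewrite lt_neqAle normsq_ge0 andbT eq_sym; apply/eqP => /normsq_eq0; exact: wx0.
pose s : Cx R := toC (Num.sqrt c)^-1.
pose psi (i : 'I_m.+1) : G -> Cx R :=
  if unlift ord_max i is Some j then phi j else fun x => s * w x.
have wphi j : cI w (phi j) = 0.
  rewrite /w cipBl //; last by apply: ccont_sum => i; exact: ccontZ.
  by rewrite cip_basis // subrr.
have cipZl (a : Cx R) u v : ccont u -> ccont v -> cI (fun x => a * u x) v = a * cI u v.
  move=> cu cv; have := cip_suml mu (index_enum 'I_1) (fun=> a) (fun=> cu) cv.
  rewrite big_ord1 => <-; rewrite (_ : (fun x => a * u x) = fun x => \sum_(i <- index_enum 'I_1) a * u x) //.
  by apply/funext => x; rewrite big_ord1.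
exists psi; split; last first.
  move=> i; rewrite /psi; case: unlift => [j|] //.
  have := Ecomb (fun _ : 'I_1 => s) (fun=> Ew).
  by congr E; apply/funext => x; rewrite big_ord1.
split; first by move=> i; rewrite /psi; case: unlift => [j|] //; exact: ccontZ.
have csw : ccont (fun x => s * w x) by exact: ccontZ.
move=> i j; rewrite /psi; case: unliftP => [i' ->|->]; case: unliftP => [j' ->|->].
- by rewrite ophi (inj_eq lift_inj).
- rewrite -cip_conj // cipZl // wphi mulr0 rmorph0.
  by rewrite eq_sym (negbTE (neq_lift _ _)).
- by rewrite cipZl // wphi mulr0 (negbTE (neq_lift _ _)).
rewrite eqxx cipZl // -cip_conj // cipZl // rmorphM /= cip_conj // /cI cint_normsq // -/c.
rewrite toC_conj -!toCM -toC1; congr toC.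
have sc : Num.sqrt c != 0 by rewrite gt_eqF // sqrtr_gt0.
by rewrite -[X in _ * (_ * X)](sqr_sqrtr (ltW c0)); field.
Qed.

Hypotheses (B : nat)
  (EB : forall m (phi : 'I_m -> G -> Cx R), orthonormal_in phi -> (m <= B)%N)
  (f0 : G -> Cx R) (Ef0 : E f0) (x0 : G) (f0x : f0 x0 != 0).

Let invariant_family m (phi : 'I_m -> G -> Cx R) := orthonormal_in phi /\
  forall g j, exists c : 'I_m -> Cx R, forall x, phi j (g^-1 * x)%g = \sum_i c i * phi i x.

Let invariant_exists : exists m, (0 < m)%N && `[< exists phi : 'I_m -> G -> Cx R, invariant_family phi >].
Proof.
have ex0 : exists m, `[< exists phi : 'I_m -> G -> Cx R, orthonormal_in phi >].
  by exists 0%N; apply/asboolP; exists (fun i _ => 0); split; [split|]; case.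
have exB m : `[< exists phi : 'I_m -> G -> Cx R, orthonormal_in phi >] -> (m <= B)%N.
  by move=> /asboolP[phi]; exact: EB.
case: (ex_maxnP ex0 exB) => m /asboolP[phi phiE] maxm.
have exp f : E f -> forall x, f x = \sum_i cI f (phi i) * phi i x.
  move=> /(orthonormal_extend phiE)[//|ex].
  by have := maxm m.+1 (asboolT ex); rewrite ltnn.
exists m; apply/andP; split.
  case: m phi phiE maxm exp => // phi _ _ exp.
  by move: f0x; rewrite (exp _ Ef0) big_ord0 eqxx.
apply/asboolP; exists phi; split=> // g j.
exists (fun i => cI (fun x => phi j (g^-1 * x)%g) (phi i)) => x.
by apply: (exp (fun x => phi j (g^-1 * x)%g)); apply: EL; case: phiE.
Qed.

(** A left invariant orthonormal family of minimal size carries an irreducible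
    representation: a proper stable subspace would have a smaller invariant
    orthonormal basis. *)
Lemma translation_irrep : exists (xi : irrep G) (phi : 'I_(rdim xi) -> G -> Cx R),
  orthonormal_in phi /\
  forall g j x, phi j (g^-1 * x)%g = \sum_i xi g i j * phi i x.
Proof.
case: (ex_minnP invariant_exists) => m /andP[m0 /asboolP[phi [phiE inv]]] minm.
have [[cphi ophi] Ephi] := phiE.
pose xi (g : G) : 'M[Cx R]_m := \matrix_(i, j) cI (fun x => phi j (g^-1 * x)%g) (phi i).
have xiE g j x : phi j (g^-1 * x)%g = \sum_i xi g i j * phi i x.
  have [c Hc] := inv g j; rewrite Hc; apply: eq_bigr => i _; congr (_ * _).
  rewrite mxE (_ : (fun x => phi j (g^-1 * x)%g) = fun x => \sum_i c i * phi i x).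
    by rewrite cip_basis.
  exact/funext.
have xiM g h : xi (g * h)%g = xi g *m xi h.
  apply/matrixP => i j; rewrite [LHS]mxE [RHS]mxE.
  have -> : (fun x => phi j ((g * h)^-1 * x)%g) =
      fun x => \sum_l (\sum_k xi g l k * xi h k j) * phi l x.
    apply/funext => x; rewrite invMg -mulgA xiE.
    under eq_bigr do rewrite xiE mulr_sumr.
    rewrite exchange_big /=; apply: eq_bigr => l _; rewrite mulr_suml.
    by apply: eq_bigr => k _; rewrite mulrA [xi h _ _ * _]mulrC.
  by rewrite cip_basis.
have xiU g : xi g *m adjmx (xi g) = 1%:M.
  apply: mulmx1C; apply/matrixP => k j; rewrite [LHS]mxE [RHS]mxE.
  rewrite eq_sym -(ophi j k) /cI -(cint_left mu g^-1%g); last first.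
    by apply: ccontM => //; exact: ccont_conj.
  have -> : (fun x => phi j (g^-1 * x)%g * (phi k (g^-1 * x)%g)^*) =
      fun x => (\sum_i xi g i j * phi i x) * (phi k (g^-1 * x)%g)^*.
    by apply/funext => x; rewrite xiE.
  rewrite -[RHS]/(cI _ (fun x => phi k (g^-1 * x)%g)).
  rewrite cip_suml //; last exact: ccont_lshift.
  apply: eq_bigr => i _; rewrite -cip_conj //; last exact: ccont_lshift.
  by rewrite !mxE mulrC.
have xic i j : continuous (fun g => xi g i j).
  have [cr ci] := cphi j; have [cr' ci'] := cphi i.
  have key (u v : G -> R) : continuous u -> continuous v ->
      continuous (fun p : G * G => u (p.1^-1 * p.2)%g * v p.2).
    move=> cu cv; apply: contMX; last exact: cont_pull (@cont_snd2 _).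
    by apply: (cont_pull cu); apply: cont_ldiv; [exact: cont_fst2|exact: cont_snd2].
  have keyI (u v u' v' : G -> R) (e : R) : continuous u -> continuous v ->
      continuous u' -> continuous v' -> continuous (fun g : G =>
       hint mu (fun x => u (g^-1 * x)%g * v x + e * (u' (g^-1 * x)%g * v' x))).
    move=> cu cv cu' cv'.
    apply: (hint_param_continuous (F := fun p : G * G =>
      u (p.1^-1 * p.2)%g * v p.2 + e * (u' (p.1^-1 * p.2)%g * v' p.2))) => p.
    apply: (@continuousD _ _ _ (fun p : G * G => u (p.1^-1 * p.2)%g * v p.2)); first exact: key.
    apply: (@continuousM _ _ (cst e) (fun p : G * G => u' (p.1^-1 * p.2)%g * v' p.2)).
      exact: cst_continuous.
    exact: key.
  apply/ccontP; split.
    have -> : (fun g => re (xi g i j)) = (fun g =>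
       hint mu (fun x => re (phi j (g^-1 * x)%g) * re (phi i x) + 1 * (im (phi j (g^-1 * x)%g) * im (phi i x)))).
      apply/funext => g; rewrite mxE /=; congr (hint mu _); apply/funext => x.
      by rewrite re_mul re_conj im_conj mul1r mulrN opprK.
    exact: (keyI (fun x => re (phi j x)) (fun x => re (phi i x)) (fun x => im (phi j x)) (fun x => im (phi i x))).
  have -> : (fun g => im (xi g i j)) = (fun g =>
     hint mu (fun x => im (phi j (g^-1 * x)%g) * re (phi i x) + - 1 * (re (phi j (g^-1 * x)%g) * im (phi i x)))).
    apply/funext => g; rewrite mxE /=; congr (hint mu _); apply/funext => x.
    by rewrite im_mul re_conj im_conj mulN1r mulrN addrC.
  exact: (keyI (fun x => im (phi j x)) (fun x => re (phi i x)) (fun x => re (phi j x)) (fun x => im (phi i x))).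
have irr : is_irrep xi.
  split=> // U stU.
  have [->|U0] := eqVneq U 0; [by left|right].
  have rU : (0 < \rank U)%N by rewrite lt0n mxrank_eq0.
  pose r := \rank U; pose Bm : 'M[Cx R]_(r, m) := schmidt (row_base U).
  have rm : (r <= m)%N := rank_leq_col U.
  have BmU : Bm *m (map_mx Num.conj Bm^T) = 1%:M.
    exact: (unitarymxP (schmidt_unitarymx (row_base U) rm)).
  have Bmeq : (Bm :=: U)%MS.
    apply: eqmx_trans (eqmx_schmidt_free (row_base_free U)) (eq_row_base U).
  pose psi (i : 'I_r) := fun x => \sum_j Bm i j * phi j x.
  have psiE : orthonormal_in psi.
    split; last by move=> i; exact: Ecomb.
    split; first by move=> i; apply: ccont_sum => j; exact: ccontZ.
    move=> i k; rewrite /psi cip_suml //; last by apply: ccont_sum => j; exact: ccontZ.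
    transitivity ((Bm *m map_mx Num.conj Bm^T) i k); last by rewrite BmU mxE.
    rewrite mxE; apply: eq_bigr => j _; rewrite cip_sumr // !mxE; congr (_ * _).
    rewrite (bigD1 j) //= ophi eqxx mulr1 big1 ?addr0 // => l lj.
    by rewrite ophi eq_sym (negbTE lj) mulr0.
  have psiI : invariant_family psi.
    split=> // g i.
    have /submxP[D DE] : (Bm *m (xi g)^T <= Bm)%MS.
      by rewrite !Bmeq (submx_trans _ (stU g)) // submxMr ?Bmeq.
    exists (fun k => D i k) => x.
    transitivity (\sum_l (Bm *m (xi g)^T) i l * phi l x).
      rewrite /psi; under eq_bigr do rewrite xiE mulr_sumr.
      rewrite exchange_big /=; apply: eq_bigr => l _; rewrite mxE mulr_suml.
      by apply: eq_bigr => k _; rewrite [(_^T) _ _]mxE mulrA.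
    rewrite DE /psi; under [RHS]eq_bigr do rewrite mulr_sumr.
    rewrite [RHS]exchange_big /=; apply: eq_bigr => l _; rewrite mxE mulr_suml.
    by apply: eq_bigr => k _; rewrite mulrA.
  have := minm r; rewrite rU /= => /(_ (asboolT (ex_intro _ psi psiI))) mr.
  by rewrite /row_full eqn_leq rm mr.
by exists (Irrep irr), phi.
Qed.

End TranslationIrrep.

Section PeterWeyl.
Context {R : realType} {n : nat} (G : compactLieGroup R n) (mu : haarMeasure G).
Local Notation cont := (fun u : G -> R => continuous u).
Local Notation cv := (conv mu).
Local Notation cint := (haar_int mu).

Lemma conv_powers (k : G -> R) : cont k -> even_fun k ->
  let kp m := iter m (cv k) k in
  [/\ forall m, cont (kp m), forall m, even_fun (kp m) &
      forall m l, cv (kp m) (kp l) = kp (m + l).+1].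
Proof.
move=> ck ek kp.
have ckp m : continuous (kp m).
  by elim: m => [|m IH]; [exact: ck|exact: (conv_cont ck IH)].
have kpD m l : cv (kp m) (kp l) = kp (m + l).+1.
  elim: m => [|m IH]; first by rewrite add0n.
  apply/funext => x; rewrite -[kp m.+1]/(cv k (kp m)).
  by rewrite (conv_assoc mu ck (ckp m) (ckp l)) IH.
split=> //; elim=> [|m IH] // x.
rewrite -[kp m.+1]/(cv k (kp m)) (conv_rev mu x ck (ckp m)).
rewrite (_ : (fun y => kp m y^-1%g) = kp m); last exact/funext.
rewrite (_ : (fun y => k y^-1%g) = kp 0); last exact/funext.
by rewrite -[k]/(kp 0) !kpD addn0 add0n.
Qed.

Lemma conv_left_shift (u p : G -> R) g x : cont u -> cont p ->
  cv (fun y => u (g^-1 * y)%g) p x = cv u p (g^-1 * x)%g.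
Proof.
move=> cu cp; rewrite /cv -[RHS](hint_left mu g^-1%g); last exact: conv_integrand.
by congr (hint mu _); apply/funext => z; rewrite invMg invgK mulgA mulgK.
Qed.

Lemma conv_sum (p : G -> R) m (a : 'I_m -> R) (u : 'I_m -> G -> R) x :
  cont p -> (forall i, cont (u i)) ->
  cv (fun y => \sum_i a i * u i y) p x = \sum_i a i * cv (u i) p x.
Proof.
move=> cp cu; rewrite /cv; under eq_fun do rewrite mulr_suml.
rewrite hint_sum; last first.
  move=> i; apply: contM; last exact: cont_inv_shift.
  by apply: contM => //; exact: cont_cst.
apply: eq_bigr => i _; under eq_fun do rewrite -mulrA.
by rewrite hintZ //; exact: conv_integrand.
Qed.

Lemma convD (p u v : G -> R) x : cont p -> cont u -> cont v ->
  cv (fun y => u y + v y) p x = cv u p x + cv v p x.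
Proof.
move=> cp cu cw; rewrite /cv; under eq_fun do rewrite mulrDl.
by rewrite hintD //; exact: conv_integrand.
Qed.

(** The space of functions reproduced by a continuous idempotent [p] of the
    convolution algebra has dimension at most [p 1], since the squares of an
    orthonormal family sum up pointwise to at most [p 1]. It is invariant under
    left translations, so it contains the entries of an irreducible
    representation. Taking for [p] the leading idempotent of the symmetric
    kernel [k] made from a function [f] orthogonal to all these entries gives a
    contradiction, as [k] both kills these entries and scales them by a nonzero
    factor. *)
Lemma peter_weyl_real (f : G -> R) : cont f ->
  (forall (xi : irrep G) i j, cint (fun x => toC (f x) * xi x i j) = 0) ->
  forall x, f x = 0.
Proof.
move=> cf fperp x; apply/eqP; apply: contraT => fx.
(* The symmetric kernel [k] is the autocorrelation of [f]; its value at the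
identity is the squared norm of [f]. *)
pose fr y := f y^-1%g; have cfr : continuous fr by exact: cont_rev.
pose k := cv fr f; have ck : continuous k by exact: conv_cont.
have ek : even_fun k.
  move=> y; rewrite /k conv_rev //; congr (conv mu _ _ y).
  by apply/funext => z; rewrite /fr invgK.
have k1 : k 1%g != 0.
  rewrite gt_eqF //; have -> : k 1%g = hint mu (fun z => fr z ^+ 2).
    by congr (hint mu _); apply/funext => z; rewrite mulg1 expr2.
  apply: (@hint_gt0 _ _ _ mu _ x^-1%g).
  - by under eq_fun do rewrite expr2; exact: contM.
  - by move=> y; exact: sqr_ge0.
  - by rewrite /fr invgK exprn_even_gt0.
have [ckp ekp kpD] := conv_powers ck ek.
have [a a0 [p [cp ep p1 pp pk]]] := leading_idempotent ckp ekp kpD k1.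
rewrite /= in pk.
pose Er (u : G -> R) := cont u /\ cv u p = u.
pose E (phi : G -> Cx R) := Er (fun y => re (phi y)) /\ Er (fun y => im (phi y)).
have Ec phi : E phi -> ccont phi by move=> [[? _] [? _]].
have ErL g u : Er u -> Er (fun y => u (g^-1 * y)%g).
  move=> [cu pu]; split; first exact: cont_lshift.
  by apply/funext => y; rewrite conv_left_shift // pu.
have EL g phi : E phi -> E (fun y => phi (g^-1 * y)%g).
  by move=> [h1 h2]; split; [exact: (ErL g _ h1)|exact: (ErL g _ h2)].
have ErC m (b : 'I_m -> R) (u : 'I_m -> G -> R) : (forall i, Er (u i)) ->
    Er (fun y => \sum_i b i * u i y).
  move=> Eu; split.
    by apply: cont_sum => i; apply: contM; [exact: cont_cst|have [] := Eu i].
  apply/funext => y; rewrite conv_sum //; last by move=> i; have [] := Eu i.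
  by apply: eq_bigr => i _; have [_ ->] := Eu i.
have ErD u v : Er u -> Er v -> Er (fun y => u y + v y).
  move=> [cu pu] [cw pw]; split; first exact: contD.
  by apply/funext => y; rewrite convD // pu pw.
have Ecomb m (b : 'I_m -> Cx R) (phi : 'I_m -> G -> Cx R) : (forall i, E (phi i)) ->
    E (fun y => \sum_i b i * phi i y).
  move=> Ephi; split.
    have -> : (fun y => re (\sum_i b i * phi i y)) = fun y =>
        \sum_i re (b i) * re (phi i y) + \sum_i (- im (b i)) * im (phi i y).
      apply/funext => y; rewrite re_sum -big_split; apply: eq_bigr => i _.
      by rewrite re_mul mulNr.
    apply: ErD.
      by apply: (ErC _ _ (fun i y => re (phi i y))) => i; have [] := Ephi i.
    by apply: (ErC _ _ (fun i y => im (phi i y))) => i; have [] := Ephi i.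
  have -> : (fun y => im (\sum_i b i * phi i y)) = fun y =>
      \sum_i re (b i) * im (phi i y) + \sum_i im (b i) * re (phi i y).
    apply/funext => y; rewrite im_sum -big_split; apply: eq_bigr => i _.
    by rewrite im_mul.
  apply: ErD.
    by apply: (ErC _ _ (fun i y => im (phi i y))) => i; have [] := Ephi i.
  by apply: (ErC _ _ (fun i y => re (phi i y))) => i; have [] := Ephi i.
have p0 : 0 <= p 1%g.
  rewrite -pp conv1 //; apply: hint_ge0 => y; rewrite -expr2; exact: sqr_ge0.
have EB m (phi : 'I_m -> G -> Cx R) : orthonormal_in mu E phi -> m%:R <= p 1%g.
  move=> [ophi Ephi].
  have cpy y : ccont (fun z => toC (p (y^-1 * z)%g)) by apply: ccont_toC; exact: cont_lshift.
  (* The reproducing property: point values are inner products with translates of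
  [p]. *)
  have val y i : cip mu (fun z => toC (p (y^-1 * z)%g)) (phi i) = (phi i y)^*.
    have [[cr pr] [ci pi]] := Ephi i.
    have Ep z : p (y^-1 * z)%g = p (z^-1 * y)%g by rewrite -ep invMg invgK.
    apply: Cx_ext; rewrite ?re_conj ?im_conj /cip cintE /=.
      rewrite -[X in _ = X](congr1 (fun h => h y) pr); congr (hint mu _).
      by apply/funext => z; rewrite re_toCM re_conj mulrC Ep.
    rewrite -[X in _ = - X](congr1 (fun h => h y) pi) -hintN; last exact: conv_integrand.
    by congr (hint mu _); apply/funext => z; rewrite im_toCM im_conj mulrN mulrC Ep.
  have bess y : \sum_i normsq (phi i y) <= p 1%g.
    have := bessel_ineq ophi (cpy y).
    have -> : hint mu (fun z => normsq (toC (p (y^-1 * z)%g))) = p 1%g.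
      rewrite -[RHS](congr1 (fun h => h 1%g) pp) conv1 // -[RHS](hint_left mu y^-1%g); last exact: contM.
      by congr (hint mu _); apply/funext => z; rewrite /normsq /= expr0n addr0 expr2.
    apply: le_trans; apply: ler_sum => i _; rewrite val /normsq re_conj im_conj.
    by rewrite sqrrN.
  have := hint_le mu _ (@cont_cst _ _ _ (p 1%g)) bess.
  rewrite hint_cst hint_sum; last by move=> i; apply: cont_normsq; exact: Ec.
  move=> /(_ _); rewrite (eq_bigr (fun=> 1)).
    by rewrite sumr_const card_ord; apply; apply: cont_sum => i; apply: cont_normsq; exact: Ec.
  move=> i _; have [_ /(_ i i)] := ophi; rewrite eqxx /cip cint_normsq; last exact: Ec.
  by rewrite -toC1 => /toC_inj.
have EBn m (phi : 'I_m -> G -> Cx R) : orthonormal_in mu E phi -> (m <= Num.bound (p 1%g))%N.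
  by move=> /EB h; rewrite -(ler_nat R) (le_trans h) // ltW // archi_boundP.
have Ep : E (fun y => toC (p y)).
  split; split => //; first exact: cont_cst.
  by apply/funext => y; rewrite /conv; under eq_fun do rewrite mul0r; rewrite hint_cst.
have p1' : toC (p 1%g) != 0 by apply: contraNN p1 => /eqP/toC_inj ->.
have [xi [phi [[ophi Ephi] xiE]]] := translation_irrep Ec EL Ecomb EBn Ep p1'.
(* The hypothesis on [f] extends to the basis functions and their translates,
which are combinations of matrix entries. *)
have fphi g j : cint (fun z => toC (f z) * phi j (g^-1 * z)%g) = 0.
  have h i : cint (fun z => toC (f z) * phi i z) = 0.
    have -> : (fun z => toC (f z) * phi i z) =
        fun z => \sum_l phi l 1%g * (toC (f z) * xi z i l)^*.
      apply/funext => z; have := xiE z^-1%g i 1%g.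
      rewrite invgK mulg1 => ->; rewrite mulr_sumr; apply: eq_bigr => l _.
      by rewrite rep_inv rmorphM /= toC_conj mulrA mulrC.
    rewrite cint_sum => [|l]; last first.
      by apply/ccontZ/ccont_conj/ccontM; [exact: ccont_toC|exact: rep_ccont].
    rewrite big1 // => l _; rewrite cintZ ?cint_conj ?fperp ?rmorph0 ?mulr0 //.
      by apply: ccontM; [exact: ccont_toC|exact: rep_ccont].
    by apply/ccont_conj/ccontM; [exact: ccont_toC|exact: rep_ccont].
  have -> : (fun z => toC (f z) * phi j (g^-1 * z)%g) =
      fun z => \sum_i xi g i j * (toC (f z) * phi i z).
    by apply/funext => z; rewrite xiE mulr_sumr; apply: eq_bigr => i _; rewrite mulrCA.
  rewrite cint_sum => [|l]; last first.
    by apply/ccontZ/ccontM; [exact: ccont_toC|exact: Ec].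
  rewrite big1 // => i _; rewrite cintZ ?h ?mulr0 //.
  by apply/ccontM; [exact: ccont_toC|exact: Ec].
(* On a function reproduced by [p] the convolution with the square [kp 1] of [k]
is the multiplication by [a], but the convolution with [k] vanishes. *)
have kill u : Er u -> (forall g, hint mu (fun z => f z * u (g^-1 * z)%g) = 0) ->
    forall y, u y = 0.
  move=> [cu pu] fu y.
  have ufr : cv u fr = fun=> 0.
    apply/funext => w; rewrite /conv -[LHS](hint_left mu w); last exact: conv_integrand.
    rewrite -[RHS](fu w^-1%g) invgK; congr (hint mu _); apply/funext => z.
    by rewrite /fr invMg invgK mulKg mulrC.
  have uk : cv u k = fun=> 0.
    apply/funext => w; rewrite -conv_assoc // ufr /conv.
    by under eq_fun do rewrite mul0r; rewrite hint_cst.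
  have : cv u (cv k k) y = a * u y.
    rewrite -[in LHS]pu conv_assoc //; last exact: (ckp 1).
    rewrite [cv p _]pk /conv; under eq_fun do rewrite mulrCA.
    rewrite hintZ; last exact: conv_integrand.
    by rewrite -/(conv mu u p y) pu.
  rewrite -conv_assoc // uk /conv; under eq_fun do rewrite mul0r.
  by rewrite hint_cst => /esym/eqP; rewrite mulf_eq0 (negbTE a0) => /eqP.
pose j0 := Ordinal (rdim_gt0 xi).
have phi0 y : phi j0 y = 0.
  have [Erp Eip] := Ephi j0.
  apply: Cx_ext.
    apply: (kill _ Erp) => g; rewrite -[RHS](congr1 re (fphi g j0)) cintE /=.
    by congr (hint mu _); apply/funext => z; rewrite re_toCM.
  apply: (kill _ Eip) => g; rewrite -[RHS](congr1 im (fphi g j0)) cintE /=.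
  by congr (hint mu _); apply/funext => z; rewrite im_toCM.
have [_ /(_ j0 j0)] := ophi; rewrite eqxx /cip.
under eq_fun do rewrite phi0 mul0r.
by rewrite cint_cst => /esym/eqP; rewrite oner_eq0.
Qed.

End PeterWeyl.

(** * Schur orthogonality *)

Section Schur.
Context {R : realType} {n : nat} (G : compactLieGroup R n) (mu : haarMeasure G).
Local Notation cint := (haar_int mu).
Implicit Types xi eta : irrep G.

Lemma adjmxM m k l (A : 'M[Cx R]_(m, k)) (B : 'M[Cx R]_(k, l)) :
  adjmx (A *m B) = adjmx B *m adjmx A.
Proof. by rewrite /adjmx trmx_mul map_mxM. Qed.

Lemma rep_unitaryC xi g : adjmx (xi g) *m xi g = 1%:M.
Proof. exact/mulmx1C/rep_unitary. Qed.

Lemma conj_rep_irrep xi : is_irrep (conj_rep xi).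
Proof.
have [d0 mul uni con irr] := irrepP xi.
have conjK m k (A : 'M[Cx R]_(m, k)) : map_mx Num.conj (map_mx Num.conj A) = A.
  by apply/matrixP => i j; rewrite !mxE conjCK.
split; first exact: d0.
- by move=> g h; rewrite /conj_rep mul map_mxM.
- move=> g; have := congr1 (map_mx Num.conj) (uni g).
  rewrite map_mxM map_mx1 => <-; congr (_ *m _).
  by apply/matrixP => i j; rewrite !mxE.
- move=> i j; have /ccontP/ccont_conj/ccontP := con i j.
  rewrite (_ : (fun g => conj_rep xi g i j) = fun g => (xi g i j)^*) //.
  by apply/funext => g; rewrite mxE.
- move=> U stU; have [g|U0|Uf] := irr (map_mx Num.conj U).
  + have := stU g; rewrite /conj_rep map_trmx => h.
    by rewrite -(conjK _ _ (xi g)^T) -map_mxM map_submx.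
  + by left; rewrite -[U]conjK U0 map_mx0.
  + by right; move: Uf; rewrite row_full_map.
Qed.

Definition conj_irrep xi : irrep G := Irrep (conj_rep_irrep xi).

(** The kernel and the range of an intertwining operator are stable. *)
Lemma schur_equiv xi eta (A : 'M[Cx R]_(rdim eta, rdim xi)) :
  (forall g, A *m xi g = eta g *m A) -> A = 0 \/ equiv_rep xi eta.
Proof.
move=> Axi; have [_ _ _ _ irx] := irrepP xi; have [_ _ _ _ ire] := irrepP eta.
have [g|K0|Kf] := irx (kermx A^T).
- apply/sub_kermxP; rewrite -mulmxA -trmx_mul Axi trmx_mul mulmxA.
  by rewrite mulmx_ker mul0mx.
- have [g|I0|If] := ire <<A^T>>%MS.
  + rewrite !genmxE (eqmxMr _ (genmxE _)) -trmx_mul -Axi trmx_mul; exact: submxMl.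
  + left; apply: trmx_inj; apply/eqP; rewrite trmx0 -submx0 -(genmxE A^T) I0.
    exact: submx_refl.
  + right; move: If; rewrite /row_full genmxE -/(row_full _) => /row_fullP[C CA].
    have /row_freeP[B AB] : row_free A^T by rewrite -kermx_eq0 K0.
    have AC : A *m C^T = 1%:M by rewrite -[A]trmxK -trmx_mul CA trmx1.
    have BA : B^T *m A = 1%:M by rewrite -[A]trmxK -trmx_mul AB trmx1.
    exists A, C^T; split=> //.
    by rewrite -[C^T]mul1mx -BA -(mulmxA B^T) AC mulmx1.
- left; apply: trmx_inj; rewrite trmx0; apply/eqP; rewrite -submx0.
  have /row_fullP[B BK] := Kf.
  by rewrite -[A^T]mul1mx -BK -mulmxA mulmx_ker mulmx0 sub0mx.
Qed.

(** Over the complex numbers an intertwining operator has an eigenvalue, and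
    the corresponding eigenspace is stable. *)
Lemma schur_scalar xi (A : 'M[Cx R]_(rdim xi)) :
  (forall g, A *m xi g = xi g *m A) -> exists a, A = a%:M.
Proof.
move=> Axi; have d0 := rdim_gt0 xi.
have [a /eigenvalueP[v vA v0]] : exists a, eigenvalue A^T a.
  have /closed_rootP[a ra] : size (char_poly A^T) != 1%N.
    by rewrite size_char_poly eqSS -lt0n.
  by exists a; rewrite eigenvalue_root_char.
exists a; apply/eqP; rewrite -subr_eq0; apply/eqP.
have Bxi g : (A - a%:M) *m xi g = xi g *m (A - a%:M).
  by rewrite mulmxBl mulmxBr Axi scalar_mxC.
have [_ _ _ _ irx] := irrepP xi.
have [g|K0|Kf] := irx (kermx (A - a%:M)^T).
- apply/sub_kermxP; rewrite -mulmxA -trmx_mul Bxi trmx_mul mulmxA.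
  by rewrite mulmx_ker mul0mx.
- have : (v <= kermx (A - a%:M)^T)%MS.
    apply/sub_kermxP; rewrite linearB /= tr_scalar_mx mulmxBr vA.
    by rewrite mul_mx_scalar subrr.
  by rewrite K0 submx0 (negbTE v0).
- apply: trmx_inj; rewrite trmx0; have /row_fullP[B BK] := Kf.
  by rewrite -[X in X = _]mul1mx -BK -mulmxA mulmx_ker mulmx0.
Qed.

(** Averaging a matrix unit over the group gives an intertwining operator. *)
Lemma schur_average xi eta i j :
  let M := \matrix_(a, b) cip mu (fun g => eta g a i) (fun g => xi g b j) in
  forall h, M *m xi h = eta h *m M.
Proof.
move=> M h.
have cM a b : ccont (fun g => eta g a i * (xi g b j)^*).
  by apply: ccontM; [exact: rep_ccont|exact/ccont_conj/rep_ccont].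
suff key : eta h *m M *m adjmx (xi h) = M.
  by rewrite -{1}key -mulmxA rep_unitaryC mulmx1.
apply/matrixP => a b; rewrite [RHS]mxE /cip -(cint_left mu h) //.
transitivity (cint (fun g => \sum_l \sum_k (xi h b l)^* * (eta h a k * (eta g k i * (xi g l j)^*)))).
  rewrite cint_sum => [|l]; last by apply: ccont_sum => k; do 2 apply: ccontZ.
  rewrite mxE; apply: eq_bigr => l _; rewrite cint_sum => [|k]; last by do 2 apply: ccontZ.
  rewrite mxE mulr_suml; apply: eq_bigr => k _; rewrite !cintZ //; last exact: ccontZ.
  by rewrite !mxE mulrC.
congr (haar_int mu _); apply/funext => g; rewrite !repM !mxE rmorph_sum mulr_sumr.
apply: eq_bigr => l _; rewrite mulr_suml; apply: eq_bigr => k _.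
by rewrite rmorphM /=; ring.
Qed.

Lemma rep_orth_inequiv xi eta a i b j : ~ equiv_rep xi eta ->
  cip mu (fun g => eta g a i) (fun g => xi g b j) = 0.
Proof.
move=> neq; have [/matrixP/(_ a b)|//] := schur_equiv (@schur_average xi eta i j).
by rewrite !mxE.
Qed.

Lemma rep_orth xi a i b j :
  cip mu (fun g => xi g a i) (fun g => xi g b j) =
  ((a == b) && (i == j))%:R / (rdim xi)%:R.
Proof.
have [c /matrixP Mc] := schur_scalar (@schur_average xi xi i j).
have E a' b' : cip mu (fun g => xi g a' i) (fun g => xi g b' j) = c *+ (a' == b').
  by have := Mc a' b'; rewrite !mxE.
have d0 : (rdim xi)%:R != 0 :> Cx R by rewrite pnatr_eq0 -lt0n rdim_gt0.
have cE : c = (i == j)%:R / (rdim xi)%:R.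
  apply: (mulIf d0); rewrite divfK //.
  (* The scalar is found by taking the trace. *)
  have : \sum_a' cip mu (fun g => xi g a' i) (fun g => xi g a' j) = (i == j)%:R.
    rewrite /cip -cint_sum => [|k]; last first.
      by apply: ccontM; [exact: rep_ccont|exact/ccont_conj/rep_ccont].
    rewrite (_ : (fun _ => _) = fun=> (i == j)%:R) ?cint_cst //.
    apply/funext => g; have /matrixP/(_ j i) := rep_unitaryC xi g.
    rewrite !mxE eq_sym => <-; apply: eq_bigr => k _; by rewrite !mxE mulrC.
  rewrite (eq_bigr (fun=> c)) => [|a' _]; last by rewrite E eqxx.
  by rewrite sumr_const card_ord mulr_natr.
rewrite E cE; case: (a == b); case: (i == j) => //=; by rewrite ?mulr0n ?mul0r.
Qed.

Lemma equiv_rep_refl d (xi : G -> 'M[Cx R]_d) : equiv_rep xi xi.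
Proof. by exists 1%:M, 1%:M; split=> [||g]; rewrite ?mulmx1 ?mul1mx. Qed.

Lemma equiv_rep_sym d e (xi : G -> 'M[Cx R]_d) (eta : G -> 'M[Cx R]_e) :
  equiv_rep xi eta -> equiv_rep eta xi.
Proof.
move=> [A [B [AB BA h]]]; exists B, A; split=> // g.
by rewrite -[xi g]mul1mx -BA -(mulmxA B) h -!mulmxA AB mulmx1.
Qed.

Lemma equiv_rep_trans d e f (xi : G -> 'M[Cx R]_d) (eta : G -> 'M[Cx R]_e)
    (zeta : G -> 'M[Cx R]_f) :
  equiv_rep xi eta -> equiv_rep eta zeta -> equiv_rep xi zeta.
Proof.
move=> [A [B [AB BA h]]] [A' [B' [AB' BA' h']]]; exists (A' *m A), (B *m B').
split=> [||g].
- by rewrite -mulmxA (mulmxA A) AB mul1mx.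
- by rewrite -mulmxA (mulmxA B') BA' mul1mx.
- by rewrite -mulmxA h !mulmxA h'.
Qed.

Lemma equiv_rep_conj d e (xi : G -> 'M[Cx R]_d) (eta : G -> 'M[Cx R]_e) :
  equiv_rep xi eta -> equiv_rep (conj_rep xi) (conj_rep eta).
Proof.
move=> [A [B [AB BA h]]]; exists (map_mx Num.conj A), (map_mx Num.conj B).
by split=> [||g]; rewrite -map_mxM ?AB ?BA ?map_mx1 // h map_mxM.
Qed.

Lemma conj_repK d (xi : G -> 'M[Cx R]_d) : conj_rep (conj_rep xi) = xi.
Proof. by apply/funext => g; apply/matrixP => i j; rewrite !mxE conjCK. Qed.

Lemma peter_weyl (f : G -> Cx R) : ccont f ->
  (forall xi i j, cint (fun x => f x * xi x i j) = 0) -> forall x, f x = 0.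
Proof.
move=> cf fxi.
have cx xi i j : ccont (fun x => xi x i j) by exact: rep_ccont.
have fcxi xi i j : cint (fun x => (f x)^* * xi x i j) = 0.
  have := fxi (conj_irrep xi) i j; rewrite -[X in X = _]conjCK -cint_conj.
    under eq_fun do rewrite rmorphM /= mxE conjCK.
    by move=> /(congr1 Num.conj); rewrite conjCK rmorph0.
  by apply: ccontM => //; exact: cx.
have part (a b : Cx R) xi i j : cint (fun x => (a * f x + b * (f x)^*) * xi x i j) = 0.
  have -> : (fun x => (a * f x + b * (f x)^*) * xi x i j) =
      fun x => a * (f x * xi x i j) + b * ((f x)^* * xi x i j).
    by apply/funext => x; rewrite mulrDl !mulrA.
  have c1 : ccont (fun x => f x * xi x i j) by exact: ccontM.
  have c2 : ccont (fun x => (f x)^* * xi x i j) by apply: ccontM => //; exact: ccont_conj.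
  by rewrite cintD ?cintZ ?fxi ?fcxi ?mulr0 ?addr0 //; exact: ccontZ.
have n2 : (2 : Cx R) != 0 by rewrite pnatr_eq0.
have fr x : re (f x) = 0.
  apply: (peter_weyl_real (f := fun x => re (f x))) => [|xi i j]; first by case: cf.
  rewrite -(part 2^-1 2^-1 xi i j); congr (haar_int mu _); apply/funext => y.
  congr (_ * _); rewrite -mulrDr; apply: (mulfI n2); rewrite mulVKf //.
  by apply: Cx_ext; rewrite ?reD ?imD ?re_conj ?im_conj mulr_natl mulr2n ?reD ?imD /= ?subrr ?addr0.
have fi x : im (f x) = 0.
  apply: (peter_weyl_real (f := fun x => im (f x))) => [|xi i j]; first by case: cf.
  rewrite -(part (mkC 0 (- 2^-1)) (mkC 0 2^-1) xi i j); congr (haar_int mu _); apply/funext => y.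
  by congr (_ * _); apply: Cx_ext; rewrite ?reD ?imD ?re_mul ?im_mul ?re_conj ?im_conj /=; field.
by move=> x; apply: Cx_ext; rewrite ?fr ?fi.
Qed.

End Schur.

(** * Bump functions *)

Section Bumps.
Context {R : realType}.

(** [t ^ m] for [t > 0] and [0] elsewhere: the class C^(m-1) is enough for the
    arguments below, which differentiate a bounded number of times. *)
Definition pospow (m : nat) (t : R) : R := if 0 < t then t ^+ m else 0.

Lemma pospow_ge0 m t : 0 <= pospow m t.
Proof. by rewrite /pospow; case: ifP => // /ltW t0; exact: exprn_ge0. Qed.

Lemma is_derive_pospow m (t : R) :
  is_derive t 1 (pospow m.+2) (m.+2%:R * pospow m.+1 t).
Proof.
have [t0|t0|<-] := ltgtP 0 t.
- have e : \forall s \near t, (fun s => s ^+ m.+2) s = pospow m.+2 s.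
    by apply: filterS (lt_nbhsr t0) => s s0; rewrite /pospow s0.
  apply: (near_eq_is_derive e).
  have -> : (fun s : R => s ^+ m.+2) = (@idfun R : R -> R) ^+ m.+2.
    by apply/funext => s; rewrite exprfctE.
  apply: (is_derive_eq (is_deriveX m.+2 (is_derive_id t 1))).
  by rewrite /pospow t0 /=; exact: mulr1.
- have e : \forall s \near t, (fun=> 0) s = pospow m.+2 s.
    by apply: filterS (lt_nbhsl t0) => s s0; rewrite /pospow ltNge ltW.
  apply: (near_eq_is_derive e).
  apply: is_derive_eq (is_derive_cst (0 : R) t 1) _.
  by rewrite /pospow ltNge ltW //= mulr0.
have p0 k : pospow k 0 = 0 by rewrite /pospow ltxx.
have pow0 : (fun h : R => `|h| ^+ m.+1) @ 0^' --> (0 : R).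
  have h1 : {for 0, continuous (fun h : R => `|h| ^+ m.+1)}.
    apply: (@continuous_comp _ _ _ (fun h : R => `|h|) (fun t : R => t ^+ m.+1)).
      exact: norm_continuous.
    exact: exprn_continuous.
  rewrite /prop_for /continuous_at normr0 expr0n /= in h1.
  exact: cvg_trans (cvg_app _ (@nbhs_dnbhs _ _)) h1.
have key : (fun h : R => h^-1 *: (pospow m.+2 (h *: 1 + 0) - pospow m.+2 0)) @ 0^' --> (0 : R).
  apply: (@squeeze_cvgr _ _ _ _ (fun h => - `|h| ^+ m.+1) (fun h => `|h| ^+ m.+1)).
  - near=> h; have h0 : h != 0 by near: h; exact: nbhs_dnbhs_neq.
    rewrite p0 subr0 addr0 [h *: 1]mulr1 -ler_norml normrM normfV.
    rewrite ler_pdivrMl ?normr_gt0 // -exprS /pospow; case: ifP => [hp|_].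
      by rewrite normrX.
    by rewrite normr0 exprn_ge0.
  - by rewrite -[X in _ --> X]oppr0; apply: cvgN; exact: pow0.
  - exact: pow0.
rewrite p0 mulr0; apply: DeriveDef; first by apply/cvg_ex; exists 0.
exact: cvg_lim key.
Unshelve. all: by end_near. Qed.

Lemma Ck_pospow k : Ck k [set: 'rV[R]_1] (fun z => pospow k.+1 (z 0 0)).
Proof.
have cpos m (z : 'rV[R]_1) : {for z, continuous (fun z : 'rV[R]_1 => pospow m.+1 (z 0 0))}.
  have -> : (fun z : 'rV[R]_1 => pospow m.+1 (z 0 0)) =
      fun z : 'rV[R]_1 => ((z 0 0 + `|z 0 0|) / 2) ^+ m.+1.
    apply/funext => y; rewrite /pospow; case: ltP => [h|h].
      by congr (_ ^+ _); rewrite gtr0_norm //; field.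
    by rewrite ler0_norm // subrr mul0r expr0n.
  have cc : {for z, continuous (fun z : 'rV[R]_1 => z 0 0)} by exact: coord_continuous.
  apply: (@continuous_comp _ _ _ (fun z : 'rV[R]_1 => z 0 0) (fun t : R => ((t + `|t|) / 2) ^+ m.+1)) => //.
  apply: (@continuous_comp _ _ _ (fun t : R => (t + `|t|) / 2) (fun t : R => t ^+ m.+1)).
    apply: (@continuousM _ _ (fun t : R => t + `|t|) (cst 2^-1)); last exact: cst_continuous.
    by apply: (@continuousD _ _ _ id (fun t : R => `|t|)); [exact: cvg_id|exact: norm_continuous].
  exact: exprn_continuous.
elim: k => [|k IH]; split=> //; try by move=> z _; exact: cpos.
move=> i; have dP (z : 'rV[R]_1) : is_derive z (std i) (fun z => pospow k.+2 (z 0 0))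
    (k.+2%:R * pospow k.+1 (z 0 0)).
  have E : (fun h : R => h^-1 *: (pospow k.+2 ((h *: (std i : 'rV[R]_1) + z) 0 0) - pospow k.+2 (z 0 0))) =
     (fun h : R => h^-1 *: (pospow k.+2 (h *: 1 + z 0 0) - pospow k.+2 (z 0 0))).
    by apply/funext => h; rewrite !mxE ord1 !eqxx.
  have [d1 d2] := is_derive_pospow k (z 0 0).
  apply: DeriveDef; first by rewrite /derivable /= E.
  by rewrite /derive /= E.
split; first by move=> z _; have [] := dP z.
apply: (Ck_ext openT (f := fun z => k.+2%:R * pospow k.+1 (z 0 0))) => [z _|].
  by have [_ ->] := dP z.
exact: Ck_scale openT _.
Qed.

Lemma Ck_pospow_comp n k (U : set 'rV[R]_n) f : open U -> Ck k U f ->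
  Ck k U (fun x => pospow k.+1 (f x)).
Proof.
move=> oU Cf; have := @Ck_comp _ n 1 k U setT (fun z => pospow k.+1 (z 0 0))
  (fun x => (f x)%:M) oU openT (fun _ _ => I).
have -> : (fun x => pospow k.+1 (((f x)%:M : 'M[R]_1) 0 0)) = fun x => pospow k.+1 (f x).
  by apply/funext => x; rewrite mxE eqxx.
apply; last exact: Ck_pospow.
by move=> j; apply: Ck_ext Cf => // x _; rewrite mxE ord1 eqxx.
Qed.

(** A product over the coordinates rather than a function of the distance, as
    the norm of row vectors is the maximum of the coordinates. *)
Definition box_bump n k (r : R) (a y : 'rV[R]_n) : R :=
  \prod_j pospow k.+1 (r ^+ 2 - (y 0 j - a 0 j) ^+ 2).

Lemma Ck_box_bump n k (r : R) (a : 'rV[R]_n) (U : set 'rV[R]_n) : open U ->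
  Ck k U (box_bump k r a).
Proof.
move=> oU; apply: Ck_prod => // j; apply: Ck_pospow_comp => //.
apply: (Ck_ext (f := fun y => r ^+ 2 + -1 * ((y 0 j + - a 0 j) * (y 0 j + - a 0 j)))) => //.
  by move=> y _; ring.
apply: Ck_add => //; first exact: Ck_cst.
apply: Ck_scale => //; apply: Ck_mul => //; apply: Ck_add => //;
  [exact: Ck_coord|exact: Ck_cst|exact: Ck_coord|exact: Ck_cst].
Qed.

Lemma box_bump_supp n k (r : R) (a y : 'rV[R]_n) : 0 < r -> box_bump k r a y != 0 ->
  `|a - y| <= r.
Proof.
move=> r0 b0; apply: rV_norm_le => [|j]; first exact: ltW.
have : pospow k.+1 (r ^+ 2 - (y 0 j - a 0 j) ^+ 2) != 0.
  by apply: contraNN b0 => /eqP h; rewrite /box_bump (bigD1 j) //= h mul0r.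
rewrite /pospow; case: ifP => [|_]; last by rewrite eqxx.
rewrite subr_gt0 -(real_normK (num_real (_ - _))) ltr_pXn2r ?nnegrE ?normr_ge0 ?(ltW r0) //.
by rewrite !mxE distrC => /ltW.
Qed.

Lemma box_bump_gt0 n k (r : R) (a : 'rV[R]_n) : 0 < r -> 0 < box_bump k r a a.
Proof.
move=> r0; apply: prodr_gt0 => j _.
by rewrite subrr expr0n subr0 /pospow (exprn_gt0 2 r0) exprn_gt0 // exprn_gt0.
Qed.

End Bumps.

Section BumpOnGroup.
Context {R : realType} {n : nat} (G : compactLieGroup R n).
Local Notation c0 := (base_chart G).
Local Notation y0 := (c0 1%g).

(** A coordinate bump is extended by zero; this is of class C^k because its
    support is compact, hence closed in the group, so that every point is
    either in the chart or has a neighbourhood where the extension vanishes. *)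
Lemma GCk_bump k (U : set G) : nbhs (1%g : G) U -> exists psi : G -> R,
  [/\ GCk k psi, forall g, 0 <= psi g, 0 < psi 1%g & forall g, psi g != 0 -> U g].
Proof.
move=> U1.
have Uy : nbhs y0 (ccod c0 `&` [set y | U (cinv c0 y)]).
  apply: filterI; first by apply: open_nbhs_nbhs; split; [exact: ccod_open|exact: base_ccod].
  by apply: (cinv_continuous (base_ccod G)); rewrite cinv_base.
have [r rU] := (nbhs_closedballP _ _).1 Uy.
pose D := closed_ball y0 r%:num.
have DE y : D y <-> `|y0 - y| <= r%:num by rewrite /D closed_ballE.
pose K := cinv c0 @` D.
have cD : compact D.
  apply: bounded_closed_compact; last exact: closed_ball_closed.
  exists (`|y0| + r%:num); split; first exact: num_real.
  move=> y hy x /DE hx; apply: le_trans (ltW hy); rewrite -[x](subKr y0).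
  by rewrite (le_trans (ler_normB _ _)) // lerD2l.
have clK : closed K.
  apply: compact_closed; first exact: clg_hausdorff.
  apply: continuous_compact => //; apply: continuous_in_subspaceT => y /set_mem Dy.
  by apply: cinv_continuous; have [] := rU _ Dy.
pose beta := box_bump k r%:num y0.
pose psi g : R := if `[< cdom c0 g >] then beta (c0 g) else 0.
have psiK g : psi g != 0 -> K g /\ cdom c0 g.
  rewrite /psi; case: asboolP => [dg b0|]; last by rewrite eqxx.
  split=> //; exists (c0 g); last exact: cmapK.
  by apply/DE; exact: box_bump_supp b0.
exists psi; split.
- move=> c Ac; apply: Ck_local => x cx.
  have sI := smooth_into_chart Ac.
  have [dx|ndx] := pselect (cdom c0 (cinv c x)).
    exists [set x | ccod c x /\ cdom c0 (cinv c x)]; split=> //.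
    have oV : open [set x | ccod c x /\ cdom c0 (cinv c x)].
      exact: (@smooth_into_open _ _ _ _ _ _ c0 sI).
    apply: (Ck_ext (f := fun x => beta (c0 (cinv c x)))) => //.
      by move=> z [_ dz]; rewrite /psi asboolT.
    apply: (@Ck_comp _ _ _ _ _ setT beta (fun x => c0 (cinv c x))) => //; first exact: openT.
      by move=> j; exact: (atlas_compat (clg_atlas G) Ac (base_atlas G)).
    exact: Ck_box_bump openT.
  exists [set x | ccod c x /\ (~` K) (cinv c x)]; split.
    split=> // -[y Dy yE]; apply: ndx; rewrite -yE; apply: cinv_dom.
    by have [] := rU _ Dy.
  have oV : open [set x | ccod c x /\ (~` K) (cinv c x)].
    apply: nbhs_openP => z [cz Kz]; apply: filterI.
      by apply: open_nbhs_nbhs; split=> //; exact: ccod_open.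
    apply: (cinv_continuous cz); apply: open_nbhs_nbhs; split=> //.
    exact: closed_openC.
  apply: (Ck_ext (f := fun=> 0)) => //; last exact: Ck_cst.
  move=> z [_ Kz]; apply/esym/eqP; apply: contraT => /psiK[].
  by move: Kz => /[swap].
- by move=> g; rewrite /psi; case: asboolP => // _; apply: prodr_ge0 => j _; exact: pospow_ge0.
- by rewrite /psi asboolT; [exact: box_bump_gt0|exact: base_cdom].
- by move=> g /psiK[[y Dy <-] _]; have [] := rU _ Dy.
Qed.

End BumpOnGroup.

(** * Regularization by smearing *)

Section Smoothing.
Context {R : realType} {n : nat} (G : compactLieGroup R n) (mu : haarMeasure G)
  (met : biinvariantMetric G).
Local Notation c0 := (base_chart G).
Local Notation y0 := (c0 1%g).
Local Notation cont := (fun u : G -> R => continuous u).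

Lemma is_derive_line_rev m (f : 'rV[R]_m -> R) x v d :
  is_derive (0 : R) 1 (fun t : R => f (t *: v + x)) d -> is_derive x v f d.
Proof.
have E : (fun h : R => h^-1 *: (f ((h *: 1 + 0) *: v + x) - f (0 *: v + x))) =
         (fun h : R => h^-1 *: (f (h *: v + x) - f x)).
  by apply/funext => h; rewrite [h *: 1]mulr1 addr0 scale0r add0r.
move=> [d1 d2]; apply: DeriveDef; first by move: d1; rewrite /derivable /= E.
by move: d2; rewrite /derive /= E.
Qed.

Lemma GCk_continuous k (f : G -> R) : GCk k f -> cont f.
Proof.
move=> Cf g; have [c Ac cg] := atlas_cover (clg_atlas G) g.
have h : {for g, continuous (fun y => f (cinv c (c y)))}.
  apply: (@continuous_comp _ _ _ c (fun x => f (cinv c x)) g).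
    exact: cmap_continuous.
  by apply: Ck_continuous (Cf c Ac) _; exact: chart_ccod.
rewrite /prop_for /continuous_at /= (cmapK cg) in h *.
apply: cvg_trans h; apply: near_eq_cvg.
by apply: filterS (nbhs_cdom cg) => y dy /=; rewrite cmapK.
Qed.

(** The variable is on the left of [g], so that right-invariant fields in [x]
    act on [psi]. *)
Definition smear (a psi : G -> R) (x : G) : R := hint mu (fun g => a g * psi (x * g)%g).

Lemma cont_mul2 (X : topologicalType) (a b : X -> G) :
  continuous a -> continuous b -> continuous (fun x => (a x * b x)%g).
Proof.
move=> ca cb x; apply: (@continuous2_cvg _ _ _ _ _ _ a b (fun x y => (x * y)%g)).
- exact: (@mulg_continuous G (a x, b x)).
- exact: ca.
- exact: cb.
Qed.

Lemma smear_cont a psi : cont a -> cont psi -> cont (smear a psi).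
Proof.
move=> ca cpsi; apply: (hint_param_continuous (F := fun p : G * G => a p.2 * psi (p.1 * p.2)%g)).
apply: contMX; first exact: cont_pull (@cont_snd2 _).
by apply: (cont_pull cpsi); apply: cont_mul2; [exact: cont_fst2|exact: cont_snd2].
Qed.

Lemma is_derive_translate k c x (psi : G -> R) (g : G) : GCk 1 psi -> atlas c -> ccod c x ->
  is_derive x (std k) (fun y => psi (cinv c y * g)%g)
    (\sum_i coframe met c x k i * rfield i psi (cinv c x * g)%g).
Proof.
move=> Cpsi Ac cx; have Cg : GCk 1 (fun h => psi (h * g)%g).
  have := GCk_translate (1%g : G) g Cpsi.
  by rewrite (_ : (fun h => psi (1 * h * g)%g) = fun h => psi (h * g)%g) //;
     apply/funext => h; rewrite mul1g.
apply: DeriveDef; first by have [_ /(_ k)[+ _]] := Cg c Ac; apply.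
rewrite (derive_coframe met k Cg Ac cx); apply: eq_bigr => i _.
by rewrite rfield_right_translate.
Qed.

Lemma smear_is_derive k c x a psi : cont a -> GCk 1 psi -> atlas c -> ccod c x ->
  is_derive x (std k) (fun y => smear a psi (cinv c y))
    (\sum_i coframe met c x k i * smear a (rfield i psi) (cinv c x)).
Proof.
move=> ca Cpsi Ac cx; apply: is_derive_line_rev.
have crf i : cont (rfield i psi) by exact: (@GCk_continuous 0 _ (GCk_rfield _ Cpsi)).
have cpsi : cont psi by exact: GCk_continuous Cpsi.
pose z t : 'rV[R]_n := t *: std k + x.
have near_x : \forall y \near x, ccod c y /\
    forall i, `|coframe met c x k i - coframe met c y k i| <= 1.
  apply: filterI; first by apply: open_nbhs_nbhs; split; [exact: ccod_open|].
  apply: (filter_forall (nbhs_filter x)) => i.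
  have cc : {for x, continuous (fun y => coframe met c y k i)}.
    exact: Ck_continuous (coframe_smooth met k i Ac 0) cx.
  exact: (@cvgrPdist_le _ _ _ _ (nbhs_filter x) _ _).1 cc 1 ltr01.
have near_t : \forall t \near (0 : R), ccod c (z t) /\
    forall i, `|coframe met c x k i - coframe met c (z t) k i| <= 1.
  have cz : z t @[t --> (0 : R)] --> (0 : R) *: std k + x.
    by apply: cvgD; [apply: cvgZr_tmp; exact: cvg_id|exact: cvg_cst].
  by rewrite scale0r add0r in cz; exact: cz near_x.
have [r /= r0 rz] := near_t.
have {}rz t : `|t - 0| < r -> ccod c (z t) /\
    forall i, `|coframe met c x k i - coframe met c (z t) k i| <= 1.
  by move=> tr; apply: rz; rewrite /ball /= distrC.
have [Ba Ba0 aB] := continuous_bounded ca.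
have bounds i : exists B, forall g, `|rfield i psi g| <= B.
  by have [B _ HB] := continuous_bounded (crf i); exists B.
pose B i := projT1 (cid (bounds i)).
have BP i g : `|rfield i psi g| <= B i := projT2 (cid (bounds i)) g.
pose F t g := a g * psi (cinv c (z t) * g)%g.
pose dF t g := a g * \sum_i coframe met c (z t) k i * rfield i psi (cinv c (z t) * g)%g.
have := @hint_is_derive _ _ _ mu F dF 0 r
  (Ba * \sum_i (`|coframe met c x k i| + 1) * B i) r0.
have -> : hint mu (dF 0) = \sum_i coframe met c x k i * smear a (rfield i psi) (cinv c x).
  rewrite /dF /z; under eq_fun do rewrite scale0r add0r mulr_sumr.
  rewrite hint_sum => [|i]; last first.
    by apply: contM => //; apply: contM; [exact: cont_cst|exact: cont_lshift].
  apply: eq_bigr => i _; rewrite /smear -hintZ; last by apply: contM => //; exact: cont_lshift.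
  by congr (hint mu _); apply/funext => g; rewrite mulrCA.
apply.
- by move=> t tr; apply: contM => //; exact: cont_lshift.
- move=> t g tr; have [cz _] := rz t tr.
  have [d1 d2] := is_derive_translate k g Cpsi Ac cz.
  have := is_derive_line d1; rewrite d2 => d3.
  exact: (@is_deriveZ _ _ _ _ (a g) _ _ _ d3).
- move=> t g tr; have [_ cz] := rz t tr.
  rewrite /dF normrM; apply: ler_pM => //; apply: le_trans (ler_norm_sum _ _ _) _.
  apply: ler_sum => i _; rewrite normrM; apply: ler_pM => //.
  by rewrite -lerBlDl (le_trans (lerB_dist _ _)) // distrC cz.
Qed.

(** In a chart the derivatives fall on the kernel. *)
Lemma GCk_smear k a psi : cont a -> GCk k psi -> GCk k (smear a psi).
Proof.
move=> ca; elim: k psi => [|k IH] psi Cpsi c Ac.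
  have cs := smear_cont ca (GCk_continuous Cpsi).
  split=> // x cx; apply: (@continuous_comp _ _ _ (cinv c) (smear a psi)); last exact: cs.
  exact: cinv_continuous.
have cs := smear_cont ca (GCk_continuous Cpsi).
have C1 : GCk 1 psi by move=> d Ad; apply: Ck_le (Cpsi d Ad).
split.
  move=> x cx; apply: (@continuous_comp _ _ _ (cinv c) (smear a psi)); last exact: cs.
  exact: cinv_continuous.
move=> i; split; first by move=> x cx; have [] := smear_is_derive i ca C1 Ac cx.
apply: (Ck_ext (ccod_open c) (f := fun x =>
   \sum_j coframe met c x i j * smear a (rfield j psi) (cinv c x))).
  by move=> x cx; have [_ ->] := smear_is_derive i ca C1 Ac cx.
apply: Ck_sum => [|j]; first exact: ccod_open.
apply: Ck_mul; [exact: ccod_open|exact: coframe_smooth|].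
by apply: IH => //; exact: GCk_rfield.
Qed.

(** The integral of [psi (x * g)] over [g] does not depend on [x], so its
    derivatives along the coordinate fields vanish; these fields span the
    invariant ones. *)
Lemma hint_rfield i psi : GCk 1 psi -> hint mu (rfield i psi) = 0.
Proof.
move=> Cpsi; have A0 := base_atlas G; have y0c := base_ccod G.
have cpsi := GCk_continuous Cpsi.
have smear1 u (x : G) : cont u -> smear (fun=> 1) u x = hint mu u.
  move=> cu; rewrite /smear -(hint_left mu x cu); congr (hint mu _).
  by apply/funext => g; rewrite mul1r.
have crf j : cont (rfield j psi) by exact: (@GCk_continuous 0 _ (GCk_rfield _ Cpsi)).
have key k : \sum_j coframe met c0 y0 k j * hint mu (rfield j psi) = 0.
  have [_ ] := smear_is_derive k (@cont_cst _ _ _ 1) Cpsi A0 y0c.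
  rewrite (_ : (fun y => smear _ psi (cinv c0 y)) = fun=> hint mu psi); last first.
    by apply/funext => y; rewrite smear1.
  rewrite derive_cst => /esym; under eq_bigr do rewrite smear1 //.
  by [].
have : \sum_k frame c0 y0 i k * \sum_j coframe met c0 y0 k j * hint mu (rfield j psi) = 0.
  by rewrite big1 // => k _; rewrite key mulr0.
under eq_bigr do rewrite mulr_sumr; rewrite exchange_big /= => <-.
have fE j : \sum_k frame c0 y0 i k * (coframe met c0 y0 k j * hint mu (rfield j psi)) =
    (i == j)%:R * hint mu (rfield j psi).
  have /matrixP/(_ i j) := frameK met A0 y0c; rewrite !mxE => <-.
  by rewrite mulr_suml; apply: eq_bigr => k _; rewrite mulrA.
rewrite (eq_bigr _ (fun j _ => fE j)) [RHS](bigD1 i) //= eqxx mul1r big1 ?addr0 //.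
by move=> j ji; rewrite eq_sym (negbTE ji) mul0r.
Qed.

End Smoothing.

(** * Smoothness of representations *)

Section ComplexFields.
Context {R : realType} {n : nat} (G : compactLieGroup R n).

Definition CGk k (f : G -> Cx R) :=
  GCk k (fun g => re (f g)) /\ GCk k (fun g => im (f g)).

Lemma GCkD k (u v : G -> R) : GCk k u -> GCk k v -> GCk k (fun g => u g + v g).
Proof. by move=> Cu Cv c Ac; apply: Ck_add; [exact: ccod_open|exact: Cu|exact: Cv]. Qed.

Lemma GCkZ k (a : R) (u : G -> R) : GCk k u -> GCk k (fun g => a * u g).
Proof. by move=> Cu c Ac; apply: Ck_scale; [exact: ccod_open|exact: Cu]. Qed.

Lemma GCkM k (u v : G -> R) : GCk k u -> GCk k v -> GCk k (fun g => u g * v g).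
Proof. by move=> Cu Cv c Ac; apply: Ck_mul; [exact: ccod_open|exact: Cu|exact: Cv]. Qed.

Lemma GCk_cst k (a : R) : GCk k (fun _ : G => a).
Proof. by move=> c Ac; apply: Ck_cst; exact: ccod_open. Qed.

Lemma GCk_sum k I (r : seq I) (u : I -> G -> R) : (forall i, GCk k (u i)) ->
  GCk k (fun g => \sum_(i <- r) u i g).
Proof.
by move=> Cu c Ac; apply: (Ck_sum r (ccod_open c)) => i; exact: Cu.
Qed.

Lemma GCk_eq k (u v : G -> R) : u =1 v -> GCk k u -> GCk k v.
Proof. by move=> /funext ->. Qed.

Lemma CGkM k f g : CGk k f -> CGk k g -> CGk k (fun x => f x * g x).
Proof.
move=> [fr fi] [gr gi]; split.
  apply: (@GCk_eq _ (fun x => re (f x) * re (g x) + -1 * (im (f x) * im (g x)))).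
    by move=> x; rewrite re_mul mulN1r.
  by apply: GCkD; [exact: GCkM|apply: GCkZ; exact: GCkM].
apply: (@GCk_eq _ (fun x => re (f x) * im (g x) + im (f x) * re (g x))).
  by move=> x; rewrite im_mul.
by apply: GCkD; exact: GCkM.
Qed.

Lemma CGk_cst k (a : Cx R) : CGk k (fun=> a).
Proof. by split; exact: GCk_cst. Qed.

Lemma CGkZ k (a : Cx R) f : CGk k f -> CGk k (fun x => a * f x).
Proof. by move=> Cf; apply: CGkM => //; exact: CGk_cst. Qed.

Lemma CGkD k f g : CGk k f -> CGk k g -> CGk k (fun x => f x + g x).
Proof.
move=> [fr fi] [gr gi]; split.
  by apply: GCk_eq (GCkD fr gr) => x; rewrite reD.
by apply: GCk_eq (GCkD fi gi) => x; rewrite imD.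
Qed.

Lemma CGk_sum k I (r : seq I) (f : I -> G -> Cx R) : (forall i, CGk k (f i)) ->
  CGk k (fun g => \sum_(i <- r) f i g).
Proof.
move=> Cf; split.
  apply: (@GCk_eq _ (fun g => \sum_(i <- r) re (f i g))) => [x|]; first by rewrite re_sum.
  by apply: GCk_sum => i; have [] := Cf i.
apply: (@GCk_eq _ (fun g => \sum_(i <- r) im (f i g))) => [x|]; first by rewrite im_sum.
by apply: GCk_sum => i; have [] := Cf i.
Qed.

Lemma CGk_conj k f : CGk k f -> CGk k (fun g => (f g)^*).
Proof.
move=> [fr fi]; split; first by apply: GCk_eq fr => x; rewrite re_conj.
by apply: GCk_eq (GCkZ (-1) fi) => x; rewrite im_conj mulN1r.
Qed.

Lemma CGk_translate k (a b : G) f : CGk k f -> CGk k (fun g => f (a * g * b)%g).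
Proof.
by move=> [fr fi]; split; [exact: (GCk_translate a b fr)|exact: (GCk_translate a b fi)].
Qed.

Lemma CGk_ltranslate k (a : G) f : CGk k f -> CGk k (fun g => f (a * g)%g).
Proof.
move=> /(CGk_translate a 1%g); rewrite (_ : (fun g => f (a * g * 1)%g) = fun g => f (a * g)%g) //.
by apply/funext => g; rewrite mulg1.
Qed.

Lemma CGk_rtranslate k (a : G) f : CGk k f -> CGk k (fun g => f (g * a)%g).
Proof.
move=> /(CGk_translate 1%g a); rewrite (_ : (fun g => f (1 * g * a)%g) = fun g => f (g * a)%g) //.
by apply/funext => g; rewrite mul1g.
Qed.

Lemma smooth_funP f : smooth_fun f <-> forall k, CGk k f.
Proof.
split=> [sf k|Cf c Ac]; first by split=> c Ac; have [] := sf c Ac.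
by split=> k; have [] := Cf k; move=> + + ; [move=> /(_ c Ac)|move=> _ /(_ c Ac)].
Qed.

Lemma CGk_ccont k f : CGk k f -> ccont f.
Proof. by move=> [fr fi]; split; [exact: (GCk_continuous fr)|exact: (GCk_continuous fi)]. Qed.

Lemma to_CinftyE f : smooth_fun f -> (to_Cinfty f : G -> Cx R) = f.
Proof. by move=> sf; exact: (@insubdK _ _ (Cinfty G) 0 f (asboolT sf)). Qed.

Lemma rfieldD i u v g : GCk 1 u -> GCk 1 v ->
  rfield i (fun x : G => u x + v x) g = rfield i u g + rfield i v g.
Proof.
move=> Cu Cv; have du := rfield_is_derive i g Cu; have dv := rfield_is_derive i g Cv.
by have [_ <-] := @is_deriveD _ _ _ _ _ _ _ _ _ du dv.
Qed.

Lemma rfieldZ i (a : R) u g : GCk 1 u ->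
  rfield i (fun x : G => a * u x) g = a * rfield i u g.
Proof.
move=> Cu; have du := rfield_is_derive i g Cu.
by have [_ h] := @is_deriveZ _ _ _ _ a _ _ _ du; exact: h.
Qed.

Lemma rfieldM i u v g : GCk 1 u -> GCk 1 v ->
  rfield i (fun x : G => u x * v x) g = rfield i u g * v g + u g * rfield i v g.
Proof.
move=> Cu Cv; have du := rfield_is_derive i g Cu; have dv := rfield_is_derive i g Cv.
have [_] := @is_deriveM _ _ _ _ _ _ _ _ du dv.
rewrite cinv_base mul1g => h; apply: (etrans h).
by rewrite addrC; congr (_ + _); exact: mulrC.
Qed.

Lemma rfield_cst i (a : R) (g : G) : rfield i (fun=> a) g = 0.
Proof. exact: derive_cst. Qed.

(** The complex linear extension of [rfield]. *)
Definition crf i (f : G -> Cx R) (g : G) : Cx R :=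
  mkC (rfield i (fun x => re (f x)) g) (rfield i (fun x => im (f x)) g).

Lemma CGk_crf k i f : CGk k.+1 f -> CGk k (crf i f).
Proof. by move=> [fr fi]; split; [exact: (GCk_rfield i fr)|exact: (GCk_rfield i fi)]. Qed.

Lemma crf_rtranslate i f h g : crf i (fun x => f (x * h)%g) g = crf i f (g * h)%g.
Proof.
by rewrite /crf (rfield_right_translate i (fun x => re (f x))) (rfield_right_translate i (fun x => im (f x))).
Qed.

Lemma crf_conj i f g : CGk 1 f -> crf i (fun x => (f x)^*) g = (crf i f g)^*.
Proof.
move=> [fr fi]; apply: Cx_ext; rewrite ?re_conj ?im_conj /=.
  by under eq_fun do rewrite re_conj.
by under eq_fun do rewrite im_conj -mulN1r; rewrite rfieldZ // mulN1r.
Qed.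

Lemma crfD i f g x : CGk 1 f -> CGk 1 g ->
  crf i (fun y => f y + g y) x = crf i f x + crf i g x.
Proof.
move=> [fr fi] [gr gi]; apply: Cx_ext; rewrite ?reD ?imD /=.
  by under eq_fun do rewrite reD; rewrite rfieldD.
by under eq_fun do rewrite imD; rewrite rfieldD.
Qed.

Lemma crfM i f g x : CGk 1 f -> CGk 1 g ->
  crf i (fun y => f y * g y) x = crf i f x * g x + f x * crf i g x.
Proof.
move=> [fr fi] [gr gi]; apply: Cx_ext; rewrite ?reD ?imD ?re_mul ?im_mul /=.
  under eq_fun do rewrite re_mul -mulN1r.
  rewrite (rfieldD i x (GCkM fr gr) (GCkZ (-1) (GCkM fi gi))) (rfieldZ i (-1) x (GCkM fi gi)).
  by rewrite (rfieldM i x fr gr) (rfieldM i x fi gi) mulN1r; ring.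
under eq_fun do rewrite im_mul.
rewrite (rfieldD i x (GCkM fr gi) (GCkM fi gr)) (rfieldM i x fr gi) (rfieldM i x fi gr).
by ring.
Qed.

Lemma crf_cst i (a : Cx R) (g : G) : crf i (fun=> a) g = 0.
Proof. by rewrite /crf !rfield_cst. Qed.

Lemma crfZ i (a : Cx R) f x : CGk 1 f -> crf i (fun y => a * f y) x = a * crf i f x.
Proof. by move=> Cf; rewrite (crfM i x (CGk_cst 1 a) Cf) crf_cst mul0r add0r. Qed.

Lemma crf_sum i I (r : seq I) (f : I -> G -> Cx R) x : (forall j, CGk 1 (f j)) ->
  crf i (fun y => \sum_(j <- r) f j y) x = \sum_(j <- r) crf i (f j) x.
Proof.
move=> Cf; elim: r => [|j r IH].
  by under eq_fun do rewrite big_nil; rewrite big_nil crf_cst.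
under eq_fun do rewrite big_cons; rewrite big_cons crfD ?IH //; exact: CGk_sum.
Qed.

End ComplexFields.

Section RepSmooth.
Context {R : realType} {n : nat} (G : compactLieGroup R n) (mu : haarMeasure G)
  (met : biinvariantMetric G).
Implicit Types xi : irrep G.

Lemma toC_nat (k : nat) : toC (k%:R : R) = k%:R.
Proof. exact: (rmorph_nat (real_complex R)). Qed.

(** Diagonal dominance. *)
Lemma almost_scalar_unit d (M : 'M[Cx R]_d) (m e : R) : d%:R * e < m -> 0 <= m ->
  (forall i j, `|M i j - toC m *+ (i == j)| <= toC e) -> M \in unitmx.
Proof.
move=> dem m0 ME; rewrite unitmxE unitfE; apply/negP => /det0P[w w0 wM].
pose S := \sum_i `|w 0 i|.
have S0 : 0 < S.
  rewrite lt0r sumr_ge0 ?andbT // psumr_eq0 //.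
  apply: contraNN w0 => /allP h; apply/eqP/rowP => i; rewrite mxE.
  by apply/eqP; rewrite -normr_eq0; apply: h; rewrite mem_index_enum.
have col j : toC m * `|w 0 j| <= toC e * S.
  have -> : toC m * `|w 0 j| = `|\sum_i w 0 i * (M i j - toC m *+ (i == j))|.
    under eq_bigr do rewrite mulrBr; rewrite sumrB.
    have -> : \sum_i w 0 i * M i j = 0 by have /rowP/(_ j) := wM; rewrite !mxE.
    rewrite (bigD1 j) //= eqxx mulr1n big1 => [|i ij]; last by rewrite (negbTE ij) mulr0n mulr0.
    rewrite addr0 sub0r normrN normrM mulrC; congr (_ * _); apply/esym/ger0_norm.
    by rewrite -toC0 toC_le.
  apply: le_trans (ler_norm_sum _ _ _) _; rewrite mulr_sumr; apply: ler_sum => i _.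
  by rewrite normrM mulrC; apply: ler_wpM2r => //; exact: ME.
have : toC m * S <= toC (d%:R * e) * S.
  rewrite [leLHS]mulr_sumr; apply: le_trans (ler_sum _ (fun j _ => col j)) _.
  by rewrite sumr_const card_ord toCM toC_nat -mulrA mulr_natl.
by rewrite ler_pM2r // toC_le leNgt dem.
Qed.

(** Averaging [xi] against a bump [psi] concentrated near the identity gives an
    invertible matrix [Phi], and the smeared matrix equals [xi x^-1 *m Phi]. As
    smearing regularizes, [xi] has the class of [psi], which is arbitrary. *)
Lemma rep_CGk xi k i j : CGk k (fun g => xi g i j).
Proof.
pose d := rdim xi; have d0 : (0 < d)%N := rdim_gt0 xi.
(* Small enough for the diagonal dominance of [Phi]. *)
pose e : R := (4 * d%:R)^-1.
have dR : 0 < d%:R :> R by rewrite ltr0n.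
have e0 : 0 < e by rewrite invr_gt0 mulr_gt0.
pose del (a b : 'I_d) : R := (a == b)%:R.
pose U := [set g : G | forall a b, `|re (xi g a b) - del a b| <= e /\ `|im (xi g a b)| <= e].
have U1 : nbhs (1%g : G) U.
  apply: filter_forall => a; apply: filter_forall => b; have [cr ci] := @rep_ccont _ _ _ xi a b.
  have FG := nbhs_filter (1%g : G).
  have h1 := (@cvgrPdist_le _ _ _ _ FG _ _).1 (cr 1%g) e e0.
  have h2 := (@cvgrPdist_le _ _ _ _ FG _ _).1 (ci 1%g) e e0.
  apply: (@filterS2 _ _ FG _ _ _ _ h1 h2) => g.
  rewrite rep1 mxE distrC => g1; rewrite distrC => g2; move: g1 g2; rewrite /del.
  by case: (a == b); rewrite ?subr0.
have [psi [Cpsi psi0 psi1 psiU]] := GCk_bump k U1.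
have cpsi := GCk_continuous Cpsi.
pose m := hint mu psi; have m0 : 0 < m by exact: hint_gt0 psi1.
have small u (dl : R) : continuous u -> (forall g, U g -> `|u g - dl| <= e) ->
    `|hint mu (fun g => u g * psi g) - dl * m| <= e * m.
  move=> cu uU; rewrite -hintZ // -hintB; last 2 first.
  - exact: contM.
  - by apply: contM => //; exact: cont_cst.
  rewrite ler_norml -mulNr -!hintZ //.
  have le1 g : - e * psi g <= u g * psi g - dl * psi g <= e * psi g.
    have [->|pg] := eqVneq (psi g) 0; first by rewrite !mulr0 subrr lexx.
    rewrite -mulrBl; have := uU g (psiU g pg); rewrite ler_norml => /andP[h1 h2].
    by rewrite !ler_wpM2r.
  have ck (a : R) : continuous (fun g => a * psi g) by apply: contM => //; exact: cont_cst.
  have cd : continuous (fun g => u g * psi g - dl * psi g) by apply: contB => //; exact: contM.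
  by apply/andP; split; apply: hint_le => // g; have /andP[] := le1 g.
pose Phi : 'M[Cx R]_d := \matrix_(a, b) haar_int mu (fun g => xi g a b * toC (psi g)).
have PhiU : Phi \in unitmx.
  apply: (@almost_scalar_unit _ _ m (2 * (e * m))); [|exact: ltW|].
    by rewrite /e; rewrite (_ : _ * _ = m / 2); [rewrite ltr_pdivrMr // ltr_pMr // ltr1n|field; rewrite gt_eqF].
  move=> a b; have [cr ci] := @rep_ccont _ _ _ xi a b.
  have -> : Phi a b - toC m *+ (a == b) =
     mkC (hint mu (fun g => re (xi g a b) * psi g) - del a b * m)
         (hint mu (fun g => im (xi g a b) * psi g) - 0 * m).
    rewrite mxE cintE; apply: Cx_ext; rewrite ?reD ?imD ?reN ?imN /=.
      congr (_ - _); last by rewrite /del; case: (a == b); rewrite ?mul1r ?mul0r.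
      by congr (hint mu _); apply/funext => g; rewrite mulrC re_toCM mulrC.
    rewrite mul0r; congr (_ - _); last by case: (a == b).
    by congr (hint mu _); apply/funext => g; rewrite mulrC im_toCM mulrC.
  apply: norm_mkC_le; apply: small => // g Ug; first by have [] := Ug a b.
  by rewrite subr0; have [] := Ug a b.
pose H x : 'M[Cx R]_d := \matrix_(a, b) haar_int mu (fun g => xi g a b * toC (psi (x * g)%g)).
have CH a b : CGk k (fun x => H x a b).
  have [cr ci] := @rep_ccont _ _ _ xi a b; split.
    apply: GCk_eq (GCk_smear mu met cr Cpsi) => x; rewrite mxE cintE /= /smear.
    by congr (hint mu _); apply/funext => g; rewrite [in RHS]mulrC re_toCM mulrC.
  apply: GCk_eq (GCk_smear mu met ci Cpsi) => x; rewrite mxE cintE /= /smear.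
  by congr (hint mu _); apply/funext => g; rewrite [in RHS]mulrC im_toCM mulrC.
have cP x a b : ccont (fun g => xi g a b * toC (psi (x * g)%g)).
  by apply: ccontM; [exact: rep_ccont|apply: ccont_toC; exact: cont_lshift].
have HE x : H x = xi x^-1%g *m Phi.
  apply/matrixP => a b; rewrite [LHS]mxE [RHS]mxE -[LHS](cint_left mu x^-1%g) //.
  transitivity (haar_int mu (fun g => \sum_l xi x^-1%g a l * (xi g l b * toC (psi g)))).
    congr (haar_int mu _); apply/funext => g; rewrite mulVKg repM mxE mulr_suml.
    by apply: eq_bigr => l _; rewrite mulrA.
  have cP1 l : ccont (fun g => xi g l b * toC (psi g)).
    by apply: ccontM; [exact: rep_ccont|exact: ccont_toC].
  rewrite cint_sum => [|l]; last exact: ccontZ.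
  by apply: eq_bigr => l _; rewrite cintZ // [Phi _ _]mxE.
have -> : (fun g => xi g i j) = fun g => (\sum_l (invmx Phi) l i * H g j l)^*.
  apply/funext => g; have E := mulmxK PhiU (xi g^-1%g).
  move: E; rewrite -HE => /matrixP/(_ j i); rewrite rep_inv => /(congr1 Num.conj).
  rewrite conjCK => <-; rewrite mxE; congr (_ ^*); apply: eq_bigr => l _; exact: mulrC.
by apply: CGk_conj; apply: CGk_sum => l; exact: CGkZ.
Qed.

Lemma rep_smooth xi i j : smooth_fun (fun g => xi g i j).
Proof. by apply/smooth_funP => k; exact: rep_CGk. Qed.

End RepSmooth.

(** * The Casimir operator *)

Lemma sum4_rev (V : nmodType) (I : finType) (T : I -> I -> I -> I -> V) :
  \sum_i \sum_j \sum_l \sum_k T i j k l = \sum_k \sum_l \sum_j \sum_i T i j k l.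
Proof.
rewrite exchange_big /=.
transitivity (\sum_j \sum_l \sum_k \sum_i T i j k l).
  apply: eq_bigr => j _; rewrite exchange_big /=; apply: eq_bigr => l _; exact: exchange_big.
transitivity (\sum_l \sum_j \sum_k \sum_i T i j k l); first exact: exchange_big.
transitivity (\sum_l \sum_k \sum_j \sum_i T i j k l).
  by apply: eq_bigr => l _; exact: exchange_big.
exact: exchange_big.
Qed.

Section Casimir.
Context {R : realType} {n : nat} (G : compactLieGroup R n) (mu : haarMeasure G)
  (met : biinvariantMetric G).
Local Notation c0 := (base_chart G).
Local Notation y0 := (c0 1%g).
Local Notation Q := (invmx (gram0 met)).
Implicit Types xi : irrep G.

(** The image of a basis of the Lie algebra under the derivative of [xi]. *)
Definition gen xi (i : 'I_n) : 'M[Cx R]_(rdim xi) :=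
  \matrix_(k, l) crf i (fun g => xi g k l) 1%g.

Lemma crf_rep xi i k l g : crf i (fun g => xi g k l) g = (gen xi i *m xi g) k l.
Proof.
rewrite -[X in crf _ _ X]mul1g -(crf_rtranslate i (fun g => xi g k l) g 1%g).
under eq_fun do rewrite repM mxE.
have C m : CGk 1 (fun x => xi x k m) by exact: (rep_CGk mu met).
have C' m : CGk 1 (fun x => xi x k m * xi g m l) by apply: CGkM => //; exact: CGk_cst.
rewrite crf_sum // mxE; apply: eq_bigr => m _.
by rewrite (crfM i _ (C m) (CGk_cst G 1 (xi g m l))) crf_cst mulr0 addr0 mxE.
Qed.

(** Differentiating the unitarity of [xi]. *)
Lemma gen_adj xi i : adjmx (gen xi i) = - gen xi i.
Proof.
apply/matrixP => k l; rewrite mxE mxE [RHS]mxE; apply/eqP; rewrite -addr_eq0; apply/eqP.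
have Cx' a b : CGk 1 (fun g => xi g a b) by exact: (rep_CGk mu met).
have h : crf i (fun g => \sum_m xi g k m * (xi g l m)^*) 1%g = 0.
  rewrite (_ : (fun g => _) = fun=> (k == l)%:R) ?crf_cst //.
  apply/funext => g; have /matrixP/(_ k l) := rep_unitary xi g; rewrite !mxE => <-.
  by apply: eq_bigr => m _; rewrite !mxE.
rewrite -[RHS]h crf_sum => [|m]; last by apply: CGkM => //; exact: CGk_conj.
rewrite (eq_bigr (fun m => gen xi i k m *+ (l == m) + (k == m)%:R * (gen xi i l m)^*)).
  rewrite big_split /= (bigD1 l) //= eqxx big1 ?addr0 => [|m ml]; last by rewrite eq_sym (negbTE ml).
  rewrite (bigD1 k) //= eqxx big1 ?addr0 => [|m mk]; last by rewrite eq_sym (negbTE mk) mul0r.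
  by rewrite mul1r addrC.
move=> m _; rewrite crfM //; last exact: CGk_conj.
rewrite crf_conj // !rep1 ![_%:M _ _]mxE !mxE; case: (l == m); case: (k == m);
  by rewrite /= ?conjC1 ?conjC0 ?mulr1 ?mulr0 ?mul1r ?mul0r.
Qed.

(** The matrix of the adjoint action of [h] in the basis of coordinate vectors. *)
Definition conj_jac (h : G) : 'M[R]_n :=
  jacobian (fun y => c0 (h * cinv c0 y * h^-1)%g) y0.

(** Conjugations are isometries of a bi-invariant metric. *)
Lemma conj_jac_gram h : gram0 met = conj_jac h *m gram0 met *m (conj_jac h)^T.
Proof.
have e1 : (h * cinv c0 y0 * h^-1)%g = 1%g by rewrite cinv_base mulg1 mulgV.
have := gram_invariant met (base_atlas G) (base_atlas G) (a := h) (b := h^-1%g) (base_ccod G).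
rewrite e1 => /(_ (base_cdom G)) E; by rewrite {1}/gram0 E /= e1.
Qed.

Lemma conj_jac_invmx h : (conj_jac h)^T *m Q *m conj_jac h = Q.
Proof.
have E := conj_jac_gram h; have Gu := gram0_unit met.
have Ju : conj_jac h \in unitmx.
  move: Gu; rewrite E; rewrite !unitmx_mul => /andP[/andP[]] //.
have h1 : gram0 met *m (conj_jac h)^T *m Q *m conj_jac h = 1%:M.
  apply: mulmx1C; rewrite !mulmxA -E; exact: mulmxV.
transitivity (Q *m (gram0 met *m (conj_jac h)^T *m Q *m conj_jac h)).
  by rewrite !mulmxA mulVmx // mul1mx.
by rewrite h1 mulmx1.
Qed.

Lemma rfield_conj i (u : G -> R) h : GCk 1 u ->
  rfield i (fun g => u (h * g * h^-1)%g) 1%g = \sum_k conj_jac h i k * rfield k u 1%g.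
Proof.
move=> Cu; have A0 := base_atlas G; have yc := base_ccod G.
have sI := smooth_into_translate h h^-1%g A0.
have e1 : (h * cinv c0 y0 * h^-1)%g = 1%g by rewrite cinv_base mulg1 mulgV.
have dc : cdom c0 (h * cinv c0 y0 * h^-1)%g by rewrite e1; exact: base_cdom.
have [_ D] := is_derive_chart i sI Cu A0 yc dc.
rewrite /rfield; under eq_fun do rewrite mulg1; rewrite D.
apply: eq_bigr => k _; rewrite mulrC e1; congr (_ * _); last first.
  by congr ('D_(std k) _ _); apply/funext => y; rewrite mulg1.
rewrite /conj_jac jacobianE // => j.
have [_ _ /(_ c0 A0 j 1%N) C1] := sI.
apply: (C1_differentiable _ C1) => //.
exact: (@smooth_into_open _ _ _ _ _ _ c0 sI).
Qed.

Lemma gen_conj xi i h :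
  xi h *m gen xi i *m xi h^-1%g = \sum_k toC (conj_jac h i k) *: gen xi k.
Proof.
apply/matrixP => a b.
have C p q : CGk 1 (fun g => xi g p q) by exact: (rep_CGk mu met).
transitivity (crf i (fun g => xi (h * g * h^-1)%g a b) 1%g); last first.
  have [Cr Ci] := C a b.
  rewrite summxE; apply: Cx_ext; rewrite ?re_sum ?im_sum /=.
    rewrite (rfield_conj i h Cr); apply: eq_bigr => k _.
    by rewrite !mxE re_toCM.
  rewrite (rfield_conj i h Ci); apply: eq_bigr => k _.
  by rewrite !mxE im_toCM.
under eq_fun do rewrite !repM mxE.
have C1 q : CGk 1 (fun g => \sum_p xi h a p * xi g p q).
  by apply: CGk_sum => p; exact: CGkZ.
have E : (fun g => \sum_j (xi h *m xi g) a j * xi h^-1%g j b) =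
    fun g => \sum_j xi h^-1%g j b * (\sum_p xi h a p * xi g p j).
  by apply/funext => g; apply: eq_bigr => j _; rewrite mulrC mxE.
rewrite E crf_sum => [|j]; last exact: CGkZ.
rewrite mxE; apply: eq_bigr => j _; rewrite crfZ // crf_sum => [|p]; last exact: CGkZ.
rewrite mulrC mxE; congr (_ * _); apply: eq_bigr => p _.
by rewrite crfZ // mxE.
Qed.

(** The Casimir element for the scalar product that the metric induces on the
    Lie algebra, in the representation [xi]. *)
Definition casimir xi : 'M[Cx R]_(rdim xi) :=
  \sum_i \sum_j toC (Q i j) *: (gen xi j *m gen xi i).

Lemma gram0_sym : (gram0 met)^T = gram0 met.
Proof. by apply: gram_sym; [exact: base_atlas|exact: base_ccod]. Qed.

Lemma Qsym i j : Q i j = Q j i.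
Proof. by rewrite -[in LHS]gram0_sym -trmx_inv mxE. Qed.

(** Conjugation by [xi h] replaces the generators by their images under the
    adjoint action, which preserves the form [Q]. *)
Lemma casimir_comm xi h : casimir xi *m xi h = xi h *m casimir xi.
Proof.
suff E : xi h *m casimir xi *m xi h^-1%g = casimir xi.
  by rewrite -[in LHS]E -mulmxA -repM mulVg rep1 mulmx1.
have conjM A B : xi h *m (A *m B) *m xi h^-1%g =
    (xi h *m A *m xi h^-1%g) *m (xi h *m B *m xi h^-1%g).
  by rewrite !mulmxA -(mulmxA _ (xi h^-1%g)) -repM mulVg rep1 mulmx1.
have conjZ c A : xi h *m (c *: A) *m xi h^-1%g = c *: (xi h *m A *m xi h^-1%g).
  by rewrite -scalemxAr -scalemxAl.
rewrite /casimir mulmx_sumr mulmx_suml.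
pose T i j k l := toC (conj_jac h i k * Q i j * conj_jac h j l) *: (gen xi l *m gen xi k).
transitivity (\sum_i \sum_j \sum_l \sum_k T i j k l).
  apply: eq_bigr => i _; rewrite mulmx_sumr mulmx_suml; apply: eq_bigr => j _.
  rewrite conjZ (conjM (gen xi j) (gen xi i)) (gen_conj xi j h) (gen_conj xi i h) mulmx_suml scaler_sumr.
  apply: eq_bigr => l _; rewrite mulmx_sumr scaler_sumr; apply: eq_bigr => k _.
  by rewrite -scalemxAr -scalemxAl !scalerA -!toCM /T; congr (toC _ *: _); ring.
transitivity (\sum_k \sum_l \sum_j \sum_i T i j k l).
  exact: sum4_rev.
apply: eq_bigr => k _; apply: eq_bigr => l _.
rewrite -[in RHS](conj_jac_invmx h) mxE toC_sum scaler_suml; apply: eq_bigr => j _.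
rewrite mxE mulr_suml toC_sum scaler_suml; apply: eq_bigr => i _.
by rewrite mxE.
Qed.

Definition qform (u : 'rV[R]_n) : R := \sum_i \sum_j Q i j * (u 0 i * u 0 j).

Lemma qformE u : qform u = (u *m Q *m u^T) 0 0.
Proof.
rewrite mxE /qform exchange_big /=; apply: eq_bigr => j _.
rewrite [in RHS]mxE mulr_suml; apply: eq_bigr => i _.
by rewrite [u^T _ _]mxE; ring.
Qed.

Lemma qform_ge0 u : 0 <= qform u.
Proof.
rewrite -[u](mulmxKV (gram0_unit met)); set v := u *m _.
rewrite qformE mulmxK ?gram0_unit // trmx_mul gram0_sym mulmxA.
have [->|v0] := eqVneq v 0; first by rewrite !mul0mx mxE.
apply/ltW; apply: gram_posdef v0; [exact: base_atlas|exact: base_ccod].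
Qed.

(** Cauchy-Schwarz for the form [Q], as [u 0 i] is the [Q]-product of [u] with
    the row [i] of the inverse of [Q]. *)
Lemma coord_qform (u : 'rV[R]_n) i : u 0 i ^+ 2 <= gram0 met i i * qform u.
Proof.
pose s : 'rV[R]_n := std i; pose w : 'rV[R]_n := s *m gram0 met; pose g := gram0 met i i.
have wi : w 0 i = g by rewrite /w -rowE mxE.
have sv (v : 'rV[R]_n) : (v *m s^T) 0 0 = v 0 i.
  rewrite mxE (bigD1 i) //= !mxE !eqxx mulr1 big1 ?addr0 //.
  by move=> j ji; rewrite !mxE eqxx (negbTE ji) mulr0.
have g0 : 0 < g.
  rewrite -wi -sv; apply: gram_posdef; [exact: base_atlas|exact: base_ccod|].
  by apply/eqP => /rowP/(_ i)/eqP; rewrite !mxE !eqxx oner_eq0.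
have wQ : w *m Q = s by rewrite /w mulmxK // gram0_unit.
have Qw : Q *m w^T = s^T.
  by rewrite /w trmx_mul gram0_sym mulmxA mulVmx ?gram0_unit // mul1mx.
pose t := u 0 i / g.
have : 0 <= qform (u - t *: w) := qform_ge0 _.
have -> : qform (u - t *: w) = qform u - u 0 i ^+ 2 / g.
  rewrite !qformE.
  have -> : (u - t *: w)^T = u^T - t *: w^T by rewrite linearB linearZ.
  rewrite mulmxBr !mulmxBl -!scalemxAl -!scalemxAr wQ.
  rewrite -(mulmxA u Q w^T) Qw.
  have e1 : (s *m u^T) 0 0 = u 0 i by rewrite -[s *m _]trmxK trmx_mul trmxK mxE sv.
  have e2 : (s *m w^T) 0 0 = g by rewrite -[s *m _]trmxK trmx_mul trmxK mxE sv wi.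
  have sbE (A B : 'M[R]_1) : (A - B) 0 0 = A 0 0 - B 0 0 by rewrite !mxE.
  have scE (a : R) (A : 'M[R]_1) : (a *: A) 0 0 = a * A 0 0 by rewrite mxE.
  rewrite !(sbE, scE) e1 e2 sv /t; field; exact: lt0r_neq0.
by rewrite subr_ge0 ler_pdivrMr // mulrC.
Qed.

Definition nrm2 d (v : 'rV[Cx R]_d) : R := \sum_m normsq (v 0 m).

Lemma nrm2E d (v : 'rV[Cx R]_d) : (v *m adjmx v) 0 0 = toC (nrm2 v).
Proof. by rewrite mxE /nrm2 toC_sum; apply: eq_bigr => m _; rewrite !mxE normsqE. Qed.

Lemma casimir_form xi (v : 'rV[Cx R]_(rdim xi)) :
  (v *m casimir xi *m adjmx v) 0 0 =
  - toC (\sum_m (qform (\row_j re ((v *m gen xi j) 0 m)) +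
                 qform (\row_j im ((v *m gen xi j) 0 m)))).
Proof.
pose w j := v *m gen xi j.
have E i j : (v *m (gen xi j *m gen xi i) *m adjmx v) 0 0 = - \sum_m w j 0 m * (w i 0 m)^*.
  have -> : v *m (gen xi j *m gen xi i) *m adjmx v = - (w j *m adjmx (w i)).
    rewrite /w adjmxM gen_adj; move: (gen xi j) (gen xi i) (adjmx v) => A B C.
    by rewrite mulNmx mulmxN opprK !mulmxA.
  move: (w i) (w j) => a b; rewrite mxE; congr (- _); rewrite mxE.
  by apply: eq_bigr => m _; rewrite !mxE.
have -> : (v *m casimir xi *m adjmx v) 0 0 =
    - \sum_i \sum_j \sum_m toC (Q i j) * (w j 0 m * (w i 0 m)^*).
  rewrite /casimir mulmx_sumr mulmx_suml summxE -sumrN; apply: eq_bigr => i _.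
  rewrite mulmx_sumr mulmx_suml summxE -sumrN; apply: eq_bigr => j _.
  by rewrite -scalemxAr -scalemxAl mxE E mulrN mulr_sumr.
congr (- _); transitivity (\sum_m \sum_i \sum_j toC (Q i j) * (w j 0 m * (w i 0 m)^*)).
  rewrite [RHS]exchange_big /=; apply: eq_bigr => i _; exact: exchange_big.
rewrite toC_sum; apply: eq_bigr => m _.
set a : 'rV[R]_n := \row_j re _; set b : 'rV[R]_n := \row_j im _.
have aE j : a 0 j = re (w j 0 m) by rewrite mxE.
have bE j : b 0 j = im (w j 0 m) by rewrite mxE.
clearbody a b; clearbody w.
apply: Cx_ext; rewrite ?re_sum ?im_sum /=.
  rewrite /qform -big_split /=; apply: eq_bigr => i _; rewrite re_sum -big_split /=.
  apply: eq_bigr => j _; rewrite re_toCM re_mul re_conj im_conj.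
  rewrite (aE i) (aE j) (bE i) (bE j).
  by ring.
transitivity (\sum_i \sum_j (Q i j * (im (w j 0 m) * re (w i 0 m)) -
                            Q i j * (re (w j 0 m) * im (w i 0 m)))).
  apply: eq_bigr => i _; rewrite im_sum; apply: eq_bigr => j _.
  by rewrite im_toCM im_mul re_conj im_conj; ring.
under eq_bigr do rewrite sumrB; rewrite sumrB exchange_big /= -sumrB big1 // => i _.
by rewrite -sumrB big1 // => j _; rewrite (Qsym j i); ring.
Qed.

Lemma casimir_scalar xi : exists2 l : R, l <= 0 & casimir xi = (toC l)%:M.
Proof.
have [a aE] := schur_scalar (casimir_comm xi).
pose v : 'rV[Cx R]_(rdim xi) := delta_mx 0 (Ordinal (rdim_gt0 xi)).
have := casimir_form v; rewrite aE mul_mx_scalar -scalemxAl mxE nrm2E.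
have -> : nrm2 v = 1.
  rewrite /nrm2 (bigD1 (Ordinal (rdim_gt0 xi))) //= big1 ?addr0 => [|m m0].
    by rewrite /normsq /v mxE !eqxx /= expr1n expr0n addr0.
  by rewrite /normsq /v mxE (negbTE m0) andbF /= expr0n addr0.
rewrite toC1 mulr1 => a_eq; exists (- \sum_m (qform (\row_j re ((v *m gen xi j) 0 m)) +
                 qform (\row_j im ((v *m gen xi j) 0 m)))); last by rewrite toCN -a_eq.
by rewrite oppr_le0 sumr_ge0 // => m _; rewrite addr_ge0 ?qform_ge0.
Qed.

Definition eigval xi : R := s2val (cid2 (casimir_scalar xi)).

Lemma eigval_le0 xi : eigval xi <= 0.
Proof. exact: (s2valP (cid2 (casimir_scalar xi))). Qed.

Lemma casimirE xi : casimir xi = (toC (eigval xi))%:M.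
Proof. exact: (s2valP' (cid2 (casimir_scalar xi))). Qed.

(** By [casimir_form] the Casimir operator is minus a sum of squares of the
    generators, so its eigenvalue, and with it [bracket], controls every
    derivative of a representation. *)
Lemma gen_bound xi i (v : 'rV[Cx R]_(rdim xi)) :
  nrm2 (v *m gen xi i) <= gram0 met i i * (- eigval xi) * nrm2 v.
Proof.
have := casimir_form v; rewrite casimirE mul_mx_scalar -scalemxAl mxE nrm2E -toCM -toCN.
move=> /toC_inj h; rewrite -mulrA mulNr h opprK mulr_sumr; apply: ler_sum => m _.
rewrite /normsq mulrDr; apply: lerD.
  by have := coord_qform (\row_j re ((v *m gen xi j) 0 m)) i; rewrite mxE.
by have := coord_qform (\row_j im ((v *m gen xi j) 0 m)) i; rewrite mxE.
Qed.

(** The Casimir operator acts on the entries as the Laplacian, by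
    [laplace_beltrami_rfield]. *)
Lemma crf_casimir xi k l g :
  \sum_i \sum_j toC (Q i j) * crf i (crf j (fun x => xi x k l)) g =
  toC (eigval xi) * xi g k l.
Proof.
have C p q : CGk 1 (fun g => xi g p q) by exact: (rep_CGk mu met).
have e i j : crf i (crf j (fun x => xi x k l)) g = (gen xi j *m gen xi i *m xi g) k l.
  have -> : crf j (fun x => xi x k l) = fun x => \sum_m gen xi j k m * xi x m l.
    by apply/funext => x; rewrite crf_rep mxE.
  rewrite crf_sum => [|m]; last exact: CGkZ.
  by rewrite -mulmxA mxE; apply: eq_bigr => m _; rewrite crfZ // crf_rep.
transitivity ((casimir xi *m xi g) k l).
  rewrite /casimir mulmx_suml summxE; apply: eq_bigr => i _.
  rewrite mulmx_suml summxE; apply: eq_bigr => j _.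
  by rewrite -scalemxAl [RHS]mxE e.
by rewrite casimirE mul_scalar_mx mxE.
Qed.

Lemma rep_laplacian xi k l :
  is_laplacian met (fun g => xi g k l) (fun g => toC (eigval xi) * xi g k l).
Proof.
move=> c Ac x cx; have [Cr Ci] := @rep_CGk _ _ _ mu met xi 2 k l.
rewrite -crf_casimir; apply: Cx_ext => /=.
  rewrite (laplace_beltrami_rfield met Ac cx Cr) re_sum; apply: eq_bigr => i _.
  by rewrite re_sum; apply: eq_bigr => j _; rewrite re_toCM.
rewrite (laplace_beltrami_rfield met Ac cx Ci) im_sum; apply: eq_bigr => i _.
by rewrite im_sum; apply: eq_bigr => j _; rewrite im_toCM.
Qed.

Lemma rep_eigenvalueE xi : rep_eigenvalue met xi = eigval xi.
Proof.
rewrite /rep_eigenvalue; set P := [set l : R | _].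
have /xgetPex : exists l, P l by exists (eigval xi) => i j; exact: rep_laplacian.
move=> /(_ 0); set l' := xget 0 P => Pl'.
pose o := Ordinal (rdim_gt0 xi); have [c Ac c1] := atlas_cover (clg_atlas G) 1%g.
have cx := chart_ccod c1.
have := Pl' o o c Ac (c 1%g) cx; rewrite -(rep_laplacian o o Ac cx) cmapK // rep1 mxE eqxx !mulr1.
by move/toC_inj.
Qed.

Lemma bracket_sqr xi : bracket met xi ^+ 2 = 1 - eigval xi.
Proof. by rewrite /bracket rep_eigenvalueE sqr_sqrtr // addr_ge0 // oppr_ge0 eigval_le0. Qed.

Lemma bracket_ge1 xi : 1 <= bracket met xi.
Proof.
rewrite /bracket rep_eigenvalueE -[X in X <= _]sqrtr1 ler_wsqrtr //.
by rewrite lerDl oppr_ge0 eigval_le0.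
Qed.

Lemma bracket_conj xi : bracket met (conj_rep xi) = bracket met xi.
Proof.
have gE i : gen (conj_irrep xi) i = map_mx Num.conj (gen xi i).
  apply/matrixP => k l; rewrite !mxE.
  under eq_fun do rewrite mxE.
  by rewrite crf_conj //; exact: (rep_CGk mu met).
have cE : casimir (conj_irrep xi) = map_mx Num.conj (casimir xi).
  rewrite /casimir map_mx_sum; apply: eq_bigr => i _; rewrite map_mx_sum; apply: eq_bigr => j _.
  by rewrite map_mxZ /= toC_conj map_mxM !gE.
move: cE; rewrite !casimirE map_scalar_mx /= toC_conj.
pose o : 'I_(rdim xi) := Ordinal (rdim_gt0 xi); move=> /matrixP/(_ o o).
have sE (x : Cx R) : (x%:M : 'M[Cx R]_(rdim xi)) o o = x by rewrite mxE eqxx mulr1n.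
move=> h0; have /toC_inj h := etrans (esym (sE _)) (etrans h0 (sE _)).
have e : rep_eigenvalue met (conj_rep xi) = eigval xi.
  by rewrite -h; exact: (rep_eigenvalueE (conj_irrep xi)).
by rewrite /bracket e rep_eigenvalueE.
Qed.

End Casimir.

(** * Counting representations *)

HB.instance Definition _ (R : realType) n (G : compactLieGroup R n) := gen_eqMixin (irrep G).
HB.instance Definition _ (R : realType) n (G : compactLieGroup R n) := gen_choiceMixin (irrep G).

Section CubeCover.
Context {R : realType} {n : nat} (G : compactLieGroup R n).

Definition cube (a : 'rV[R]_n) (r : R) := [set y | `|a - y| <= r].

Lemma cube_compact a (r : R) : 0 < r -> compact (cube a r).
Proof.
move=> r0; have -> : cube a r = closed_ball a r by rewrite closed_ballE.
apply: bounded_closed_compact; last exact: closed_ball_closed.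
exists (`|a| + r); split; first exact: num_real.
rewrite closed_ballE // => y hy x; rewrite /closed_ball_ /= => hx.
apply: le_trans (ltW hy); rewrite -[x](subKr a).
by rewrite (le_trans (ler_normB _ _)) // lerD2l.
Qed.

Lemma finite_cube_cover : exists (m : nat) (c : 'I_m -> chart R n G)
    (a : 'I_m -> 'rV[R]_n) (r : 'I_m -> R),
  (forall i, [/\ atlas (c i), 0 < r i & cube (a i) (r i) `<=` ccod (c i)]) /\
  forall g, exists i x, cube (a i) (r i) x /\ cinv (c i) x = g.
Proof.
have loc (g : G) : exists cr : chart R n G * R,
    [/\ atlas cr.1, 0 < cr.2, cube (cr.1 g) cr.2 `<=` ccod cr.1 &
     \forall y \near g, cube (cr.1 g) cr.2 (cr.1 y) /\ cinv cr.1 (cr.1 y) = y].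
  have [c Ac cg] := atlas_cover (clg_atlas G) g.
  have ncod : nbhs (c g) (ccod c).
    by apply: open_nbhs_nbhs; split; [exact: ccod_open|exists g].
  have [r rc] := (nbhs_closedballP _ _).1 ncod.
  have E : cube (c g) r%:num = closed_ball (c g) r%:num by rewrite closed_ballE.
  exists (c, r%:num); rewrite /= E; split=> //.
  have hr : nbhs (c g) (closed_ball (c g) r%:num) by apply/nbhs_closedballP; exists r.
  have pull (B : set 'rV[R]_n) : nbhs (c g) B -> \forall y \near g, B (c y).
    by move=> nB; exact: (cmap_continuous cg nB).
  have h1 := pull _ hr.
  by apply: filterS2 h1 (nbhs_cdom cg) => y ? /cmapK.
pose cr g := projT1 (cid (loc g)).
have crP g := projT2 (cid (loc g)).
pose O g := [set y | cube ((cr g).1 g) (cr g).2 ((cr g).1 y) /\ cinv (cr g).1 ((cr g).1 y) = y]°.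
have [D _ Dc] : finite_subset_cover [set: G] O [set: G].
  have := clg_compact G; rewrite compact_cover; apply.
    by move=> g _; exact: open_interior.
  by move=> g _; exists g => //; have [] := crP g.
pose s := enum_fset D; pose p (i : 'I_(size s)) := nth 1%g s i.
exists (size s), (fun i => (cr (p i)).1), (fun i => (cr (p i)).1 (p i)), (fun i => (cr (p i)).2).
split; first by move=> i; have [] := crP (p i).
move=> g; have [h hD /interior_subset [h1 h2]] := Dc g I.
have hs : h \in s by [].
have hi : (index h s < size s)%N by rewrite index_mem.
by exists (Ordinal hi), ((cr h).1 g); rewrite /p /= nth_index.
Qed.

Lemma unit_grid (t : R) q : 0 <= t <= 1 -> exists k : 'I_q.+1, `|k%:R / q.+1%:R - t| <= q.+1%:R^-1.
Proof.
move=> /andP[t0 t1]; have q0 : 0 < q.+1%:R :> R by [].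
have T0 : 0 <= t * q.+1%:R by rewrite mulr_ge0.
have /andP[h1 h2] := truncn_itv T0; set k := Num.truncn _ in h1 h2.
have [kq|qk] := ltnP k q.+1.
  exists (Ordinal kq) => /=; rewrite -[t](mulfK (lt0r_neq0 q0)) -mulrBl normrM.
  rewrite [X in _ * X]gtr0_norm ?invr_gt0 // -[leRHS]mul1r ler_wpM2r ?invr_ge0 ?ltW //.
  rewrite -natr1 in h2; rewrite ltr_norml; apply/andP; split; lra.
exists ord_max => /=; have te : t = 1.
  apply/eqP; rewrite eq_le t1 /= -(ler_pM2r q0) mul1r; apply: le_trans h1.
  by rewrite ler_nat.
have -> : q%:R / q.+1%:R - t = - q.+1%:R^-1 :> R.
  rewrite te; apply: (mulIf (lt0r_neq0 q0)); rewrite mulrBl mulNr mulVf ?lt0r_neq0 //.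
  by rewrite divfK ?lt0r_neq0 // mul1r -natr1; ring.
by rewrite normrN gtr0_norm // invr_gt0.
Qed.

Definition grid_point (a : 'rV[R]_n) (r : R) q (k : {ffun 'I_n -> 'I_q.+1}) : 'rV[R]_n :=
  \row_j (a 0 j - r + 2 * r * ((k j)%:R / q.+1%:R)).

Lemma grid_point_cube a (r : R) q k : 0 < r -> cube a r (grid_point a r (q := q) k).
Proof.
move=> r0; apply: rV_norm_le => [|j]; first exact: ltW.
rewrite !mxE; set t := _ / _; have t0 : 0 <= t by rewrite divr_ge0.
have t1 : t <= 1 by rewrite ler_pdivrMr // mul1r ler_nat ltnW.
by rewrite ler_norml; apply/andP; split; nra.
Qed.

Lemma grid_near a (r : R) q y : 0 < r -> cube a r y ->
  exists k, `|grid_point a r (q := q) k - y| <= 2 * r / q.+1%:R.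
Proof.
move=> r0 ya.
have ex j : exists k : 'I_q.+1, `|k%:R / q.+1%:R - (y 0 j - a 0 j + r) / (2 * r)| <= q.+1%:R^-1.
  apply: unit_grid; have := le_trans (coord_norm_le (a - y) j) ya.
  rewrite !mxE ler_norml => /andP[h1 h2].
  apply/andP; split; first by apply: divr_ge0; lra.
  by rewrite ler_pdivrMr ?mulr_gt0 // mul1r; lra.
exists [ffun j => projT1 (cid (ex j))].
apply: rV_norm_le => [|j]; first by rewrite divr_ge0 // mulr_ge0 // ltW.
rewrite !mxE ffunE; case: cid => k /= kP.
have -> : a 0 j - r + 2 * r * (k%:R / q.+1%:R) - y 0 j =
    2 * r * (k%:R / q.+1%:R - (y 0 j - a 0 j + r) / (2 * r)).
  by rewrite mulrBr [X in _ = _ - X]mulrCA divff ?mulr1; [ring|rewrite mulf_neq0 // lt0r_neq0].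
by rewrite normrM [X in X * _]gtr0_norm ?mulr_gt0 // ler_pM2l // mulr_gt0.
Qed.

End CubeCover.

Section Lipschitz.
Context {R : realType} {n : nat} (G : compactLieGroup R n) (mu : haarMeasure G)
  (met : biinvariantMetric G).
Implicit Types xi eta : irrep G.

Definition cgram : R := 1 + \sum_i `|gram0 met i i|.

Lemma cgram_ge1 : 1 <= cgram.
Proof. by rewrite lerDl sumr_ge0. Qed.

Lemma gen_bound_bracket xi i (v : 'rV[Cx R]_(rdim xi)) :
  nrm2 (v *m gen xi i) <= (cgram * bracket met xi) ^+ 2 * nrm2 v.
Proof.
have v0 : 0 <= nrm2 v by rewrite sumr_ge0 // => m _; exact: normsq_ge0.
apply: le_trans (gen_bound mu met i v) _; apply: ler_wpM2r => //.
have gi : `|gram0 met i i| <= cgram.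
  by rewrite /cgram (bigD1 i) //= addrCA lerDl addr_ge0 // sumr_ge0.
have c1 := cgram_ge1; have l0 := eigval_le0 mu met xi.
have le0 : 0 <= - eigval mu met xi by rewrite oppr_ge0.
apply: le_trans (ler_wpM2r le0 (ler_norm _)) _.
rewrite exprMn (bracket_sqr mu); apply: ler_pM => //; last by rewrite lerDr.
by apply: le_trans gi _; rewrite expr2 ler_peMr // (le_trans ler01).
Qed.

Lemma nrm2_rep xi (v : 'rV[Cx R]_(rdim xi)) g : nrm2 (v *m xi g) = nrm2 v.
Proof.
apply: toC_inj; rewrite -!nrm2E adjmxM mulmxA -(mulmxA v) rep_unitary.
by rewrite mulmx1.
Qed.

Lemma nrm2_row_rep xi k g : nrm2 (row k (xi g)) = 1.
Proof.
rewrite rowE nrm2_rep /nrm2 (bigD1 k) //= big1 ?addr0 => [|m mk].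
  by rewrite mxE !eqxx /normsq /= expr1n expr0n addr0.
by rewrite mxE (negbTE mk) andbF /normsq /= expr0n addr0.
Qed.

Lemma derive_coord_sum (f : 'rV[R]_n -> R) x v : differentiable f x ->
  'D_v f x = \sum_k v 0 k * 'D_(std k) f x.
Proof.
move=> df; rewrite deriveE // [in LHS](rV_sum_std v) linear_sum; apply: eq_bigr => k _.
by rewrite linearZ /= deriveE.
Qed.

(** The mean value theorem, with the derivatives bounded by [gen_bound]: the
    constant does not depend on the representation, and the dimension factors
    out. *)
Lemma trace_lipschitz (c : chart R n G) a (r : R) : atlas c -> 0 < r -> cube a r `<=` ccod c ->
  exists2 L : R, 0 < L & forall xi x x', cube a r x -> cube a r x' ->
    (rdim xi)%:R * (1 - L * bracket met xi * `|x' - x|) <=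
    re (\sum_k (xi (cinv c x)^-1%g *m xi (cinv c x')) k k).
Proof.
move=> Ac r0 Kc.
have bnd k i : exists B, forall x, cube a r x -> `|coframe met c x k i| <= B.
  have /compact_bounded[M [_ HM]] : compact ((fun x => coframe met c x k i) @` cube a r).
    apply: continuous_compact; last exact: cube_compact.
    apply: continuous_in_subspaceT => x /set_mem /Kc cx.
    exact: Ck_continuous (coframe_smooth met k i Ac 0) cx.
  exists (`|M| + 1) => x Kx; apply: HM; last by exists x.
  by rewrite (le_lt_trans (ler_norm M)) // ltrDl.
pose Bf k i := projT1 (cid (bnd k i)).
have BP k i x : cube a r x -> `|coframe met c x k i| <= Bf k i := projT2 (cid (bnd k i)) x.
pose B := \sum_k \sum_i `|Bf k i|.
have B0 : 0 <= B by do 2 (apply: sumr_ge0 => ? _).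
have cg := cgram_ge1.
exists (B * cgram + 1) => [|xi x x' Kx Kx']; first by rewrite ltr_wpDl // mulr_ge0 // (le_trans ler01).
have b1 := bracket_ge1 mu met xi; set b := bracket met xi in b1 *.
pose F h := \sum_k (xi (cinv c x)^-1%g *m xi h) k k.
have FE h : F h = \sum_k \sum_l (xi (cinv c x) l k)^* * xi h l k.
  by apply: eq_bigr => k _; rewrite mxE; apply: eq_bigr => l _; rewrite rep_inv.
have CF : CGk 1 F.
  have -> : F = fun h => \sum_k \sum_l (xi (cinv c x) l k)^* * xi h l k by apply/funext.
  by do 2 (apply: CGk_sum => ?); apply: CGkZ; exact: (rep_CGk mu met).
have CFr : GCk 1 (fun h => re (F h)) by case: CF.
pose f y := re (F (cinv c y)).
have df y : ccod c y -> differentiable f y.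
  by move=> cy; exact: (C1_differentiable (ccod_open c) (CFr c Ac) cy).
have conv t : 0 <= t <= 1 -> cube a r (t *: (x' - x) + x).
  move=> /andP[t0 t1]; rewrite /cube /=.
  have -> : a - (t *: (x' - x) + x) = t *: (a - x') + (1 - t) *: (a - x).
    by apply/rowP => j; rewrite !mxE; ring.
  apply: le_trans (ler_normD _ _) _; rewrite !normrZ ger0_norm // ger0_norm ?subr_ge0 //.
  have := ler_wpM2l t0 Kx'; have : (1 - t) * `|a - x| <= (1 - t) * r.
    by apply: ler_wpM2l => //; rewrite subr_ge0.
  by rewrite /=; lra.
have [t t01] := @line_MVT _ _ f x (x' - x) (fun t t01 => diff_derivable (df _ (Kc _ (conv t t01)))).
rewrite subrK; set z := t *: _ + x; have Kz := conv t t01; rewrite -/z in Kz.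
have cz := Kc _ Kz.
rewrite (derive_coord_sum _ (df _ cz)).
have fx : f x = (rdim xi)%:R.
  rewrite /f /F -repM mulVg rep1 -[RHS]re_toC toC_nat; congr re.
  by rewrite -[RHS]mulr1n -mxtrace1.
have rfb i h : `|rfield i (fun h => re (F h)) h| <= (rdim xi)%:R * (cgram * b).
  have -> : rfield i (fun h => re (F h)) h =
      \sum_l re (\sum_k (row l (xi (cinv c x)) 0 k)^* * (row l (gen xi i) *m xi h) 0 k).
    rewrite -re_sum -[LHS]/(re (crf i F h)); congr re.
    have -> : F = fun h => \sum_k \sum_l (xi (cinv c x) l k)^* * xi h l k by apply/funext.
    have C1 k l : CGk 1 (fun h => (xi (cinv c x) l k)^* * xi h l k).
      by apply: CGkZ; exact: (rep_CGk mu met).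
    rewrite crf_sum => [|k]; last by apply: CGk_sum.
    rewrite exchange_big /=; apply: eq_bigr => k _; rewrite crf_sum //.
    apply: eq_bigr => l _; rewrite crfZ; last exact: (rep_CGk mu met).
    by rewrite (crf_rep mu met) -row_mul !mxE.
  apply: le_trans (ler_norm_sum _ _ _) _.
  have -> : (rdim xi)%:R * (cgram * b) = \sum_(l < rdim xi) cgram * b.
    by rewrite sumr_const card_ord mulr_natl.
  apply: ler_sum => l _; set s := cgram * b.
  have s0 : 0 < s by rewrite mulr_gt0 // (lt_le_trans ltr01).
  set p := row l (xi _); set q := _ *m xi h.
  have p1 : nrm2 p = 1 by exact: nrm2_row_rep.
  have q1 : nrm2 q <= s ^+ 2.
    rewrite /q nrm2_rep rowE; apply: le_trans (gen_bound_bracket _ _) _.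
    by rewrite -[delta_mx 0 l]mulmx1 -(rep1 xi) -rowE nrm2_row_rep mulr1.
  rewrite re_sum; apply: le_trans (ler_norm_sum _ _ _) _.
  apply: (@le_trans _ _ (\sum_k (s * normsq (p 0 k) + normsq (q 0 k) / s) / 2)).
    apply: ler_sum => k _; rewrite re_mul re_conj im_conj /normsq.
    move: (re (p 0 k)) (im (p 0 k)) (re (q 0 k)) (im (q 0 k)) => p1' p2 q1' q2.
    have e1 : 0 <= (s * p1' - q1') ^+ 2 / s by rewrite divr_ge0 ?sqr_ge0 ?ltW.
    have e2 : 0 <= (s * p2 - q2) ^+ 2 / s by rewrite divr_ge0 ?sqr_ge0 ?ltW.
    have e3 : 0 <= (s * p1' + q1') ^+ 2 / s by rewrite divr_ge0 ?sqr_ge0 ?ltW.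
    have e4 : 0 <= (s * p2 + q2) ^+ 2 / s by rewrite divr_ge0 ?sqr_ge0 ?ltW.
    have E (u v : R) : (s * u - v) ^+ 2 / s = s * u ^+ 2 - 2 * (u * v) + v ^+ 2 / s.
      by field; exact: lt0r_neq0.
    have E' (u v : R) : (s * u + v) ^+ 2 / s = s * u ^+ 2 + 2 * (u * v) + v ^+ 2 / s.
      by field; exact: lt0r_neq0.
    rewrite E in e1; rewrite E in e2; rewrite E' in e3; rewrite E' in e4.
    rewrite ler_norml; apply/andP; split; rewrite ?ler_pdivlMr //; rewrite mulrDl; lra.
  rewrite -mulr_suml big_split /= -mulr_sumr -mulr_suml -/(nrm2 p) -/(nrm2 q) p1 mulr1.
  rewrite ler_pdivrMr // mulr_natr mulr2n lerD2l ler_pdivrMr // -expr2 //.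
have bound : `|\sum_k (x' - x) 0 k * 'D_(std k) f z| <= (rdim xi)%:R * ((B * cgram) * b * `|x' - x|).
  apply: (@le_trans _ _ (\sum_k `|x' - x| * (\sum_i `|Bf k i| * ((rdim xi)%:R * (cgram * b))))).
    apply: le_trans (ler_norm_sum _ _ _) _; apply: ler_sum => k _.
    rewrite normrM; apply: ler_pM => //; first exact: coord_norm_le.
    rewrite (derive_coframe met k CFr Ac cz); apply: le_trans (ler_norm_sum _ _ _) _.
    apply: ler_sum => i _; rewrite normrM; apply: ler_pM => //.
    by apply: le_trans (BP k i z Kz) (ler_norm _).
  rewrite -mulr_sumr; under eq_bigr do rewrite -mulr_suml; rewrite -mulr_suml -/B.
  by rewrite le_eqVlt; apply/orP; left; apply/eqP; ring.
rewrite -/(F (cinv c x')) -/(f x') => fE; have := bound; rewrite -fE fx ler_norml => /andP[h _].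
have d0 : 0 <= (rdim xi)%:R :> R by [].
have nz : 0 <= `|x' - x| by [].
have : 0 <= (rdim xi)%:R * (b * `|x' - x|) by rewrite !mulr_ge0 // (le_trans ler01).
by move: h; lra.
Qed.

End Lipschitz.

Section Counting.
Context {R : realType} {n : nat} (G : compactLieGroup R n) (mu : haarMeasure G)
  (met : biinvariantMetric G).
Implicit Types xi eta : irrep G.

Definition repchar xi (g : G) : Cx R := \sum_k xi g k k.

Lemma repchar_ccont xi : ccont (repchar xi).
Proof. by apply: ccont_sum => k; exact: rep_ccont. Qed.

Lemma cip_sum2 m l (u : 'I_m -> G -> Cx R) (v : 'I_l -> G -> Cx R) :
  (forall i, ccont (u i)) -> (forall i, ccont (v i)) ->
  cip mu (fun g => \sum_i u i g) (fun g => \sum_j v j g) = \sum_i \sum_j cip mu (u i) (v j).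
Proof.
move=> cu cv; have cV : ccont (fun g => \sum_j v j g) by exact: ccont_sum.
have := cip_suml mu (index_enum 'I_m) (fun=> 1) cu cV.
under eq_fun do under eq_bigr do rewrite mul1r.
move=> ->; apply: eq_bigr => i _; rewrite mul1r.
have := cip_sumr mu (index_enum 'I_l) (fun=> 1) cv (cu i).
under eq_fun do under eq_bigr do rewrite mul1r.
by move=> ->; apply: eq_bigr => j _; rewrite rmorph1 mul1r.
Qed.

Lemma repchar_orth xi eta : (equiv_rep xi eta -> xi = eta) ->
  cip mu (repchar xi) (repchar eta) = (xi == eta)%:R.
Proof.
move=> eqx; have d0 : (rdim xi)%:R != 0 :> Cx R by rewrite pnatr_eq0 -lt0n rdim_gt0.
rewrite /repchar cip_sum2; try by move=> k; exact: rep_ccont.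
have [<-|ne] := eqVneq xi eta.
  under eq_bigr => i _ do rewrite (eq_bigr _ (fun j _ => rep_orth mu i i j j)).
  rewrite (eq_bigr (fun=> (rdim xi)%:R^-1)).
    by rewrite sumr_const card_ord -[LHS]mulr_natl divff.
  move=> i _; rewrite (bigD1 i) //= eqxx mul1r big1 ?addr0 // => j ji.
  by rewrite eq_sym (negbTE ji) mul0r.
rewrite big1 // => i _; rewrite big1 // => j _; apply: rep_orth_inequiv => /equiv_rep_sym /eqx.
by move/eqP: ne.
Qed.

Definition inequiv (s : seq (irrep G)) := uniq s /\
  forall xi eta, xi \in s -> eta \in s -> equiv_rep xi eta -> xi = eta.

Definition dim2 (s : seq (irrep G)) : R := \sum_(xi <- s) (rdim xi)%:R ^+ 2.

Definition bigchar s (g : G) : Cx R := \sum_(xi <- s) toC (rdim xi)%:R * repchar xi g.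

Lemma bigchar_norm s : inequiv s ->
  hint mu (fun g => normsq (bigchar s g)) = dim2 s.
Proof.
move=> [us eqs]; apply: toC_inj.
have cb : ccont (bigchar s) by apply: ccont_sum => xi; apply: ccontZ; exact: repchar_ccont.
rewrite -cint_normsq // -/(cip mu _ _) cip_suml //; last exact: repchar_ccont.
rewrite /dim2 toC_sum [LHS]big_seq [RHS]big_seq; apply: eq_bigr => xi xs.
rewrite cip_sumr; [|exact: repchar_ccont|exact: repchar_ccont].
rewrite (bigD1_seq xi) //= repchar_orth ?eqxx // mulr1 big_seq_cond big1 ?addr0.
  by rewrite toC_conj -toCM -expr2.
move=> eta /andP[es ne]; rewrite repchar_orth; last exact: eqs.
by rewrite eq_sym (negbTE ne) mulr0.
Qed.

(** A packing argument, which gives a weak form of the Weyl law that suffices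
    for the convergence of Fourier series: the weighted character of the family
    stays above half of its value at the identity on a neighbourhood of size
    1/m, and O(m^n) translates of that neighbourhood cover the group. *)
Lemma dim2_bound : exists2 K : R, 0 < K & forall s m, inequiv s -> 1 <= m ->
  (forall xi, xi \in s -> bracket met xi <= m) -> dim2 s <= K * m ^+ n.
Proof.
have [M [c [a [r [cP cov]]]]] := finite_cube_cover G.
have lip i := let: And3 A1 A2 A3 := cP i in trace_lipschitz mu met A1 A2 A3.
pose L i := s2val (cid2 (lip i)).
have L0 i : 0 < L i := s2valP (cid2 (lip i)).
have LP i := s2valP' (cid2 (lip i)).
pose Z : R := \sum_i 4 * r i * L i.
have ri0 i : 0 < r i by have [] := cP i.
have Zi0 i : 0 <= 4 * r i * L i by rewrite !mulr_ge0 // ltW.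
have Z0 : 0 <= Z by rewrite sumr_ge0.
exists (4 * M%:R * (Z + 1) ^+ n + 1).
  by rewrite ltr_wpDl // !mulr_ge0 // exprn_ge0 // addr_ge0.
move=> s m iq m1 bm; have m0 : 0 <= m := le_trans ler01 m1.
(* With [q.+1] points in each direction the mesh is small enough for the
characters to keep half of their value at the identity. *)
pose q := Num.truncn (Z * m).
have Zm0 : 0 <= Z * m by rewrite mulr_ge0.
have /andP[q1 q2] := truncn_itv Zm0; rewrite -/q in q1 q2.
pose J : finType := ('I_M * {ffun 'I_n -> 'I_q.+1})%type.
pose p (j : J) : 'rV[R]_n := grid_point (a j.1) (r j.1) j.2.
pose gp (j : J) : G := cinv (c j.1) (p j).
have close y : exists j : J, forall xi, bracket met xi <= m ->
    (rdim xi)%:R / 2 <= re (repchar xi ((gp j)^-1 * y)%g).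
  have [i [x [Kx <-]]] := cov y.
  have [k pk] := grid_near q (ri0 i) Kx; exists (i, k) => xi bxi.
  have Kp := grid_point_cube (a i) (q := q) k (ri0 i).
  have := LP i xi _ _ Kp Kx; rewrite /repchar repM; apply: le_trans.
  apply: ler_wpM2l => //.
  have b0 : 0 <= bracket met xi by rewrite (le_trans ler01) // (bracket_ge1 mu).
  have : L i * bracket met xi * `|x - grid_point (a i) (r i) k| <= 2^-1; last by rewrite -/(L i); lra.
  apply: (@le_trans _ _ (L i * m * (2 * r i / q.+1%:R))).
    rewrite distrC; apply: ler_pM => //; first by rewrite mulr_ge0 // ltW.
    by apply: ler_wpM2l => //; exact: ltW.
  rewrite mulrA ler_pdivrMr //.
  have : 4 * r i * L i <= Z by rewrite /Z (bigD1 i) //= lerDl sumr_ge0.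
  by move/(ler_wpM2r m0); lra.
have cs : ccont (bigchar s) by apply: ccont_sum => xi; apply: ccontZ; exact: repchar_ccont.
pose D := dim2 s; have D0 : 0 <= D by apply: sumr_ge0 => xi _; exact: sqr_ge0.
have big y : D ^+ 2 / 4 <= \sum_(j : J) re (bigchar s ((gp j)^-1 * y)%g) ^+ 2.
  have [j jP] := close y; rewrite (bigD1 j) //=.
  apply: ler_wpDr; first by apply: sumr_ge0 => ? _; exact: sqr_ge0.
  have : D / 2 <= re (bigchar s ((gp j)^-1 * y)%g).
    rewrite re_sum /D /dim2 mulr_suml big_seq [leRHS]big_seq; apply: ler_sum => xi xs.
    by rewrite re_toCM expr2 -mulrA; apply: ler_wpM2l => //; exact/jP/bm.
  move=> h; have h0 : 0 <= D / 2 by rewrite divr_ge0.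
  have := lerXn2r 2 h0 (le_trans h0 h) h; rewrite expr_div_n.
  by rewrite (_ : (2 : R) ^+ 2 = 4) //; ring.
have csq j : continuous (fun y => re (bigchar s ((gp j)^-1 * y)%g) ^+ 2).
  have [cr _] := ccont_lshift (gp j)^-1%g cs.
  by under eq_fun do rewrite expr2; exact: contM.
have cS : continuous (fun y : G => \sum_(j : J) re (bigchar s ((gp j)^-1 * y)%g) ^+ 2).
  by apply: cont_sum => j; exact: csq.
have := hint_le mu (@cont_cst _ _ _ (D ^+ 2 / 4)) cS big.
rewrite hint_cst hint_sum // => h1.
(* By orthogonality of characters each translate has squared norm [D]. *)
have h2 j : hint mu (fun y => re (bigchar s ((gp j)^-1 * y)%g) ^+ 2) <= D.
  rewrite (hint_left mu (gp j)^-1%g (u := fun y => re (bigchar s y) ^+ 2)); last first.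
    by have [cr _] := cs; under eq_fun do rewrite expr2; exact: contM.
  rewrite /D -bigchar_norm //; apply: hint_le; last by move=> x; rewrite lerDl sqr_ge0.
    by have [cr _] := cs; under eq_fun do rewrite expr2; exact: contM.
  exact: cont_normsq.
have h3 : D ^+ 2 / 4 <= #|J|%:R * D.
  by apply: le_trans h1 (le_trans (ler_sum _ (fun j _ => h2 j)) _); rewrite sumr_const mulr_natl.
have DJ : D <= 4 * #|J|%:R.
  have [->|Dn] := eqVneq D 0; first by rewrite mulr_ge0.
  have Dp : 0 < D by rewrite lt_neqAle eq_sym Dn D0.
  by rewrite -(ler_pM2r Dp); move: h3; rewrite ler_pdivrMr //; lra.
apply: le_trans DJ _; rewrite card_prod card_ord card_ffun !card_ord natrM natrX.
have mn0 : 0 <= m ^+ n by exact: exprn_ge0.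
apply: (@le_trans _ _ (4 * M%:R * (Z + 1) ^+ n * m ^+ n)); last first.
  by apply: ler_wpM2r => //; rewrite lerDl.
rewrite mulrA -[leRHS]mulrA.
apply: ler_wpM2l => //.
rewrite -exprMn; apply: lerXn2r; rewrite ?nnegrE ?mulr_ge0 ?addr_ge0 //.
by rewrite -natr1 mulrDl mul1r; apply: lerD.
Qed.

Lemma dim_bound : exists2 K : R, 0 < K & forall xi,
  (rdim xi)%:R ^+ 2 <= K * bracket met xi ^+ n.
Proof.
have [K K0 KP] := dim2_bound; exists K => // xi.
have := KP [:: xi] (bracket met xi); rewrite /dim2 big_seq1; apply.
- by split=> // ? ?; rewrite !inE => /eqP -> /eqP ->.
- exact: (bracket_ge1 mu).
- by move=> ?; rewrite inE => /eqP ->.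
Qed.

(** A dyadic decomposition according to the size of [bracket]. *)
Lemma dim2_summable : exists2 K : R, 0 < K & forall s, inequiv s ->
  \sum_(xi <- s) (rdim xi)%:R ^+ 2 * (bracket met xi ^+ n.+1)^-1 <= K.
Proof.
have [K K0 KP] := dim2_bound; pose b xi := bracket met xi.
have b1 xi : 1 <= b xi by exact: (bracket_ge1 mu).
exists (K * 2 ^+ n * 2 + 1); first by rewrite ltr_wpDl // !mulr_ge0 // ?exprn_ge0 // ltW.
pose lv xi := trunc_log 2 (Num.truncn (b xi)).
have lvP xi : 2 ^+ lv xi <= b xi <= 2 ^+ (lv xi).+1.
  have b0 : 0 <= b xi := le_trans ler01 (b1 xi).
  have /andP[h1 h2] := truncn_itv b0.
  have t0 : (0 < Num.truncn (b xi))%N by rewrite truncn_gt0.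
  apply/andP; split.
    by apply: le_trans h1; rewrite -natrX ler_nat; exact: trunc_logP.
  by apply: ltW (lt_le_trans h2 _); rewrite -natrX ler_nat; exact: trunc_log_ltn.
have geo S : \sum_(k < S) (2 ^+ k)^-1 <= 2 :> R.
  have : \sum_(k < S) (2 ^+ k)^-1 <= 2 - 2 * (2 ^+ S)^-1 :> R.
    elim: S => [|S IH]; first by rewrite big_ord0 expr0 invr1 mulr1 subrr.
    rewrite big_ord_recr /= exprS invfM; lra.
  by move/le_trans; apply; rewrite gerBl mulr_ge0 // invr_ge0 exprn_ge0.
move=> s [us eqs]; pose S := (\max_(xi <- s) lv xi).+1.
pose w xi : R := (rdim xi)%:R ^+ 2 * (b xi ^+ n.+1)^-1.
have -> : \sum_(xi <- s) w xi = \sum_(k < S) \sum_(xi <- [seq xi <- s | lv xi == k]) w xi.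
  rewrite [RHS](eq_bigr (fun k : 'I_S => \sum_(xi <- s) if lv xi == k then w xi else 0)); last first.
    by move=> k _; rewrite big_filter big_mkcond.
  rewrite exchange_big /= [LHS]big_seq [RHS]big_seq; apply: eq_bigr => xi xs.
  have lt : (lv xi < S)%N by rewrite ltnS; exact: leq_bigmax_seq.
  rewrite (bigD1 (Ordinal lt)) //= eqxx big1 ?addr0 // => k kne.
  by rewrite ifN //; apply: contraNN kne => /eqP h; apply/eqP/val_inj.
have shell k : \sum_(xi <- [seq xi <- s | lv xi == k]) w xi <= K * 2 ^+ n * (2 ^+ k)^-1.
  set s' := [seq xi <- s | lv xi == k].
  have is' : inequiv s'.
    split; first exact: filter_uniq.
    by move=> xi eta; rewrite !mem_filter => /andP[_ ?] /andP[_ ?]; exact: eqs.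
  have two (l : nat) : 0 < 2 ^+ l :> R by rewrite exprn_gt0.
  apply: (@le_trans _ _ (dim2 s' * ((2 ^+ k) ^+ n.+1)^-1)).
    rewrite /dim2 mulr_suml big_seq [leRHS]big_seq; apply: ler_sum => xi.
    rewrite mem_filter => /andP[/eqP lk _]; apply: ler_wpM2l; first exact: sqr_ge0.
    have /andP[h1 _] := lvP xi; rewrite lk in h1.
    have b0 : 0 < b xi := lt_le_trans ltr01 (b1 xi).
    by rewrite lef_pV2 ?posrE ?exprn_gt0 // lerXn2r // nnegrE ltW.
  rewrite ler_pdivrMr ?exprn_gt0 //.
  have := KP s' (2 ^+ k.+1) is'; rewrite exprn_ege1 ?ler1n // => /(_ isT) h.
  apply: le_trans (h _) _.
    by move=> xi; rewrite mem_filter => /andP[/eqP <- _]; have /andP[] := lvP xi.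
  rewrite le_eqVlt; apply/orP; left; apply/eqP.
  rewrite [2 ^+ k.+1]exprS exprMn [(2 ^+ k) ^+ n.+1]exprS; field; exact: lt0r_neq0.
apply: (@le_trans _ _ (\sum_(k < S) K * 2 ^+ n * (2 ^+ k)^-1)).
  by apply: ler_sum => k _; exact: shell.
rewrite -mulr_sumr.
apply: ler_wpDr => //; apply: ler_wpM2l => //.
by rewrite mulr_ge0 // ?exprn_ge0 // ltW.
Qed.

End Counting.

(** * Seminorms by invariant fields *)

Section ChangeOfDerivatives.
Context {R : realType} {n : nat} (U : set 'rV[R]_n) (oU : open U) (T : Type)
  (E D : T -> seq 'I_n -> 'rV[R]_n -> R) (alpha beta : 'I_n -> 'I_n -> 'rV[R]_n -> R).
Hypotheses (sE : forall f v, smooth_on U (E f v))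
  (salpha : forall i k, smooth_on U (alpha i k)) (sbeta : forall i k, smooth_on U (beta i k))
  (DE : forall f v k x, U x -> 'D_(std k) (E f v) x = \sum_l beta k l x * E f (l :: v) x)
  (D0 : forall f x, U x -> D f [::] x = E f [::] x)
  (DS : forall f i w x, U x -> D f (i :: w) x = \sum_k alpha i k x * 'D_(std k) (D f w) x).

(** Two ways of iterating derivations that span each other pointwise, with
    smooth coefficients, differ by a triangular change with smooth
    coefficients. *)
Lemma change_derivatives w : exists (J : finType) (b : J -> 'rV[R]_n -> R) (v : J -> seq 'I_n),
  (forall j, (size (v j) <= size w)%N /\ smooth_on U (b j)) /\
  forall f x, U x -> D f w x = \sum_j b j x * E f (v j) x.
Proof.
elim: w => [|i w [J [b [v [bv IH]]]]].
  exists unit, (fun _ _ => 1), (fun=> [::]); split=> [_|f x Ux].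
    by split=> // k; exact: Ck_cst.
  by rewrite big_const card_unit /= addr0 mul1r D0.
have sD k j : smooth_on U ('D_(std k) (b j)).
  by move=> m; have [_ sb] := bv j; have [_ /(_ k)[]] := sb m.+1.
(* By the Leibniz rule the derivative falls on a coefficient or adds a letter. *)
pose J' := ('I_n * (J + J * 'I_n))%type.
pose b' (q : J') x := alpha i q.1 x * match q.2 with
  | inl j => 'D_(std q.1) (b j) x | inr p => b p.1 x * beta q.1 p.2 x end.
pose v' (q : J') := match q.2 with inl j => v j | inr p => p.2 :: v p.1 end.
exists J', b', v'; split=> [[k [j|[j l]]]|f x Ux]; rewrite /v' /b' /=.
- have [h1 h2] := bv j; split; first exact: leqW.
  by move=> m; apply: Ck_mul => //; [exact: salpha|exact: sD].
- have [h1 h2] := bv j; split; first by rewrite ltnS.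
  move=> m; apply: Ck_mul => //; first exact: salpha.
  by apply: Ck_mul => //; exact: sbeta.
rewrite DS // -(pair_big xpredT xpredT (fun k s => b' (k, s) x * E f (v' (k, s)) x)) /=.
apply: eq_bigr => k _.
have -> : 'D_(std k) (D f w) x = 'D_(std k) (fun y => \sum_j b j y * E f (v j) y) x.
  by apply: near_eq_derive; apply: (near_open oU Ux) => y Uy; exact: IH.
have dj j : is_derive x (std k) (fun y => b j y * E f (v j) y)
    ('D_(std k) (b j) x * E f (v j) x + \sum_l b j x * (beta k l x * E f (l :: v j) x)).
  have [_ sb] := bv j; have [_ /(_ k)[db _]] := sb 1%N.
  have [_ /(_ k)[dE _]] := sE f (v j) 1%N.
  have [h1 h2] := @is_deriveM _ _ _ _ _ _ _ _ (derivableP (db x Ux)) (derivableP (dE x Ux)).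
  apply: DeriveDef; first exact: h1.
  apply: (etrans h2); rewrite DE // addrC -mulr_sumr; congr (_ + _); exact: mulrC.
have [_ ->] := is_derive_sum_seq (index_enum J) dj.
rewrite big_split mulrDr big_sumType /=; congr (_ + _).
  by rewrite mulr_sumr; apply: eq_bigr => j _; rewrite /b' /v' /= mulrA.
rewrite -(pair_big xpredT xpredT (fun j l => b' (k, inr (j, l)) x * E f (v' (k, inr (j, l))) x)) /=.
rewrite mulr_sumr; apply: eq_bigr => j _; rewrite mulr_sumr; apply: eq_bigr => l _.
by rewrite /b' /v' /= !mulrA.
Qed.

Lemma change_derivatives_bound (K : set 'rV[R]_n) N : compact K -> K `<=` U ->
  exists2 C, 0 <= C & forall f M, 0 <= M ->
    (forall v x, (size v <= N)%N -> K x -> `|E f v x| <= M) ->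
    forall w x, (size w <= N)%N -> K x -> `|D f w x| <= C * M.
Proof.
move=> cK KU.
have one w : exists2 C, 0 <= C & forall f M, 0 <= M ->
    (forall v x, (size v <= size w)%N -> K x -> `|E f v x| <= M) ->
    forall x, K x -> `|D f w x| <= C * M.
  have [J [b [v [bv DwE]]]] := change_derivatives w.
  have bnd j : exists B, 0 <= B /\ forall x, K x -> `|b j x| <= B.
    have [_ sb] := bv j.
    have /compact_bounded[B [_ HB]] : compact (b j @` K).
      apply: continuous_compact; last exact: cK.
      apply: continuous_in_subspaceT => x /set_mem /KU Ux.
      exact: Ck_continuous (sb 0%N) Ux.
    exists (`|B| + 1); split=> [|x Kx]; first by rewrite addr_ge0.
    by apply: HB; [rewrite (le_lt_trans (ler_norm B)) // ltrDl|exists x].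
  pose B j := projT1 (cid (bnd j)).
  have B0 j : 0 <= B j by have [] := projT2 (cid (bnd j)).
  have BP j x : K x -> `|b j x| <= B j by have [_] := projT2 (cid (bnd j)); apply.
  exists (\sum_j B j); first by rewrite sumr_ge0.
  move=> f M M0 HM x Kx; rewrite DwE; last exact: KU.
  rewrite mulr_suml; apply: le_trans (ler_norm_sum _ _ _) _; apply: ler_sum => j _.
  rewrite normrM; apply: ler_pM => //; first exact: BP.
  by apply: HM => //; have [] := bv j.
pose C w := s2val (cid2 (one w)).
have C0 w : 0 <= C w := s2valP (cid2 (one w)).
have CP w := s2valP' (cid2 (one w)).
exists (\sum_(k < N.+1) \sum_(t : k.-tuple 'I_n) C t).
  by do 2 (apply: sumr_ge0 => ? _).
move=> f M M0 HM w x wN Kx; apply: (@le_trans _ _ (C w * M)).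
  by apply: CP => // v y vw; apply: HM; exact: leq_trans vw wN.
apply: ler_wpM2r => //; have wN' : (size w < N.+1)%N by [].
rewrite (bigD1 (Ordinal wN')) //= (bigD1 (in_tuple w)) //= -addrA lerDl addr_ge0 //.
  by rewrite sumr_ge0.
by do 2 (apply: sumr_ge0 => ? _).
Qed.

End ChangeOfDerivatives.

Section SeminormsByFields.
Context {R : realType} {n : nat} (G : compactLieGroup R n) (met : biinvariantMetric G).

(** Invariant fields are used to measure derivatives, as they act on matrix
    entries by matrices and commute with right translations. The estimates in
    charts that define distributions are equivalent to these, by
    [change_derivatives_bound]. *)
Definition rfw (w : seq 'I_n) (f : G -> R) : G -> R := foldr (fun i h => rfield i h) f w.
Definition crfw (w : seq 'I_n) (f : G -> Cx R) : G -> Cx R := foldr (fun i h => crf i h) f w.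

Lemma crfwE w f g : crfw w f g = mkC (rfw w (fun x => re (f x)) g) (rfw w (fun x => im (f x)) g).
Proof.
elim: w g => [|i w IH] g /=; first exact: Cx_eta.
by rewrite /crf; congr (mkC (rfield i _ g) (rfield i _ g)); apply/funext => x; rewrite IH.
Qed.

Lemma GCk_rfw k w f : (forall k, GCk k f) -> GCk k (rfw w f).
Proof. by move=> Cf; elim: w k => [|i w IH] k //=; exact: GCk_rfield. Qed.

Lemma CGk_crfw k w f : (forall k, CGk k f) -> CGk k (crfw w f).
Proof. by move=> Cf; elim: w k => [|i w IH] k //=; exact: CGk_crf. Qed.

(** The type indexing the functions in [change_derivatives], whose coefficients
    do not depend on the function. *)
Definition smoothR := {f : G -> R | forall k, GCk k f}.

Let smooth_iter_pd c w (f : smoothR) : atlas c ->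
  smooth_on (ccod c) (iter_pd w (fun y => projT1 f (cinv c y))).
Proof.
move=> Ac; elim: w => [|i w IH] k /=; first exact: (projT2 f k c Ac).
by have [_ /(_ i)[]] := IH k.+1.
Qed.

Lemma iter_pd_by_rfw c K N : atlas c -> compact K -> K `<=` ccod c ->
  exists2 C, 0 <= C & forall (f : smoothR) M, 0 <= M ->
    (forall v g, (size v <= N)%N -> `|rfw v (projT1 f) g| <= M) ->
    forall w x, (size w <= N)%N -> K x ->
      `|iter_pd w (fun y => projT1 f (cinv c y)) x| <= C * M.
Proof.
move=> Ac cK Kc.
have [||||||C C0 CP] := @change_derivatives_bound R n _ (ccod_open c) smoothR
  (fun f v x => rfw v (projT1 f) (cinv c x))
  (fun f w => iter_pd w (fun y => projT1 f (cinv c y)))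
  (fun i k _ => (i == k)%:R) (fun k l x => coframe met c x k l) _ _ _ _ _ _ K N cK Kc.
- by move=> f v k; exact: (GCk_rfw k v (projT2 f) Ac).
- by move=> i k m; apply: Ck_cst; exact: ccod_open.
- by move=> i k; exact: coframe_smooth.
- by move=> f v k x cx; rewrite (derive_coframe met k (GCk_rfw 1 v (projT2 f)) Ac cx).
- by [].
- move=> f i w x cx /=; rewrite (bigD1 i) //= eqxx mul1r big1 ?addr0 // => k ki.
  by rewrite eq_sym (negbTE ki) mul0r.
exists C => // f M M0 HM w x wN Kx; apply: CP => // v y vN _; exact: HM.
Qed.

Lemma rfw_by_iter_pd c K N : atlas c -> compact K -> K `<=` ccod c ->
  exists2 C, 0 <= C & forall (f : smoothR) M, 0 <= M ->
    (forall v x, (size v <= N)%N -> K x ->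
      `|iter_pd v (fun y => projT1 f (cinv c y)) x| <= M) ->
    forall w x, (size w <= N)%N -> K x -> `|rfw w (projT1 f) (cinv c x)| <= C * M.
Proof.
move=> Ac cK Kc.
have [||||||C C0 CP] := @change_derivatives_bound R n _ (ccod_open c) smoothR
  (fun f w => iter_pd w (fun y => projT1 f (cinv c y)))
  (fun f v x => rfw v (projT1 f) (cinv c x))
  (fun i k x => frame c x i k) (fun i k _ => (i == k)%:R) _ _ _ _ _ _ K N cK Kc.
- by move=> f v; exact: smooth_iter_pd.
- by move=> i k; exact: frame_smooth.
- by move=> i k m; apply: Ck_cst; exact: ccod_open.
- move=> f v k x cx; rewrite (bigD1 k) //= eqxx mul1r big1 ?addr0 // => l lk.
  by rewrite eq_sym (negbTE lk) mul0r.
- by [].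
- by move=> f i w x cx /=; exact: (rfield_frame i (GCk_rfw 1 w (projT2 f)) Ac cx).
by exists C.
Qed.

Definition word_bounded N (f : G -> Cx R) (M : R) :=
  forall w g, (size w <= N)%N -> `|crfw w f g| <= toC M.

Lemma word_bounded_parts N f M : word_bounded N f M -> forall v g, (size v <= N)%N ->
  `|rfw v (fun x => re (f x)) g| <= M /\ `|rfw v (fun x => im (f x)) g| <= M.
Proof. by move=> fM v g vN; have := fM v g vN; rewrite crfwE => /norm_re_le[]. Qed.

(** The order and constant of a distribution measured by invariant fields
    instead of partial derivatives in charts. *)
Definition fields_bounded N (C : R) (u : Cinfty G -> Cx R) :=
  forall (f : Cinfty G) M, 0 <= M -> word_bounded N f M -> `|u f| <= toC (C * M).

Lemma distr_fields_bounded (u : distr G) : exists N C, 0 <= C /\ fields_bounded N C u.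
Proof.
have [_ [m [c [K [N [C [HK uC]]]]]]] := distrP u.
have one i : exists2 B, 0 <= B & forall (f : smoothR) M, 0 <= M ->
    (forall v g, (size v <= N)%N -> `|rfw v (projT1 f) g| <= M) ->
    forall w x, (size w <= N)%N -> K i x ->
      `|iter_pd w (fun y => projT1 f (cinv (c i) y)) x| <= B * M.
  by have [Ac cK Kc] := HK i; exact: iter_pd_by_rfw.
pose B i := s2val (cid2 (one i)).
have B0 i : 0 <= B i := s2valP (cid2 (one i)).
have BP i := s2valP' (cid2 (one i)).
pose SB := \sum_i B i; have SB0 : 0 <= SB by rewrite sumr_ge0.
exists N, (`|C| * (2 * SB)); split=> [|f M M0 fM]; first by rewrite !mulr_ge0.
have Cf := (smooth_funP f).1 (CinftyP f).
have fr k : GCk k (fun x => re (f x)) by have [] := Cf k.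
have fi k : GCk k (fun x => im (f x)) by have [] := Cf k.
have S0 : 0 <= 2 * (SB * M) by rewrite !mulr_ge0.
apply: (@le_trans _ _ (toC (C * (2 * (SB * M))))); last first.
  rewrite toC_le -mulrA -[2 * SB * M]mulrA; apply: ler_wpM2r => //; exact: ler_norm.
apply: uC => // i w x wN Kx.
have parts := word_bounded_parts fM.
have h1 := BP i (exist _ _ fr) M M0 (fun v g vN => (parts v g vN).1) w x wN Kx.
have h2 := BP i (exist _ _ fi) M M0 (fun v g vN => (parts v g vN).2) w x wN Kx.
have le : B i * M <= SB * M.
  by apply: ler_wpM2r => //; rewrite /SB (bigD1 i) //= lerDl sumr_ge0.
by apply: norm_mkC_le; [exact: le_trans h1 le|exact: le_trans h2 le].
Qed.

Lemma fields_bounded_seminorm N C (u : Cinfty G -> Cx R) : 0 <= C ->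
  fields_bounded N C u -> seminorm_bounded u.
Proof.
move=> C0 uC; have [m [c [K [HK cov]]]] := finite_chart_cover G.
have one i : exists2 B, 0 <= B & forall (f : smoothR) M, 0 <= M ->
    (forall v x, (size v <= N)%N -> K i x ->
      `|iter_pd v (fun y => projT1 f (cinv (c i) y)) x| <= M) ->
    forall w x, (size w <= N)%N -> K i x -> `|rfw w (projT1 f) (cinv (c i) x)| <= B * M.
  by have [Ac cK Kc] := HK i; exact: rfw_by_iter_pd.
pose B i := s2val (cid2 (one i)).
have B0 i : 0 <= B i := s2valP (cid2 (one i)).
have BP i := s2valP' (cid2 (one i)).
pose SB := \sum_i B i; have SB0 : 0 <= SB by rewrite sumr_ge0.
exists m, c, K, N, (C * (2 * SB)); split=> // f M M0 HM.
rewrite -mulrA; apply: uC; first by rewrite !mulr_ge0.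
have Cf := (smooth_funP f).1 (CinftyP f).
have fr k : GCk k (fun x => re (f x)) by have [] := Cf k.
have fi k : GCk k (fun x => im (f x)) by have [] := Cf k.
move=> w g wN; have [i [x [Kx <-]]] := cov g.
rewrite crfwE -mulrA.
have le : B i * M <= SB * M.
  by apply: ler_wpM2r => //; rewrite /SB (bigD1 i) //= lerDl sumr_ge0.
have parts v y : (size v <= N)%N -> K i y ->
    `|iter_pd v (fun y => re (f (cinv (c i) y))) y| <= M /\
    `|iter_pd v (fun y => im (f (cinv (c i) y))) y| <= M.
  by move=> vN Ky; have := HM i v y vN Ky => /norm_re_le[].
have h1 := BP i (exist _ _ fr) M M0 (fun v y vN Ky => (parts v y vN Ky).1) w x wN Kx.
have h2 := BP i (exist _ _ fi) M M0 (fun v y vN Ky => (parts v y vN Ky).2) w x wN Kx.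
by apply: norm_mkC_le; [exact: le_trans h1 le|exact: le_trans h2 le].
Qed.

End SeminormsByFields.

(** * Growth and decay of Fourier coefficients *)

Section FourierEstimates.
Context {R : realType} {n : nat} (G : compactLieGroup R n) (mu : haarMeasure G)
  (met : biinvariantMetric G).
Local Notation cint := (haar_int mu).
Local Notation Q := (invmx (gram0 met)).
Implicit Types xi eta : irrep G.

Lemma norm_toC (x : R) : `|toC x| = toC `|x|.
Proof.
have [h|/ltW h] := lerP 0 x; first by rewrite [in RHS]ger0_norm // ger0_norm // -toC0 toC_le.
by rewrite [in RHS]ler0_norm // toCN ler0_norm // -toC0 toC_le.
Qed.

Lemma crf_row xi i (v : 'rV[Cx R]_(rdim xi)) l g :
  crf i (fun x => (v *m xi x) 0 l) g = (v *m gen xi i *m xi g) 0 l.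
Proof.
have C p q : CGk 1 (fun g => xi g p q) by exact: (rep_CGk mu met).
have -> : (fun x => (v *m xi x) 0 l) = fun x => \sum_m v 0 m * xi x m l.
  by apply/funext => x; rewrite mxE.
rewrite crf_sum => [|m]; last exact: CGkZ.
rewrite -mulmxA mxE; apply: eq_bigr => m _.
by rewrite crfZ // (crf_rep mu met).
Qed.

(** A row of the representation stays a combination of its rows, with norm
    controlled by [gen_bound]. *)
Lemma crfw_row xi w (v : 'rV[Cx R]_(rdim xi)) :
  exists2 v' : 'rV[Cx R]_(rdim xi),
    nrm2 v' <= ((cgram met * bracket met xi) ^+ 2) ^+ size w * nrm2 v &
    forall l g, crfw w (fun x => (v *m xi x) 0 l) g = (v' *m xi g) 0 l.
Proof.
elim: w => [|i w [v' v'v E]] /=; first by exists v; rewrite ?expr0 ?mul1r.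
exists (v' *m gen xi i).
  apply: le_trans (gen_bound_bracket mu met i v') _.
  by rewrite [_ ^+ (size w).+1]exprS -mulrA; apply: ler_wpM2l; [exact: sqr_ge0|exact: v'v].
by move=> l g; rewrite -crf_row; congr (crf i _ g); apply/funext => x; exact: E.
Qed.

Lemma rep_word_bounded xi k l N :
  word_bounded N (fun g => xi g k l) ((cgram met * bracket met xi) ^+ N).
Proof.
move=> w g wN; set s := _ * _.
have s1 : 1 <= s by rewrite mulr_ege1 ?cgram_ge1 // (bracket_ge1 mu).
have s0 : 0 <= s := le_trans ler01 s1.
have [v vs E] := crfw_row w (delta_mx 0 k : 'rV[Cx R]_(rdim xi)).
have -> : (fun g => xi g k l) = fun x => ((delta_mx 0 k : 'rV[Cx R]_(rdim xi)) *m xi x) 0 l.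
  by apply/funext => x; rewrite -rowE mxE.
rewrite E norm_le_normsq ?exprn_ge0 //.
apply: (@le_trans _ _ (nrm2 (v *m xi g))).
  by rewrite /nrm2 (bigD1 l) //= lerDl sumr_ge0 // => m _; exact: normsq_ge0.
rewrite nrm2_rep; apply: le_trans vs _.
have -> : nrm2 (delta_mx 0 k : 'rV[Cx R]_(rdim xi)) = 1.
  by rewrite -[delta_mx 0 k]mulmx1 -(rep1 xi) -rowE nrm2_row_rep.
by rewrite mulr1 -!exprM; apply: ler_weXn2l => //; rewrite mulnC leq_mul2r wN orbT.
Qed.

Lemma crfw_conj (w : seq 'I_n) (f : G -> Cx R) g : (forall k, CGk k f) -> crfw w (fun x => (f x)^*) g = (crfw w f g)^*.
Proof.
move=> Cf; elim: w g => [//|i w IH] g /=.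
by rewrite -crf_conj; [congr (crf i _ g); exact/funext|exact: CGk_crfw].
Qed.

Lemma conj_rep_word_bounded xi k l N :
  word_bounded N (fun g => (xi g k l)^*) ((cgram met * bracket met xi) ^+ N).
Proof.
move=> w g wN; rewrite crfw_conj ?norm_conjC; first exact: rep_word_bounded.
by move=> m; exact: (rep_CGk mu met).
Qed.

Lemma conj_entry_smooth xi k l : smooth_fun (fun g => (xi g k l)^*).
Proof. by apply: smooth_conj; exact: (rep_smooth mu met). Qed.

(** A distribution has finite order, and the derivatives of [xi] of that order
    are bounded by a power of [bracket]. *)
Lemma fourier_growth (u : distr G) : exists C N, 0 <= C /\
  forall xi k l, `|fourier u xi k l| <= toC (C * bracket met xi ^+ N).
Proof.
have [N [C [C0 uC]]] := distr_fields_bounded met u.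
have c0 : 0 <= cgram met := le_trans ler01 (cgram_ge1 met).
exists (C * cgram met ^+ N), N; split=> [|xi k l]; first by rewrite mulr_ge0 ?exprn_ge0.
have b0 : 0 <= bracket met xi := le_trans ler01 (bracket_ge1 mu met xi).
rewrite mxE -mulrA -exprMn; apply: uC; first by rewrite exprn_ge0 // mulr_ge0.
rewrite to_CinftyE; last exact: conj_entry_smooth.
exact: conj_rep_word_bounded.
Qed.

Lemma cint_crf i (f : G -> Cx R) : CGk 1 f -> cint (crf i f) = 0.
Proof.
move=> [fr fi]; rewrite cintE /=.
have -> : hint mu (fun x => rfield i (fun x => re (f x)) x) = 0 by exact: (hint_rfield mu met).
have -> : hint mu (fun x => rfield i (fun x => im (f x)) x) = 0 by exact: (hint_rfield mu met).
by [].
Qed.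

Lemma crf_ccont i (f : G -> Cx R) : CGk 1 f -> ccont (crf i f).
Proof. by move=> Cf; exact: (CGk_ccont (CGk_crf (k := 0) i Cf)). Qed.

Lemma cint_by_parts i (f h : G -> Cx R) : CGk 1 f -> CGk 1 h ->
  cint (fun g => crf i f g * h g) = - cint (fun g => f g * crf i h g).
Proof.
move=> Cf Ch; apply/eqP; rewrite -addr_eq0 -cintD; last 2 first.
- by apply: ccontM; [exact: crf_ccont|exact: CGk_ccont Ch].
- by apply: ccontM; [exact: CGk_ccont Cf|exact: crf_ccont].
apply/eqP; rewrite -[RHS](cint_crf i (CGkM Cf Ch)); congr (haar_int mu _).
by apply/funext => g; rewrite crfM.
Qed.

(** The operator [1 - Laplacian], under which the entries of [xi] are multiplied
    by [bracket xi ^+ 2]. *)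
Definition lap1 (f : G -> Cx R) (g : G) : Cx R :=
  f g - \sum_i \sum_j toC (Q i j) * crf i (crf j f) g.

Lemma CGk_lap1 f : (forall k, CGk k f) -> forall k, CGk k (lap1 f).
Proof.
move=> Cf k; have -> : lap1 f = fun g => f g + -1 * \sum_i \sum_j toC (Q i j) * crf i (crf j f) g.
  by apply/funext => g; rewrite mulN1r.
apply: CGkD => //; apply: CGkZ; do 2 (apply: CGk_sum => ?); apply: CGkZ.
exact: (CGk_crf _ (CGk_crf _ (Cf _))).
Qed.

Lemma cint_lap1 f xi k l : (forall k, CGk k f) ->
  cint (fun g => lap1 f g * xi g k l) = toC (bracket met xi ^+ 2) * cint (fun g => f g * xi g k l).
Proof.
move=> Cf; have Cx' m p q : CGk m (fun g => xi g p q) by exact: (rep_CGk mu met).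
have cf : ccont f := CGk_ccont (Cf 0%N).
have cx p q : ccont (fun g => xi g p q) := CGk_ccont (Cx' 0%N p q).
have C1 j : CGk 1 (crf j f) by exact: CGk_crf.
have C2 i : CGk 1 (crf i (fun g => xi g k l)) by exact: CGk_crf.
have c2 i j : ccont (crf i (crf j f)) by exact: crf_ccont.
have c3 i j : ccont (crf j (crf i (fun g => xi g k l))) by exact: crf_ccont.
have swap i j : cint (fun g => crf i (crf j f) g * xi g k l) =
    cint (fun g => f g * crf j (crf i (fun g => xi g k l)) g).
  by rewrite (cint_by_parts i (C1 j) (Cx' 1%N k l)) (cint_by_parts j (Cf 1%N) (C2 i)) opprK.
have -> : (fun g => lap1 f g * xi g k l) = fun g => f g * xi g k l -
    \sum_i \sum_j toC (Q i j) * (crf i (crf j f) g * xi g k l).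
  apply/funext => g; rewrite mulrBl mulr_suml; congr (_ - _); apply: eq_bigr => i _.
  by rewrite mulr_suml; apply: eq_bigr => j _; rewrite mulrA.
have cM i j : ccont (fun g => toC (Q i j) * (crf i (crf j f) g * xi g k l)).
  by apply: ccontZ; exact: ccontM.
rewrite cintB; [|exact: ccontM|by do 2 (apply: ccont_sum => ?)].
rewrite (bracket_sqr mu) toCD toC1 toCN mulrBl mul1r; congr (_ - _).
rewrite -cintZ; last exact: ccontM.
have -> : (fun g => toC (eigval mu met xi) * (f g * xi g k l)) =
    fun g => \sum_i \sum_j toC (Q i j) * (f g * crf i (crf j (fun g => xi g k l)) g).
  apply/funext => g; rewrite mulrCA -crf_casimir mulr_sumr; apply: eq_bigr => i _.
  by rewrite mulr_sumr; apply: eq_bigr => j _; rewrite mulrCA.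
have cM' i j : ccont (fun g => toC (Q i j) * (f g * crf i (crf j (fun g => xi g k l)) g)).
  by apply: ccontZ; exact: ccontM.
rewrite cint_sum => [|i]; last by apply: ccont_sum.
rewrite [RHS]cint_sum => [|i]; last by apply: ccont_sum.
under eq_bigr do rewrite cint_sum //; under [RHS]eq_bigr do rewrite cint_sum //.
rewrite [RHS]exchange_big /=; apply: eq_bigr => i _; apply: eq_bigr => j _.
rewrite cintZ; last exact: ccontM.
rewrite cintZ; last exact: ccontM.
by rewrite swap (Qsym met j i).
Qed.

Lemma crfw_cat (v w : seq 'I_n) (f : G -> Cx R) : crfw (v ++ w) f = crfw v (crfw w f).
Proof. exact: foldr_cat. Qed.

Lemma crfwD (w : seq 'I_n) (f h : G -> Cx R) g : (forall k, CGk k f) -> (forall k, CGk k h) ->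
  crfw w (fun x => f x + h x) g = crfw w f g + crfw w h g.
Proof.
move=> Cf Ch; elim: w g => [//|i w IH] g /=.
by rewrite -crfD; [congr (crf i _ g); exact/funext|exact: CGk_crfw|exact: CGk_crfw].
Qed.

Lemma crfwZ (w : seq 'I_n) (a : Cx R) (f : G -> Cx R) g : (forall k, CGk k f) ->
  crfw w (fun x => a * f x) g = a * crfw w f g.
Proof.
move=> Cf; elim: w g => [//|i w IH] g /=.
by rewrite -crfZ; [congr (crf i _ g); exact/funext|exact: CGk_crfw].
Qed.

Lemma crfw_sum (w : seq 'I_n) I (r : seq I) (f : I -> G -> Cx R) g : (forall i k, CGk k (f i)) ->
  crfw w (fun x => \sum_(i <- r) f i x) g = \sum_(i <- r) crfw w (f i) g.
Proof.
move=> Cf; elim: w g => [//|i w IH] g /=.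
rewrite -crf_sum => [|j]; last exact: CGk_crfw.
by congr (crf i _ g); exact/funext.
Qed.

Definition lap_const : R := 1 + \sum_i \sum_j `|Q i j|.

Lemma lap1_word_bounded N f M : (forall k, CGk k f) -> word_bounded N.+2 f M ->
  word_bounded N (lap1 f) (lap_const * M).
Proof.
move=> Cf fM w g wN.
have Cij i j k : CGk k (crf i (crf j f)) by exact: (CGk_crf _ (CGk_crf _ (Cf _))).
have CZ i j k : CGk k (fun x => toC (Q i j) * crf i (crf j f) x) by exact: CGkZ.
have CS k : CGk k (fun x => \sum_i \sum_j toC (Q i j) * crf i (crf j f) x).
  by do 2 (apply: CGk_sum => ?).
have -> : lap1 f = fun x => f x + -1 * \sum_i \sum_j toC (Q i j) * crf i (crf j f) x.
  by apply/funext => x; rewrite mulN1r.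
rewrite crfwD //; last by move=> k; exact: CGkZ.
rewrite crfwZ // crfw_sum => [|i k]; last exact: CGk_sum.
rewrite mulN1r; apply: le_trans (ler_normB _ _) _.
rewrite mulrDl mul1r toCD; apply: lerD.
  by apply: fM; rewrite (leq_trans wN) // leqW // leqW.
rewrite mulr_suml toC_sum; apply: le_trans (ler_norm_sum _ _ _) _; apply: ler_sum => i _.
rewrite crfw_sum //; rewrite mulr_suml toC_sum; apply: le_trans (ler_norm_sum _ _ _) _.
apply: ler_sum => j _; rewrite crfwZ // normrM toCM.
have -> : `|toC (Q i j)| = toC `|Q i j| by exact: norm_toC.
apply: ler_wpM2l; first by rewrite -toC0 toC_le.
have -> : crfw w (crf i (crf j f)) g = crfw (w ++ [:: i; j]) f g by rewrite crfw_cat.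
by apply: fM; rewrite size_cat addn2 !ltnS.
Qed.

(** [lap1] is symmetric: its powers are moved from the entry to [f]. *)
Lemma fourier_decay N : exists2 K : R, 0 <= K & forall f M, (forall k, CGk k f) -> 0 <= M ->
  word_bounded N.*2 f M -> forall xi k l,
  `|cint (fun g => f g * xi g k l)| <= toC (K * M * (bracket met xi ^+ N.*2)^-1).
Proof.
have lc0 : 0 <= lap_const by rewrite addr_ge0 //; do 2 (apply: sumr_ge0 => ? _).
exists (2 * lap_const ^+ N); first by rewrite mulr_ge0 // exprn_ge0.
move=> f M Cf M0 fM xi k l.
have b0 : 0 < bracket met xi := lt_le_trans ltr01 (bracket_ge1 mu met xi).
have C_iter j m : CGk m (iter j lap1 f).
  by elim: j m => [|j IH] m //; exact: CGk_lap1.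
have int_iter j : cint (fun g => iter j lap1 f g * xi g k l) =
    toC (bracket met xi ^+ j.*2) * cint (fun g => f g * xi g k l).
  elim: j => [|j IH]; first by rewrite toC1 mul1r.
  by rewrite (cint_lap1 k l (C_iter j)) IH mulrA -toCM -exprD.
have wb j : (j <= N)%N -> word_bounded (N - j).*2 (iter j lap1 f) (lap_const ^+ j * M).
  elim: j => [|j IH] jN; first by rewrite subn0 mul1r.
  rewrite exprS -mulrA; apply: (lap1_word_bounded (C_iter j)).
  by have := IH (ltnW jN); rewrite (_ : (N - j).*2 = ((N - j.+1).*2).+2) // -doubleS -subSn.
have := wb N (leqnn N); rewrite subnn => /(_ [::]) wbN.
have cx : ccont (fun g => xi g k l) by exact: rep_ccont.
have cN : ccont (iter N lap1 f) := CGk_ccont (C_iter N 0%N).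
have : `|cint (fun g => iter N lap1 f g * xi g k l)| <= toC (2 * (lap_const ^+ N * M)).
  apply: cint_norm_le; first exact: ccontM.
  move=> g; rewrite normrM -[leRHS]mulr1; apply: ler_pM => //; first exact: wbN.
  have := @rep_word_bounded xi k l 0 [::] g isT.
  by rewrite /= expr0 toC1.
have bN : 0 < bracket met xi ^+ N.*2 by rewrite exprn_gt0.
rewrite int_iter normrM norm_toC (ger0_norm (ltW bN)).
have bC : 0 < toC (bracket met xi ^+ N.*2) by rewrite lt_def -toC0 toC_le (ltW bN) andbT;
  apply/eqP => /toC_inj h; move: bN; rewrite h ltxx.
rewrite -ler_pdivlMl // => h; apply: le_trans h _.
rewrite le_eqVlt; apply/orP; left; apply/eqP; rewrite -[LHS]mulrC; apply: (mulIf (lt0r_neq0 bC)).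
by rewrite divfK ?lt0r_neq0 // -toCM divfK ?lt0r_neq0 // mulrA.
Qed.

End FourierEstimates.

(** * Uniqueness of Fourier coefficients *)

Section Uniqueness.
Context {R : realType} {n : nat} (G : compactLieGroup R n) (mu : haarMeasure G)
  (met : biinvariantMetric G).
Local Notation cint := (haar_int mu).
Implicit Types xi eta : irrep G.

Lemma rfield_smear i (a psi : G -> R) x : continuous a -> GCk 1 psi ->
  rfield i (smear mu a psi) x = smear mu a (rfield i psi) x.
Proof.
move=> ca Cpsi; have [c Ac cx] := atlas_cover (clg_atlas G) x.
have cz := chart_ccod cx; have Cs := GCk_smear mu met ca Cpsi.
rewrite -(cmapK cx) (rfield_frame i Cs Ac cz).
under eq_bigr => k _ do rewrite (derive_val (is_derive := smear_is_derive mu met k ca Cpsi Ac cz)) mulr_sumr.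
rewrite exchange_big /= -[RHS](mul1r).
have fE j : \sum_k frame c (c x) i k * (coframe met c (c x) k j * smear mu a (rfield j psi) (cinv c (c x))) =
    (i == j)%:R * smear mu a (rfield j psi) (cinv c (c x)).
  have /matrixP/(_ i j) := frameK met Ac cz; rewrite !mxE => <-.
  by rewrite mulr_suml; apply: eq_bigr => k _; rewrite mulrA.
rewrite (eq_bigr _ (fun j _ => fE j)) (bigD1 i) //= eqxx big1 ?addr0 //.
by move=> j ji; rewrite eq_sym (negbTE ji) mul0r.
Qed.

Definition csmear (a psi : G -> Cx R) (x : G) : Cx R := cint (fun g => a g * psi (x * g)%g).

Lemma csmearE a psi x : ccont a -> ccont psi -> csmear a psi x =
  mkC (smear mu (fun g => re (a g)) (fun g => re (psi g)) x
         + -1 * smear mu (fun g => im (a g)) (fun g => im (psi g)) x)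
      (smear mu (fun g => re (a g)) (fun g => im (psi g)) x
         + smear mu (fun g => im (a g)) (fun g => re (psi g)) x).
Proof.
move=> [ar ai] [pr p_i]; rewrite /csmear cintE; congr mkC.
  rewrite mulN1r -hintB; first by congr (hint mu _); apply/funext => g; rewrite re_mul.
    exact: (@contM _ _ _ _ _ ar (@cont_lshift _ _ _ x _ pr)).
  exact: (@contM _ _ _ _ _ ai (@cont_lshift _ _ _ x _ p_i)).
rewrite -hintD; first by congr (hint mu _); apply/funext => g; rewrite im_mul.
  exact: (@contM _ _ _ _ _ ar (@cont_lshift _ _ _ x _ p_i)).
exact: (@contM _ _ _ _ _ ai (@cont_lshift _ _ _ x _ pr)).
Qed.

Lemma CGk_csmear k a psi : ccont a -> CGk k psi -> CGk k (csmear a psi).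
Proof.
move=> ca Cpsi; have cpsi := CGk_ccont Cpsi.
have -> : csmear a psi = fun x => mkC
   (smear mu (fun g => re (a g)) (fun g => re (psi g)) x
         + -1 * smear mu (fun g => im (a g)) (fun g => im (psi g)) x)
   (smear mu (fun g => re (a g)) (fun g => im (psi g)) x
         + smear mu (fun g => im (a g)) (fun g => re (psi g)) x).
  by apply/funext => x; exact: csmearE.
move: ca Cpsi => [ar ai] [pr p_i]; split => /=.
  by apply: GCkD; [exact: (GCk_smear mu met)|apply: GCkZ; exact: (GCk_smear mu met)].
by apply: GCkD; exact: (GCk_smear mu met).
Qed.

Lemma crf_csmear i a psi x : ccont a -> CGk 1 psi ->
  crf i (csmear a psi) x = csmear a (crf i psi) x.
Proof.
move=> ca Cpsi; have cpsi := CGk_ccont Cpsi.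
have cc : ccont (crf i psi) by exact: crf_ccont.
rewrite (csmearE x ca cc).
have -> : csmear a psi = fun x => mkC
   (smear mu (fun g => re (a g)) (fun g => re (psi g)) x
         + -1 * smear mu (fun g => im (a g)) (fun g => im (psi g)) x)
   (smear mu (fun g => re (a g)) (fun g => im (psi g)) x
         + smear mu (fun g => im (a g)) (fun g => re (psi g)) x).
  by apply/funext => y; exact: csmearE.
move: ca Cpsi => [ar ai] [pr p_i]; rewrite /crf /=.
have Sm (u v : G -> R) : continuous u -> GCk 1 v -> GCk 1 (smear mu u v).
  by move=> cu Cv; exact: (GCk_smear mu met).
rewrite (rfieldD i x (Sm _ _ ar pr) (GCkZ (-1) (Sm _ _ ai p_i))).
rewrite (rfieldZ i (-1) x (Sm _ _ ai p_i)) (rfieldD i x (Sm _ _ ar p_i) (Sm _ _ ai pr)).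
by rewrite (rfield_smear i x ar pr) (rfield_smear i x ai p_i) (rfield_smear i x ar p_i)
  (rfield_smear i x ai pr).
Qed.

Lemma crfw_csmear w a psi x : ccont a -> (forall k, CGk k psi) ->
  crfw w (csmear a psi) x = csmear a (crfw w psi) x.
Proof.
move=> ca Cpsi; elim: w x => [//|i w IH] x /=.
rewrite -crf_csmear //; last exact: CGk_crfw.
by congr (crf i _ x); exact/funext.
Qed.

Lemma crfw_rtranslate (w : seq 'I_n) (f : G -> Cx R) h g :
  crfw w (fun x => f (x * h)%g) g = crfw w f (g * h)%g.
Proof.
elim: w g => [//|i w IH] g /=; rewrite -crf_rtranslate.
by congr (crf i _ g); apply/funext => x; rewrite IH.
Qed.

Lemma crfw_translate_diff (w : seq 'I_n) (psi : G -> Cx R) a1 a2 g1 g2 y :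
  (forall k, CGk k psi) ->
  crfw w (fun x => a1 * psi (x * g1)%g - a2 * psi (x * g2)%g) y =
  a1 * crfw w psi (y * g1)%g - a2 * crfw w psi (y * g2)%g.
Proof.
move=> Cpsi; have CT g k : CGk k (fun x => psi (x * g)%g) by exact: CGk_rtranslate.
have -> : (fun x => a1 * psi (x * g1)%g - a2 * psi (x * g2)%g) =
    fun x => a1 * psi (x * g1)%g + - a2 * psi (x * g2)%g.
  by apply/funext => x; rewrite mulNr.
rewrite crfwD; [|by move=> k; exact: CGkZ..].
by rewrite crfwZ // crfwZ // !crfw_rtranslate mulNr.
Qed.

Lemma translate_words_near N (a psi : G -> Cx R) h0 e : 0 < e -> ccont a ->
  (forall k, CGk k psi) ->
  \forall h \near h0, word_bounded N (fun x => a h * psi (x * h)%g - a h0 * psi (x * h0)%g) (2 * e).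
Proof.
move=> e0 ca Cpsi; have FG := nbhs_filter h0.
pose F w (p : G * G) := a p.1 * crfw w psi (p.2 * p.1)%g.
have CF w : continuous (fun p => re (F w p)) /\ continuous (fun p => im (F w p)).
  have [cr ci] : ccont (crfw w psi) := CGk_ccont (CGk_crfw 0%N w Cpsi).
  have [ar ai] := ca.
  have cm : continuous (fun p : G * G => (p.2 * p.1)%g).
    by apply: cont_mul2; [exact: cont_snd2|exact: cont_fst2].
  have key (u v u' v' : G -> R) (s : R) : continuous u -> continuous v -> continuous u' -> continuous v' ->
      continuous (fun p : G * G => u p.1 * v (p.2 * p.1)%g + s * (u' p.1 * v' (p.2 * p.1)%g)).
    move=> cu cv cu' cv' p.
    have c1 : continuous (fun p : G * G => u p.1 * v (p.2 * p.1)%g).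
      by apply: contMX; [exact: cont_pull (@cont_fst2 _)|exact: cont_pull cm].
    have c2 : continuous (fun p : G * G => u' p.1 * v' (p.2 * p.1)%g).
      by apply: contMX; [exact: cont_pull (@cont_fst2 _)|exact: cont_pull cm].
    apply: (@continuousD _ _ _ (fun p : G * G => u p.1 * v (p.2 * p.1)%g)); first exact: c1.
    by apply: (@continuousM _ _ (cst s) (fun p : G * G => u' p.1 * v' (p.2 * p.1)%g));
      [exact: cst_continuous|exact: c2].
  split.
    have -> : (fun p => re (F w p)) = fun p : G * G => re (a p.1) * re (crfw w psi (p.2 * p.1)%g)
        + -1 * (im (a p.1) * im (crfw w psi (p.2 * p.1)%g)).
      by apply/funext => p; rewrite re_mul mulN1r.
    exact: (key (fun g => re (a g)) (fun g => re (crfw w psi g)) (fun g => im (a g)) (fun g => im (crfw w psi g))).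
  have -> : (fun p => im (F w p)) = fun p : G * G => re (a p.1) * im (crfw w psi (p.2 * p.1)%g)
      + 1 * (im (a p.1) * re (crfw w psi (p.2 * p.1)%g)).
    by apply/funext => p; rewrite im_mul mul1r.
  exact: (key (fun g => re (a g)) (fun g => im (crfw w psi g)) (fun g => im (a g)) (fun g => re (crfw w psi g))).
have step w : \forall h \near h0, forall x, `|re (F w (h, x)) - re (F w (h0, x))| <= e /\
    `|im (F w (h, x)) - im (F w (h0, x))| <= e.
  have [cr ci] := CF w.
  have h1 := near_unif h0 cr e0; have h2 := near_unif h0 ci e0.
  by apply: (@filterS2 _ _ FG _ _ _ _ h1 h2) => h H1 H2 x; split; [exact: H1|exact: H2].
have all_step : \forall h \near h0, forall (k : 'I_N.+1) (t : k.-tuple 'I_n) x,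
    `|re (F t (h, x)) - re (F t (h0, x))| <= e /\ `|im (F t (h, x)) - im (F t (h0, x))| <= e.
  by apply: (filter_forall FG) => k; apply: (filter_forall FG) => t; exact: step.
apply: (@filterS _ _ FG _ _ _ all_step) => h H w x wN.
have wN' : (size w < N.+1)%N by [].
have [hr hi] := H (Ordinal wN') (in_tuple w) x.
rewrite crfw_translate_diff //.
rewrite [X in `|X|]Cx_eta; apply: norm_mkC_le.
  by rewrite reD reN.
by rewrite imD imN.
Qed.

Lemma distr_linear_sum (u : distr G) m (c : 'I_m -> Cx R) (f : 'I_m -> G -> Cx R) :
  (forall i, smooth_fun (f i)) ->
  u (to_Cinfty (fun x => \sum_i c i * f i x)) = \sum_i c i * u (to_Cinfty (f i)).
Proof.
move=> sf; have -> : to_Cinfty (fun x => \sum_i c i * f i x) = \sum_i c i *: to_Cinfty (f i).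
  apply/val_inj/funext => x; rewrite raddf_sum /= fct_sumE to_CinftyE; last first.
    by apply/smooth_funP => k; apply: CGk_sum => i; apply: CGkZ; exact: ((smooth_funP _).1 (sf i) k).
  by apply: eq_bigr => i _; rewrite /= !fctE to_CinftyE.
by rewrite linear_sum; apply: eq_bigr => i _; rewrite linearZ.
Qed.

(** The integral is approximated, together with all its derivatives up to a
    given order, by a finite sum of translates; a distribution may therefore be
    applied under the integral sign. *)
Lemma distr_csmear (u : distr G) (a psi : G -> Cx R) : ccont a -> (forall k, CGk k psi) ->
  let U g := u (to_Cinfty (fun x => psi (x * g)%g)) in
  ccont U /\ u (to_Cinfty (csmear a psi)) = cint (fun g => a g * U g).
Proof.
move=> ca Cpsi U; have [N [C [C0 uC]]] := distr_fields_bounded met u.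
have sT g : smooth_fun (fun x => psi (x * g)%g).
  by apply/smooth_funP => k; exact: CGk_rtranslate.
have uB f g M : smooth_fun f -> smooth_fun g -> 0 <= M -> word_bounded N (fun x => f x - g x) M ->
    `|u (to_Cinfty f) - u (to_Cinfty g)| <= toC (C * M).
  move=> sf sg M0 fgM; rewrite -linearB; apply: uC => //.
  by have -> : (to_Cinfty f - to_Cinfty g : Cinfty G) = (fun x => f x - g x) :> (G -> Cx R)
    by apply/funext => x; rewrite /= !fctE !to_CinftyE.
have C1 : 0 < C + 1 by rewrite ltr_wpDl.
have c1 : ccont (fun _ : G => 1 : Cx R) by exact: ccont_cst.
(* Translates depend continuously on the translation for all the seminorms. *)
have near_U h0 e : 0 < e -> \forall h \near h0, `|U h - U h0| <= toC e.
  move=> e0; pose e' := e / (2 * (C + 1)).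
  have e'0 : 0 < e' by rewrite divr_gt0 // mulr_gt0.
  apply: (@filterS _ _ (nbhs_filter h0) _ _ _ (translate_words_near N h0 e'0 c1 Cpsi)) => h.
  have -> : (fun x => 1 * psi (x * h)%g - 1 * psi (x * h0)%g) =
      fun x => psi (x * h)%g - psi (x * h0)%g by apply/funext => x; rewrite !mul1r.
  move=> hw; apply: le_trans (uB _ _ (2 * e') (sT h) (sT h0) _ hw) _.
    by rewrite mulr_ge0 // ltW.
  rewrite toC_le /e' (_ : C * (2 * (e / (2 * (C + 1)))) = e * (C / (C + 1))); last first.
    by field; rewrite lt0r_neq0.
  by apply: ler_piMr; [exact: ltW|rewrite ler_pdivrMr // mul1r lerDl].
have parts_le (z z' : Cx R) e : `|z - z'| <= toC e -> `|re z' - re z| <= e /\ `|im z' - im z| <= e.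
  by rewrite distrC => /norm_re_le; rewrite reD imD reN imN.
have cU : ccont U.
  split=> h0; apply/(@cvgrPdist_le _ _ _ _ (nbhs_filter h0)) => e e0;
    apply: (@filterS _ _ (nbhs_filter h0) _ _ _ (near_U h0 e e0)) => h /parts_le[] //.
split=> //.
have caU : ccont (fun g => a g * U g) by exact: ccontM.
have main e : 0 < e ->
    `|u (to_Cinfty (csmear a psi)) - cint (fun g => a g * U g)| <= toC (4 * (C + 1) * e).
  move=> e0; have e20 : 0 < 2 * e by rewrite mulr_gt0.
  pose Nh h := [set x' | word_bounded N (fun x => a x' * psi (x * x')%g - a h * psi (x * h)%g) (2 * e) /\
    (`|re (a h * U h) - re (a x' * U x')| <= 2 * e /\ `|im (a h * U h) - im (a x' * U x')| <= 2 * e)].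
  have nNh h : nbhs h (Nh h).
    have h1 := translate_words_near N h e0 ca Cpsi; have [cr ci] := caU.
    have h2 := (@cvgrPdist_le _ _ _ _ (nbhs_filter h) _ _).1 (cr h) _ e20.
    have h3 := (@cvgrPdist_le _ _ _ _ (nbhs_filter h) _ _).1 (ci h) _ e20.
    exact: filterI h1 (filterI h2 h3).
  have [m [t [g [t0 t1 quad]]]] := hint_quadrature mu nNh.
  have cq (F : G -> Cx R) : ccont F ->
      (forall h x', Nh h x' -> `|re (F x') - re (F h)| <= 2 * e /\ `|im (F x') - im (F h)| <= 2 * e) ->
      `|cint F - \sum_i toC (t i) * F (g i)| <= toC (2 * (2 * e)).
    move=> [cr ci] FN.
    have -> : cint F - \sum_i toC (t i) * F (g i) =
       mkC (hint mu (fun x => re (F x)) - \sum_i t i * re (F (g i)))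
           (hint mu (fun x => im (F x)) - \sum_i t i * im (F (g i))).
      rewrite cintE; apply: Cx_ext; rewrite ?reD ?imD ?reN ?imN ?re_sum ?im_sum /=.
        by congr (_ - _); apply: eq_bigr => i _; rewrite re_toCM.
      by congr (_ - _); apply: eq_bigr => i _; rewrite im_toCM.
    by apply: norm_mkC_le; [apply: (quad _ _ cr)|apply: (quad _ _ ci)] => h x' /FN[].
  have q1 := cq _ caU (fun h x' Nx => let: conj _ (conj A1 A2) := Nx in
    conj (eq_rect _ (fun z => z <= 2 * e) A1 _ (distrC _ _))
         (eq_rect _ (fun z => z <= 2 * e) A2 _ (distrC _ _))).
  (* A single quadrature serves the function [a * U] and all the derivatives of
  [csmear a psi] up to the order of [u]. *)
  pose T x := \sum_i (toC (t i) * a (g i)) * psi (x * g i)%g.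
  have sTi i k : CGk k (fun x => (toC (t i) * a (g i)) * psi (x * g i)%g).
    by apply: CGkZ; exact: CGk_rtranslate.
  have CTT k : CGk k T by exact: CGk_sum.
  have CS k : CGk k (csmear a psi) by exact: CGk_csmear.
  have wT : word_bounded N (fun x => csmear a psi x - T x) (2 * (2 * e)).
    move=> w y wN.
    have -> : (fun x => csmear a psi x - T x) = fun x => csmear a psi x + -1 * T x.
      by apply/funext => x; rewrite mulN1r.
    rewrite crfwD //; last by move=> k; exact: CGkZ.
    rewrite crfwZ // mulN1r crfw_csmear // /T crfw_sum //.
    have -> : \sum_i crfw w (fun x => (toC (t i) * a (g i)) * psi (x * g i)%g) y =
        \sum_i toC (t i) * (a (g i) * crfw w psi (y * g i)%g).
      apply: eq_bigr => i _; rewrite crfwZ; last by move=> k; exact: CGk_rtranslate.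
      by rewrite crfw_rtranslate mulrA.
    have cw : ccont (crfw w psi) := CGk_ccont (CGk_crfw 0%N w Cpsi).
    apply: (cq (fun h => a h * crfw w psi (y * h)%g)); first by apply: ccontM => //; exact: ccont_lshift.
    move=> h x' [+ _] => /(_ w y wN); rewrite crfw_translate_diff // distrC => /parts_le[? ?].
    by split.
  have uT : u (to_Cinfty T) = \sum_i toC (t i) * (a (g i) * U (g i)).
    by rewrite (distr_linear_sum u (fun i => toC (t i) * a (g i)) (fun i => sT (g i)));
       apply: eq_bigr => i _; rewrite mulrA.
  have q2 : `|u (to_Cinfty (csmear a psi)) - u (to_Cinfty T)| <= toC (C * (2 * (2 * e))).
    by apply: uB => //; [exact/smooth_funP|exact/smooth_funP|rewrite mulr_ge0 // ltW].
  rewrite uT in q2; set X := \sum_i _ in q1 q2.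
  rewrite -(subrK X (u _)) -addrA; apply: le_trans (ler_normD _ _) _.
  apply: (@le_trans _ _ (toC (C * (2 * (2 * e))) + toC (2 * (2 * e)))).
    by apply: lerD => //; rewrite distrC.
  by rewrite -toCD toC_le; nra.
have [r r0 rE] := normC_toC (u (to_Cinfty (csmear a psi)) - cint (fun g => a g * U g)).
apply/eqP; rewrite -subr_eq0 -normr_eq0 rE; apply/eqP; rewrite -toC0; congr toC.
apply/eqP; rewrite eq_le r0 andbT; apply/ler_addgt0Pr => e e0; rewrite add0r.
have K0 : 0 < 4 * (C + 1) by rewrite mulr_gt0.
have := main (e / (4 * (C + 1))); rewrite divr_gt0 // rE toC_le => /(_ isT).
by rewrite mulrC divfK // lt0r_neq0.
Qed.

(** Smearing by an entry is a combination of conjugate entries, whose pairings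
    with a distribution are Fourier coefficients. *)
Lemma csmear_rep xi k l psi x : ccont psi ->
  csmear (fun g => xi g k l) psi x =
  \sum_m cint (fun g => xi g m l * psi g) * (xi x m k)^*.
Proof.
move=> cpsi; have cx a b : ccont (fun g => xi g a b) by exact: rep_ccont.
rewrite /csmear -(cint_left mu x^-1%g); last by apply: ccontM => //; exact: ccont_lshift.
have -> : (fun g => xi (x^-1 * g)%g k l * psi (x * (x^-1 * g))%g) =
    fun g => \sum_m (xi x m k)^* * (xi g m l * psi g).
  apply/funext => g; rewrite mulVKg repM mxE mulr_suml; apply: eq_bigr => m _.
  by rewrite rep_inv mulrA.
rewrite cint_sum => [|m]; last by apply: ccontZ; exact: ccontM.
by apply: eq_bigr => m _; rewrite cintZ; [rewrite mulrC|exact: ccontM].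
Qed.

(** The translates of [u] against a test function form a continuous function,
    all of whose matrix coefficients are combinations of Fourier coefficients of
    [u]; by [peter_weyl] it vanishes. *)
Lemma fourier_eq0 (u : distr G) : (forall xi, fourier u xi = 0) -> u = 0.
Proof.
move=> u0; apply/val_inj/funext => psi; change (u psi = 0).
have Cpsi := (smooth_funP psi).1 (CinftyP psi).
pose U g := u (to_Cinfty (fun x => psi (x * g)%g)).
have [cU _] := distr_csmear u (ccont_cst _ 0) Cpsi.
have U0 g : U g = 0.
  apply: (@peter_weyl _ _ _ mu U cU) => xi k l.
  have [_ E] := distr_csmear u (@rep_ccont _ _ _ xi k l) Cpsi.
  under eq_fun do rewrite mulrC; rewrite -E.
  have -> : csmear (fun g => xi g k l) psi =
      fun x => \sum_m cint (fun g => xi g m l * psi g) * (xi x m k)^*.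
    by apply/funext => x; apply: csmear_rep; exact: CGk_ccont (Cpsi 0%N).
  rewrite (distr_linear_sum u); last by move=> m; exact: (conj_entry_smooth mu met).
  rewrite big1 // => m _; have /matrixP/(_ k m) := u0 xi; rewrite !mxE => ->.
  by rewrite mulr0.
rewrite -[RHS](U0 1%g) /U; congr (u _); apply/val_inj; rewrite /= to_CinftyE.
  by apply/funext => x; rewrite mulg1.
by apply/smooth_funP => k; exact: CGk_rtranslate.
Qed.

End Uniqueness.

(** * Fourier partial sums *)

Section UltraLimits.
Context {R : realType} (I : Type) (U : set_system I) (UU : UltraFilter U).

Lemma ultra_fmap (V : Type) (v : I -> V) : UltraFilter (v @ U).
Proof.
split=> [|F FF vF]; first exact: fmap_proper_filter.
rewrite predeqE => A; split=> [FA|]; last exact: vF.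
have [//|nA] := in_ultra_setVsetC (v @^-1` A) UU.
have FnA : F (~` A) by apply: vF; rewrite /fmap /= preimage_setC.
by have [x []] := filter_ex (filterI FA FnA).
Qed.

Lemma ultra_bounded_cvg (v : I -> R) B : (forall s, `|v s| <= B) ->
  exists l : R, v s @[s --> U] --> l.
Proof.
move=> vB; have cB := @segment_compact R (- B) B.
have {}cB : [set A : set R | forall F : set_system R, UltraFilter F -> F A ->
    A `&` [set p | F --> p] !=set0] `[- B, B]%classic by rewrite -compact_ultra.
have [] := cB (v @ U) (@ultra_fmap _ v).
  by apply: (@filterS _ U _ setT) filterT => s _ /=; rewrite in_itv /= -ler_norml.
by move=> l [_ h]; exists l.
Qed.

Lemma ultra_norm_le (v : I -> R) B l : (forall s, `|v s| <= B) ->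
  v s @[s --> U] --> l -> `|l| <= B.
Proof.
move=> vB vl; apply: (@closed_cvg _ _ U _ v (fun x => `|x| <= B)) vl => //.
  apply: (@closed_comp _ _ (fun x : R => `|x|) [set x | x <= B]); last exact: closed_le.
  by move=> x _; exact: norm_continuous.
by apply: (@filterS _ U _ setT) filterT => s _; exact: vB.
Qed.

End UltraLimits.

Lemma Cx_cvg (R : realType) (I : Type) (U : set_system I) (FU : Filter U) (v : I -> Cx R) (z : Cx R) :
  re (v s) @[s --> U] --> re z -> im (v s) @[s --> U] --> im z ->
  v s @[s --> U] --> z.
Proof.
move=> hr hi; apply/cvgrPdist_le => e e0.
have [r _ eE] := normC_toC e; rewrite gtr0_norm // in eE; rewrite eE.
have r0 : 0 < r / 2.
  rewrite divr_gt0 // lt_def; move: e0; rewrite eE lt_def -toC0 toC_le => /andP[+ ->].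
  by rewrite andbT; apply: contraNN => /eqP ->.
have h1 := (@cvgrPdist_le _ _ _ _ FU _ _).1 hr _ r0.
have h2 := (@cvgrPdist_le _ _ _ _ FU _ _).1 hi _ r0.
apply: filterS2 h1 h2 => s h1 h2.
have -> : z - v s = mkC (re z - re (v s)) (im z - im (v s)).
  by apply: Cx_ext; rewrite ?reD ?imD ?reN ?imN.
by apply: le_trans (norm_mkC_le h1 h2) _; rewrite toC_le; lra.
Qed.

Section Synthesis.
Context {R : realType} {n : nat} (G : compactLieGroup R n) (mu : haarMeasure G)
  (met : biinvariantMetric G).
Local Notation cint := (haar_int mu).
Implicit Types xi eta : irrep G.

Lemma toC_natM m (x : R) : toC (m%:R * x) = toC x *+ m.
Proof. by rewrite toCM toC_nat mulr_natl. Qed.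

Definition entry xi (k l : 'I_(rdim xi)) : Cinfty G := to_Cinfty (fun g => xi g k l).
Definition conj_entry xi (k l : 'I_(rdim xi)) : Cinfty G := to_Cinfty (fun g => (xi g k l)^*).

Lemma entryE xi (k l : 'I_(rdim xi)) : (entry k l : G -> Cx R) = fun g => xi g k l.
Proof. by rewrite to_CinftyE //; exact: (rep_smooth mu met). Qed.

Lemma conj_entryE xi (k l : 'I_(rdim xi)) : (conj_entry k l : G -> Cx R) = fun g => (xi g k l)^*.
Proof. by rewrite to_CinftyE //; exact: (conj_entry_smooth mu met). Qed.

Lemma Cinfty_ccont (f : Cinfty G) : ccont (f : G -> Cx R).
Proof. exact: CGk_ccont ((smooth_funP f).1 (CinftyP f) 0%N). Qed.

Lemma distr_of_sum I (r : seq I) (c : I -> Cx R) (f : I -> Cinfty G) :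
  distr_of mu (\sum_(i <- r) c i *: f i) = \sum_(i <- r) c i *: distr_of mu (f i).
Proof.
have evE (u : I -> distr G) (s : seq I) psi : (\sum_(i <- s) u i : distr G) psi = \sum_(i <- s) u i psi.
  by elim: s => [|i s IH]; rewrite ?big_nil // !big_cons -IH.
apply/val_inj/funext => psi; change (cint (fun x => (\sum_(i <- r) c i *: f i) x * psi x) =
  (\sum_(i <- r) c i *: distr_of mu (f i) : distr G) psi).
rewrite evE; transitivity (cint (fun x => \sum_(i <- r) c i * (f i x * psi x))).
  congr (haar_int mu _); apply/funext => x.
  have -> : (\sum_(i <- r) c i *: f i) x = \sum_(i <- r) c i * f i x.
    by elim: r => [|i r IH]; rewrite ?big_nil // !big_cons -IH.
  by rewrite mulr_suml; apply: eq_bigr => i _; rewrite mulrA.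
have cf i : ccont (fun x => f i x * psi x) by apply: ccontM; exact: Cinfty_ccont.
rewrite cint_sum => [|i]; last exact: ccontZ.
by apply: eq_bigr => i _; rewrite cintZ.
Qed.

(** Testing a difference against its own conjugate. *)
Lemma distr_of_inj : injective (distr_of mu).
Proof.
move=> f h fh; have e (psi : Cinfty G) : cint (fun x => f x * psi x) = cint (fun x => h x * psi x).
  exact: (congr1 (fun u : distr G => u psi) fh).
have cf := Cinfty_ccont f; have ch := Cinfty_ccont h.
have cfh := ccontB cf ch.
apply/val_inj/funext => x; apply/eqP; rewrite -subr_eq0; apply/eqP; move: x.
apply: (cint_normsq_eq0 (mu := mu) cfh).
have E := e (conj_Cinfty (f - h)).
have cc : ccont (fun x => (f x - h x)^*) by exact: ccont_conj.
transitivity (cint (fun x => f x * (f x - h x)^*) - cint (fun x => h x * (f x - h x)^*)).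
  rewrite -cintB; [|exact: ccontM|exact: ccontM].
  by congr (haar_int mu _); apply/funext => x; rewrite mulrBl.
by apply/eqP; rewrite subr_eq0; apply/eqP.
Qed.

Variables (T : set (irrep G)).
Hypothesis hT : forall xi eta, T xi -> T eta -> equiv_rep xi eta -> xi = eta.

(** The partial sums [sum d tr (a xi)] of a Fourier series over a finite part of [T]. *)
Definition trig (a : forall xi, 'M[Cx R]_(rdim xi)) (s : seq (irrep G)) : Cinfty G :=
  \sum_(xi <- [seq xi <- undup s | `[< T xi >]]) (rdim xi)%:R *:
    \sum_k \sum_l a xi k l *: entry l k.

Lemma finite_part_inequiv s : inequiv [seq xi <- undup s | `[< T xi >]].
Proof.
split; first by rewrite filter_uniq // undup_uniq.
by move=> xi eta; rewrite !mem_filter => /andP[/asboolP Tx _] /andP[/asboolP Te _]; exact: hT.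
Qed.

Lemma trig_pairing a s psi : distr_of mu (trig a s) psi =
  \sum_(xi <- [seq xi <- undup s | `[< T xi >]]) (rdim xi)%:R *
    \sum_k \sum_l a xi k l * cint (fun g => psi g * xi g l k).
Proof.
rewrite /trig distr_of_sum.
have evE (I : Type) (r : seq I) (c : I -> Cx R) (u : I -> distr G) :
    (\sum_(i <- r) c i *: u i : distr G) psi = \sum_(i <- r) c i * u i psi.
  by elim: r => [|i r IH]; rewrite ?big_nil // !big_cons -IH.
rewrite evE; apply: eq_bigr => xi _; congr (_ * _).
have -> : \sum_k \sum_l a xi k l *: entry l k = \sum_k 1 *: \sum_l a xi k l *: entry l k.
  by apply: eq_bigr => k _; rewrite scale1r.
rewrite distr_of_sum evE; apply: eq_bigr => k _; rewrite mul1r distr_of_sum evE.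
apply: eq_bigr => l _; congr (_ * _); congr (haar_int mu _); apply/funext => g.
by rewrite mulrC entryE.
Qed.

Lemma trig_coefficient a s eta (k l : 'I_(rdim eta)) :
  (forall xi, T xi -> equiv_rep xi eta -> xi = eta) ->
  distr_of mu (trig a s) (conj_entry l k) =
  if (eta \in s) && `[< T eta >] then a eta k l else 0.
Proof.
move=> Te; rewrite trig_pairing.
have orth xi a' b' : xi != eta -> T xi -> cint (fun g => conj_entry l k g * xi g a' b') = 0.
  move=> ne Tx; have -> : (fun g => conj_entry l k g * xi g a' b') =
      fun g => xi g a' b' * (eta g l k)^* by apply/funext => g; rewrite conj_entryE mulrC.
  by apply: rep_orth_inequiv => /equiv_rep_sym /(Te _ Tx) e; rewrite e eqxx in ne.
have [es|es] := boolP (eta \in [seq xi <- undup s | `[< T xi >]]); last first.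
  rewrite (_ : (eta \in s) && _ = false); last by apply: negbTE; move: es; rewrite mem_filter mem_undup andbC.
  rewrite big_seq big1 // => xi xs; have ne : xi != eta by apply: contraNneq es => <-.
  have Tx : T xi by move: xs; rewrite mem_filter => /andP[/asboolP].
  by rewrite big1 ?mulr0 // => k' _; rewrite big1 // => l' _; rewrite orth ?mulr0.
have [us _] := finite_part_inequiv s.
rewrite (bigD1_seq eta) //= [X in _ + X]big_seq_cond [X in _ + X]big1 ?addr0; last first.
  move=> xi /andP[xs ne]; have Tx : T xi by move: xs; rewrite mem_filter => /andP[/asboolP].
  by rewrite big1 ?mulr0 // => k' _; rewrite big1 // => l' _; rewrite orth ?mulr0.
have -> : (eta \in s) && `[< T eta >] by move: es; rewrite mem_filter mem_undup andbC.
have E a' b' : cint (fun g => conj_entry l k g * eta g a' b') =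
    ((a' == l) && (b' == k))%:R / (rdim eta)%:R.
  rewrite -(rep_orth mu); congr (haar_int mu _); apply/funext => g.
  by rewrite conj_entryE mulrC.
rewrite (bigD1 k) //= [X in _ + X]big1 ?addr0; last first.
  by move=> k' kk; rewrite big1 // => l' _; rewrite E (negbTE kk) andbF mul0r mulr0.
rewrite (bigD1 l) //= [X in _ + X]big1 ?addr0; last first.
  by move=> l' ll; rewrite E (negbTE ll) mul0r mulr0.
rewrite E !eqxx mul1r mulrCA divff ?mulr1 //.
by rewrite pnatr_eq0 -lt0n rdim_gt0.
Qed.

(** The decay of the coefficients of a test function beats the growth of [a], of
    the dimensions, and the number of representations. *)
Lemma trig_bound (a : forall xi, 'M[Cx R]_(rdim xi)) (C : R) N : 0 <= C ->
  (forall xi k l, T xi -> `|a xi k l| <= toC (C * bracket met xi ^+ N)) ->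
  exists N' K, 0 <= K /\ forall s, fields_bounded N' K (distr_of mu (trig a s)).
Proof.
(* The exponents [N], [n] and [n.+1] come from the growth of [a], from a
surplus dimension factor and from [dim2_summable]. *)
move=> C0 aC; pose N0 := (N + n + 1)%N.
have [K1 K10 K1P] := fourier_decay mu met N0.
have [K2 K20 K2P] := dim_bound mu met.
have [K3 K30 K3P] := dim2_summable mu met.
exists N0.*2, (C * K1 * K2 * K3); split=> [|s psi M M0 psiM]; first by rewrite !mulr_ge0 // ltW.
have Cpsi := (smooth_funP psi).1 (CinftyP psi).
rewrite trig_pairing; apply: le_trans (ler_norm_sum _ _ _) _.
pose s' := [seq xi <- undup s | `[< T xi >]].
pose b xi := bracket met xi.
have b1 xi : 1 <= b xi by exact: (bracket_ge1 mu).
have b0 xi : 0 < b xi := lt_le_trans ltr01 (b1 xi).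
apply: (@le_trans _ _ (toC (\sum_(xi <- s') C * K1 * K2 * M * ((rdim xi)%:R ^+ 2 * (b xi ^+ n.+1)^-1)))).
  rewrite toC_sum big_seq [leRHS]big_seq; apply: ler_sum => xi; rewrite mem_filter => /andP[/asboolP Tx _].
  set d := rdim xi; rewrite normrM.
  have term k l : `|a xi k l * cint (fun g => psi g * xi g l k)| <=
      toC (C * b xi ^+ N * (K1 * M * (b xi ^+ N0.*2)^-1)).
    by rewrite normrM toCM; apply: ler_pM => //; [exact: aC|exact: K1P].
  set q := C * _ * _ in term.
  have h1 : `|\sum_k \sum_l a xi k l * cint (fun g => psi g * xi g l k)| <= toC (d%:R ^+ 2 * q).
    apply: le_trans (ler_norm_sum _ _ _) _.
    have -> : toC (d%:R ^+ 2 * q) = \sum_(k < d) toC (d%:R * q).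
      by rewrite sumr_const card_ord expr2 -mulrA toC_natM.
    apply: ler_sum => k _; apply: le_trans (ler_norm_sum _ _ _) _.
    have -> : toC (d%:R * q) = \sum_(l < d) toC q by rewrite sumr_const card_ord toC_natM.
    by apply: ler_sum => l _; exact: term.
  have -> : `|(d%:R : Cx R)| = toC d%:R by rewrite -toC_nat norm_toC ger0_norm.
  apply: (@le_trans _ _ (toC (d%:R * (d%:R ^+ 2 * q)))).
    by rewrite toCM; apply: ler_wpM2l => //; rewrite -toC0 toC_le.
  rewrite toC_le.
  have d1 : 1 <= d%:R :> R by rewrite ler1n rdim_gt0.
  have dK : d%:R <= K2 * b xi ^+ n.
    apply: le_trans (K2P xi); rewrite expr2 ler_peMr //.
  have bpos m : 0 < b xi ^+ m by rewrite exprn_gt0.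
  have q0 : 0 <= q by rewrite /q !mulr_ge0 ?invr_ge0 // ltW.
  apply: (@le_trans _ _ (K2 * b xi ^+ n * (d%:R ^+ 2 * q))).
    by apply: ler_wpM2r => //; rewrite mulr_ge0 // sqr_ge0.
  have -> : K2 * b xi ^+ n * (d%:R ^+ 2 * q) =
     C * K1 * K2 * M * (d%:R ^+ 2 * (b xi ^+ n * b xi ^+ N / b xi ^+ N0.*2)).
    by rewrite /q; ring.
  apply: ler_wpM2l; first by rewrite !mulr_ge0 // ltW.
  apply: ler_wpM2l; first exact: sqr_ge0.
  rewrite ler_pdivrMr // ler_pdivlMl // -!exprD; apply: ler_weXn2l => //.
  by rewrite /N0; lia.
rewrite toC_le -mulr_sumr -!mulrA [M * _]mulrC !mulrA; apply: ler_wpM2r => //.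
apply: ler_wpM2l; first by rewrite !mulr_ge0 // ltW.
exact: K3P (finite_part_inequiv s).
Qed.

End Synthesis.

(** * Fourier synthesis of distributions *)

Lemma cvg_lin2 (R : realType) (I : Type) (U : set_system I) (FU : Filter U)
    (f g h : I -> R) (a b x y z : R) :
  f s @[s --> U] --> x -> g s @[s --> U] --> y -> h s @[s --> U] --> z ->
  a * f s + (b * g s + h s) @[s --> U] --> a * x + (b * y + z).
Proof. by move=> fx gy hz; apply: cvgD; [exact: cvgMr|apply: cvgD => //; exact: cvgMr]. Qed.

Section FourierSynthesis.
Context {R : realType} {n : nat} (G : compactLieGroup R n) (mu : haarMeasure G)
  (met : biinvariantMetric G).
Local Notation cint := (haar_int mu).
Implicit Types xi eta : irrep G.

Lemma smooth_word_bounded N (f : G -> Cx R) : (forall k, CGk k f) ->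
  exists2 B, 0 <= B & word_bounded N f B.
Proof.
move=> Cf; have one w : exists2 B : R, 0 <= B & forall g, `|crfw w f g| <= toC B.
  exact: ccont_bounded (CGk_ccont (CGk_crfw 0%N w Cf)).
pose B w := s2val (cid2 (one w)).
have B0 w : 0 <= B w := s2valP (cid2 (one w)).
have BP w := s2valP' (cid2 (one w)).
exists (\sum_(k < N.+1) \sum_(t : k.-tuple 'I_n) B t).
  by do 2 (apply: sumr_ge0 => ? _).
move=> w g wN; apply: le_trans (BP w g) _; rewrite toC_le -/(B w).
have wN' : (size w < N.+1)%N by [].
rewrite (bigD1 (Ordinal wN')) //= (bigD1 (in_tuple w)) //= -addrA lerDl addr_ge0 //.
  by rewrite sumr_ge0.
by do 2 (apply: sumr_ge0 => ? _).
Qed.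

(** Convergence along finite sets of representations ordered by inclusion, each
    set being listed by a sequence. Summation in that sense requires no
    enumeration of the classes. *)
Definition exhausting : set_system (seq (irrep G)) :=
  [set A | exists s0 : seq (irrep G), forall s : seq (irrep G), {subset s0 <= s} -> A s].

Lemma exhausting_proper : ProperFilter exhausting.
Proof.
split; first by move=> [s0 /(_ s0)]; apply => x.
split; first by exists [::].
  move=> A B [s0 A0] [s1 B1]; exists (s0 ++ s1) => s ss; split.
    by apply: A0 => x xs; apply: ss; rewrite mem_cat xs.
  by apply: B1 => x xs; apply: ss; rewrite mem_cat xs orbT.
by move=> A B AB [s0 A0]; exists s0 => s /A0 /AB.
Qed.

(** The partial sums are uniformly bounded as distributions of a fixed order, so
    they converge pointwise along an ultrafilter, and the limit has that order. *)
Lemma fourier_synthesis (T : set (irrep G)) (a : forall xi, 'M[Cx R]_(rdim xi)) (C : R) N :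
  (forall xi eta, T xi -> T eta -> equiv_rep xi eta -> xi = eta) -> 0 <= C ->
  (forall xi k l, T xi -> `|a xi k l| <= toC (C * bracket met xi ^+ N)) ->
  exists (u : distr G) (U : set_system (seq (irrep G))),
    [/\ ProperFilter U, exhausting `<=` U,
        forall psi, distr_of mu (trig T a s) psi @[s --> U] --> u psi,
        forall xi, T xi -> fourier u xi = a xi &
        forall eta, (forall xi, T xi -> ~ equiv_rep xi eta) -> fourier u eta = 0].
Proof.
move=> hT C0 aC; have [N' [K [K0 KP]]] := trig_bound mu hT C0 aC.
have [U [UU EU]] := ultraFilterLemma exhausting_proper.
have bnd psi : exists2 B, 0 <= B & forall s, `|distr_of mu (trig T a s) psi| <= toC B.
  have [B B0 BP] := smooth_word_bounded N' ((smooth_funP psi).1 (CinftyP psi)).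
  by exists (K * B) => [|s]; [exact: mulr_ge0|exact: KP].
pose B psi := s2val (cid2 (bnd psi)).
have B0 psi : 0 <= B psi := s2valP (cid2 (bnd psi)).
have BP psi s : `|distr_of mu (trig T a s) psi| <= toC (B psi) := s2valP' (cid2 (bnd psi)) s.
have lim psi : exists z : Cx R,
    re (distr_of mu (trig T a s) psi : Cx R) @[s --> U] --> re z /\
    im (distr_of mu (trig T a s) psi : Cx R) @[s --> U] --> im z.
  have parts s := norm_re_le (BP psi s).
  have [x hx] := ultra_bounded_cvg UU (fun s => (parts s).1).
  have [y hy] := ultra_bounded_cvg UU (fun s => (parts s).2).
  by exists (mkC x y).
pose L psi : (Cx R)^o := projT1 (cid (lim psi)).
have LP psi := projT2 (cid (lim psi)).
have FU : ProperFilter U by exact: ultra_proper.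
have uniq_lim (v : seq (irrep G) -> R) (x y : R) : v s @[s --> U] --> x -> v s @[s --> U] --> y -> x = y.
  by move=> h1 h2; exact: (@cvg_unique R (@norm_hausdorff _ R) _ (fmap_proper_filter v FU) _ _ h1 h2).
have L_linear : linear L.
  move=> c psi phi; have [hr hi] := LP (c *: psi + phi).
  have [pr p_i] := LP psi; have [qr qi] := LP phi.
  have e s : (distr_of mu (trig T a s) (c *: psi + phi) : Cx R) =
     c * distr_of mu (trig T a s) psi + distr_of mu (trig T a s) phi by rewrite linearP.
  apply: Cx_ext; rewrite -/(L _) /= ?re_lin ?im_lin.
    apply: uniq_lim hr _; under eq_fun do rewrite e re_lin.
    exact: (@cvg_lin2 _ _ U _ _ _ _ (re c) (- im c) _ _ _ pr p_i qr).
  apply: uniq_lim hi _; under eq_fun do rewrite e im_lin.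
  exact: (@cvg_lin2 _ _ U _ _ _ _ (re c) (im c) _ _ _ p_i pr qi).
have L_bounded : fields_bounded N' (2 * K) L.
  move=> psi M M0 psiM; have [hr hi] := LP psi.
  have parts s := norm_re_le (KP s psi M M0 psiM).
  rewrite -mulrA (Cx_eta (L psi)); apply: norm_mkC_le.
    exact: ultra_norm_le (fun s => (parts s).1) hr.
  exact: ultra_norm_le (fun s => (parts s).2) hi.
have K20 : 0 <= 2 * K by rewrite mulr_ge0.
pose u : distr G := MkDistr (asboolT (conj L_linear (fields_bounded_seminorm K20 L_bounded))).
have conv psi : distr_of mu (trig T a s) psi @[s --> U] --> u psi.
  by have [hr hi] := LP psi; exact: Cx_cvg hr hi.
(* Against a matrix entry the pairings are eventually constant, so the choice of
the ultrafilter does not matter for the Fourier coefficients. *)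
have eventually psi z : (exists s0 : seq (irrep G), forall s : seq (irrep G), {subset s0 <= s} ->
    distr_of mu (trig T a s) psi = z) -> u psi = z.
  move=> [s0 s0P]; apply: (@cvg_unique (Cx R) (@norm_hausdorff _ (Cx R)) _ (fmap_proper_filter _ FU) _ _ (conv psi)).
  apply: cvg_near_cst; apply: EU; exists s0; exact: s0P.
exists u, U; split=> //.
- move=> xi Tx; apply/matrixP => k l; rewrite mxE; apply: eventually.
  exists [:: xi] => s /(_ xi); rewrite inE eqxx => /(_ isT) xs.
  rewrite -/(conj_entry l k) (trig_coefficient mu met hT); last by move=> eta Te; exact: hT.
  by rewrite xs asboolT.
- move=> eta Te; apply/matrixP => k l; rewrite mxE [RHS]mxE; apply: eventually.
  exists [::] => s _; rewrite -/(conj_entry l k) (trig_coefficient mu met hT).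
    by rewrite asboolF ?andbF // => Tet; apply: (Te _ Tet); exact: equiv_rep_refl.
  by move=> xi Tx /(Te xi Tx).
Qed.

(** Equivalent representations have entries spanning the same space. *)
Lemma fourier_equiv_eq0 (u : distr G) xi eta : equiv_rep xi eta -> fourier u xi = 0 -> fourier u eta = 0.
Proof.
move=> [A [B [AB BA AX]]] u0; apply/matrixP => k l; rewrite mxE [RHS]mxE.
have E g : eta g = A *m xi g *m B by rewrite AX -mulmxA AB mulmx1.
pose c (q : 'I_(rdim xi * rdim xi)%N) : Cx R := 0.
have -> : (fun g => (eta g l k)^*) = fun g => \sum_q (B q k)^* *
    (\sum_p (A l p)^* * (xi g p q)^*).
  apply/funext => g; rewrite E mxE rmorph_sum; apply: eq_bigr => q _.
  rewrite mxE rmorphM mulrC rmorph_sum; congr (_ * _); apply: eq_bigr => p _.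
  by rewrite rmorphM.
have sx p q : smooth_fun (fun g => (xi g p q)^*) by exact: (conj_entry_smooth mu met).
rewrite (distr_linear_sum u (fun q => (B q k)^*)); last first.
  move=> q; apply/smooth_funP => m; apply: CGk_sum => p; apply: CGkZ.
  exact: ((smooth_funP _).1 (sx p q) m).
rewrite big1 // => q _; rewrite (distr_linear_sum u (fun p => (A l p)^*)) //.
rewrite big1 ?mulr0 // => p _; have /matrixP/(_ q p) := u0; rewrite !mxE => ->.
by rewrite mulr0.
Qed.

Lemma fourierB (u v : distr G) d (xi : G -> 'M[Cx R]_d) : fourier (u - v) xi = fourier u xi - fourier v xi.
Proof. by apply/matrixP => k l; rewrite !mxE. Qed.

Lemma fourierD (u v : distr G) d (xi : G -> 'M[Cx R]_d) : fourier (u + v) xi = fourier u xi + fourier v xi.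
Proof. by apply/matrixP => k l; rewrite !mxE. Qed.

Lemma fourierZ (c : Cx R) (u : distr G) d (xi : G -> 'M[Cx R]_d) : fourier (c *: u) xi = c *: fourier u xi.
Proof. by apply/matrixP => k l; rewrite !mxE. Qed.

Lemma fourier_eq (u v : distr G) (T : set (irrep G)) :
  (forall eta, exists2 xi, T xi & equiv_rep xi eta) ->
  (forall xi, T xi -> fourier u xi = fourier v xi) -> u = v.
Proof.
move=> comp uv; apply/eqP; rewrite -subr_eq0; apply/eqP; apply: (fourier_eq0 mu met) => eta.
have [xi Tx xe] := comp eta; apply: (fourier_equiv_eq0 xe).
by rewrite fourierB uv // subrr.
Qed.

End FourierSynthesis.

(** * Left-invariant operators as multipliers *)

Section WeakStar.
Context {R : realType} {n : nat} (G : compactLieGroup R n).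

(** The topology of distributions is that of pointwise convergence on test
    functions. *)
Lemma distr_cvg (I : Type) (U : set_system I) (FU : Filter U) (v : I -> distr G) (u : distr G) :
  (forall psi, v s psi @[s --> U] --> u psi) -> v s @[s --> U] --> u.
Proof.
move=> h.
have h' : (v s : {ptws Cinfty G -> (Cx R)^o}) @[s --> U] --> (u : {ptws Cinfty G -> (Cx R)^o}).
  apply/cvg_sup => psi A [B [[W oW <-] Wu sB]].
  have hW : nbhs (u psi) W by exact: open_nbhs_nbhs.
  have := h psi W hW; rewrite /fmap /= /nbhs /=; apply: filterS => s Ws; exact: sB.
move=> A [B [[W oW <-] Wu sB]].
have hW : nbhs (u : {ptws Cinfty G -> (Cx R)^o}) W by exact: open_nbhs_nbhs.
have := h' W hW; rewrite /fmap /= /nbhs /=; apply: filterS => s Ws; exact: sB.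
Qed.

Lemma distr_eval_cvg (I : Type) (U : set_system I) (v : I -> distr G) (u : distr G) psi :
  v s @[s --> U] --> u -> v s psi @[s --> U] --> u psi.
Proof.
move=> h; have c1 := @initial_continuous _ _ (@distr_fun _ _ G : distr G -> {ptws Cinfty G -> (Cx R)^o}) u.
have c2 := @proj_continuous _ (fun _ : Cinfty G => (Cx R)^o) psi (u : {ptws Cinfty G -> (Cx R)^o}).
exact: cvg_comp (cvg_comp _ _ h c1) c2.
Qed.

End WeakStar.

Section Multiplier.
Context {R : realType} {n : nat} (G : compactLieGroup R n) (mu : haarMeasure G)
  (met : biinvariantMetric G) (S : set (irrep G)) (hS : representatives S)
  (L : {linear distr G -> distr G}).
Hypotheses (cL : continuous L) (lL : left_invariant L) (pL : preserves_Cinfty mu L).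
Local Notation cint := (haar_int mu).
Implicit Types xi eta : irrep G.

Lemma on_CinftyE f : L (distr_of mu f) = distr_of mu (on_Cinfty mu L f).
Proof. by rewrite /on_Cinfty; case: xgetP => [h _ //|no]; have [h /no] := pL f. Qed.

Definition shift (h : G) (f : Cinfty G) : Cinfty G := to_Cinfty (fun g => f (h * g)%g).

Lemma shiftE h f : (shift h f : G -> Cx R) = fun g => f (h * g)%g.
Proof.
apply: to_CinftyE; apply/smooth_funP => k; apply: CGk_ltranslate.
exact: (smooth_funP f).1 (CinftyP f) k.
Qed.

Lemma distr_of_shift h (f : Cinfty G) :
  is_left_translate h^-1%g (distr_of mu f) (distr_of mu (shift h f)).
Proof.
move=> phi; rewrite -/(shift h^-1%g phi).
change (cint (fun x => shift h f x * phi x) = cint (fun x => f x * shift h^-1%g phi x)).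
rewrite !shiftE -[RHS](cint_left mu h); last first.
  by apply: ccontM; [exact: Cinfty_ccont|rewrite -shiftE; exact: Cinfty_ccont].
by congr (haar_int mu _); apply/funext => x; rewrite mulKg.
Qed.

Lemma L_shift h f : L (distr_of mu (shift h f)) = distr_of mu (shift h (on_Cinfty mu L f)).
Proof.
have := lL (distr_of_shift h f); rewrite on_CinftyE => H.
apply/val_inj/funext => phi; rewrite [LHS]H; exact/esym/distr_of_shift.
Qed.

(** The left translates of a column of entries are combinations of that column,
    so left invariance leaves the values at the identity as the only freedom,
    and these are the symbol. *)
Lemma on_Cinfty_entry xi (k l : 'I_(rdim xi)) :
  on_Cinfty mu L (entry k l) = \sum_m symbol mu L xi m l *: entry k m.
Proof.
pose M (k' l' : 'I_(rdim xi)) := on_Cinfty mu L (entry k' l') : Cinfty G.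
have sE m (c : 'I_m -> Cx R) (f : 'I_m -> Cinfty G) x :
    (\sum_i c i *: f i : Cinfty G) x = \sum_i c i * f i x.
  by elim/big_rec2: _ => // i a b _ <-.
have symE m : symbol mu L xi m l = M m l 1%g.
  rewrite /symbol /symbol_at rep1 /adjmx trmx1 map_mx1 mul1mx mxE.
  by [].
have shE h : shift h (entry k l) = \sum_m xi h k m *: entry m l.
  apply/val_inj/funext => x; change (shift h (entry k l) x = (\sum_m xi h k m *: entry m l : Cinfty G) x).
  rewrite sE shiftE (entryE mu met) repM mxE.
  by apply: eq_bigr => m _; rewrite (entryE mu met).
have key h : shift h (M k l) = \sum_m xi h k m *: M m l.
  apply: (distr_of_inj (mu := mu)); rewrite -L_shift shE !distr_of_sum linear_sum.
  by apply: eq_bigr => m _; rewrite linearZ on_CinftyE.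
apply/val_inj/funext => x.
change (M k l x = (\sum_m symbol mu L xi m l *: entry k m : Cinfty G) x).
have := congr1 (fun f : Cinfty G => f 1%g : Cx R) (key x); rewrite shiftE mulg1 => ->.
rewrite !sE; apply: eq_bigr => m _.
by rewrite symE (entryE mu met) mulrC.
Qed.

Lemma L_trig T (a : forall xi, 'M[Cx R]_(rdim xi)) s :
  L (distr_of mu (trig T a s)) = distr_of mu (trig T (fun xi => symbol mu L xi *m a xi) s).
Proof.
rewrite on_CinftyE.
have linf : forall m (c : 'I_m -> Cx R) (f : 'I_m -> Cinfty G),
    L (distr_of mu (\sum_i c i *: f i)) = \sum_i c i *: L (distr_of mu (f i)).
  by move=> m c f; rewrite distr_of_sum linear_sum; apply: eq_bigr => i _; rewrite linearZ.
rewrite -on_CinftyE /trig !distr_of_sum linear_sum; apply: eq_bigr => xi _.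
rewrite linearZ; congr (_ *: _).
have one (f : 'I_(rdim xi) -> Cinfty G) : \sum_k f k = \sum_k 1 *: f k.
  by apply: eq_bigr => k _; rewrite scale1r.
transitivity (\sum_k \sum_l a xi k l *: \sum_m symbol mu L xi m k *: distr_of mu (entry l m)).
  rewrite one linf; apply: eq_bigr => k _; rewrite scale1r linf; apply: eq_bigr => l _.
  by rewrite on_CinftyE on_Cinfty_entry distr_of_sum.
rewrite [in RHS]one distr_of_sum.
transitivity (\sum_k \sum_l \sum_m (symbol mu L xi m k * a xi k l) *: distr_of mu (entry l m)).
  apply: eq_bigr => k _; apply: eq_bigr => l _; rewrite scaler_sumr.
  by apply: eq_bigr => m _; rewrite scalerA mulrC.
under eq_bigr do rewrite exchange_big /=; rewrite exchange_big /=.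
apply: eq_bigr => m _; rewrite scale1r distr_of_sum exchange_big /=; apply: eq_bigr => l _.
by rewrite mxE scaler_suml.
Qed.

(** For trigonometric polynomials this is left invariance ([L_trig]); every
    distribution is a weak limit of its partial sums, and [L] is continuous. *)
Lemma fourier_multiplier u eta : fourier (L u) eta = symbol mu L eta *m fourier u eta.
Proof.
(* A complete set of representatives containing [eta] itself. *)
pose T := [set xi | xi = eta \/ (S xi /\ ~ equiv_rep xi eta)].
have hT xi zeta : T xi -> T zeta -> equiv_rep xi zeta -> xi = zeta.
  move=> [->|[Sx nx]] [->|[Sz nz]] // e.
  - by case: nz; exact: equiv_rep_sym.
  - have [w [_ uw]] := hS zeta; rewrite -(uw xi) //.
    by apply: uw; split=> //; exact: equiv_rep_refl.
have compT (zeta : irrep G) : exists2 xi, T xi & equiv_rep xi zeta.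
  have [xi [[Sx xz] _]] := hS zeta; have [xe|nxe] := pselect (equiv_rep xi eta).
    by exists eta; [left|exact: equiv_rep_trans (equiv_rep_sym xe) xz].
  by exists xi => //; right.
have [C [N [C0 uC]]] := fourier_growth mu met u.
have [v [U [FU EU conv vT _]]] := @fourier_synthesis _ _ _ mu met T (fun xi => fourier u xi) C N
  hT C0 (fun xi k l _ => uC xi k l).
have vu : v = u by apply: (fourier_eq mu met compT) => xi /vT.
rewrite {}vu in conv.
have c1 := @distr_cvg R n G _ U _ (fun s => distr_of mu (trig T (fun xi => fourier u xi) s)) u conv.
have cLu : L (distr_of mu (trig T (fun xi => fourier u xi) s)) @[s --> U] --> L u.
  by move=> A LA; have hA := cL LA; exact: (c1 _ _ hA).
apply/matrixP => k l; rewrite [LHS]mxE -/(conj_entry l k).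
have h := @distr_eval_cvg _ _ _ _ U (fun s => L (distr_of mu (trig T (fun xi => fourier u xi) s)))
  (L u) (conj_entry l k) cLu.
apply: (@cvg_unique (Cx R) (@norm_hausdorff _ (Cx R)) _ (fmap_proper_filter _ FU) _ _ h).
apply: cvg_near_cst; apply: EU; exists [:: eta] => s /(_ eta); rewrite inE eqxx => /(_ isT) es.
rewrite /= L_trig (trig_coefficient mu met hT); last by move=> xi Tx; apply: hT => //; left.
by rewrite es asboolT //; left.
Qed.

End Multiplier.

(** * The Vekua-type operator *)

(** The Fourier coefficients of [vekua L p q u] at [xi] and, conjugated, at its
    conjugate are a linear system of determinant [Delta] in those of [u]. When
    the determinant vanishes, the compatibility condition makes the two
    equations proportional, and an explicit solution is chosen that is bounded
    by the right-hand side; each unknown accounts for half of each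
    equation, whence the factors 2. *)
Lemma vekua_cramer (R : realType) (p q s g h D : Cx R) : p != 0 ->
  D = (s - q) * (s - q^*) - `|p| ^+ 2 -> (D = 0 -> (s - q^*) * g + p * h = 0) ->
  let x := if D == 0 then - h / (2 * p^*) else ((s - q^*) * g + p * h) / D in
  let y := if D == 0 then - g / (2 * p) else ((s - q) * h + p^* * g) / D in
  (s - q) * x - p * y = g /\ (s - q^*) * y - p^* * x = h.
Proof.
move=> p0; rewrite normCK => DE comp.
have pc0 : p^* != 0 by rewrite conjC_eq0.
have [D0|D0] /= := eqVneq D 0; last first.
  split; apply: (mulIf D0); rewrite mulrBl ![_ * (_ / D)]mulrA !divfK //; rewrite DE; ring.
have e := comp D0; rewrite D0 in DE.
have e1 : p * h = - ((s - q^*) * g) by apply/eqP; rewrite -addr_eq0 addrC; apply/eqP.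
have e2 : (s - q) * (s - q^*) = p * p^* by apply/eqP; rewrite -subr_eq0 -DE.
have e3 : (s - q) * h = - (p^* * g).
  apply: (mulfI p0); rewrite mulrCA e1 mulrN mulrA e2; ring.
have n2 : (2 : Cx R) != 0 by rewrite pnatr_eq0.
split.
  have -> : (s - q) * (- h / (2 * p^*)) = - ((s - q) * h) / (2 * p^*) by ring.
  by rewrite e3; field; rewrite p0 pc0.
have -> : (s - q^*) * (- g / (2 * p)) = - ((s - q^*) * g) / (2 * p) by ring.
by rewrite -e1; field; rewrite p0 pc0.
Qed.

Lemma toC_inv (R : realType) (x : R) : toC x^-1 = (toC x)^-1.
Proof. exact: (fmorphV (real_complex R)). Qed.

Lemma mxBE (V : zmodType) m n (A B : 'M[V]_(m, n)) i j : (A - B) i j = A i j - B i j.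
Proof. by rewrite !mxE. Qed.

Lemma mxZE (K : pzRingType) m n (c : K) (A : 'M[K]_(m, n)) i j : (c *: A) i j = c * A i j.
Proof. by rewrite mxE. Qed.

Lemma mxDE (V : nmodType) m n (A B : 'M[V]_(m, n)) i j : (A + B) i j = A i j + B i j.
Proof. by rewrite mxE. Qed.

Lemma map_mxE (A B : Type) (f : A -> B) m n (M : 'M[A]_(m, n)) i j : map_mx f M i j = f (M i j).
Proof. by rewrite mxE. Qed.

Lemma conjf_div (F : numClosedFieldType) (x y : F) : (x / y)^* = x^* / y^*.
Proof. by rewrite rmorphM fmorphV. Qed.

Lemma mx0E (V : nmodType) m n i j : (0 : 'M[V]_(m, n)) i j = 0.
Proof. by rewrite mxE. Qed.

Section Vekua.
Context {R : realType} {n : nat} (G : compactLieGroup R n) (mu : haarMeasure G)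
  (met : biinvariantMetric G)
  (hG : forall xi : irrep G, ~ trivial_rep xi -> ~ equiv_rep xi (conj_rep xi))
  (S : set (irrep G)) (hS : representatives S)
  (L : {linear distr G -> distr G}) (hL : diagonal_operator mu met S L)
  (p q : Cx R) (hp : p != 0).
Implicit Types xi eta : irrep G.
Local Notation P := (vekua L p q).
Local Notation D := (Delta mu L p q).
Local Notation sy := (symbol mu L).

Lemma S_inj xi eta : S xi -> S eta -> equiv_rep xi eta -> xi = eta.
Proof.
move=> Sx Se e; have [w [_ uw]] := hS eta; rewrite -(uw xi) //.
by apply: uw; split=> //; exact: equiv_rep_refl.
Qed.

Lemma equiv_trivial d e (xi : G -> 'M[Cx R]_d) (eta : G -> 'M[Cx R]_e) :
  equiv_rep xi eta -> trivial_rep xi -> trivial_rep eta.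
Proof.
move=> [A [B [AB BA h]]] tx g; have := h g; rewrite tx mulmx1 => /(congr1 (mulmx^~ B)).
by rewrite AB -mulmxA AB mulmx1.
Qed.

Lemma trivial_conj d (xi : G -> 'M[Cx R]_d) : trivial_rep xi -> conj_rep xi = xi.
Proof. by move=> tx; apply/funext => g; rewrite /conj_rep tx map_mx1. Qed.

Lemma conj_trivial d (xi : G -> 'M[Cx R]_d) : trivial_rep (conj_rep xi) -> trivial_rep xi.
Proof. by move=> tx; rewrite -[xi]conj_repK trivial_conj. Qed.

Lemma trivial_equiv xi eta : trivial_rep xi -> trivial_rep eta -> equiv_rep xi eta.
Proof.
move=> tx te; have [||//] := @schur_equiv _ _ _ xi eta (const_mx 1).
  by move=> g; rewrite tx te mulmx1 mul1mx.
move=> /matrixP/(_ (Ordinal (rdim_gt0 eta)) (Ordinal (rdim_gt0 xi)))/eqP.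
by rewrite !mxE oner_eq0.
Qed.

Lemma fourier_conj (u : distr G) xi k l :
  fourier (conj_distr u) xi k l = (fourier u (conj_rep xi) k l)^*.
Proof.
rewrite !mxE; change ((u (conj_Cinfty (conj_entry l k)))^* =
  (u (to_Cinfty (fun g => (conj_rep xi g l k)^*)))^*).
congr ((u _)^*); apply/val_inj/funext => x.
change ((conj_entry l k x)^* = (to_Cinfty (fun g => (conj_rep xi g l k)^*) : Cinfty G) x).
rewrite (conj_entryE mu met) (to_CinftyE (conj_entry_smooth mu met (xi := conj_irrep xi) l k)).
by rewrite mxE.
Qed.

Lemma symbol_diag xi : S xi -> is_diag_mx (sy xi).
Proof. by move=> Sx; have [_ _ _ /(_ xi Sx)[]] := hL. Qed.

Lemma symbol_conj xi : S xi -> sy (conj_rep xi) = map_mx Num.conj (sy xi).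
Proof. by move=> Sx; have [_ _ _ /(_ xi Sx)[]] := hL. Qed.

Lemma diag_mul d (A B : 'M[Cx R]_d) k l : is_diag_mx A -> (A *m B) k l = A k k * B k l.
Proof.
move=> /is_diag_mxP dA; rewrite mxE (bigD1 k) //= big1 ?addr0 // => m mk.
by rewrite dA ?mul0r // eq_sym.
Qed.

Lemma multiplier u eta : fourier (L u) eta = sy eta *m fourier u eta.
Proof. by have [cL lL pL _ _] := hL; exact: (fourier_multiplier met hS cL lL pL). Qed.

Lemma fourier_vekua u xi k l : S xi ->
  fourier (P u) xi k l =
    (sy xi k k - q) * fourier u xi k l - p * (fourier u (conj_rep xi) k l)^*.
Proof.
move=> Sx; rewrite /vekua fourierB fourierB !fourierZ multiplier.
by rewrite !mxBE !mxZE (diag_mul _ _ _ (symbol_diag Sx)) fourier_conj; ring.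
Qed.

Lemma fourier_vekua_conj u xi k l : S xi ->
  (fourier (P u) (conj_rep xi) k l)^* =
    (sy xi k k - q^*) * (fourier u (conj_rep xi) k l)^* - p^* * fourier u xi k l.
Proof.
move=> Sx; have E := multiplier u (conj_irrep xi).
have E2 := @fourier_conj u (conj_irrep xi) k l.
rewrite /= conj_repK in E2.
have dc : is_diag_mx (sy (conj_rep xi)).
  rewrite symbol_conj //; apply/is_diag_mxP => i j ij.
  by rewrite mxE (is_diag_mxP (symbol_diag Sx)) // rmorph0.
rewrite /vekua fourierB fourierB !fourierZ E.
rewrite !mxBE !mxZE (diag_mul _ _ _ dc) symbol_conj //.
by rewrite map_mxE E2 !rmorphB !rmorphM /= !conjCK; ring.
Qed.

Lemma range_admissible : range P `<=` admissible mu S L p q.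
Proof.
move=> _ [u _ <-] xi Sx k l D0; rewrite fourier_vekua // fourier_vekua_conj //.
move: D0; rewrite /Delta normCK.
set s := sy xi k k; set x := fourier u xi k l; set y := (fourier u (conj_rep xi) k l)^* => D0.
have -> : (s - q^*) * ((s - q) * x - p * y) + p * ((s - q^*) * y - p^* * x) =
  ((s - q) * (s - q^*) - p * p^*) * x by ring.
by rewrite D0 mul0r.
Qed.

Definition compatible f xi := forall k l, D xi k = 0 ->
  (sy xi k k - q^*) * fourier f xi k l + p * (fourier f (conj_rep xi) k l)^* = 0.

(** The solution given by [vekua_cramer]: [solx] is the coefficient at [xi], and
    [soly] the conjugate of the one at the conjugate representation. *)
Definition solx f xi : 'M[Cx R]_(rdim xi) := \matrix_(k, l)
  if D xi k == 0 then - (fourier f (conj_rep xi) k l)^* / (2 * p^*)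
  else ((sy xi k k - q^*) * fourier f xi k l + p * (fourier f (conj_rep xi) k l)^*) / D xi k.

Definition soly f xi : 'M[Cx R]_(rdim xi) := \matrix_(k, l)
  if D xi k == 0 then - fourier f xi k l / (2 * p)
  else ((sy xi k k - q) * (fourier f (conj_rep xi) k l)^* + p^* * fourier f xi k l) / D xi k.

Lemma solxE f xi k l : solx f xi k l =
  if D xi k == 0 then - (fourier f (conj_rep xi) k l)^* / (2 * p^*)
  else ((sy xi k k - q^*) * fourier f xi k l + p * (fourier f (conj_rep xi) k l)^*) / D xi k.
Proof. by rewrite [LHS]mxE. Qed.

Lemma solyE f xi k l : soly f xi k l =
  if D xi k == 0 then - fourier f xi k l / (2 * p)
  else ((sy xi k k - q) * (fourier f (conj_rep xi) k l)^* + p^* * fourier f xi k l) / D xi k.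
Proof. by rewrite [LHS]mxE. Qed.

(** The lower bound on the determinants, the growth of the symbol and that of
    the coefficients of [f] give the growth condition of [fourier_synthesis]. *)
Lemma sol_growth f (T : set (irrep G)) (c : R) M : T `<=` S -> 0 < c ->
  (forall xi k, T xi -> D xi k != 0 -> toC (c * (bracket met xi ^+ M)^-1) <= `|D xi k|) ->
  exists C N, 0 <= C /\ forall xi k l, T xi ->
    `|solx f xi k l| <= toC (C * bracket met xi ^+ N) /\
    `|soly f xi k l| <= toC (C * bracket met xi ^+ N).
Proof.
move=> TS c0 Dlow; have [Cf [Nf [Cf0 fB]]] := fourier_growth mu met f.
have [_ _ _ _ [Cs [K [Cs0 sB]]]] := hL.
have [pn pn0 pE] := normC_toC p; have [qn qn0 qE] := normC_toC q.
have pn_gt0 : 0 < pn.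
  rewrite lt_def pn0 andbT; apply: contraNneq hp => e.
  by rewrite -normr_eq0 pE e toC0.
exists (Cf / (2 * pn) + (Cs + qn + pn) * Cf / c), (K + Nf + M)%N; split.
  by rewrite addr_ge0 // divr_ge0 ?mulr_ge0 ?addr_ge0 // ltW.
move=> xi k l Tx; have Sx := TS _ Tx; pose b := bracket met xi.
have b1 : 1 <= b by exact: (bracket_ge1 mu).
have b0 : 0 < b := lt_le_trans ltr01 b1.
set g := fourier f xi k l; set h := (fourier f (conj_rep xi) k l)^*.
have gB : `|g| <= toC (Cf * b ^+ Nf) by exact: fB.
have hB : `|h| <= toC (Cf * b ^+ Nf).
  rewrite norm_conjC; have := fB (conj_irrep xi) k l.
  by have -> : bracket met (conj_irrep xi) = b := bracket_conj mu met xi.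
have [gn gn0 gE] := normC_toC g; have [hn hn0 hE] := normC_toC h.
rewrite gE toC_le in gB; rewrite hE toC_le in hB.
have key0 (z r : Cx R) (zn : R) : `|z| = toC zn -> 0 <= zn <= Cf * b ^+ Nf -> `|r| = toC pn ->
    `|- z / (2 * r)| <= toC ((Cf / (2 * pn) + (Cs + qn + pn) * Cf / c) * b ^+ (K + Nf + M)).
  move=> zE /andP[zn0 znB] rE; rewrite normrM normrN normfV normrM zE rE.
  have -> : `|(2 : Cx R)| = toC 2 by rewrite ger0_norm // toC_nat.
  rewrite -toCM -toC_inv -toCM toC_le; apply: (@le_trans _ _ (Cf * b ^+ Nf / (2 * pn))).
    by apply: ler_wpM2r => //; rewrite invr_ge0 mulr_ge0.
  rewrite mulrAC [leRHS]mulrDl; apply: le_trans (_ : _ <= Cf / (2 * pn) * b ^+ (K + Nf + M)) _.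
    apply: ler_wpM2l; first by rewrite divr_ge0 // mulr_ge0.
    by apply: (ler_weXn2l b1); rewrite -addnA addnCA leq_addr.
  by rewrite lerDl mulr_ge0 ?exprn_ge0 ?divr_ge0 ?mulr_ge0 ?addr_ge0 // ltW.
have key1 (z w r t : Cx R) (zn wn : R) : D xi k != 0 -> `|z| = toC zn -> `|w| = toC wn ->
    0 <= zn <= Cf * b ^+ Nf -> 0 <= wn <= Cf * b ^+ Nf -> `|r| = toC qn -> `|t| = toC pn ->
    `|((sy xi k k - r) * z + t * w) / D xi k| <=
      toC ((Cf / (2 * pn) + (Cs + qn + pn) * Cf / c) * b ^+ (K + Nf + M)).
  move=> Dn zE wE /andP[zn0 znB] /andP[wn0 wnB] rE tE.
  have [sn sn0 sE] := normC_toC (sy xi k k); have snB := sB xi Sx k; rewrite sE toC_le in snB.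
  have [dn dn0 dE] := normC_toC (D xi k); have dnB := Dlow xi k Tx Dn; rewrite dE toC_le in dnB.
  rewrite -/b in snB dnB.
  have bp m : 0 < b ^+ m by rewrite exprn_gt0.
  have dn_gt0 : 0 < dn by apply: lt_le_trans dnB; rewrite divr_gt0.
  rewrite normrM normfV dE -toC_inv.
  apply: (@le_trans _ _ (toC (((sn + qn) * zn + pn * wn) / dn))).
    rewrite toCM; apply: ler_wpM2r; first by rewrite -toC0 toC_le invr_ge0.
    apply: le_trans (ler_normD _ _) _; rewrite toCD !normrM tE wE zE.
    rewrite [toC (_ * zn)]toCM [toC (pn * _)]toCM; apply: lerD => //; apply: ler_wpM2r; first by rewrite -toC0 toC_le.
    by apply: le_trans (ler_normB _ _) _; rewrite sE rE -toCD.
  rewrite toC_le ler_pdivrMr //.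
  have bK : 1 <= b ^+ K by rewrite exprn_ege1.
  have h1 : (sn + qn) * zn + pn * wn <= (Cs + qn + pn) * b ^+ K * (Cf * b ^+ Nf).
    apply: (@le_trans _ _ ((sn + qn + pn) * (Cf * b ^+ Nf))).
      by rewrite [X in _ <= X]mulrDl; apply: lerD; [apply: ler_wpM2l => //; rewrite addr_ge0|exact: ler_wpM2l].
    apply: ler_wpM2r; first by rewrite mulr_ge0 // ltW.
    rewrite !mulrDl; apply: lerD; first apply: lerD => //; by rewrite ler_peMr.
  apply: le_trans h1 _.
  have h2 : 1 <= dn * b ^+ M / c.
    by rewrite ler_pdivlMr // mul1r -ler_pdivrMr.
  apply: (@le_trans _ _ ((Cs + qn + pn) * b ^+ K * (Cf * b ^+ Nf) * (dn * b ^+ M / c))).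
    by rewrite ler_peMr // !mulr_ge0 ?addr_ge0 // ltW.
  rewrite !exprD; have -> : (Cs + qn + pn) * b ^+ K * (Cf * b ^+ Nf) * (dn * b ^+ M / c) =
    ((Cs + qn + pn) * Cf / c) * (b ^+ K * b ^+ Nf * b ^+ M) * dn by ring.
  apply: ler_wpM2r => //; apply: ler_wpM2r; first by rewrite !mulr_ge0 // ltW.
  by rewrite lerDr divr_ge0 // mulr_ge0.
split; rewrite mxE -/g -/h; case: eqVneq => Dk.
- by apply: (key0 _ _ hn) => //; rewrite ?norm_conjC // hn0.
- by apply: (key1 _ _ _ _ gn hn) => //; rewrite ?norm_conjC // ?gn0 ?hn0.
- by apply: (key0 _ _ gn) => //; rewrite gn0.
- by apply: (key1 _ _ _ _ hn gn) => //; rewrite ?norm_conjC // ?gn0 ?hn0.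
Qed.


(** The coefficients at [xi] and at its conjugate are prescribed separately: [u]
    is the sum of a distribution carried by [T] and of the conjugate of another
    one. The trivial representation is its own conjugate, so it only enters the
    first one; there the symbol is real, and the solution is consistent. *)
Lemma solvable_on f (T : set (irrep G)) (c : R) M : T `<=` S -> 0 < c ->
  (forall xi eta, T xi -> T eta -> ~ trivial_rep xi -> ~ equiv_rep eta (conj_rep xi)) ->
  (forall xi k, T xi -> D xi k != 0 -> toC (c * (bracket met xi ^+ M)^-1) <= `|D xi k|) ->
  (forall xi, T xi -> compatible f xi) ->
  exists u, forall xi, T xi -> fourier (P u) xi = fourier f xi /\
    fourier (P u) (conj_rep xi) = fourier f (conj_rep xi).
Proof.
move=> TS c0 TC Dlow comp.
have [C [N [C0 aC]]] := sol_growth f TS c0 Dlow.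
have injT (T' : set (irrep G)) : T' `<=` T ->
    forall xi eta, T' xi -> T' eta -> equiv_rep xi eta -> xi = eta.
  by move=> sT xi eta Tx Te; apply: S_inj; apply/TS/sT.
pose T2 := [set xi | T xi /\ ~ trivial_rep xi].
have T2T : T2 `<=` T by move=> xi [].
have [u1 [_ [_ _ _ u1E u1Z]]] := @fourier_synthesis _ _ _ mu met T (solx f) C N
  (injT T (fun x Tx => Tx)) C0 (fun xi k l Tx => (aC xi k l Tx).1).
have [u2 [_ [_ _ _ u2E u2Z]]] := @fourier_synthesis _ _ _ mu met T2 (soly f) C N
  (injT T2 T2T) C0 (fun xi k l Tx => (aC xi k l (T2T _ Tx)).2).
pose u := u1 + conj_distr u2.
have uE xi : T xi -> forall k l, fourier u xi k l = solx f xi k l /\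
    (fourier u (conj_rep xi) k l)^* = soly f xi k l.
  move=> Tx k l; have Sx := TS _ Tx.
  have E1 : fourier u xi k l = fourier u1 xi k l + (fourier u2 (conj_rep xi) k l)^*.
    by rewrite -fourier_conj /u fourierD mxDE.
  have [tx|nx] := pselect (trivial_rep xi).
    have tc : conj_rep xi = xi := trivial_conj tx.
    have z2 : fourier u2 xi k l = 0.
      rewrite u2Z ?mx0E // => zeta [_ nz] e; exact: (nz (equiv_trivial (equiv_rep_sym e) tx)).
    rewrite tc E1 tc z2 conjC0 addr0 u1E //; split=> //.
    have sr : (sy xi k k)^* = sy xi k k.
      have := congr1 (fun A : 'M[Cx R]_(rdim xi) => A k k) (symbol_conj Sx).
      by rewrite tc /= map_mxE => <-.
    have Dr : (D xi k)^* = D xi k.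
      rewrite /Delta normCK rmorphB !rmorphM /= !rmorphB /= !conjCK sr; ring.
    rewrite solxE solyE tc; case: ifP => _.
      by rewrite rmorphM fmorphV rmorphM rmorphN /= !conjCK conjC_nat.
    move: (D xi k) Dr (sy xi k k) sr (fourier f xi k l) => d dr s sr' z.
    by rewrite conjf_div dr rmorphD !rmorphM rmorphB /= !conjCK sr'.
  have z1 : fourier u2 (conj_rep xi) = 0.
    by apply: (u2Z (conj_irrep xi)) => zeta [Tz _] e; exact: (TC _ _ Tx Tz nx e).
  have z2 : fourier u1 (conj_rep xi) = 0.
    by apply: (u1Z (conj_irrep xi)) => zeta Tz e; exact: (TC _ _ Tx Tz nx e).
  split; first by rewrite E1 z1 mx0E conjC0 addr0 u1E.
  have E2 := @fourier_conj u2 (conj_irrep xi) k l; rewrite /= conj_repK in E2.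
  by rewrite /u fourierD mxDE z2 mx0E add0r E2 conjCK u2E.
exists u => xi Tx; have Sx := TS _ Tx.
have key k l : fourier (P u) xi k l = fourier f xi k l /\
    (fourier (P u) (conj_rep xi) k l)^* = (fourier f (conj_rep xi) k l)^*.
  rewrite fourier_vekua // fourier_vekua_conj //; have [-> ->] := uE xi Tx k l.
  have := @vekua_cramer _ p q (sy xi k k) (fourier f xi k l)
    ((fourier f (conj_rep xi) k l)^*) (D xi k) hp erefl (comp xi Tx k l).
  by rewrite solxE solyE.
split; apply/matrixP => k l; first exact: (key k l).1.
by apply: (can_inj conjCK); exact: (key k l).2.
Qed.

Definition lower_bound (T : set (irrep G)) (c : R) M := forall xi k, T xi -> D xi k != 0 ->
  toC (c * (bracket met xi ^+ M)^-1) <= `|D xi k|.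

Lemma lower_bound_le (T : set (irrep G)) c c' M M' : lower_bound T c M -> 0 < c' -> c' <= c ->
  (M <= M')%N -> lower_bound T c' M'.
Proof.
move=> h c0 cc MM xi k Tx Dk; apply: le_trans (h xi k Tx Dk); rewrite toC_le.
have b1 := bracket_ge1 mu met xi; have b0 : 0 < bracket met xi := lt_le_trans ltr01 b1.
apply: ler_pM => //; first exact: ltW.
  by rewrite invr_ge0 exprn_ge0 // ltW.
by rewrite lef_pV2 ?posrE ?exprn_gt0 //; exact: ler_weXn2l.
Qed.

Lemma lower_bound1 xi : exists2 c, 0 < c & lower_bound [set xi] c 0.
Proof.
have h (s : seq 'I_(rdim xi)) : exists2 c : R, 0 < c &
    forall k, k \in s -> D xi k != 0 -> toC c <= `|D xi k|.
  elim: s => [|k s [c c0 IH]]; first by exists 1.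
  have [e|ne] := eqVneq (D xi k) 0.
    exists c => // m; rewrite inE => /orP[/eqP ->|]; last exact: IH.
    by rewrite e eqxx.
  have [r r0 rE] := normC_toC (D xi k).
  have rp : 0 < r.
    rewrite lt_def r0 andbT; apply: contraNneq ne => e.
    by rewrite -normr_eq0 rE e toC0.
  exists (Num.min c r); first by rewrite lt_min c0 rp.
  move=> m; rewrite inE => /orP[/eqP ->|ms] Dm.
    by rewrite rE toC_le ge_min lexx orbT.
  by apply: le_trans (IH m ms Dm); rewrite toC_le ge_min lexx.
have [c c0 hc] := h (enum 'I_(rdim xi)); exists c => // eta k e Dk.
rewrite /= in e; subst eta; rewrite expr0 invr1 mulr1; apply: hc => //; exact: mem_enum.
Qed.

(** One representative out of each pair formed by a nontrivial class and the
    conjugate class. *)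
Definition half_system (H : set (irrep G)) := [/\ H `<=` S,
  forall xi, H xi -> ~ trivial_rep xi,
  forall xi eta, H xi -> H eta -> ~ equiv_rep eta (conj_rep xi) &
  forall xi, S xi -> ~ trivial_rep xi -> H xi \/ exists2 eta, H eta & equiv_rep eta (conj_rep xi)].

Lemma partner xi : exists2 eta, S eta & equiv_rep eta (conj_rep xi).
Proof. by have [eta [[Se e] _]] := hS (conj_irrep xi); exists eta. Qed.

Lemma equiv_conj_swap xi eta : equiv_rep eta (conj_rep xi) -> equiv_rep xi (conj_rep eta).
Proof. by move=> /equiv_rep_conj; rewrite conj_repK => /equiv_rep_sym. Qed.

Lemma equiv_conj_trivial xi eta : equiv_rep eta (conj_rep xi) -> trivial_rep eta -> trivial_rep xi.
Proof. by move=> e te; apply/conj_trivial/(equiv_trivial e). Qed.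

(** The choice function picks one element in each pair; the two elements differ
    by the hypothesis on [G]. *)
Lemma half_system_exists : exists H, half_system H.
Proof.
pose good xi eta := [/\ S xi, S eta & equiv_rep eta (conj_rep xi)].
exists [set xi : irrep G | ~ trivial_rep xi /\ exists2 eta : irrep G, good xi eta & choose (pred2 xi eta) xi = xi].
have swap xi eta : choose (pred2 xi eta) xi = choose (pred2 eta xi) eta.
  rewrite (@eq_choose _ _ (pred2 eta xi)); last by move=> z; rewrite /= orbC.
  by apply: choose_id; rewrite /= eqxx ?orbT.
split.
- by move=> xi [_ [eta []]].
- by move=> xi [].
- move=> xi eta [nx [x' [Sx Sx' ex] cx]] [ne [e' [Se Se' ee] ce]] e.
  have e1 : x' = eta by apply: S_inj => //; apply: equiv_rep_trans ex (equiv_rep_sym e).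
  have e2 : e' = xi.
    by apply: S_inj => //; apply: equiv_rep_trans ee (equiv_rep_sym (equiv_conj_swap e)).
  rewrite e1 in cx; rewrite e2 in ce.
  have E : xi = eta by rewrite -cx swap ce.
  by move: e; case: eta / E {e1 cx Se ne Se' ee ce} => e; exact: (hG nx).
move=> xi Sx nx; have [eta Se e] := partner xi.
have /orP[/eqP cx|/eqP cx] : pred2 xi eta (choose (pred2 xi eta) xi).
  by apply: chooseP; rewrite /= eqxx.
- by left; split=> //; exists eta.
- right; exists eta => //; split; first by move=> te; apply/nx/(equiv_conj_trivial e).
  by exists xi; [split=> //; exact: equiv_conj_swap|rewrite swap in cx].
Qed.

(** The conjugates of a half system are represented in its complement. *)
Lemma half_system_compl H : half_system H ->
  half_system [set xi | [/\ S xi, ~ trivial_rep xi & ~ H xi]].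
Proof.
move=> [HS Hn Hi Hc]; split; [by move=> xi []|by move=> xi []| |].
  move=> xi eta [Sx nx hx] [Se ne he] e; have [//|[z Hz ez]] := Hc xi Sx nx.
  suff E : z = eta by apply: he; rewrite -E.
  by apply: S_inj (HS _ Hz) Se _; apply: equiv_rep_trans ez (equiv_rep_sym e).
move=> xi Sx nx; have [hx|hx] := pselect (H xi); last by left.
right; have [eta Se e] := partner xi; exists eta => //; split=> //.
  by move=> te; apply/nx/(equiv_conj_trivial e).
by move=> he; exact: Hi hx he e.
Qed.

Section HalfSystem.
Variable H : set (irrep G).
Hypothesis hH : half_system H.
Local Notation T := [set xi | H xi \/ (S xi /\ trivial_rep xi)].

Lemma halfS : T `<=` S.
Proof. by have [HS _ _ _] := hH; move=> xi [/HS|[]]. Qed.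

Lemma half_conj xi eta : T xi -> T eta -> ~ trivial_rep xi -> ~ equiv_rep eta (conj_rep xi).
Proof.
have [_ _ Hi _] := hH; move=> [hx|[_ tx]] // [he|[_ te]] nx e; first exact: Hi hx he e.
by apply/nx/(equiv_conj_trivial e).
Qed.

Lemma half_cover xi : S xi -> T xi \/ exists2 eta, H eta & equiv_rep eta (conj_rep xi).
Proof.
have [_ _ _ Hc] := hH; move=> Sx; have [tx|nx] := pselect (trivial_rep xi); first by left; right.
by have [hx|] := Hc xi Sx nx; [left; left|right].
Qed.

Lemma vekua_surjective f c M : 0 < c -> lower_bound T c M ->
  (forall xi, T xi -> compatible f xi) -> range P f.
Proof.
move=> c0 low comp; have [u uE] := solvable_on halfS c0 half_conj low comp; exists u => //.
apply: (fourier_eq mu met (T := [set zeta | T zeta \/ exists2 xi, T xi & zeta = conj_irrep xi])).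
  move=> eta; have [xi [[Sx e] _]] := hS eta.
  have [Tx|[z Hz ez]] := half_cover Sx; first by exists xi => //; left.
  exists (conj_irrep z); first by right; exists z => //; left.
  exact: equiv_rep_trans (equiv_rep_sym (equiv_conj_swap ez)) e.
by move=> _ [/uE[]//|[xi /uE[_ e] ->]].
Qed.

(** The compatibility condition at a representation follows from the one at the
    conjugate class, although the chosen representatives are conjugate only up
    to equivalence and diagonalize the symbol in their own bases: a solution for
    the single pair exists, and its image satisfies all the conditions. *)
Lemma admissible_half f : (forall xi, T xi -> compatible f xi) -> admissible mu S L p q f.
Proof.
move=> comp xi Sx k l D0; have [Tx|[z Hz ez]] := half_cover Sx; first exact: comp.
have Tz : T z by left.
have [c c0 low] := lower_bound1 z.
have zS : [set z] `<=` S by move=> _ ->; exact: halfS.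
have zC x y : [set z] x -> [set z] y -> ~ trivial_rep x -> ~ equiv_rep y (conj_rep x).
  by move=> -> -> nz; exact: hG.
have zcomp x : [set z] x -> compatible f x by move=> ->; exact: comp.
have [u /(_ z erefl)[E1 E2]] := solvable_on zS c0 zC low zcomp.
have E3 : fourier (P u) (conj_rep xi) = fourier f (conj_rep xi).
  apply/eqP; rewrite -subr_eq0 -fourierB; apply/eqP.
  by apply: (@fourier_equiv_eq0 _ _ _ mu met _ z (conj_irrep xi) ez) => //; rewrite fourierB E1 subrr.
have E4 : fourier (P u) xi = fourier f xi.
  apply/eqP; rewrite -subr_eq0 -fourierB; apply/eqP.
  apply: (@fourier_equiv_eq0 _ _ _ mu met _ (conj_irrep z) xi _).
    exact: equiv_rep_sym (equiv_conj_swap ez).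
  by rewrite fourierB E2 subrr.
by rewrite -E3 -E4; apply: range_admissible => //; exists u.
Qed.

(** The right-hand side with conjugate coefficients 1 wherever the determinant
    does not vanish is admissible, and forces the coefficients of a solution to
    be [p / Delta]; these have polynomial growth. *)
Lemma half_lower_bound : admissible mu S L p q `<=` range P ->
  exists c N, 0 < c /\ lower_bound H c N.
Proof.
move=> surj; have [HS Hn Hi _] := hH.
pose a xi : 'M[Cx R]_(rdim xi) := \matrix_(k, l) (if D xi k == 0 then 0 else 1).
have aE xi k l : a xi k l = if D xi k == 0 then 0 else 1 by rewrite [LHS]mxE.
have aB xi k l : H xi -> `|a xi k l| <= toC (1 * bracket met xi ^+ 0).
  by move=> _; rewrite aE expr0 mulr1; case: ifP => _; rewrite ?normr0 ?normr1 -?toC0 // toC_le ler01.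
have injH xi eta : H xi -> H eta -> equiv_rep xi eta -> xi = eta.
  by move=> hx he; apply: S_inj; exact: HS.
have [f2 [_ [_ _ _ fE fZ]]] := @fourier_synthesis _ _ _ mu met H a 1 0 injH ler01 aB.
have z1 xi : T xi -> fourier f2 (conj_rep xi) = 0.
  move=> Tx; apply: (fZ (conj_irrep xi)) => eta he e.
  have [hx|[_ tx]] := Tx; first exact: Hi hx he e.
  by apply: (Hn _ he); apply: equiv_trivial (equiv_rep_sym e) _; rewrite /= trivial_conj.
have fx xi k l : T xi -> fourier (conj_distr f2) xi k l = 0.
  by move=> Tx; rewrite fourier_conj z1 // mx0E conjC0.
have fy xi k l : (fourier (conj_distr f2) (conj_rep xi) k l)^* = fourier f2 xi k l.
  by have := @fourier_conj f2 (conj_irrep xi) k l; rewrite /= conj_repK => ->; rewrite conjCK.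
have [u _ uE] : range P (conj_distr f2).
  apply/surj/admissible_half => xi Tx k l D0; rewrite fx // mulr0 add0r fy.
  have [hx|[_ tx]] := Tx; first by rewrite fE // aE D0 eqxx mulr0.
  by rewrite -[X in fourier _ X](trivial_conj tx) z1 // mx0E mulr0.
have [C [N [C0 uB]]] := fourier_growth mu met u.
have [pn pn0 pE] := normC_toC p.
have pn_gt0 : 0 < pn.
  rewrite lt_def pn0 andbT; apply: contraNneq hp => e.
  by rewrite -normr_eq0 pE e toC0.
have C1 : 0 < C + 1 by rewrite ltr_wpDl.
exists (pn / (C + 1)), N; split; first exact: divr_gt0.
move=> xi k hx Dk; have Sx := HS _ hx.
have b0 : 0 < bracket met xi := lt_le_trans ltr01 (bracket_ge1 mu met xi).
have key : D xi k * fourier u xi k k = p.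
  have e1 := fourier_vekua u k k Sx; have e2 := fourier_vekua_conj u k k Sx.
  rewrite uE fx in e1; last by left.
  rewrite uE fy fE // aE (negPf Dk) in e2.
  move: e1 e2; rewrite /Delta normCK.
  move: (sy xi k k) (fourier u xi k k) ((fourier u (conj_rep xi) k k)^*) => s x y e1 e2.
  have -> : ((s - q) * (s - q^*) - p * p^*) * x =
    (s - q^*) * ((s - q) * x - p * y) + p * ((s - q^*) * y - p^* * x) by ring.
  by rewrite -e1 -e2; ring.
have [x x0 xE] := normC_toC (fourier u xi k k); have xB := uB xi k k; rewrite xE toC_le in xB.
have [d d0 dE] := normC_toC (D xi k).
have := congr1 (fun z : Cx R => `|z|) key; rewrite normrM xE dE pE -toCM => /toC_inj dx.
rewrite toC_le -dx ler_pdivrMr ?exprn_gt0 // ler_pdivrMr // -mulrA; apply: ler_wpM2l => //.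
by apply: le_trans xB _; rewrite mulrC; apply: ler_wpM2l; rewrite ?exprn_ge0 ?lerDl // ltW.
Qed.

End HalfSystem.

(** A half system and its complement cover the nontrivial representatives, which
    gives the lower bound on all of them; the trivial class adds finitely many
    determinants. *)
Lemma solvable_iff : range P = admissible mu S L p q <-> exists c N, 0 < c /\ lower_bound S c N.
Proof.
have [H hH] := half_system_exists; have [HS _ _ Hc] := hH.
split=> [E|[c [N [c0 low]]]]; last first.
  rewrite eqEsubset; split; first exact: range_admissible.
  move=> f fA; apply: (vekua_surjective hH c0 (M := N)).
    by move=> xi k Tx; apply: low; exact: (halfS hH).
  by move=> xi Tx k l; apply: fA; exact: (halfS hH).
have surj : admissible mu S L p q `<=` range P by rewrite E.
have [c1 [N1 [c10 low1]]] := half_lower_bound hH surj.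
have [c2 [N2 [c20 low2]]] := half_lower_bound (half_system_compl hH) surj.
have [c3 c30 low3] : exists2 c, 0 < c & lower_bound [set xi | S xi /\ trivial_rep xi] c 0.
  have [[z [Sz tz]]|no] := pselect (exists xi, S xi /\ trivial_rep xi); last first.
    by exists 1 => // xi k tx; case: no; exists xi.
  have [c c0 low] := lower_bound1 z; exists c => // xi k [Sx tx]; apply: low.
  by apply: S_inj => //; exact: trivial_equiv.
pose c := Num.min c1 (Num.min c2 c3).
have c0 : 0 < c by rewrite !lt_min c10 c20.
exists c, (N1 + N2)%N; split=> // xi k Sx.
have [tx|nx] := pselect (trivial_rep xi).
  by apply: (lower_bound_le low3) => //; rewrite !ge_min lexx !orbT.
have [hx|hx] := pselect (H xi).
  by apply: (lower_bound_le low1) => //; rewrite ?ge_min ?lexx ?leq_addr.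
by apply: (lower_bound_le low2) => //; rewrite ?ge_min ?lexx ?orbT ?leq_addl.
Qed.

Lemma lower_bound_powR (T : set (irrep G)) : (exists c N, 0 < c /\ lower_bound T c N) <->
  exists C M : R, [/\ 0 < C, 0 < M & forall xi, T xi -> forall k : 'I_(rdim xi), D xi k != 0 ->
    toC (C * powR (bracket met xi) (- M)) <= `|D xi k|].
Proof.
have pE xi N : powR (bracket met xi) (- N%:R) = (bracket met xi ^+ N)^-1.
  have b0 : 0 <= bracket met xi := le_trans ler01 (bracket_ge1 mu met xi).
  by rewrite powRN powR_mulrn.
split=> [[c [N [c0 low]]]|[C [M [C0 M0 low]]]].
  exists c, N.+1%:R; split=> // xi Tx k Dk; rewrite pE.
  exact: (lower_bound_le low c0 (lexx c) (leqnSn N)).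
exists C, (Num.bound M); split=> // xi k Tx Dk; apply: le_trans (low xi Tx k Dk).
rewrite toC_le -pE; apply: ler_wpM2l; first exact: ltW.
apply: ler_powR; first exact: (bracket_ge1 mu).
by rewrite lerN2 ltW //; apply: archi_boundP; exact: ltW.
Qed.

End Vekua.

Theorem proposition3p5 (R : realType) (n : nat) (G : compactLieGroup R n)
    (mu : haarMeasure G) (met : biinvariantMetric G)
    (hG : forall xi : irrep G,
       ~ trivial_rep xi -> ~ equiv_rep xi (conj_rep xi))
    (S : set (irrep G)) (hS : representatives S)
    (L : {linear distr G -> distr G}) (hL : diagonal_operator mu met S L)
    (p q : Cx R) (hp : p != 0) :
  range (vekua L p q) = admissible mu S L p q
  <->
  exists C M : R, [/\ 0 < C, 0 < M &
    forall xi : irrep G, S xi -> forall k : 'I_(rdim xi),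
      Delta mu L p q xi k != 0 ->
      toC (C * powR (bracket met xi) (- M)) <= `|Delta mu L p q xi k|].
Proof. exact: iff_trans (solvable_iff hG hS hL q hp) (lower_bound_powR mu met L p q S). Qed.
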